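(* Let $\lambda<0$, let $B^{\lambda,br}$ be a Brownian bridge of length $1$ from $0$ to $\lambda$, and let $V(B^{\lambda,br})$ be its Vervaat transform. Let $Y=(Y_t;0\le t\le 1)$ denote the process $V(B^{\lambda,br})$ conditioned on the (positive probability) event $\{\forall t \in (0,1),\ V(B^{\lambda,br})_t>\lambda t\}$, and let $\widetilde{Z}^{\lambda}:=\inf\{t>0:Y_t=0\}$ be the length of its first excursion. Put $$c_\lambda:=1-|\lambda| \exp\left(\frac{\lambda^2}{2}\right) \int_{|\lambda|}^{\infty} \exp\left(-\frac{s^2}{2}\right)ds .$$ Then $\widetilde{Z}^{\lambda}$ has density $$f_{\widetilde{Z}^{\lambda}}(t)=\frac{t}{c_\lambda}\cdot\frac{|\lambda|}{\sqrt{2 \pi t(1-t)^3}} \exp\left(-\frac{\lambda^2 t}{2(1-t)}\right),\qquad 0<t<1,$$ and, given $\widetilde{Z}^{\lambda}$, the path of $Y$ is decomposed into two conditionally independent pieces: (i) $(Y_u;\ 0 \leq u \leq \widetilde{Z}^{\lambda})$ is a Brownian excursion of length $\widetilde{Z}^{\lambda}$; (ii) $(Y_u;\ \widetilde{Z}^{\lambda} \leq u \leq 1)$ is a first passage bridge through level $\lambda$ of length $1-\widetilde{Z}^{\lambda}$ conditioned to stay above the line $t \mapsto \lambda(t+\widetilde{Z}^{\lambda})$ for $t \in (0,1-\widetilde{Z}^{\lambda})$. In addition, the law of $Y$ is absolutely continuous with respect to the law of the drifting excursion $(B_t^{ex,\lambda \downarrow};\ 0\leq t \leq 1)$, $B_t^{ex,\lambda\downarrow}:=B^{ex}_t+\lambda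 t$, where $B^{ex}$ is a standard Brownian excursion of length $1$, and the corresponding density is $$\frac{H}{c_\lambda},\qquad H:=\inf \{ t>0:\ B^{ex, \lambda \downarrow}_{t}<0\}.$$
   Context: Vervaat transform: for continuous $f:[0,1]\to\mathbb{R}$ with $f(0)=0$, let $\tau(f)$ be the first time at which $f$ attains its minimum on $[0,1]$. Define $V(f)(t)=f(\tau(f)+t)-f(\tau(f))$ for $0\le t\le 1-\tau(f)$ and $V(f)(t)=f(\tau(f)+t-1)+f(1)-f(\tau(f))$ for $1-\tau(f)\le t\le 1$. A Brownian excursion of length $\ell>0$ is a three-dimensional Bessel bridge from $0$ to $0$ of length $\ell$. A first passage bridge through level $\lambda<0$ of length $\ell>0$ is standard Brownian motion $(B_t;0\le t\le \ell)$ started at $0$ and conditioned on the event that its first hitting time of $\lambda$ equals $\ell$; equivalently, it has the law of $\lambda$ plus a three-dimensional Bessel bridge from $|\lambda|$ to $0$ of length $\ell$. The piece on $[\widetilde Z^\lambda,1]$ is re-indexed by $t=u-\widetilde Z^\lambda$. *)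

(* Defs.v *)
From HB Require Import structures.
From mathcomp Require Import all_boot all_order all_algebra.
From mathcomp Require Import all_classical all_reals all_analysis measurable_realfun.
Import Order.TTheory GRing.Theory Num.Theory.
Import numFieldNormedType.Exports.

Set Implicit Arguments.
Unset Strict Implicit.
Unset Printing Implicit Defensive.

Local Open Scope classical_set_scope.
Local Open Scope ring_scope.

(* C([0, l]), 0 < l <= 1, is encoded by continuous functions on the whole     *)
(* line of which only the values on [0, l] are meaningful. The sigma-algebra  *)
(* is generated by the evaluations at times in [0, 1], that is, it is the     *)
(* Borel sigma-algebra of C([0, 1]) pulled back by the restriction map.       *)
HB.instance Definition _ (R : realType) :=
  @isPointed.Build (continuousType R R) (cst 0 : continuousType R R).

Definition evaluation_sets (R : realType) : set (set (continuousType R R)) :=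
  [set A | exists t (U : set R), [/\ 0 <= t <= 1, measurable U &
     A = [set w : continuousType R R | U (w t)]]].

Definition cpath (R : realType) := g_sigma_algebraType (@evaluation_sets R).

(* The zero path when f is not continuous; by the lemmas below this happens   *)
(* only for the Vervaat transform of a path that does not start at 0.         *)
Definition to_cpath (R : realType) (f : R -> R) : cpath R :=
  match pselect (continuous f) with
  | left fc => mkcts fc
  | right _ => (cst 0 : continuousType R R)
  end.

Lemma to_cpathE (R : realType) (f : R -> R) :
  continuous f -> to_cpath f = f :> (R -> R).
Proof. by rewrite /to_cpath; case: pselect. Qed.

Section cpath_operations.
Context (R : realType).
Implicit Types (w f : cpath R) (a l t z : R).

(* Forgets the values after time l. *)
Definition stop l w : cpath R := to_cpath (fun t => w (Num.min t l)).

Definition time_shift z w : cpath R := to_cpath (fun t => w (z + t)).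

Definition add_drift a w : cpath R := to_cpath (fun t => w t + a * t).

Definition add_const a w : cpath R := to_cpath (fun t => a + w t).

Definition norm3 (p : cpath R * cpath R * cpath R) : cpath R :=
  to_cpath (fun t =>
    Num.sqrt (p.1.1 t ^+ 2 + p.1.2 t ^+ 2 + p.2 t ^+ 2)).

Definition argmin01 f : R :=
  inf [set t | 0 <= t <= 1 /\ forall s, 0 <= s <= 1 -> f t <= f s].

Definition vervaat_fun f t : R :=
  let tau := argmin01 f in
  if t <= 1 - tau then f (tau + t) - f tau
  else f (tau + t - 1) + f 1 - f tau.

Definition vervaat f : cpath R := to_cpath (vervaat_fun f).

Definition first_return w : R := inf [set t | 0 < t <= 1 /\ w t = 0].

Definition first_negative w : R := inf [set t | 0 < t <= 1 /\ w t < 0].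

End cpath_operations.

Section cpath_operations_continuous.
Context (R : realType).
Implicit Types (w f : cpath R) (a l t z : R).

Let contw w : continuous (w : R -> R).
Proof. exact: (@cts_fun R R w). Qed.

Let cont_comp w (g : R -> R) : continuous g -> continuous (fun t => w (g t)).
Proof. by move=> cg t; apply: (continuous_comp (cg t)); exact: contw. Qed.

Let cont_shift z : continuous (fun t => z + t).
Proof. by move=> t; apply: cvgD; [exact: cvg_cst|exact: cvg_id]. Qed.

Lemma stopE l w t : stop l w t = w (Num.min t l).
Proof.
rewrite /stop to_cpathE//; apply: cont_comp => x.
exact: (@continuous_min R R idfun (cst l) x cvg_id (@cvg_cst _ _ _ _ _)).
Qed.

Lemma time_shiftE z w t : time_shift z w t = w (z + t).
Proof. by rewrite /time_shift to_cpathE//; apply: cont_comp; exact: cont_shift. Qed.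

Lemma add_driftE a w t : add_drift a w t = w t + a * t.
Proof.
rewrite /add_drift to_cpathE// => x; apply: cvgD; first exact: contw.
by apply: cvgM; [exact: cvg_cst|exact: cvg_id].
Qed.

Lemma add_constE a w t : add_const a w t = a + w t.
Proof.
by rewrite /add_const to_cpathE// => x; apply: cvgD; [exact: cvg_cst|exact: contw].
Qed.

Lemma norm3E (p : cpath R * cpath R * cpath R) t :
  norm3 p t = Num.sqrt (p.1.1 t ^+ 2 + p.1.2 t ^+ 2 + p.2 t ^+ 2).
Proof.
rewrite /norm3 to_cpathE//.
pose g s : R := p.1.1 s ^+ 2 + p.1.2 s ^+ 2 + p.2 s ^+ 2.
have cg : continuous g.
  have cont2 w : continuous (fun s => w s ^+ 2 : R).
    by move=> x; under eq_fun do rewrite expr2; apply: cvgM; exact: contw.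
  by move=> x; apply: cvgD; [apply: cvgD; exact: cont2|exact: cont2].
by move=> x; apply: (continuous_comp (cg x)); exact: sqrt_continuous.
Qed.

Lemma vervaatE f t : f 0 = 0 -> vervaat f t = vervaat_fun f t.
Proof.
move=> f0; rewrite /vervaat to_cpathE//.
have -> : vervaat_fun f = fun s =>
    f (Num.min (argmin01 f + s) 1) + f (Num.max (argmin01 f + s - 1) 0)
    - f (argmin01 f).
  apply/funext => s; rewrite /vervaat_fun lerBrDl.
  case: (leP (argmin01 f + s) 1) => h.
  - by rewrite max_r ?subr_le0// f0 addr0.
  - by rewrite max_l ?subr_ge0 1?ltW// [f 1 + _]addrC.
have cs := @cont_shift (argmin01 f).
have c1 : continuous (fun s => f (Num.min (argmin01 f + s) 1)).
  apply: cont_comp => y.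
  exact: (@continuous_min R R _ (cst 1) y (cs y) (@cvg_cst _ _ _ _ _)).
have c2 : continuous (fun s => f (Num.max (argmin01 f + s - 1) 0)).
  apply: cont_comp => y.
  apply: (@continuous_max R R _ (cst 0) y _ (@cvg_cst _ _ _ _ _)).
  by apply: cvgB; [exact: cs|exact: cvg_cst].
move=> x; apply: cvgB; last exact: cvg_cst.
by apply: cvgD; [exact: c1|exact: c2].
Qed.

End cpath_operations_continuous.

Definition cond_law d (T : measurableType d) (R : realType)
    (mu : set T -> \bar R) (E : set T) : set T -> \bar R :=
  fun A => (mu (A `&` E) / mu E)%E.

(* The normal law with mean m and variance v, degenerate when v = 0           *)
(* (normal_prob is not a Dirac mass for a zero standard deviation).           *)
Definition gaussian_law (R : realType) (m v : R) (U : set R) : \bar R :=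
  if v == 0 then dirac m U else normal_prob m (Num.sqrt v) U.

(* The Gaussian process with mean a + (b - a) t / l and covariance            *)
(* min(s, t) - s t / l, described through the laws of the finite linear       *)
(* combinations of its coordinates.                                           *)
Definition brownian_bridge d (T : measurableType d) (R : realType)
    (P : set T -> \bar R) (a b l : R) (X : T -> cpath R) : Prop :=
  forall (n : nat) (t c : 'I_n -> R), (forall i, 0 <= t i <= l) ->
  forall U : set R, measurable U ->
    P [set omega | U (\sum_i c i * X omega (t i))] =
    gaussian_law (\sum_i c i * (a + (b - a) * t i / l))
      (\sum_i \sum_j c i * c j * (Num.min (t i) (t j) - t i * t j / l)) U.

Section path_laws.
Context (R : realType).
Implicit Types (l x lambda : R) (mu : probability (cpath R) R).

(* The three-dimensional Bessel process from x >= 0 is the Euclidean norm of  *)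
(* a three-dimensional Brownian motion from (x, 0, 0). The norm vanishes only *)
(* at the origin, so conditioning it to be 0 at time l amounts to replacing   *)
(* the Brownian motion by the bridge of length l to the origin, whose         *)
(* coordinates are independent one-dimensional bridges.                       *)
Definition bessel3_bridge_to0_law x l mu : Prop :=
  exists b1 b2 b3 : probability (cpath R) R,
    [/\ brownian_bridge b1 x 0 l id, brownian_bridge b2 0 0 l id,
        brownian_bridge b3 0 0 l id &
        forall A, measurable A -> mu A = ((b1 \x b2) \x b3)%E (@norm3 R @^-1` A)].

Definition brownian_excursion_law l mu : Prop := bessel3_bridge_to0_law 0 l mu.

Definition first_passage_bridge_law lambda l mu : Prop :=
  exists2 rho : probability (cpath R) R, bessel3_bridge_to0_law `|lambda| l rho &
    forall A, measurable A -> mu A = rho (add_const lambda @^-1` A).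

End path_laws.

Definition has_density (R : realType) (mu : set R -> \bar R) (S : set R)
    (f : R -> R) : Prop :=
  forall D : set R, measurable D ->
    mu D = (\int[lebesgue_measure]_(t in D `&` S) (f t)%:E)%E.

(* Under Q, the variable Z takes its values in S almost surely and, given     *)
(* Z = z, X1 and X2 are independent with respective laws k1 z and k2 z: the   *)
(* product of k1 z and k2 z is a regular conditional law of (X1, X2) given Z. *)
Definition cond_indep_given d (T : measurableType d) (R : realType)
    (Q : set T -> \bar R) (Z : T -> R) (S : set R) (X1 X2 : T -> cpath R)
    (k1 k2 : R -> set (cpath R) -> \bar R) : Prop :=
  [/\ forall A, measurable A -> measurable_fun S (k1 ^~ A),
      forall A, measurable A -> measurable_fun S (k2 ^~ A) &
      forall (D : set R) A1 A2, measurable D -> measurable A1 -> measurable A2 ->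
        Q (Z @^-1` D `&` X1 @^-1` A1 `&` X2 @^-1` A2) =
        (\int[pushforward Q Z]_(z in D `&` S) (k1 z A1 * k2 z A2))%E].

Definition c_const (R : realType) (lambda : R) : R :=
  1 - `|lambda| * expR (lambda ^+ 2 / 2) *
      (\int[lebesgue_measure]_(s in `[`|lambda|, +oo[) expR (- (s ^+ 2 / 2)))%R.

Definition first_return_density (R : realType) (lambda t : R) : R :=
  t / c_const lambda *
  (`|lambda| / Num.sqrt (2 * pi * t * (1 - t) ^+ 3)) *
  expR (- (lambda ^+ 2 * t / (2 * (1 - t)))).

(* Main.v *)
(* Write a = |lambda|, and let [bes x l] be the Bessel bridge from x to 0 of length l, built from
   three independent bridges. A law on paths is determined by the means of products of functions
   of finitely many values; for (killed) Brownian and Bessel bridges these means are iterated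
   integrals of explicit kernels, to which first passage decompositions apply. Decomposing the
   Brownian bridge at its minimum gives Vervaat's theorem: it is the normalized excursion seen
   from an independent uniform time u. Hence, if X = bes 0 1 - a t and H is its first passage
   below 0, the Vervaat transform of the bridge to lambda stays above the line if and only if u
   <= H, and is X in that case: integrating over u, Y has density H / E H with respect to the law
   of X. Decomposing X at its first return Z to 0 gives the law of Z, an excursion before Z, and
   after Z a passage bridge staying above the line, an event of probability Z given Z. Finally Z
   <= H, and H is at most the first return for any smaller drift b < a, whose mean tends to E Z =
   c_lambda as b increases to a; hence H = Z almost surely. *)

Require Import Defs.
From HB Require Import structures.
From mathcomp Require Import all_boot all_order all_algebra.
From mathcomp Require Import all_classical all_reals all_analysis measurable_realfun.
From mathcomp Require Import ring lra.
Import Order.TTheory GRing.Theory Num.Theory.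
Import numFieldNormedType.Exports.

Set Implicit Arguments.
Unset Strict Implicit.

Local Open Scope classical_set_scope.
Local Open Scope ring_scope.

(** The given bridges are known only through the laws of finite linear combinations of their
    coordinates. All processes are therefore modelled as explicit functions of one standard bridge
    [beta], or of three independent copies of it ([gam], [bes]), and the last lemmas transfer the
    results to the given laws. Chains are unnormalized and indexed by the remaining time:
    conditioning on the end value then only changes the final factor, and Girsanov factors telescope
    along a chain. Most integrands are kept nonnegative, so that Tonelli's theorem applies without
    integrability; this is why characteristic functions appear as [1 + cos]. Two facts cannot be
    read on finitely many times. Positivity of Bessel bridges inside their interval, needed to
    recognize the first return in a glued path and to undo the rotation, follows from a bound
    uniform in the number of tested times. The equality of the first return with the first passage
    below 0 uses no zero-one law: two ordered variables with the same finite mean are almost surely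
    equal. *)

Local Notation meas_fun := (measurable_fun setT).
Local Notation mu := (@lebesgue_measure _).
Local Notation isder x := (is_derive x (1 : Real.sort _)).

(** * Measurability of real-valued expressions *)

Section real_measurability.
Context {R : realType} d (T : measurableType d).
Implicit Types f g : T -> R.

Lemma measurable_invr : measurable_fun [set: R] (fun x : R => x^-1).
Proof.
have -> : [set: R] = [set~ 0] `|` [set 0] by rewrite setUC setUv.
apply/measurable_funU => //; first exact: measurableC.
split.
- apply: open_continuous_measurable_fun.
    by apply: closed_openC; exact: closed_eq.
  by move=> x; rewrite inE /= => /eqP x0; exact: inv_continuous.
- exact: measurable_fun_set1.
Qed.

Lemma mfD f g : meas_fun f -> meas_fun g ->
  meas_fun (fun x => f x + g x).
Proof. exact: measurable_funD. Qed.

Lemma mfN f : meas_fun f -> meas_fun (fun x => - f x).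
Proof. exact: measurableT_comp. Qed.

Lemma mfM f g : meas_fun f -> meas_fun g ->
  meas_fun (fun x => f x * g x).
Proof. exact: measurable_funM. Qed.

Lemma mfV f : meas_fun f -> meas_fun (fun x => (f x)^-1).
Proof. by apply: measurableT_comp; exact: measurable_invr. Qed.

Lemma mfX f n : meas_fun f -> meas_fun (fun x => f x ^+ n).
Proof. exact: measurable_funX. Qed.

Lemma mf_expR f : meas_fun f -> meas_fun (fun x => expR (f x)).
Proof. by apply: measurableT_comp; exact: measurable_expR. Qed.

Lemma mf_sqrt f : meas_fun f ->
  meas_fun (fun x => Num.sqrt (f x)).
Proof.
by apply: measurableT_comp; apply: continuous_measurable_fun; exact: sqrt_continuous.
Qed.

Lemma mf_norm f : meas_fun f -> meas_fun (fun x => `|f x|).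
Proof. by apply: measurableT_comp; exact: normr_measurable. Qed.

Lemma mf_cos f : meas_fun f -> meas_fun (fun x => cos (f x)).
Proof.
by apply: measurableT_comp; apply: continuous_measurable_fun; exact: continuous_cos.
Qed.

Lemma mf_max f g : meas_fun f -> meas_fun g ->
  meas_fun (fun x => Num.max (f x) (g x)).
Proof. exact: measurable_maxr. Qed.

Lemma mf_min f g : meas_fun f -> meas_fun g ->
  meas_fun (fun x => Num.min (f x) (g x)).
Proof. exact: measurable_minr. Qed.

Lemma mf_if (b : T -> bool) f g : meas_fun b ->
  meas_fun f -> meas_fun g ->
  meas_fun (fun x => if b x then f x else g x).
Proof. exact: measurable_fun_ifT. Qed.

Lemma mf_lt f g : meas_fun f -> meas_fun g ->
  meas_fun (fun x => f x < g x).
Proof. exact: measurable_fun_ltr. Qed.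

Lemma mf_le f g : meas_fun f -> meas_fun g ->
  meas_fun (fun x => f x <= g x).
Proof. exact: measurable_fun_ler. Qed.

Lemma mf_and (b c : T -> bool) : meas_fun b -> meas_fun c ->
  meas_fun (fun x => b x && c x).
Proof. exact: measurable_and. Qed.

Lemma mf_indic (A : set R) f : measurable A -> meas_fun f ->
  meas_fun (fun x => \1_A (f x) : R).
Proof. by move=> mA mf; apply: measurableT_comp => //; exact: measurable_indic. Qed.

Lemma mfE f : meas_fun f -> meas_fun (fun x => (f x)%:E).
Proof. by move=> ?; apply/measurable_EFinP. Qed.

Lemma mfeM (f g : T -> \bar R) : meas_fun f -> meas_fun g ->
  meas_fun (fun x => f x * g x)%E.
Proof. exact: emeasurable_funM. Qed.

Lemma mfeD (f g : T -> \bar R) : meas_fun f -> meas_fun g ->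
  meas_fun (fun x => f x + g x)%E.
Proof. exact: emeasurable_funD. Qed.

Lemma mfe_if (b : T -> bool) (f g : T -> \bar R) : meas_fun b ->
  meas_fun f -> meas_fun g ->
  meas_fun (fun x => if b x then f x else g x).
Proof. exact: measurable_fun_ifT. Qed.

Lemma mf_fst d1 d2 (T1 : measurableType d1) (T2 : measurableType d2)
  (f : T -> T1 * T2) : meas_fun f -> meas_fun (fun x => (f x).1).
Proof. by move=> mf; apply: (measurableT_comp measurable_fst). Qed.

Lemma mf_snd d1 d2 (T1 : measurableType d1) (T2 : measurableType d2)
  (f : T -> T1 * T2) : meas_fun f -> meas_fun (fun x => (f x).2).
Proof. by move=> mf; apply: (measurableT_comp measurable_snd). Qed.

End real_measurability.

Ltac meas1 :=
  lazymatch goal with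
  | |- measurable_fun _ (fun _ => ?c) => exact: measurable_cst
  | |- measurable_fun _ (fun x => x) => exact: measurable_id
  | mf : measurable_fun setT ?f |- measurable_fun _ (fun x => ?f (@?g x)) => apply: (measurableT_comp mf)
  | |- measurable_fun _ (fun x => (@?f x)%:E) => apply: mfE
  | |- measurable_fun _ (fun x => (@?f x * @?g x)%E) => apply: mfeM
  | |- measurable_fun _ (fun x => (@?f x + @?g x)%E) => apply: mfeD
  | |- measurable_fun _ (fun x => @?f x + @?g x) => apply: mfD
  | |- measurable_fun _ (fun x => @?f x * @?g x) => apply: mfM
  | |- measurable_fun _ (fun x => - @?f x) => apply: mfN
  | |- measurable_fun _ (fun x => (@?f x)^-1) => apply: mfV
  | |- measurable_fun _ (fun x => (@?f x) ^+ _) => apply: mfX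
  | |- measurable_fun _ (fun x => expR (@?f x)) => apply: mf_expR
  | |- measurable_fun _ (fun x => Num.sqrt (@?f x)) => apply: mf_sqrt
  | |- measurable_fun _ (fun x => `|@?f x|) => apply: mf_norm
  | |- measurable_fun _ (fun x => cos (@?f x)) => apply: mf_cos
  | |- measurable_fun _ (fun x => Num.max (@?f x) (@?g x)) => apply: mf_max
  | |- measurable_fun _ (fun x => Num.min (@?f x) (@?g x)) => apply: mf_min
  | |- measurable_fun _ (fun x => @?f x < @?g x) => apply: mf_lt
  | |- measurable_fun _ (fun x => @?f x <= @?g x) => apply: mf_le
  | |- measurable_fun _ (fun x => @?f x && @?g x) => apply: mf_and
  | |- measurable_fun _ (fun x => fst (@?f x)) => apply: mf_fst
  | |- measurable_fun _ (fun x => snd (@?f x)) => apply: mf_snd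
  | |- measurable_fun _ (fun x => (@?f x, @?g x)) => apply: measurable_fun_pair
  | |- measurable_fun _ (fun x => indic ?A (@?g x)) => apply: mf_indic
  | |- measurable_fun _ _ => first [apply: mf_if | apply: mfe_if]
  end.
Ltac meas := repeat (first [assumption | meas1 | by []]).

(** * Iterated integrals, mixtures and uniqueness of measures *)

Section integration_tools.
Local Open Scope ereal_scope.
Context d1 d2 (T : measurableType d1) (Y : measurableType d2) (R : realType).
Variables (m1 : {sigma_finite_measure set T -> \bar R})
          (m2 : {sigma_finite_measure set Y -> \bar R}).

Lemma tonelli (f : T -> Y -> \bar R) :
  meas_fun (fun z : T * Y => f z.1 z.2) -> (forall x y, 0 <= f x y) ->
  \int[m1]_x \int[m2]_y f x y = \int[m2]_y \int[m1]_x f x y.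
Proof.
by move=> mf f0; exact: (fubini_tonelli (fun z : T * Y => f z.1 z.2)).
Qed.

Lemma measurable_int_param (f : T -> Y -> \bar R) :
  meas_fun (fun z : T * Y => f z.1 z.2) -> (forall x y, 0 <= f x y) ->
  meas_fun (fun x => \int[m2]_y f x y).
Proof.
move=> mf f0.
exact: (measurable_fun_fubini_tonelli_F (m2 := m2) (fun z : T * Y => f z.1 z.2)).
Qed.

Lemma measurable_section (f : T -> Y -> \bar R) x :
  meas_fun (fun z : T * Y => f z.1 z.2) -> meas_fun (f x).
Proof.
move=> mf; have mp : meas_fun (fun y : Y => (x, y)) by exact: measurable_pair1.
exact: (measurableT_comp (f := fun z : T * Y => f z.1 z.2) mf mp).
Qed.

End integration_tools.
Arguments tonelli {d1 d2 T Y R} m1 m2 f _ _.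
Arguments measurable_int_param {d1 d2 T Y R} m2 f _ _.

Lemma measurable_swap d1 d2 d (T : measurableType d1) (Y : measurableType d2) (X : measurableType d)
  (f : T -> Y -> X) : meas_fun (fun z => f z.1 z.2) -> meas_fun (fun z => f z.2 z.1).
Proof.
by move=> mf; apply: (measurableT_comp (f := fun z => f z.1 z.2) (g := fun z => (z.2, z.1)) mf); meas.
Qed.

Section mixture.
Local Open Scope ereal_scope.
Context d1 d2 (T : measurableType d1) (X : measurableType d2) (R : realType).
Variables (m : {measure set T -> \bar R}) (Q : T -> {measure set X -> \bar R}).
Hypothesis mQ : forall A, measurable A -> meas_fun (fun t => Q t A).

(** The proof argument ties the set function to the measurability of the family, so that the
    structure of a measure can be attached to [mixture mQ]. *)
Definition mixture (_ : forall A, measurable A -> meas_fun (fun t => Q t A))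
  (A : set X) : \bar R := \int[m]_t Q t A.

Let mix0 : mixture mQ set0 = 0.
Proof. by rewrite /mixture; under eq_integral do rewrite measure0; rewrite integral0. Qed.

Let mix_ge0 A : 0 <= mixture mQ A.
Proof. by apply: integral_ge0 => t _; exact: measure_ge0. Qed.

Let mix_sigma : semi_sigma_additive (mixture mQ).
Proof.
move=> F mF tF mUF; rewrite /mixture.
have -> : \int[m]_t Q t (\bigcup_n F n) = \sum_(n <oo) \int[m]_t Q t (F n).
  rewrite -integral_nneseries//.
  - by apply: eq_integral => t _; rewrite measure_semi_bigcup.
  - by move=> n; exact: mQ.
by apply: is_cvg_nneseries => n _ _; exact: mix_ge0.
Qed.

HB.instance Definition _ := isMeasure.Build _ _ _ (mixture mQ) mix0 mix_ge0 mix_sigma.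

End mixture.

Lemma measure_unique_generated d (T : measurableType d) (R : realType) (G : set (set T))
  (m m' : {measure set T -> \bar R}) : G `<=` measurable -> setI_closed G -> G setT ->
  (forall A, G A -> m A = m' A) -> (m setT < +oo)%E -> forall A, <<s G >> A -> m A = m' A.
Proof.
move=> Gm GI GT e fin A sA; apply: (g_sigma_algebra_measure_unique G Gm (fun=> setT)) => //.
by rewrite bigcup_const.
Qed.

(** * The sigma-algebra of the path space *)

Section path_measurability.
Context {R : realType}.

(** Evaluation of a path is measurable only at times in [0, 1]; truncation to that interval makes
    random, shifted or reflected times harmless. *)
Definition clip (s : R) : R := Num.max 0 (Num.min s 1).

Lemma clip_itv s : 0 <= clip s <= 1.
Proof. by rewrite /clip le_max lexx/= ge_max ler01 ge_min lexx orbT. Qed.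

Lemma clip_id s : 0 <= s <= 1 -> clip s = s.
Proof. by move=> /andP[s0 s1]; rewrite /clip min_l// max_r. Qed.

Lemma clip_gt1 s : 1 <= s -> clip s = 1.
Proof. by move=> s1; rewrite /clip min_r// max_r. Qed.

Lemma clip_lt0 s : s <= 0 -> clip s = 0.
Proof. by move=> s0; rewrite /clip max_l// ge_min s0. Qed.

Lemma continuous_clip : continuous clip.
Proof.
move=> x; exact: (@continuous_max R R (cst 0) (fun s => Num.min s 1) x
  (@cvg_cst _ _ _ _ _) (@continuous_min R R idfun (cst 1) x cvg_id (@cvg_cst _ _ _ _ _))).
Qed.

Lemma measurable_clip d (T : measurableType d) (f : T -> R) :
  meas_fun f -> meas_fun (fun x => clip (f x)).
Proof.
by apply: measurableT_comp; apply: continuous_measurable_fun; exact: continuous_clip.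
Qed.

Lemma continuous_path (w : cpath R) : continuous (w : R -> R).
Proof. exact: (@cts_fun R R w). Qed.

Lemma continuous_path_comp (w : cpath R) (g : R -> R) :
  continuous g -> continuous (fun t => w (g t)).
Proof. by move=> cg t; apply: (continuous_comp (cg t)); exact: continuous_path. Qed.

Lemma measurable_ev (t : R) : 0 <= t <= 1 ->
  measurable_fun [set: cpath R] (fun w : cpath R => w t).
Proof.
move=> t01 _ U mU; rewrite setTI; apply: sub_gen_smallest.
by exists t, U.
Qed.

Lemma measurable_into_cpath d (T : measurableType d) (f : T -> cpath R) :
  (forall t, 0 <= t <= 1 -> meas_fun (fun x => f x t)) ->
  meas_fun f.
Proof.
move=> mf; apply: (@measurability _ _ T (cpath R) setT f (@evaluation_sets R)) => //.
move=> _ [_ [t [U [t01 mU ->]]] <-].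
by have := mf _ t01 measurableT _ mU.
Qed.

(** For [t >= 0] this is the largest multiple of [2^-n] below [t]: a random time is approximated by
    one with countably many values. *)
Definition dyad n (t : R) : R := (Num.truncn (t * 2 ^+ n))%:R / 2 ^+ n.

Let exp2_gt0 n : 0 < (2 : R) ^+ n. Proof. exact: exprn_gt0. Qed.

Lemma dyad_itv n t : 0 <= t <= 1 -> 0 <= dyad n t <= t.
Proof.
move=> /andP[t0 t1]; rewrite divr_ge0// ?exprn_ge0//= ler_pdivrMr//.
by have /andP[] := truncn_itv (mulr_ge0 t0 (ltW (exp2_gt0 n))).
Qed.

Lemma dyad_dist n t : 0 <= t <= 1 -> `|t - dyad n t| <= 2^-1 ^+ n.
Proof.
move=> t01; have /andP[d0 dt] := dyad_itv n t01; have /andP[t0 _] := t01.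
rewrite ger0_norm ?subr_ge0// exprVn -[leRHS]mul1r ler_pdivlMr// mulrBl.
rewrite /dyad divfK ?gt_eqF// lerBlDr.
have /andP[_ /ltW] := truncn_itv (mulr_ge0 t0 (ltW (exp2_gt0 n))).
by rewrite addrC natr1.
Qed.

Lemma cvg_dyad t : 0 <= t <= 1 -> dyad n t @[n --> \oo] --> t.
Proof.
move=> t01; apply/cvgrPdist_le => e e0.
have : (2^-1 : R) ^+ n @[n --> \oo] --> 0.
  by apply: cvg_expr; rewrite ger0_norm ?invr_ge0// invf_lt1// ltr1n.
move=> /cvgrPdist_le/(_ _ e0); apply: filterS => n.
rewrite sub0r normrN ger0_norm ?exprn_ge0 ?invr_ge0//.
exact/le_trans/dyad_dist.
Qed.

Lemma cvg_dyad_path (w : cpath R) t : 0 <= t <= 1 -> w (dyad n t) @[n --> \oo] --> w t.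
Proof.
move=> t01; have c : {for t, continuous (w : R -> R)} by exact: continuous_path.
exact: (cvg_comp _ _ (cvg_dyad t01) c).
Qed.

(** At the dyadic approximations of the random time, preimages are countable unions over the
    possible times; continuity of paths then gives a pointwise limit. *)
Lemma measurable_eval d (T : measurableType d) (f : T -> cpath R) (g : T -> R) :
  meas_fun f -> meas_fun g -> (forall x, 0 <= g x <= 1) ->
  meas_fun (fun x => f x (g x)).
Proof.
move=> mf mg g01.
apply: (@measurable_fun_cvg _ _ _ _ (fun n x => f x (dyad n (g x)))); last first.
  by move=> x _; exact: cvg_dyad_path.
move=> n _ U mU; rewrite setTI.
(* Indices [k] whose grid point exceeds 1 give an empty first set; [clip] only keeps the second one
   measurable for them. *)
have -> : (fun x => f x (dyad n (g x))) @^-1` U = \bigcup_k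
    ([set x | (2 ^+ n)^-1 * k%:R = dyad n (g x)] `&`
     [set x | U (f x (clip ((2 ^+ n)^-1 * k%:R)))]).
  apply/seteqP; split => x /=.
    move=> Ux; exists (Num.truncn (g x * 2 ^+ n)) => //=.
    rewrite mulrC; split => //.
    by rewrite clip_id//; have /andP[-> /le_trans->//] := dyad_itv n (g01 x);
      have /andP[] := g01 x.
  move=> [k _ [/= kE]]; rewrite kE clip_id//.
  by have /andP[-> /le_trans->//] := dyad_itv n (g01 x); have /andP[] := g01 x.
apply: bigcupT_measurable => k; apply: measurableI; last first.
  have := measurableT_comp (measurable_ev (clip_itv ((2 ^+ n)^-1 * k%:R))) mf.
  by move=> /(_ measurableT _ mU); rewrite setTI.
have -> : [set x | (2 ^+ n)^-1 * k%:R = dyad n (g x)] =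
    [set x | k%:R <= g x * 2 ^+ n] `&` [set x | g x * 2 ^+ n < k.+1%:R].
  apply/seteqP; split => x /=.
    rewrite mulrC /dyad => /(mulIf (invr_neq0 (lt0r_neq0 (exp2_gt0 n)))).
    move=> /eqP; rewrite eqr_nat => /eqP ->.
    have /andP[g0 _] := g01 x.
    by have /andP[] := truncn_itv (mulr_ge0 g0 (ltW (exp2_gt0 n))).
  move=> [h1 h2]; rewrite mulrC /dyad; congr (_%:R / _); apply/esym/truncn_def.
  by rewrite h1.
have mgn : meas_fun (fun x => g x * 2 ^+ n) by meas.
apply: measurableI.
  have := mf_le (measurable_cst (k%:R : R)) mgn.
  by move=> /(_ measurableT [set true]); rewrite setTI; apply.
have := mf_lt mgn (measurable_cst (k.+1%:R : R)).
by move=> /(_ measurableT [set true]); rewrite setTI; apply.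
Qed.

Lemma measurable_lt_set d (T : measurableType d) (f g : T -> R) :
  meas_fun f -> meas_fun g -> measurable [set x | f x < g x].
Proof.
move=> mf mg; have := mf_lt mf mg.
by move=> /(_ measurableT [set true]); rewrite setTI; apply.
Qed.

Lemma measurable_le_set d (T : measurableType d) (f g : T -> R) :
  meas_fun f -> meas_fun g -> measurable [set x | f x <= g x].
Proof.
move=> mf mg; have := mf_le mf mg.
by move=> /(_ measurableT [set true]); rewrite setTI; apply.
Qed.

Lemma measurable_fun_lt d (T : measurableType d) (f : T -> R) :
  (forall a, measurable [set x | f x < a]) -> meas_fun f.
Proof.
move=> mf; apply: (measurability _ (RGenInftyO.measurableE R)).
move=> _ [_ [a ->] <-]; rewrite setTI.
by have := mf a; congr measurable; apply/seteqP; split => x /=; rewrite in_itv.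
Qed.

Lemma measurable_pre d d' (T : measurableType d) (T' : measurableType d')
  (f : T -> T') A : meas_fun f -> measurable A -> measurable (f @^-1` A).
Proof. by move=> mf mA; rewrite -[_ @^-1` _]setTI; exact: mf. Qed.

Lemma rat_dense_ge0 (g : R -> R) : continuous g ->
  (forall q : rat, 0 <= g (ratr q)) -> forall s, 0 <= g s.
Proof.
move=> cg gq s; rewrite leNgt; apply/negP => gs0.
have /(_ s) := cg; move=> /cvgrPdist_lt/(_ (- g s)); rewrite oppr_gt0.
move=> /(_ gs0) [e /= e0 H].
have [q] : exists q : rat, ratr q \in `]s, s + e[ by apply: rat_in_itvoo; rewrite ltrDl.
rewrite in_itv/= => /andP[sq qe].
have := H (ratr q); rewrite /ball/= ltr0_norm ?subr_lt0// opprB ltrBlDl => /(_ qe).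
rewrite distrC => /(le_lt_trans (ler_norm _)).
by rewrite ltrBlDr addNr ltNge gq.
Qed.

Lemma measurable_all_ge0 d (T : measurableType d) (F : T -> R -> R) :
  (forall x, continuous (F x)) -> (forall s, meas_fun (F ^~ s)) ->
  measurable [set x | forall s, 0 <= F x s].
Proof.
move=> cF mF.
have -> : [set x | forall s, 0 <= F x s] =
    ~` \bigcup_(q in [set: rat]) [set x | F x (ratr q) < 0].
  apply/seteqP; split => x /=.
    by move=> h [q _ /=]; rewrite ltNge h.
  move=> h; apply: rat_dense_ge0 => // q; rewrite leNgt; apply/negP => Fq.
  by apply: h; exists q.
apply: measurableC; apply: bigcupT_measurable_rat => q.
exact: measurable_lt_set.
Qed.

Lemma measurable_all_gt0 d (T : measurableType d) (F : T -> R -> R) :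
  (forall x, continuous (F x)) -> (forall s, meas_fun (F ^~ s)) ->
  measurable [set x | forall s, 0 <= s <= 1 -> 0 < F x s].
Proof.
move=> cF mF.
have -> : [set x | forall s, 0 <= s <= 1 -> 0 < F x s] =
    \bigcup_k [set x | forall s, 0 <= F x (clip s) - k.+1%:R^-1].
  apply/seteqP; split => x /=.
    move=> h; have [|c c01 cmin] := @EVT_min R (F x) 0 1 ler01.
      exact: continuous_subspaceT.
    have Fc : 0 < F x c by apply: h; move: c01; rewrite in_itv.
    have [k] := ltr_add_invr Fc; rewrite add0r => kc.
    exists k => //= s; rewrite subr_ge0 (le_trans (ltW kc))// cmin// in_itv/=.
    exact: clip_itv.
  move=> [k _ /= h] s s01; have := h s; rewrite clip_id// subr_ge0; apply: lt_le_trans.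
  by rewrite invr_gt0.
apply: bigcupT_measurable => k; apply: measurable_all_ge0 => [x|s].
  move=> s; apply: cvgB; last exact: cvg_cst.
  by apply: (continuous_comp (@continuous_clip s)); exact: cF.
by meas; exact: mF.
Qed.

(** The saturated sets form a sigma-algebra, and it contains the generators because those evaluate
    at times in [0, 1] only. Paths thus need to be compared on [0, 1] alone. *)
Lemma cpath_saturated (A : set (cpath R)) : measurable A ->
  forall w w' : cpath R, (forall t, 0 <= t <= 1 -> w t = w' t) -> A w -> A w'.
Proof.
pose S := [set A : set (cpath R) |
  forall w w' : cpath R, (forall t, 0 <= t <= 1 -> w t = w' t) -> A w <-> A w'].
move=> mA w w' ww'; suff : S A by move=> /(_ _ _ ww')[].
move: mA; apply: smallest_sub; first split.
- by [].
- by move=> B SB u v uv; split=> -[_ nB]; split=> // Bu; apply: nB; apply/(SB u v).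
- move=> F SF u v uv; split=> -[i _ Fi]; exists i => //; first by apply/(SF i u v).
  by apply/(SF i u v).
- move=> _ [t [U [t01 mU ->]]] u v uv /=.
  by rewrite (uv t t01).
Qed.

Lemma grid_itv n k : (k <= 2 ^ n)%N -> 0 <= (k%:R / 2 ^+ n : R) <= 1.
Proof.
move=> kn; rewrite divr_ge0// ?exprn_ge0//= ler_pdivrMr// mul1r -natrX ler_nat.
exact: kn.
Qed.

Lemma grid_refine n n' j : (n <= n')%N ->
  (j * 2 ^ (n' - n))%:R / 2 ^+ n' = j%:R / 2 ^+ n :> R.
Proof.
move=> nn'; rewrite natrM natrX -[in X in _ / X](subnKC nn') exprD -mulf_div divff ?mulr1//.
Qed.

Definition grid_set n (A : nat -> set R) : set (cpath R) :=
  [set w | forall k, (k <= 2 ^ n)%N -> A k (w (k%:R / 2 ^+ n))].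

Lemma measurable_grid_set n A : (forall k, measurable (A k)) -> measurable (grid_set n A).
Proof.
move=> mA.
have -> : grid_set n A = ~` \bigcup_k [set w : cpath R |
   (k <= 2 ^ n)%N /\ ~ A k (w (clip (k%:R / 2 ^+ n)))].
  apply/seteqP; split => w /=.
    by move=> h [k _ [kn nA]]; apply: nA; rewrite clip_id ?grid_itv//; exact: h.
  move=> h k kn; apply: contrapT => nA; apply: h; exists k => //; split => //.
  by rewrite clip_id ?grid_itv.
apply: measurableC; apply: bigcupT_measurable => k.
have [kn|kn] := leqP k (2 ^ n); last first.
  by rewrite (_ : [set w | _] = set0)//; apply/seteqP; split => w //= -[].
rewrite (_ : [set w | _] = ~` ((fun w : cpath R => w (clip (k%:R / 2 ^+ n))) @^-1` A k)).
  by apply: measurableC; apply: (measurable_pre (measurable_ev (clip_itv _))).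
by apply/seteqP; split => w /=; [case|].
Qed.

Local Open Scope ereal_scope.

(** Dyadic grids are nested, so the sets [grid_set n A] are stable under intersection; they generate
    because each path value is the limit of values at dyadic times. *)
Lemma grid_unique (m m' : {measure set (cpath R) -> \bar R}) : m setT < +oo ->
  (forall n A, (forall k, measurable (A k)) -> m (grid_set n A) = m' (grid_set n A)) ->
  forall A, measurable A -> m A = m' A.
Proof.
move=> fin e A mA.
pose G := [set B | exists n C, (forall k, measurable (C k : set R)) /\ B = grid_set n C].
have GT : G setT.
  by exists 0%N, (fun=> setT); split => //; apply/seteqP; split.
have Gm : G `<=` measurable by move=> _ [n [C [mC ->]]]; exact: measurable_grid_set.
apply: (measure_unique_generated Gm) => //.
- move=> _ _ [n [C [mC ->]]] [n' [C' [mC' ->]]].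
  wlog nn' : n n' C C' mC mC' / (n <= n')%N.
    move=> H; have [|/ltnW] := leqP n n'; first exact: H.
    by rewrite setIC; exact: H.
  (* On the finer grid the constraints of level [n] sit at the multiples of [2 ^ (n' - n)]. *)
  exists n', (fun k => C' k `&`
    (if (2 ^ (n' - n) %| k)%N then C (k %/ 2 ^ (n' - n))%N else setT)); split.
    by move=> k; apply: measurableI => //; case: ifP.
  have p2 : (2 ^ n' = 2 ^ n * 2 ^ (n' - n))%N by rewrite -expnD subnKC.
  apply/seteqP; split => w /=.
    move=> [h h'] k kn'; split; first exact: h'.
    case: ifP => // /dvdnP[j kE]; rewrite kE mulnK ?expn_gt0//.
    have jn : (j <= 2 ^ n)%N by move: kn'; rewrite kE p2 leq_pmul2r ?expn_gt0.
    have := h _ jn; congr (C j (w _)).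
    by rewrite grid_refine.
  move=> h; split => k kn; last by have [] := h _ kn.
  have kn' : (k * 2 ^ (n' - n) <= 2 ^ n')%N by rewrite p2 leq_pmul2r ?expn_gt0.
  have [_] := h _ kn'; rewrite dvdn_mull// mulnK ?expn_gt0//; congr (C k (w _)).
  by rewrite grid_refine.
- by move=> _ [n [C [mC ->]]]; exact: e.
- move: mA; apply: smallest_sub.
    exact: smallest_sigma_algebra.
  move=> _ [t [U [t01 mU ->]]].
  pose T := g_sigma_algebraType G.
  suff mt : measurable_fun [set: T] (fun w : T => (w : cpath R) t).
    by have := mt measurableT _ mU; rewrite setTI.
  apply: (@measurable_fun_cvg _ _ _ _ (fun n (w : T) => (w : cpath R) (dyad n t))).
    move=> n _ V mV; rewrite setTI; apply: sub_gen_smallest.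
    pose j := Num.truncn (t * 2 ^+ n)%R.
    exists n, (fun k => if k == j then V else setT); split.
      by move=> k; case: ifP.
    have jn : (j <= 2 ^ n)%N.
      rewrite -ltnS -(ltr_nat R) -natr1 natrX.
      have /andP[d0 d1] := dyad_itv n t01; have /andP[_ t1] := t01.
      have := le_trans d1 t1; rewrite /dyad ler_pdivrMr// mul1r -/j => h.
      by rewrite (le_lt_trans h)// ltrDl.
    apply/seteqP; split => w /=.
      by move=> Vw k kn; case: eqP => // ->.
    by move=> /(_ _ jn); rewrite eqxx.
  by move=> w _; exact: cvg_dyad_path.
Qed.

End path_measurability.

(** * Uniqueness of measures from multiplicative classes of functions *)

Section polynomial_approximation_of_indicators.
Context {R : realType}.
Implicit Types p y : R.

Lemma bernoulli_ge p N : 0 <= p -> 1 + N%:R * p <= (1 + p) ^+ N.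
Proof.
move=> p0; elim: N => [|N IH]; first by rewrite mul0r addr0 expr0.
rewrite exprS -natr1; have : 0 <= N%:R :> R by [].
have := ler_wpM2l (addr_ge0 ler01 p0) IH => h hN.
by apply: le_trans h; nra.
Qed.

Lemma bernoulli_le p N : 0 <= p <= 1 -> 1 - N%:R * p <= (1 - p) ^+ N.
Proof.
move=> /andP[p0 p1]; elim: N => [|N IH]; first by rewrite mul0r subr0 expr0.
rewrite exprS -natr1; have : 0 <= N%:R :> R by [].
have q0 : 0 <= 1 - p by rewrite subr_ge0.
have := ler_wpM2l q0 IH => h hN.
by apply: le_trans h; nra.
Qed.

Lemma cvg_natr_exp z : 0 <= z < 1 -> n%:R * z ^+ n @[n --> \oo] --> (0 : R).
Proof.
move=> /andP[z0 z1]; have [->|zn0] := eqVneq z 0.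
  rewrite -(cvg_shiftn 1)/=; under eq_fun do rewrite addn1 exprS mul0r mulr0.
  exact: cvg_cst.
have zp : 0 < z by rewrite lt_neqAle eq_sym zn0.
(* With [w] the square root of [z], [n z^n = (n w^n) w^n], and Bernoulli's inequality bounds [n w^n]
   by [1/dl]. *)
pose w := Num.sqrt z; have w2 : z = w ^+ 2 by rewrite sqr_sqrtr.
have w0 : 0 < w by rewrite sqrtr_gt0.
have w1 : w < 1 by rewrite -[ltRHS]sqrtr1 ltr_sqrt.
pose dl := w^-1 - 1; have dl0 : 0 < dl by rewrite subr_gt0 invf_gt1.
have nb n : n%:R * w ^+ n <= dl^-1.
  have := bernoulli_ge n (ltW dl0).
  have -> : 1 + dl = w^-1 by rewrite /dl addrC subrK.
  rewrite exprVn => h.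
  have : n%:R * dl <= (w ^+ n)^-1 by apply: le_trans h; rewrite lerDr.
  rewrite -[w ^- n]mul1r ler_pdivlMr ?exprn_gt0// => h'.
  by rewrite -[dl^-1]mul1r ler_pdivlMr// mulrAC.
apply: (@squeeze_cvgr _ _ _ _ (cst 0) (fun n => dl^-1 * w ^+ n)).
- apply: nearW => n; rewrite mulr_ge0// ?exprn_ge0//=.
  by rewrite w2 -exprM mulnC exprM expr2 mulrA ler_wpM2r// exprn_ge0// ltW.
- exact: cvg_cst.
- rewrite -[X in _ --> X](mulr0 dl^-1); apply: cvgMr.
  by apply: cvg_expr; rewrite ger0_norm// ltW.
Qed.

(** A variant of the polynomials in the elementary proof of the Stone-Weierstrass theorem. The
    factor [n] in the exponent forces the limit 0 also when [k y = 1], so that the limit is the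
    indicator of a strict inequality everywhere. *)
Lemma cvg_indic_lt (k : nat) y : 0 <= y <= 1 ->
  (1 - y ^+ n) ^+ (n * k ^ n) @[n --> \oo] --> ((k%:R * y < 1)%R%:R : R).
Proof.
move=> /andP[y0 y1].
have yn n : 0 <= y ^+ n <= 1 by rewrite exprn_ge0//= exprn_ile1.
have NE n : (n * k ^ n)%:R * y ^+ n = n%:R * (k%:R * y) ^+ n.
  by rewrite natrM natrX exprMn mulrA.
have ky0 : 0 <= k%:R * y by rewrite mulr_ge0.
case: ltP => ky.
  apply: (@squeeze_cvgr _ _ _ _ (fun n => 1 - n%:R * (k%:R * y) ^+ n) (cst 1)).
  - apply: nearW => n; have /andP[a b] := yn n; apply/andP; split.
      by rewrite -NE; exact: bernoulli_le.
    by rewrite exprn_ile1 ?subr_ge0// lerBlDr lerDl.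
  - rewrite -[X in _ --> X]subr0; apply: cvgB; first exact: cvg_cst.
    by apply: cvg_natr_exp; rewrite ky0.
  - exact: cvg_cst.
apply: (@squeeze_cvgr _ _ _ _ (cst 0) (fun n => n.+1%:R^-1)).
- apply: nearW => n; have /andP[a b] := yn n; apply/andP; split.
    by rewrite exprn_ge0// subr_ge0.
  (* From [(1 - p)^N (1 + p)^N <= 1] and Bernoulli's inequality, the power is at most [1/(1 + N p)],
     and here [N p >= n]. *)
  set p := y ^+ n in a b *; set N := (n * k ^ n)%N.
  have N1 : n.+1%:R <= 1 + N%:R * p.
    by rewrite -natr1 addrC lerD2l NE ler_peMr// exprn_ege1.
  rewrite -div1r ler_pdivlMr//.
  rewrite (le_trans (ler_wpM2l _ (le_trans N1 (bernoulli_ge N a))))//.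
    by rewrite exprn_ge0// subr_ge0.
  by rewrite -exprMn exprn_ile1//; nra.
- exact: cvg_cst.
- exact: cvg_harmonic.
Qed.

End polynomial_approximation_of_indicators.

Section multiplicative_class.
Local Open Scope ereal_scope.
Context d (T : measurableType d) {R : realType}.
Variables (m m' : {measure set T -> \bar R}) (G : set (T -> R)).
Hypothesis mfin : m setT < +oo.
Hypothesis mfin' : m' setT < +oo.
Hypothesis G_meas : forall g, G g -> meas_fun g.
Hypothesis G01 : forall g, G g -> forall x, (0 <= g x <= 1)%R.
Hypothesis GM : forall f g, G f -> G g -> G (fun x => f x * g x)%R.
Hypothesis GZ : forall c g, (0 <= c <= 1)%R -> G g -> G (fun x => c * g x)%R.
Hypothesis G1 : G (fun=> 1%R).
Hypothesis GE : forall g, G g -> \int[m]_x (g x)%:E = \int[m']_x (g x)%:E.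

Lemma integrable01 (mu : {measure set T -> \bar R}) (f : T -> R) :
  mu setT < +oo -> meas_fun f -> (forall x, (0 <= f x <= 1)%R) ->
  mu.-integrable setT (EFin \o f).
Proof.
move=> fin mf f01; apply: measurable_bounded_integrable => //.
exists 1%R; split => // M M1 x _ /=; have /andP[f0 f1] := f01 x.
by rewrite ger0_norm// (le_trans f1)// ltW.
Qed.

(** Functions that may multiply every element of [G] without separating [m] from [m']. The class is
    closed under multiplication by [1 - g] and under pointwise limits, hence, through the
    polynomials above, under multiplication by the indicator of [g < a]. Only products and scalings
    are used in [G], no sums. *)
Let V (h : T -> R) := [/\ meas_fun h, forall x, (0 <= h x <= 1)%R &
  forall g, G g -> \int[m]_x (h x * g x)%:E = \int[m']_x (h x * g x)%:E].

Let itv_mul (a b : R) : (0 <= a <= 1 -> 0 <= b <= 1 -> 0 <= a * b <= 1)%R.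
Proof. by move=> /andP[? ?] /andP[? ?]; rewrite mulr_ge0//= mulr_ile1. Qed.

Let V_onem h g : V h -> G g -> V (fun x => h x * (1 - g x))%R.
Proof.
move=> [mh h01 hE] Gg; have mg := G_meas Gg; split.
- by meas.
- move=> x; apply: itv_mul => //; have /andP[? ?] := G01 Gg x.
  by rewrite subr_ge0 lerBlDr lerDl; apply/andP.
- move=> f Gf; have mf := G_meas Gf.
  have E (mu : {measure set T -> \bar R}) : mu setT < +oo ->
      \int[mu]_x (h x * (1 - g x) * f x)%:E =
      \int[mu]_x (h x * f x)%:E - \int[mu]_x (h x * (g x * f x))%:E.
    move=> fin; rewrite -integralB_EFin//; last 2 first.
    - apply: integrable01 => //; first by meas.
      by move=> x; apply: itv_mul => //; exact: G01.
    - apply: integrable01 => //; first by meas.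
      move=> x; apply: itv_mul => //; apply: itv_mul; exact: G01.
    by apply: eq_integral => x _; congr EFin; ring.
  by rewrite !E// hE// hE//; exact: GM.
Qed.

Let V_onem_exp h g n : V h -> G g -> V (fun x => h x * (1 - g x) ^+ n)%R.
Proof.
move=> Vh Gg; elim: n => [|n IH].
  by under eq_fun do rewrite expr0 mulr1.
under eq_fun do rewrite exprSr mulrA.
exact: V_onem.
Qed.

Let G_exp g n : G g -> G (fun x => g x ^+ n)%R.
Proof.
move=> Gg; elim: n => [|n IH]; first by under eq_fun do rewrite expr0.
by under eq_fun do rewrite exprS; exact: GM.
Qed.

Let V_lim (h_ : nat -> T -> R) h : (forall n, V (h_ n)) ->
  (forall x, h_ n x @[n --> \oo] --> h x) -> V h.
Proof.
move=> Vh_ cvh.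
have mh : meas_fun h.
  by apply: (@measurable_fun_cvg _ _ _ _ h_) => [n|x _]; [have [] := Vh_ n|exact: cvh].
split => //.
- move=> x; apply/andP; split.
    apply: (cvgr_to_ge (cvh x)); apply: nearW => n.
    by have [_ /(_ x) /andP[]] := Vh_ n.
  apply: (cvgr_to_le (cvh x)); apply: nearW => n.
  by have [_ /(_ x) /andP[]] := Vh_ n.
- move=> g Gg; have mg := G_meas Gg.
  have C (mu : {measure set T -> \bar R}) : mu setT < +oo ->
      \int[mu]_x (h_ n x * g x)%:E @[n --> \oo] --> \int[mu]_x (h x * g x)%:E.
    move=> fin; apply: (@dominated_cvg _ _ _ mu setT measurableT
      (fun n x => (h_ n x * g x)%:E) _ (cst 1)) => //.
    - by move=> n; have [mhn _ _] := Vh_ n; meas.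
    - move=> x _; apply: cvg_EFin; first exact: nearW.
      by apply: cvgMl; exact: cvh.
    - have := @integrable01 mu (cst 1%R) fin; apply; first by meas.
      by move=> _ /=; rewrite lexx ler01.
    - move=> n x _; have [_ h01 _] := Vh_ n; rewrite abse_EFin lee_fin.
      by have /andP[? ?] := itv_mul (h01 x) (G01 Gg x); rewrite ger0_norm.
  have := C m mfin; rewrite (_ : (fun n => _) =
    (fun n => \int[m']_x (h_ n x * g x)%:E)).
    by move=> h1; exact: (cvg_unique _ h1 (C m' mfin')).
  by apply/funext => n; have [_ _ ->] := Vh_ n.
Qed.

Let V_indic h g (a : R) : V h -> G g -> (0 < a <= 1)%R ->
  V (fun x => h x * (g x < a)%R%:R)%R.
Proof.
move=> Vh Gg /andP[a0 a1].
(* The scaling by [c] moves the threshold [a] to [1/k]: [k (c g) < 1] if and only if [g < a]. The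
   choice of [k] ensures [c <= 1], so that [c g] stays in [G]. *)
pose k := (Num.truncn a^-1).+1.
have ka : (1 <= k%:R * a)%R.
  rewrite -ler_pdivrMr// div1r; apply: ltW.
  have : (0 <= a^-1)%R by rewrite invr_ge0 ltW.
  by move=> /truncn_itv/andP[].
have ka0 : (0 < k%:R * a)%R by apply: lt_le_trans ka.
pose c := ((k%:R * a)^-1)%R.
have c01 : (0 <= c <= 1)%R.
  by rewrite invr_ge0 (ltW ka0)//= invf_le1.
have Gcg := GZ c01 Gg.
pose h_ n x := (h x * (1 - (c * g x) ^+ n) ^+ (n * k ^ n))%R.
apply: (V_lim (h_ := h_)).
  by move=> n; apply: V_onem_exp => //; exact: (G_exp n Gcg).
move=> x; apply: cvgMr; have := @cvg_indic_lt R k _ (G01 Gcg x).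
rewrite (_ : (k%:R * (c * g x) < 1)%R = (g x < a)%R)//.
by rewrite /c mulrCA ltr_pdivrMl// mulr1 ltr_pM2l.
Qed.

Lemma multiplicative_class (gs : seq ((T -> R) * R)) :
  (forall p, p \in gs -> G p.1 /\ (0 < p.2 <= 1)%R) ->
  m [set x | all (fun p => p.1 x < p.2)%R gs] =
  m' [set x | all (fun p => p.1 x < p.2)%R gs].
Proof.
move=> Hgs.
have : V (fun x => (all (fun p => p.1 x < p.2)%R gs)%:R)%R.
  elim: gs Hgs => [|p gs IH] Hgs /=.
    split => //; first by move=> x; rewrite ler01 lexx.
    by move=> g Gg; under eq_integral do rewrite mul1r; rewrite GE//;
      under [RHS]eq_integral do rewrite mul1r.
  have [Gp ap] : G p.1 /\ (0 < p.2 <= 1)%R by apply: Hgs; rewrite mem_head.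
  rewrite (_ : (fun x => _) = fun x =>
    ((all (fun p => p.1 x < p.2)%R gs)%:R * (p.1 x < p.2)%R%:R)%R); last first.
    by apply/funext => x; rewrite andbC -natrM mulnb.
  apply: V_indic => //; apply: IH => q qgs; apply: Hgs.
  by rewrite in_cons qgs orbT.
set A := [set x | _]; move=> [mA _ /(_ _ G1)].
have E (mu : {measure set T -> \bar R}) :
    \int[mu]_x ((all (fun p => p.1 x < p.2)%R gs)%:R * 1)%:E = mu A.
  have mAA : measurable A.
    have := mA measurableT [set 1%R] (measurable_set1 _); rewrite setTI.
    congr measurable; apply/seteqP; split => x /=; rewrite /A/=; case: all => //.
    by move=> /eqP; rewrite eq_sym oner_eq0.
  transitivity (mu (A `&` setT)); last by rewrite setIT.
  rewrite -integral_indic//; apply: eq_integral => x _.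
  rewrite mulr1 indicE (_ : (x \in A) = all (fun p => p.1 x < p.2)%R gs)//.
  by apply/idP/idP => [/set_mem//|h]; exact/mem_set.
by rewrite !E.
Qed.

End multiplicative_class.

Section laplace_uniqueness.
Local Open Scope ereal_scope.
Context {R : realType}.

(** The functions [c exp(- al y^2)] form a multiplicative class, and [exp(- y^2) < exp(- b^2)] means
    [|y| > b]. As neither measure charges negative numbers, they agree on rays. *)
Lemma squared_laplace_unique (m m' : {measure set R -> \bar R}) :
  m setT < +oo -> m' setT < +oo ->
  m `]-oo, 0%R[%classic = 0 -> m' `]-oo, 0%R[%classic = 0 ->
  (forall al : R, (0 <= al)%R -> \int[m]_y (expR (- al * y ^+ 2))%:E =
                       \int[m']_y (expR (- al * y ^+ 2))%:E) ->
  forall A, measurable A -> m A = m' A.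
Proof.
move=> mfin mfin' m0 m0' E A mA.
pose G := [set g : R -> R | exists c al, [/\ (0 <= c <= 1)%R, (0 <= al)%R &
   g = fun y => (c * expR (- al * y ^+ 2))%R]].
have Gm g : G g -> meas_fun g.
  by move=> [c [al [_ _ ->]]]; meas.
have e01 (al y : R) : (0 <= al -> 0 <= expR (- al * y ^+ 2) <= 1)%R.
  move=> al0; rewrite expR_ge0/= -expR0 ler_expR mulNr oppr_le0.
  by rewrite mulr_ge0// sqr_ge0.
have H : forall gs : seq ((R -> R) * R),
    (forall p, p \in gs -> G p.1 /\ (0 < p.2 <= 1)%R) ->
    m [set x | all (fun p => p.1 x < p.2)%R gs] =
    m' [set x | all (fun p => p.1 x < p.2)%R gs].
  apply: (@multiplicative_class _ _ R m m' G) => //.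
  - move=> _ [c [al [/andP[c0 c1] al0 ->]]] x.
    by have /andP[? ?] := e01 _ x al0; rewrite mulr_ge0//= mulr_ile1.
  - move=> _ _ [c [al [/andP[c0 c1] al0 ->]]] [c' [al' [/andP[c0' c1'] al0' ->]]].
    exists (c * c')%R, (al + al')%R; split; first by rewrite mulr_ge0//= mulr_ile1.
      exact: addr_ge0.
    by apply/funext => y; rewrite mulrACA -expRD; congr (_ * expR _)%R; ring.
  - move=> c _ /andP[c0 c1] [c' [al' [/andP[c0' c1'] al0' ->]]].
    exists (c * c')%R, al'; split => //; first by rewrite mulr_ge0//= mulr_ile1.
    by apply/funext => y; rewrite mulrA.
  - exists 1%R, 0%R; split => //; first by rewrite ler01 lexx.
    by apply/funext => y; rewrite mul1r oppr0 mul0r expR0.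
  - move=> _ [c [al [/andP[c0 c1] al0 ->]]].
    have e0 y : (0 <= expR (- al * y ^+ 2))%R by exact: expR_ge0.
    under eq_integral do rewrite EFinM.
    under [RHS]eq_integral do rewrite EFinM.
    by rewrite !ge0_integralZl ?E//; meas.
have mT : m setT = m' setT.
  rewrite (_ : setT = [set x : R | all (fun p : (R -> R) * R => (p.1 x < p.2)%R) [::]]).
    exact: H.
  by apply/seteqP.
have neg (mu : {measure set R -> \bar R}) (b : R) :
    mu `]-oo, 0%R[%classic = 0 -> (b <= 0)%R -> mu `]-oo, b[%classic = 0.
  move=> mu0 b0; apply/eqP; rewrite -measure_le0 -mu0 le_measure ?inE//.
  by move=> x /=; rewrite !in_itv/= => /lt_le_trans; apply.
have ray (b : R) : m `]b, +oo[%classic = m' `]b, +oo[%classic.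
  have [b0|b0] := leP 0%R b.
    have E1 (mu : {measure set R -> \bar R}) : mu `]-oo, 0%R[%classic = 0 ->
        mu `]b, +oo[%classic = mu [set x | all (fun p => p.1 x < p.2)%R
          [:: ((fun y => 1 * expR (- 1 * y ^+ 2)), expR (- b ^+ 2))%R]].
      move=> mu0; apply/esym; rewrite [X in mu X = _](_ : _ = `]b, +oo[%classic `|` `]-oo, (- b)%R[%classic).
        rewrite measureU//=; last first.
          apply/seteqP; split => x //=; rewrite !in_itv/= andbT => -[h1 h2].
          by have := lt_trans h1 h2; rewrite ltNge -subr_ge0 opprK addr_ge0.
        by rewrite (neg _ (- b)%R)// ?adde0// oppr_le0.
      apply/seteqP; split => x /=.
        rewrite andbT !in_itv/= andbT mul1r ltr_expR mulN1r ltrN2 => h.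
        have [x0|x0] := leP 0%R x; [left|right].
          by rewrite ltr_pXn2r ?nnegrE// in h.
        rewrite ltrNr -(ltr_pXn2r (n := 2)) ?nnegrE// ?oppr_ge0 ?(ltW x0)//.
        by rewrite sqrrN.
      rewrite andbT !in_itv/= andbT mul1r ltr_expR mulN1r ltrN2 => -[h|h].
        by rewrite ltr_pXn2r ?nnegrE// ltW// (le_lt_trans b0 h).
      rewrite -[ltRHS]sqrrN ltr_pXn2r ?nnegrE//; first by rewrite ltrNr.
      by rewrite oppr_ge0 (le_trans (ltW h))// oppr_le0.
    rewrite !E1//; apply: H => p; rewrite inE => /eqP -> /=; split.
      exists 1%R, 1%R; split => //; first by rewrite ler01 lexx.
    by rewrite expR_gt0/= -expR0 ler_expR oppr_le0 sqr_ge0.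
  have E1 (mu : {measure set R -> \bar R}) : mu `]-oo, 0%R[%classic = 0 ->
      mu `]b, +oo[%classic = mu setT.
    move=> mu0; rewrite (_ : setT = `]b, +oo[%classic `|` `]-oo, b]%classic); last first.
      by rewrite -setCitvr setUv.
    rewrite measureU//=; last by rewrite -setCitvr setICr.
    rewrite [X in _ + X](_ : _ = 0) ?adde0//.
    apply/eqP; rewrite -measure_le0 -mu0 le_measure ?inE//.
    by move=> x /=; rewrite !in_itv/= => /le_lt_trans; apply.
  by rewrite !E1.
apply: (@measure_unique_generated _ _ R [set B | B = setT \/ RGenOInfty.G B]) => //.
- by move=> _ [->|[x ->]].
- move=> _ _ [->|[x ->]] [->|[x' ->]]; rewrite ?setTI ?setIT.
  + by left.
  + by right; exists x'.
  + by right; exists x.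
  + right; exists (Num.max x x'); apply/seteqP; split => y /=;
      rewrite !in_itv/= !andbT gt_max; first by move=> [-> ->].
    by move=> /andP.
- by left.
- by move=> _ [->|[x ->]].
- move: mA; rewrite -[measurable]/(measurable : set (set (measurableTypeR R))).
  rewrite RGenOInfty.measurableE => mA.
  move: mA; apply: smallest_sub; first exact: smallest_sigma_algebra.
  by move=> B GB; apply: sub_gen_smallest; right.
Qed.

End laplace_uniqueness.

(** * Laws on paths are determined by cosines of linear functionals *)

Section trigonometric_uniqueness.
Local Open Scope ereal_scope.
Context {R : realType}.
Implicit Types (w : cpath R) (s : seq (R * R)).

Definition lin s w : R := (\sum_(p <- s) p.1 * w p.2)%R.

Definition times01 s := forall p, p \in s -> (0 <= p.2 <= 1)%R.

(** The phases make this span contain sines and constants, and make it stable under products by the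
    product-to-sum formula. *)
Inductive trig : (cpath R -> R) -> Prop :=
| trig_cos s th : times01 s -> trig (fun w => cos (lin s w + th)%R)
| trig_add f g : trig f -> trig g -> trig (fun w => f w + g w)%R
| trig_scale (c : R) f : trig f -> trig (fun w => c * f w)%R.

Lemma measurable_lin s : times01 s -> meas_fun (lin s).
Proof.
elim: s => [_|p s IH ps].
  by rewrite (_ : lin [::] = cst 0%R)//; apply/funext => w; rewrite /lin big_nil.
rewrite (_ : lin _ = fun w => p.1 * w p.2 + lin s w)%R; last first.
  by apply/funext => w; rewrite /lin big_cons.
apply: mfD; last by apply: IH => q qs; apply: ps; rewrite in_cons qs orbT.
by apply: mfM => //; apply: measurable_ev; apply: ps; rewrite mem_head.
Qed.

Lemma lin_cat s s' w : lin (s ++ s') w = (lin s w + lin s' w)%R.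
Proof. by rewrite /lin big_cat. Qed.

Lemma lin_opp s w : lin [seq (- p.1, p.2)%R | p <- s] w = (- lin s w)%R.
Proof. by rewrite /lin big_map -sumrN; apply: eq_bigr => p _; rewrite mulNr. Qed.

Lemma trig_measurable f : trig f -> meas_fun f.
Proof.
by elim => *; meas; exact: measurable_lin.
Qed.

Lemma trig_bounded f : trig f -> exists M, forall w, (`|f w| <= M)%R.
Proof.
elim => [s th _|g h _ [M gM] _ [N hN]|c g _ [M gM]].
- by exists 1%R => w; rewrite ler_norml cos_geN1 cos_le1.
- by exists (M + N)%R => w; rewrite (le_trans (ler_normD _ _))// lerD.
- by exists (`|c| * M)%R => w; rewrite normrM ler_wpM2l.
Qed.

Lemma trig_mul f g : trig f -> trig g -> trig (fun w => f w * g w)%R.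
Proof.
move=> tf; elim: tf g => [s th hs|f1 f2 _ IH1 _ IH2|c f1 _ IH] g tg; last 2 first.
- by under eq_fun do rewrite mulrDl; apply: trig_add; [exact: IH1|exact: IH2].
- by under eq_fun do rewrite -mulrA; apply: trig_scale; exact: IH.
elim: tg => [s' th' hs'|f1 f2 _ IH1 _ IH2|c f1 _ IH]; last 2 first.
- by under eq_fun do rewrite mulrDr; exact: trig_add.
- by under eq_fun do rewrite mulrCA; exact: trig_scale.
rewrite (_ : (fun w => _) = fun w => (2^-1 * (cos (lin (s ++ s') w + (th + th')) +
   cos (lin (s ++ [seq (- p.1, p.2) | p <- s']) w + (th - th'))))%R).
  apply: trig_scale; apply: trig_add; apply: trig_cos.
    by move=> p; rewrite mem_cat => /orP[/hs|/hs'].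
  move=> p; rewrite mem_cat => /orP[/hs//|/mapP[q /hs' + ->]]; exact.
apply/funext => w; rewrite !lin_cat lin_opp.
rewrite (_ : _ + _ + (th + th') = lin s w + th + (lin s' w + th'))%R; last by ring.
rewrite (_ : _ - _ + (th - th') = lin s w + th - (lin s' w + th'))%R; last by ring.
move: (_ + th)%R (_ + th')%R => x y; rewrite cosD cosB.
by lra.
Qed.

Lemma trig_cst c : trig (fun=> c).
Proof.
rewrite (_ : (fun=> c) = fun w => (c * cos (lin [::] w + 0))%R).
  by apply: trig_scale; exact: trig_cos.
by apply/funext => w; rewrite /lin big_nil addr0 cos0 mulr1.
Qed.

(** Trigonometric functions with values in [0, 1] form a multiplicative class; the work lies in
    recovering the evaluations from comparisons of such functions with constants. *)
Lemma cpath_trig_unique (m m' : {measure set (cpath R) -> \bar R}) :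
  m setT < +oo -> m' setT < +oo ->
  (forall s th, times01 s -> \int[m]_w (cos (lin s w + th))%:E =
                             \int[m']_w (cos (lin s w + th))%:E) ->
  forall A, measurable A -> m A = m' A.
Proof.
move=> mfin mfin' E A mA.
pose G := [set g | trig g /\ forall w, (0 <= g w <= 1)%R].
have int (mu : {measure set (cpath R) -> \bar R}) g : mu setT < +oo -> trig g ->
    mu.-integrable setT (EFin \o g).
  move=> fin tg; apply: measurable_bounded_integrable => //.
    exact: trig_measurable.
  have [M gM] := trig_bounded tg.
  by exists M; split => [|N MN x _ /=]; [exact: num_real|exact: le_trans (gM x) (ltW MN)].
have TE g : trig g -> \int[m]_w (g w)%:E = \int[m']_w (g w)%:E.
  elim => [s th /E//|f h tf IHf th IHh|c f tf IH].
    under eq_integral do rewrite EFinD.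
    under [RHS]eq_integral do rewrite EFinD.
    rewrite integralD_EFin//; try exact: int.
    rewrite integralD_EFin//; try exact: int.
    by rewrite IHf IHh.
  under eq_integral do rewrite EFinM.
  under [RHS]eq_integral do rewrite EFinM.
  by rewrite !integralZl ?IH//; exact: int.
have H : forall gs : seq ((cpath R -> R) * R),
    (forall p, p \in gs -> G p.1 /\ (0 < p.2 <= 1)%R) ->
    m [set x | all (fun p => p.1 x < p.2)%R gs] =
    m' [set x | all (fun p => p.1 x < p.2)%R gs].
  apply: (@multiplicative_class _ _ R m m' G) => //.
  - by move=> g [tg _]; exact: trig_measurable.
  - by move=> g [].
  - move=> f g [tf f01] [tg g01]; split; first exact: trig_mul.
    by move=> w; have /andP[? ?] := f01 w; have /andP[? ?] := g01 w;
      rewrite mulr_ge0//= mulr_ile1.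
  - move=> c g /andP[c0 c1] [tg g01]; split; first exact: trig_scale.
    by move=> w; have /andP[? ?] := g01 w; rewrite mulr_ge0//= mulr_ile1.
  - by split; [exact: trig_cst|move=> w; rewrite ler01 lexx].
  - by move=> g [tg _]; exact: TE.
pose P := [set B | exists gs : seq ((cpath R -> R) * R),
  (forall p, p \in gs -> G p.1 /\ (0 < p.2 <= 1)%R) /\
  B = [set x | all (fun p => p.1 x < p.2)%R gs]].
apply: (@measure_unique_generated _ _ R P) => //.
- move=> _ [gs [+ ->]]; elim: gs => [_|p gs IH Hp].
    by rewrite (_ : [set x | _] = setT)//; apply/seteqP; split.
  rewrite (_ : [set x | _] = [set x | (p.1 x < p.2)%R] `&`
    [set x | all (fun p => p.1 x < p.2)%R gs]); last first.
    by apply/seteqP; split => x /= /andP.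
  apply: measurableI; last by apply: IH => q qgs; apply: Hp; rewrite in_cons qgs orbT.
  apply: measurable_lt_set => //; apply: trig_measurable.
  by have [[]] := Hp _ (mem_head _ _).
- move=> _ _ [gs [h ->]] [gs' [h' ->]]; exists (gs ++ gs'); split.
    by move=> p; rewrite mem_cat => /orP[/h|/h'].
  by apply/seteqP; split => x /=; rewrite all_cat => /andP.
- by exists [::]; split => //; apply/seteqP; split.
- by move=> _ [gs [h ->]]; exact: H.
- move: mA; apply: smallest_sub.
    exact: smallest_sigma_algebra.
  move=> _ [t [U [t01 mU ->]]].
  pose T := g_sigma_algebraType P.
  suff mt : measurable_fun [set: T] (fun w : T => (w : cpath R) t).
    by have := mt measurableT _ mU; rewrite setTI.
  apply: measurable_fun_lt => a.
  (* The event [w t < a] coincides with [S n] as soon as [n] exceeds [|w t|] and [|a|], because the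
     sine increases on [-1, 1]; it is thus the lower limit of the [S n]. The affine map puts the
     sine in [0, 1]. *)
  pose S n := [set w : T | (2^-1 * (1 + sin (n%:R^-1 * (w : cpath R) t)) <
                      2^-1 * (1 + sin (n%:R^-1 * a)))%R].
  pose n0 := (Num.truncn `|a|%R).+1.
  have arc (x : R) n : (`|x| < n%:R)%R -> (n%:R^-1 * x \in `[- (pi / 2), pi / 2])%R.
    move=> xn; rewrite in_itv/= -ler_norml normrM.
    rewrite normfV [`|n%:R|%R]ger0_norm//; apply: le_trans _ (pihalf_ge1 R).
    by rewrite mulrC ler_pdivrMr ?mul1r ?ltW//; apply: le_lt_trans xn.
  have an n : (n0 <= n)%N -> (`|a| < n%:R)%R.
    move=> n0n; apply: (@lt_le_trans _ _ n0%:R); last by rewrite ler_nat.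
    by have /andP[] := truncn_itv (normr_ge0 a).
  have S_mono n w : (n0 <= n)%N -> (`|(w : cpath R) t| < n%:R)%R ->
      S n w = ((w : cpath R) t < a)%R :> Prop.
    move=> n0n wn; rewrite /S/= ltr_pM2l ?invr_gt0// ltrD2l ltr_sin ?arc ?an//.
    rewrite ltr_pM2l// invr_gt0 (le_lt_trans _ wn)//.
  have mS n : (n0 <= n)%N -> measurable (S n).
    move=> n0n; apply: sub_gen_smallest.
    exists [:: ((fun w : cpath R => 2^-1 * (1 + sin (n%:R^-1 * w t)))%R,
                (2^-1 * (1 + sin (n%:R^-1 * a)))%R)]; split; last first.
      by apply/seteqP; split => x /=; rewrite andbT.
    have h2 (x : R) : (-1 <= x <= 1)%R -> (0 <= 2^-1 * (1 + x) <= 1)%R.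
      by move=> /andP[? ?]; lra.
    move=> p; rewrite inE => /eqP -> /=; split; last first.
      have /andP[_ ->] : (0 <= 2^-1 * (1 + sin (n%:R^-1 * a)) <= 1)%R.
        by apply: h2; rewrite sin_geN1 sin_le1.
      have hm : (sin (- (pi / 2)) = -1 :> R)%R by rewrite sinN sin_pihalf.
      rewrite andbT mulr_gt0// -ltrBlDl sub0r -hm ltr_sin.
      - have := arc a n (an n n0n); rewrite in_itv/= => /andP[h _].
        rewrite lt_neqAle h andbT; apply/eqP => e.
        have n_gt0 : (0 < n%:R :> R)%R by exact: le_lt_trans (an n n0n).
        have : (`|n%:R^-1 * a| < 1)%R.
          by rewrite normrM normfV [`|n%:R|%R]ger0_norm// mulrC ltr_pdivrMr// mul1r an.
        rewrite -e normrN ger0_norm ?divr_ge0 ?pi_ge0// => /lt_le_trans/(_ (pihalf_ge1 R)).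
        by rewrite ltxx.
      - by rewrite in_itv/= lexx/= -subr_ge0 opprK addr_ge0 ?divr_ge0 ?pi_ge0.
      - exact/arc/an.
    split; last by move=> w; apply: h2; rewrite sin_geN1 sin_le1.
    apply: trig_scale; apply: trig_add; first exact: trig_cst.
    rewrite (_ : (fun w => _) = fun w => (cos (lin [:: (- n%:R^-1, t)] w + pi / 2))%R).
      by apply: trig_cos => q; rewrite inE => /eqP ->.
    by apply/funext => w; rewrite cosDpihalf /lin big_seq1 mulNr sinN opprK.
  rewrite (_ : [set x | _] = \bigcup_N \bigcap_n S (n0 + N + n)%N).
    apply: bigcupT_measurable => N; apply: bigcapT_measurable => n.
    by apply: mS; rewrite -addnA leq_addr.
  have big (x : R) n : (Num.truncn `|x|%R < n)%N -> (`|x| < n%:R)%R.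
    move=> h; apply: (@lt_le_trans _ _ (Num.truncn `|x|%R).+1%:R); last by rewrite ler_nat.
    by have /andP[] := truncn_itv (normr_ge0 x).
  apply/seteqP; split => w /=.
    move=> wa; exists (Num.truncn `|(w : cpath R) t|%R).+1 => // n _.
    rewrite S_mono//; first by rewrite -addnA leq_addr.
    by apply: big; rewrite -addnA addnCA leq_addr.
  move=> [N _ /(_ (Num.truncn `|(w : cpath R) t|%R).+1 I)].
  rewrite S_mono//; first by rewrite -addnA leq_addr.
  by apply: big; rewrite leq_addl.
Qed.

End trigonometric_uniqueness.

(** * Rules of differentiation *)

Section real_derivatives.
Context {R : realType}.
Implicit Types (f g : R -> R) (x a b : R).

Lemma der_eq f x a b : isder x f a -> a = b -> isder x f b.
Proof. by move=> h <-. Qed.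

Lemma der_D f g x a b : isder x f a -> isder x g b ->
  isder x (fun y => f y + g y) (a + b).
Proof. by move=> *; exact: is_deriveD. Qed.

Lemma der_N f x a : isder x f a ->
  isder x (fun y => - f y) (- a).
Proof. by move=> *; exact: is_deriveN. Qed.

Lemma der_M f g x a b : isder x f a -> isder x g b ->
  isder x (fun y => f y * g y) (f x * b + g x * a).
Proof. by move=> *; exact: is_deriveM. Qed.

Lemma der_cst c x : isder x (fun=> c : R) 0.
Proof. exact: is_derive_cst. Qed.

Lemma der_id x : isder x (fun y : R => y) 1.
Proof. exact: is_derive_id. Qed.

Lemma der_comp f g x a b : isder (g x) f a -> isder x g b ->
  isder x (fun y => f (g y)) (a * b).
Proof. by move=> *; exact: is_derive1_comp. Qed.

Lemma der_exp f x a : isder x f a ->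
  isder x (fun y => expR (f y)) (expR (f x) * a).
Proof. by apply: der_comp; exact: is_derive_expR. Qed.

Lemma der_cos f x a : isder x f a ->
  isder x (fun y => cos (f y)) (- sin (f x) * a).
Proof. by apply: der_comp; exact: is_derive_cos. Qed.

Lemma der_sin f x a : isder x f a ->
  isder x (fun y => sin (f y)) (cos (f x) * a).
Proof. by apply: der_comp; exact: is_derive_sin. Qed.

Lemma der_V f x a : f x != 0 -> isder x f a ->
  isder x (fun y => (f y)^-1) (- (f x ^- 2) * a).
Proof. by move=> *; exact: is_deriveV. Qed.

Lemma der_sqrt f x a : 0 < f x -> isder x f a ->
  isder x (fun y => Num.sqrt (f y)) ((2 * Num.sqrt (f x))^-1 * a).
Proof. by move=> fx; apply: der_comp; exact: is_derive1_sqrt. Qed.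

Lemma der_sqr f x a : isder x f a ->
  isder x (fun y => f y ^+ 2) (2 * f x * a).
Proof.
move=> h; rewrite (_ : (fun y => f y ^+ 2) = fun y => f y * f y).
  by apply: der_eq (der_M h h) _; ring.
by apply/funext => y; rewrite expr2.
Qed.

Lemma der_continuous f x a : isder x f a -> {for x, continuous f}.
Proof. by move=> [d _]; apply/differentiable_continuous/derivable1_diffP. Qed.

Lemma der_derive1 f x a : isder x f a -> f^`()%classic x = a.
Proof. by move=> [_ <-]; rewrite derive1E. Qed.

End real_derivatives.

Ltac der1 :=
  lazymatch goal with
  | |- is_derive _ _ (fun _ => ?c) _ => exact: der_cst
  | |- is_derive _ _ (fun y => y) _ => exact: der_id
  | |- is_derive _ _ (@GRing.opp _) _ => eapply (@der_N _ (fun y => y)); exact: der_id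
  | |- is_derive _ _ (@GRing.inv _) _ => eapply (@der_V _ (fun y => y)); [|exact: der_id]
  | |- is_derive _ _ (@Num.sqrt _) _ => eapply (@der_sqrt _ (fun y => y)); [|exact: der_id]
  | |- is_derive _ _ (fun y => @?f y + @?g y) _ => eapply der_D
  | |- is_derive _ _ (fun y => - @?f y) _ => eapply der_N
  | |- is_derive _ _ (fun y => @?f y * @?g y) _ => eapply der_M
  | |- is_derive _ _ (fun y => (@?f y)^-1) _ => eapply der_V
  | |- is_derive _ _ (fun y => @?f y ^+ 2) _ => eapply der_sqr
  | |- is_derive _ _ (fun y => expR (@?f y)) _ => eapply der_exp
  | |- is_derive _ _ (fun y => cos (@?f y)) _ => eapply der_cos
  | |- is_derive _ _ (fun y => sin (@?f y)) _ => eapply der_sin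
  | |- is_derive _ _ (fun y => Num.sqrt (@?f y)) _ => eapply der_sqrt
  end.
Ltac der := repeat (first [eassumption | der1]).

(** * Heat kernel and first hitting densities *)

Section heat_kernel.
Context {R : realType}.
Implicit Types t u x y z v : R.

(* Heat kernel at time [t]; the junk values of square root and inverse make it vanish for [t <=
   0]. *)
Definition heat t x : R :=
  (Num.sqrt (2 * pi))^-1 * (Num.sqrt t)^-1 * expR (- (x ^+ 2 / (2 * t))).

(* Density at time [t] of the first hitting time of 0 from [x > 0]. *)
Definition hit t x : R := x / t * heat t x.

Lemma sqrt2pi_gt0 : 0 < Num.sqrt (2 * pi) :> R.
Proof. by rewrite sqrtr_gt0 mulr_gt0// pi_gt0. Qed.

Lemma heat_ge0 t x : 0 <= heat t x.
Proof. by rewrite /heat !mulr_ge0 ?invr_ge0 ?sqrtr_ge0 ?expR_ge0. Qed.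

Lemma heat_gt0 t x : 0 < t -> 0 < heat t x.
Proof.
by move=> t0; rewrite /heat !mulr_gt0 ?invr_gt0 ?sqrt2pi_gt0 ?sqrtr_gt0 ?expR_gt0.
Qed.

Lemma heat_le0 t x : t <= 0 -> heat t x = 0.
Proof. by move=> t0; rewrite /heat (ler0_sqrtr t0) invr0 mulr0 mul0r. Qed.

Lemma heatN t x : heat t (- x) = heat t x.
Proof. by rewrite /heat sqrrN. Qed.

Lemma heatBC t x y : heat t (x - y) = heat t (y - x).
Proof. by rewrite -opprB heatN. Qed.

Lemma heat_abs t x : heat t `|x| = heat t x.
Proof. by rewrite /heat real_normK ?num_real. Qed.

Lemma heat_le t x : heat t x <= heat t 0.
Proof.
have [t0|t0] := leP t 0; first by rewrite !heat_le0.
rewrite /heat ler_wpM2l ?mulr_ge0 ?invr_ge0 ?sqrtr_ge0// ler_expR expr0n/= mul0r.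
by rewrite lerN2 divr_ge0 ?sqr_ge0// mulr_ge0// ltW.
Qed.

Lemma measurable_heat d (T : measurableType d) (f g : T -> R) :
  meas_fun f -> meas_fun g ->
  meas_fun (fun a => heat (f a) (g a)).
Proof. by move=> mf mg; rewrite /heat; meas. Qed.

Lemma measurable_hit d (T : measurableType d) (f g : T -> R) :
  meas_fun f -> meas_fun g ->
  meas_fun (fun a => hit (f a) (g a)).
Proof. by move=> mf mg; rewrite /hit; meas; exact: measurable_heat. Qed.

Lemma hit_ge0 t x : 0 <= x -> 0 <= hit t x.
Proof.
move=> x0; have [t0|t0] := leP t 0; first by rewrite /hit heat_le0// mulr0.
by rewrite /hit mulr_ge0 ?heat_ge0// divr_ge0// ltW.
Qed.

Lemma hit_le0 t x : t <= 0 -> hit t x = 0.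
Proof. by move=> t0; rewrite /hit heat_le0// mulr0. Qed.

Lemma heat_normal v m x : 0 < v -> heat v (x - m) = normal_pdf m (Num.sqrt v) x.
Proof.
move=> v0; rewrite normal_pdfE ?gt_eqF ?sqrtr_gt0// /normal_peak /normal_fun.
rewrite sqr_sqrtr ?ltW// /heat -invfM -sqrtrM; last by rewrite mulr_ge0// pi_ge0.
by congr ((Num.sqrt _)^-1 * expR _); [ring|rewrite mulNr mulr_natl].
Qed.

Lemma integral_heat v m : 0 < v -> (\int[mu]_x (heat v (x - m))%:E = 1)%E.
Proof.
move=> v0; rewrite -(integral_normal_pdf m (Num.sqrt v)).
by apply: eq_integral => x _; rewrite heat_normal.
Qed.

Lemma integrable_heat v m : 0 < v -> mu.-integrable setT (fun x => (heat v (x - m))%:E).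
Proof.
move=> v0; have := integrable_normal_pdf m (Num.sqrt v).
by congr (_.-integrable _ _); apply/funext => x; rewrite heat_normal.
Qed.

Lemma der_heat v x : isder x (heat v) (- (x / v) * heat v x).
Proof.
rewrite /heat; eapply der_eq; first by der.
rewrite /=; have [->|v0] := eqVneq v 0; last first.
  by rewrite /=; move: (Num.sqrt v)^-1 (Num.sqrt (2 * pi))^-1 => s1 s2; field.
by rewrite sqrtr0 invr0 !(mulr0, mul0r, addr0).
Qed.

Lemma continuous_heat v : continuous (heat v).
Proof. by move=> x; exact: der_continuous (der_heat v x). Qed.

(** Distribution function of the standard normal law, in which the antiderivatives below are
    expressed. *)
Definition Phi y : R := (\int[mu]_(t in `]-oo, y]) heat 1 t)%R.

Lemma integrable_heat1 (A : set R) : measurable A ->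
  mu.-integrable A (EFin \o heat 1).
Proof.
move=> mA; apply: (integrableS measurableT) => //.
have := integrable_heat 0 ltr01; congr (_.-integrable _ _).
by apply/funext => x; rewrite subr0.
Qed.

Lemma der_Phi y : isder y Phi (heat 1 y).
Proof.
have yy : y < y + 1 by rewrite ltrDl.
have iy : mu.-integrable [set` Interval -oo%O (BRight (y + 1))] (EFin \o heat 1).
  exact: integrable_heat1.
have [|d1 d2] := @continuous_FTC1 R (heat 1) -oo%O y (y + 1) yy iy _
  (@continuous_heat 1 y); last by split => //; rewrite -derive1E.
  by rewrite /= ltNyr.
Qed.

Lemma PhiE y : (Phi y)%:E = normal_prob 0 1 `]-oo, y]%classic.
Proof.
rewrite /Phi /Rintegral fineK; last first.
  by apply: integrable_fin_num => //; exact: integrable_heat1.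
rewrite /normal_prob; apply: eq_integral => x _; congr EFin.
by rewrite -[in LHS](subr0 x) heat_normal// sqrtr1.
Qed.

Let X : {RV (normal_prob (0 : R) 1) >-> R} :=
  HB.pack (fun x : measurableTypeR R => x : R) (isMeasurableFun.Build _ _
    (measurableTypeR R) R _ (@measurable_id _ (measurableTypeR R) setT)).

Let PhiE_cdf y : (Phi y)%:E = cdf X y.
Proof. exact: PhiE. Qed.

Lemma cvg_PhiNy : Phi x @[x --> -oo] --> (0 : R).
Proof.
have := cvg_cdfNy0 X.
by rewrite (_ : cdf X = EFin \o Phi) => [/fine_cvg//|]; apply/funext => y; rewrite -PhiE_cdf.
Qed.

Lemma cvg_Phiy : Phi x @[x --> +oo] --> (1 : R).
Proof.
have := cvg_cdfy1 X.
by rewrite (_ : cdf X = EFin \o Phi) => [/fine_cvg//|]; apply/funext => y; rewrite -PhiE_cdf.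
Qed.

Lemma PhiN y : Phi y + Phi (- y) = 1.
Proof.
have cst x : Phi x + Phi (- x) = Phi 0 + Phi (- 0).
  apply: (@is_derive_0_is_cst R (fun x => Phi x + Phi (- x))) => z.
  have h := der_comp (g := fun y => - y) (der_Phi (- z)) (der_N (der_id z)).
  by apply: der_eq (der_D (der_Phi z) h) _; rewrite heatN mulrN1 subrr.
rewrite cst.
have : Phi x + Phi (- x) @[x --> +oo] --> (1 + 0 : R).
  apply: cvgD; first exact: cvg_Phiy.
  apply: (cvg_comp -%R Phi _ cvg_PhiNy).
  by apply/cvgNrNy; exact: cvg_id.
under eq_fun do rewrite cst; rewrite addr0 => h.
exact: (cvg_unique _ (cvg_cst _) h).
Qed.

Lemma Phi0 : Phi 0 = 2^-1.
Proof. by have := PhiN 0; rewrite oppr0; lra. Qed.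

(** The integrand may be singular at both end points: the formula on the compact intervals [D n]
    passes to the limit by monotone convergence. *)
Lemma ge0_FTC_oo (f F : R -> R) (a b la lb : R) : a < b ->
  (forall x, a < x < b -> 0 <= f x) -> (forall x, a < x < b -> {for x, continuous f}) ->
  (forall x, a < x < b -> isder x F (f x)) ->
  F x @[x --> a^'+] --> la -> F x @[x --> b^'-] --> lb ->
  (\int[mu]_(x in `]a, b[) (f x)%:E = (lb - la)%:E)%E.
Proof.
move=> ab f0 cf dF Fa Fb.
(* Starting at a third of the length keeps every [D n] a nondegenerate interval. *)
pose dl n := (b - a) / n.+3%:R.
have dl0 n : 0 < dl n by rewrite divr_gt0// subr_gt0.
have dl3 n : dl n <= (b - a) / 3.
  apply: ler_wpM2l; first by rewrite subr_ge0 ltW.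
  by rewrite lef_pV2 ?posrE ?ltr0n// ler_nat.
have dlle m n : (m <= n)%N -> dl n <= dl m.
  move=> mn; apply: ler_wpM2l; first by rewrite subr_ge0 ltW.
  by rewrite lef_pV2 ?posrE ?ltr0n// ler_nat !ltnS.
have dlcvg : dl n @[n --> \oo] --> (0 : R).
  have h : harmonic (n + 2)%N @[n --> \oo] --> (0 : R).
    exact: (cvg_comp (addn^~ 2%N) _ (cvg_addnr 2) (@cvg_harmonic R)).
  rewrite -(mulr0 (b - a)) (_ : dl = fun n => (b - a) * harmonic (n + 2)%N).
    by apply: cvgMr.
  by apply/funext => n; rewrite /dl /harmonic/= addn2.
pose D n := `[a + dl n, b - dl n]%classic.
have Dsub n x : D n x -> a < x < b.
  rewrite /D/= in_itv/= => /andP[h1 h2]; apply/andP; split.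
    by apply: lt_le_trans h1; rewrite ltrDl.
  by apply: le_lt_trans h2 _; rewrite gtrBl.
have E n : (\int[mu]_(x in D n) (f x)%:E = (F (b - dl n) - F (a + dl n))%:E)%E.
  have abn : a + dl n < b - dl n by have := dl3 n; lra.
  rewrite EFinB; apply: continuous_FTC2 => //.
  - apply: continuous_in_subspaceT => x /set_mem/Dsub; exact: cf.
  - have HD x : a < x < b -> {for x, continuous F}.
      by move=> /dF; exact: der_continuous.
    split.
    + by move=> x; rewrite in_itv/= => /andP[h1 h2]; have [|] := dF x; first by
        have := dl0 n; lra.
    + by apply: cvg_at_right_filter; apply: HD; have := dl0 n; lra.
    + by apply: cvg_at_left_filter; apply: HD; have := dl0 n; lra.
  - move=> x; rewrite in_itv/= => /andP[h1 h2]; apply: der_derive1; apply: dF.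
    by have := dl0 n; lra.
have UD : \bigcup_n D n = `]a, b[%classic.
  apply/seteqP; split => [x [n _ /Dsub]|x]; rewrite /= in_itv//=.
  move=> /andP[ax xb].
  have e0 : 0 < Num.min (x - a) (b - x) by rewrite lt_min !subr_gt0 ax.
  have [n] := filter_ex (cvgr_lt _ dlcvg _ e0).
  rewrite lt_min => /andP[h1 h2]; exists n => //.
  by rewrite /D/= in_itv/=; lra.
have : (\int[mu]_(x in D n) (f x)%:E)%E @[n --> \oo] --> (\int[mu]_(x in `]a, b[) (f x)%:E)%E.
  rewrite -UD; apply: ge0_nondecreasing_set_cvg_integral.
  - move=> m n mn; apply/subsetPset => x; rewrite /D/= !in_itv/= => /andP[h1 h2].
    by have := dlle _ _ mn; lra.
  - by move=> n; exact: measurable_itv.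
  - move=> n; apply/measurable_EFinP.
    apply: (measurable_funS (E := `]a, b[%classic)) => //.
      by move=> x /Dsub; rewrite /= in_itv.
    apply: open_continuous_measurable_fun; first exact: interval_open.
    by move=> x; rewrite inE/= in_itv/=; exact: cf.
  - by move=> n x /Dsub /f0; rewrite lee_fin.
under eq_fun do rewrite E.
move=> h; apply: (cvg_unique _ h) => //.
apply: cvg_EFin; first exact: nearW.
apply: cvgB.
- move/cvg_at_leftP : Fb; apply; split => [n|]; first by rewrite gtrBl.
  by rewrite -[X in _ --> X]subr0; apply: cvgB => //; exact: cvg_cst.
- move/cvg_at_rightP : Fa; apply; split => [n|]; first by rewrite ltrDl.
  by rewrite -[X in _ --> X]addr0; apply: cvgD => //; exact: cvg_cst.
Qed.

Lemma integral_supp (D : set R) (f : R -> \bar R) : measurable D ->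
  (forall x, ~ D x -> f x = 0%E) -> (\int[mu]_x f x = \int[mu]_(x in D) f x)%E.
Proof.
move=> mD f0; rewrite [RHS]integral_mkcond; apply: eq_integral => x _.
by rewrite patchE; case: ifPn => // /negP; rewrite inE => /f0.
Qed.

Section hitting_convolution.
Variables (t x : R).
Hypotheses (t0 : 0 < t) (x0 : 0 < x).

(** Inside []0, t[], [arg c u] is [(c u - x (t - u)) / sqrt(t u (t - u))]. Normal distribution
    functions at [arg z u] and [arg (- z) u] combine into the antiderivative [G z] of the
    convolution of [hit] and [heat]. *)
Let rho u := Num.sqrt ((t - u) / u).
Let arg c u := (c * (rho u)^-1 - x * rho u) * (Num.sqrt t)^-1.

Let rhoE u : 0 < u < t -> rho u = Num.sqrt (t - u) / Num.sqrt u.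
Proof.
by move=> /andP[u0 ut]; rewrite /rho sqrtrM ?subr_ge0 ?ltW// sqrtrV// ltW.
Qed.

Let argE c u : 0 < u < t ->
  arg c u = (c * u - x * (t - u)) / (Num.sqrt t * Num.sqrt u * Num.sqrt (t - u)).
Proof.
move=> ut; rewrite /arg rhoE//; have /andP[u0 u1] := ut.
have tu0 : 0 < t - u by rewrite subr_gt0.
have a0 : 0 < Num.sqrt u by rewrite sqrtr_gt0.
have b0 : 0 < Num.sqrt (t - u) by rewrite sqrtr_gt0.
have s0 : 0 < Num.sqrt t by rewrite sqrtr_gt0.
transitivity ((c * Num.sqrt u ^+ 2 - x * Num.sqrt (t - u) ^+ 2) /
    (Num.sqrt t * Num.sqrt u * Num.sqrt (t - u))); last by rewrite !sqr_sqrtr ?ltW.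
by field; rewrite !gt_eqF.
Qed.

Let G z u := heat t (x + z) * Phi (arg z u) + heat t (x - z) * Phi (arg (- z) u).

Let dG z u : 0 < u < t -> isder u (G z) (hit u x * heat (t - u) z).
Proof.
move=> ut; have /andP[u0 u1] := ut.
have tu0 : 0 < t - u by rewrite subr_gt0.
have a0 : 0 < Num.sqrt u by rewrite sqrtr_gt0.
have b0 : 0 < Num.sqrt (t - u) by rewrite sqrtr_gt0.
have s0 : 0 < Num.sqrt t by rewrite sqrtr_gt0.
have r0 : 0 < rho u by rewrite rhoE// divr_gt0.
pose r' := (2 * rho u)^-1 * (- t / u ^+ 2).
have dq : isder u (fun y : R => (t - y) / y) (- t / u ^+ 2).
  eapply der_eq; first by der; rewrite gt_eqF.
  by rewrite /=; field; rewrite gt_eqF.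
have dr : isder u rho r'.
  rewrite /rho; eapply der_eq.
    by apply: der_sqrt dq; rewrite divr_gt0.
  by rewrite /r' /rho.
have da c : isder u (arg c)
    ((- c / rho u ^+ 2 - x) * r' * (Num.sqrt t)^-1).
  rewrite /arg; eapply der_eq; first by der; rewrite gt_eqF.
  by rewrite /=; move: (Num.sqrt t)^-1 => s; ring.
have dP c : isder u (fun v => Phi (arg c v))
    (heat 1 (arg c u) * ((- c / rho u ^+ 2 - x) * r' * (Num.sqrt t)^-1)).
  exact: der_comp (der_Phi _) (da c).
rewrite /G; eapply der_eq.
  by apply: der_D; (apply: der_M; [exact: der_cst|exact: dP]).
rewrite -![_ *: _]/(_ * _).
(* Completing the square: for [c = z] and [c = - z] alike, the Gaussian factors combine into the
   same exponential, that of [heat u x * heat (t - u) z]. *)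
pose E := (Num.sqrt (2 * pi))^-1 * (Num.sqrt t)^-1 * (Num.sqrt (2 * pi))^-1 *
  expR (- (x ^+ 2 / (2 * u)) - (z ^+ 2 / (2 * (t - u)))).
have EE c : c ^+ 2 = z ^+ 2 -> heat t (x + c) * heat 1 (arg c u) = E.
  move=> cz; rewrite /heat sqrtr1 invr1 mulr1.
  have ee : - ((x + c) ^+ 2 / (2 * t)) + - (arg c u ^+ 2 / (2 * 1)) =
      - (x ^+ 2 / (2 * u)) - (z ^+ 2 / (2 * (t - u))).
    rewrite argE// expr_div_n !exprMn !sqr_sqrtr ?ltW// -cz.
    by field; rewrite !gt_eqF.
  by rewrite /E -ee expRD; ring.
transitivity (E * ((- z / rho u ^+ 2 - x) * r' / Num.sqrt t +
    (- - z / rho u ^+ 2 - x) * r' / Num.sqrt t)).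
  by rewrite mulrDr -{1}(EE z erefl) -(EE (- z) (sqrrN z)); ring.
rewrite /hit /heat /E expRD.
rewrite /r' rhoE// expr_div_n !sqr_sqrtr ?ltW//.
rewrite -[X in X / u ^+ 2](_ : - (u + (t - u)) = _); last by ring.
have -> : (- z / ((t - u) / u) - x) * ((2 * (Num.sqrt (t - u) / Num.sqrt u))^-1 *
     (- (u + (t - u)) / u ^+ 2)) / Num.sqrt t +
    (- - z / ((t - u) / u) - x) * ((2 * (Num.sqrt (t - u) / Num.sqrt u))^-1 *
     (- (u + (t - u)) / u ^+ 2)) / Num.sqrt t =
   x * t / u ^+ 2 * Num.sqrt u / Num.sqrt (t - u) / Num.sqrt t.
  by field; rewrite !gt_eqF.
have tE : t = Num.sqrt t * Num.sqrt t by rewrite -expr2 sqr_sqrtr// ltW.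
have uE : u = Num.sqrt u * Num.sqrt u by rewrite -expr2 sqr_sqrtr// ltW.
move: (expR _) (expR _) => e1 e2.
rewrite [X in x * X / u ^+ 2]tE.
have -> : u ^+ 2 = u * (Num.sqrt u * Num.sqrt u) by rewrite -uE expr2.
by field; rewrite !gt_eqF ?sqrt2pi_gt0.
Qed.

Let arg_Ny c (p : R) (F : set_system R) : Filter F ->
  (\forall u \near F, 0 < u < t) ->
  c * p - x * (t - p) < 0 -> 0 <= p <= t -> (Num.sqrt u @[u --> F] --> Num.sqrt p) ->
  (u @[u --> F] --> p) -> (Num.sqrt (t - u) @[u --> F] --> Num.sqrt (t - p)) ->
  Num.sqrt p * Num.sqrt (t - p) = 0 ->
  arg c u @[u --> F] --> -oo.
Proof.
move=> FF nF D0 p0 sp ip stp z0.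
apply/cvgrNyPle => A.
have : c * u - x * (t - u) - A * (Num.sqrt t * Num.sqrt u * Num.sqrt (t - u)) @[u --> F]
    --> (c * p - x * (t - p) - A * (Num.sqrt t * Num.sqrt p * Num.sqrt (t - p)) : R).
  apply: cvgB.
    by apply: cvgB; apply: cvgMr => //; apply: cvgB => //; exact: cvg_cst.
  apply: cvgMr; apply: cvgM => //; exact: cvgMr.
rewrite -[_ * _ * Num.sqrt (t - p)]mulrA z0 !mulr0 subr0 => /cvgr_lt/(_ _ D0).
apply: filterS2 nF => u ut; rewrite subr_lt0 => /ltW h.
rewrite argE//; have /andP[u0 u1] := ut.
by rewrite ler_pdivrMr// !mulr_gt0 ?sqrtr_gt0 ?subr_gt0.
Qed.

Let near_right : \forall u \near 0^'+, 0 < u < t.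
Proof.
by near=> u; apply/andP; split; near: u; [exact: nbhs_right_gt|exact: nbhs_right_lt].
Unshelve. all: end_near. Qed.

Let near_left : \forall u \near t^'-, 0 < u < t.
Proof.
by near=> u; apply/andP; split; near: u; [exact: nbhs_left_gt|exact: nbhs_left_lt].
Unshelve. all: end_near. Qed.

Let cvg_sqrt_sub p : Num.sqrt (t - u) @[u --> p] --> Num.sqrt (t - p).
Proof.
apply: (@continuous_comp _ _ _ (fun u : R => t - u) Num.sqrt p); last exact: sqrt_continuous.
by apply: cvgB; [exact: cvg_cst|exact: cvg_id].
Qed.

(** A path from [x > 0] to [- z] has to hit 0, at some time [u]. At the end [t] the two normal terms
    of [G] tend to 1 and 0 if [z > 0], and to 1/2 each if [z = 0]. *)
Lemma integral_hit_heat z : 0 <= z ->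
  (\int[mu]_u (hit u x * heat (t - u) z)%:E = (heat t (x + z))%:E)%E.
Proof.
move=> z0; rewrite (@integral_supp `]0, t[%classic)//; last first.
  move=> u /=; rewrite in_itv/= => /negP; rewrite negb_and -!leNgt => /orP[u0|u1].
    by rewrite hit_le0// mul0r.
  by rewrite [heat (t - u) z]heat_le0 ?mulr0// subr_le0.
have arg0 c : arg c u @[u --> 0^'+] --> -oo.
  apply: (arg_Ny (p := 0)) => //.
  - by rewrite mulr0 subr0 sub0r oppr_lt0 mulr_gt0.
  - by rewrite lexx ltW.
  - by apply: cvg_at_right_filter; exact: sqrt_continuous.
  - by apply: cvg_at_right_filter; exact: cvg_id.
  - by apply: cvg_at_right_filter; exact: cvg_sqrt_sub.
  - by rewrite sqrtr0 mul0r.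
have argt c : c < 0 -> arg c u @[u --> t^'-] --> -oo.
  move=> c0; apply: (arg_Ny (p := t)) => //.
  - by rewrite subrr mulr0 subr0 nmulr_rlt0.
  - by rewrite lexx ltW.
  - by apply: cvg_at_left_filter; exact: sqrt_continuous.
  - by apply: cvg_at_left_filter; exact: cvg_id.
  - by apply: cvg_at_left_filter; exact: cvg_sqrt_sub.
  - by rewrite subrr sqrtr0 mulr0.
suff -> : (\int[mu]_(u in `]0%R, t[) (hit u x * heat (t - u) z)%:E =
    (heat t (x + z) - 0)%:E)%E by rewrite subr0.
refine (@ge0_FTC_oo (fun u => hit u x * heat (t - u) z) (G z) 0 t 0 (heat t (x + z)) t0 _ _ _ _ _).
- by move=> u /andP[u0 u1]; rewrite mulr_ge0 ?heat_ge0// hit_ge0// ltW.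
- move=> u ut; have /andP[u0 u1] := ut.
  have tu0 : 0 < t - u by rewrite subr_gt0.
  rewrite /hit /heat; eapply der_continuous; der; rewrite /= ?gt_eqF ?sqrtr_gt0 ?mulr_gt0//.
- by move=> u ut; exact: dG.
- rewrite -[X in _ --> X](_ : heat t (x + z) * 0 + heat t (x - z) * 0 = 0); last by ring.
  by apply: cvgD; apply: cvgMr; apply: (cvg_comp _ _ (arg0 _)); exact: cvg_PhiNy.
- move: z0; rewrite le_eqVlt => /predU1P[z0|z0].
    have rt : rho u @[u --> t^'-] --> 0.
      have h : (t - u) / u @[u --> t] --> (0 : R).
        rewrite -[X in _ --> X](mul0r t^-1) -(subrr t); apply: cvgM.
          by apply: cvgB; [exact: cvg_cst|exact: cvg_id].
        by apply: cvgV; [rewrite gt_eqF|exact: cvg_id].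
      apply: cvg_at_left_filter; rewrite -[X in _ --> X]sqrtr0.
      exact: (cvg_comp _ _ h (@sqrt_continuous R 0)).
    have at0 c : c = 0 -> Phi (arg c u) @[u --> t^'-] --> (2^-1 : R).
      move=> ->; rewrite -Phi0; apply: (cvg_comp (arg 0) Phi); last first.
        exact: (der_continuous (der_Phi 0)).
      have h : (0 * (rho u)^-1 - x * rho u) * (Num.sqrt t)^-1 @[u --> t^'-] -->
          ((0 - x * 0) * (Num.sqrt t)^-1 : R).
        apply: cvgMl; apply: cvgB; last exact: cvgMr.
        by under eq_fun do rewrite mul0r; exact: cvg_cst.
      by move: h; rewrite mulr0 subr0 mul0r.
    have GE u : G z u = heat t x * Phi (arg 0 u) + heat t x * Phi (arg 0 u).
      by rewrite /G -z0 oppr0 addr0.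
    under eq_fun do rewrite GE; rewrite -z0 addr0.
    have h : heat t x * Phi (arg 0 u) + heat t x * Phi (arg 0 u) @[u --> t^'-] -->
        (heat t x * 2^-1 + heat t x * 2^-1 : R).
      by apply: cvgD; apply: cvgMr; exact: at0.
    by move: h; rewrite (_ : heat t x * 2^-1 + heat t x * 2^-1 = heat t x); last by field.
  rewrite -[X in _ --> X](_ : heat t (x + z) * 1 + heat t (x - z) * 0 = _); last by ring.
  apply: cvgD; apply: cvgMr.
    apply: (cvg_comp _ _ (_ : arg z u @[u --> t^'-] --> +oo) cvg_Phiy).
    apply/cvgryPge => A.
    have : z * u - x * (t - u) - A * (Num.sqrt t * Num.sqrt u * Num.sqrt (t - u))
        @[u --> t^'-] --> (z * t - x * (t - t) - A * (Num.sqrt t * Num.sqrt t * Num.sqrt (t - t)) : R).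
      apply: cvg_at_left_filter; apply: cvgB.
        apply: cvgB; apply: cvgMr; first exact: cvg_id.
        by apply: cvgB; [exact: cvg_cst|exact: cvg_id].
      apply: cvgMr; apply: cvgM; last exact: cvg_sqrt_sub.
      by apply: cvgMr; exact: sqrt_continuous.
    rewrite subrr sqrtr0 !mulr0 !subr0 => /cvgr_gt/(_ 0); rewrite mulr_gt0// => /(_ isT).
    apply: filterS2 near_left => u ut; rewrite subr_gt0 => /ltW h.
    rewrite argE//; have /andP[u0 u1] := ut.
    by rewrite ler_pdivlMr// !mulr_gt0 ?sqrtr_gt0 ?subr_gt0.
  by apply: (cvg_comp _ _ (argt _ _)); [rewrite oppr_lt0|exact: cvg_PhiNy].
Qed.

End hitting_convolution.

End heat_kernel.

Ltac heat_meas :=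
  repeat (first [assumption | lazymatch goal with
  | |- measurable_fun _ (fun x => heat (@?f x) (@?g x)) => apply: measurable_heat
  | |- measurable_fun _ (fun x => hit (@?f x) (@?g x)) => apply: measurable_hit
  | |- measurable_fun _ (@GRing.inv _) => exact: measurable_invr
  | |- measurable_fun _ (heat ?t) =>
      apply: (@measurable_heat _ _ _ (fun=> t) (fun x => x))
  | |- measurable_fun _ (hit ?t) =>
      apply: (@measurable_hit _ _ _ (fun=> t) (fun x => x))
  end | meas1 | by []]).

Ltac hder := repeat (first [eassumption | exact: der_heat | der1]).

(** * Convolution identities for hitting densities *)

Section lebesgue_integrals.
Context {R : realType}.
Implicit Types (c t u v x y z : R).

Lemma integral_reflect c (f : R -> \bar R) : meas_fun f ->
  (forall x, 0 <= f x)%E -> (\int[mu]_x f (c - x)%R = \int[mu]_x f x)%E.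
Proof.
move=> mf f0.
have mg : meas_fun (fun x : measurableTypeR R => c - x : measurableTypeR R) by meas.
pose nu := measure_function_pushforward__canonical__measure_function_Measure mu mg.
have E A : measurable A -> mu A = nu A.
  apply: lebesgue_measure_unique => _ [[a b] _ <-].
  rewrite /nu/= /pushforward.
  rewrite (_ : _ @^-1` _ = `[c - b, c - a[%classic); last first.
    by apply/seteqP; split => x /=; rewrite !in_itv/= => /andP[? ?]; lra.
  rewrite !lebesgue_measure_itv/= !lte_fin ltrD2l ltrN2.
  by case: ifP => // _; rewrite -!EFinB; congr EFin; ring.
transitivity (\int[nu]_x f x)%E.
  by rewrite (ge0_integral_pushforward mg)//; exact: measurableT.
by apply: eq_measure_integral => A mA _; exact: (esym (E A mA)).
Qed.

Lemma integral_shift c (f : R -> \bar R) : meas_fun f ->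
  (forall x, 0 <= f x)%E -> (\int[mu]_x f (x + c)%R = \int[mu]_x f x)%E.
Proof.
move=> mf f0; rewrite -(integral_reflect c mf f0).
rewrite -[LHS](integral_reflect 0); last 2 first.
- by meas.
- by move=> x; exact: f0.
by apply: eq_integral => x _; congr f; ring.
Qed.

(** The coefficients may be negative; finiteness of the two integrals is what allows it. *)
Lemma integral_lincomb d (T : measurableType d) (nu : {measure set T -> \bar R})
  (f g : T -> R) a b A B :
  meas_fun f -> meas_fun g ->
  (forall w, 0 <= f w) -> (forall w, 0 <= g w) ->
  (\int[nu]_w (f w)%:E = A%:E)%E -> (\int[nu]_w (g w)%:E = B%:E)%E ->
  (\int[nu]_w (a * f w + b * g w)%:E = (a * A + b * B)%:E)%E.
Proof.
move=> mf mg f0 g0 fA gB.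
have int (h : T -> R) C : meas_fun h -> (forall w, 0 <= h w) ->
    (\int[nu]_w (h w)%:E = C%:E)%E -> nu.-integrable setT (EFin \o h).
  move=> mh h0 hC; apply/integrableP; split; first exact/measurable_EFinP.
  under eq_integral => x _ do rewrite /= ger0_norm//.
  by rewrite hC ltry.
have i1 := int _ _ mf f0 fA; have i2 := int _ _ mg g0 gB.
under eq_integral do rewrite EFinD !EFinM.
rewrite integralD//; [|exact: integrableZl|exact: integrableZl].
by rewrite !integralZl// fA gB.
Qed.

Lemma integral_heat_hit t y z : 0 < y -> 0 <= z -> 0 < t ->
  (\int[mu]_u (heat u z * hit (t - u) y)%:E = (heat t (y + z))%:E)%E.
Proof.
move=> y0 z0 t0; rewrite -(integral_hit_heat t0 y0 z0).
rewrite -[LHS](integral_reflect t); last 2 first.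
- by heat_meas.
- by move=> u; rewrite lee_fin mulr_ge0 ?heat_ge0// hit_ge0// ltW.
by apply: eq_integral => u _; rewrite mulrC subKr.
Qed.

(** A path from [x + y] down to 0 first passes through [y], so hitting times add up. The formula
    combines the two preceding ones through [1/u + 1/(t - u) = t/(u (t - u))]. *)
Lemma integral_hit_hit t x y : 0 < x -> 0 < y ->
  (\int[mu]_u (hit u x * hit (t - u) y)%:E = (hit t (x + y))%:E)%E.
Proof.
move=> x0 y0; have [t0|t0] := leP t 0.
  rewrite hit_le0// integral0_eq// => u _.
  have [u0|u0] := leP u 0; first by rewrite hit_le0// mul0r.
  by rewrite [hit (t - u) y]hit_le0 ?mulr0// subr_le0 (le_trans t0)// ltW.
have h := integral_lincomb (x / t) (y / t) _ _ _ _
  (integral_heat_hit y0 (ltW x0) t0) (integral_hit_heat t0 x0 (ltW y0)).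
rewrite (_ : hit t (x + y) = x / t * heat t (y + x) + y / t * heat t (x + y)).
  rewrite -h; last 4 first.
  - by heat_meas.
  - by heat_meas.
  - by move=> u; rewrite mulr_ge0 ?heat_ge0// hit_ge0// ltW.
  - by move=> u; rewrite mulr_ge0 ?heat_ge0// hit_ge0// ltW.
  apply: eq_integral => u _; congr EFin.
  have [u0|u0] := leP u 0; first by rewrite /hit (heat_le0 _ u0) !(mul0r, mulr0, addr0).
  have [ut|ut] := leP (t - u) 0.
    by rewrite /hit (heat_le0 _ ut) !(mul0r, mulr0, addr0).
  by rewrite /hit; field; rewrite !gt_eqF.
by rewrite [y + x]addrC /hit; ring.
Qed.

(* The density [heat u 0 / u] is the limit of [hit u x / x] as [x] tends to 0. *)
Lemma integral_heat_defect t y (b : R) : 0 < t -> `|y| <= b -> 0 < b ->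
  (\int[mu]_u (heat u 0 / u *
     (heat (t - u) y - expR ((b ^+ 2 - y ^+ 2) / (2 * t)) * heat (t - u) b))%:E =
   ((b - `|y|) / t * heat t y)%:E)%E.
Proof.
move=> t0 yb b0.
(* [heat u 0 / u] is not integrable near 0. The difference is therefore written as the integral over
   []|y|, b[] of the [z]-derivative of [- D z u], whose factor [u / t] cancels the singularity;
   Tonelli's theorem and [integral_heat_hit] then finish. *)
pose D z u := expR (z ^+ 2 / (2 * t)) * heat (t - u) z.
have dD u z : t - u != 0 -> isder z (fun z => - D z u)
    (u / t * (expR (z ^+ 2 / (2 * t)) * hit (t - u) z)).
  move=> tu; rewrite /D; eapply der_eq.
    by hder.
  rewrite /= /hit; move: (heat _ _) (expR _) => h e.
  by field; rewrite tu/= gt_eqF.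
have yE : y ^+ 2 = `|y| ^+ 2 by rewrite real_normK ?num_real.
have FTC u : 0 < u < t -> (\int[mu]_(z in `]`|y|%R, b[)
     (u / t * (expR (z ^+ 2 / (2 * t)) * hit (t - u) z))%:E = (D `|y| u - D b u)%:E)%E.
  move=> /andP[u0 u1].
  have tu : t - u != 0 by rewrite gt_eqF ?subr_gt0.
  have [yb'|yb'] := ltP `|y| b; last first.
    by rewrite (le_anti (introT andP (conj yb yb'))) set_itvoo0 integral_set0 subrr.
  rewrite (_ : D `|y| u - D b u = - D b u - - D `|y| u); last by ring.
  have cD z : {for z, continuous (fun z => - D z u)} by exact: der_continuous (dD u z tu).
  apply: (@ge0_FTC_oo R _ (fun z => - D z u)) => //.
  - move=> z /andP[z0 _]; have z0' : 0 <= z by apply: le_trans (ltW z0).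
    by apply: mulr_ge0; [rewrite divr_ge0// ltW|rewrite mulr_ge0 ?expR_ge0 ?hit_ge0].
  - move=> z _; apply: (@der_continuous _ _ _ (u / t * (expR (z ^+ 2 / (2 * t)) *
      ((t - u)^-1 * heat (t - u) z + z / (t - u) * (- (z / (t - u)) * heat (t - u) z)) +
      hit (t - u) z * (expR (z ^+ 2 / (2 * t)) * (2 * z * (2 * t)^-1))))).
    rewrite /hit; eapply der_eq; first by hder.
    by rewrite /=; ring.
  - by move=> z _; exact: dD.
  - by apply: cvg_at_right_filter; exact: cD.
  - by apply: cvg_at_left_filter; exact: cD.
transitivity (\int[mu]_u \int[mu]_(z in `]`|y|%R, b[) (expR (- y ^+ 2 / (2 * t)) *
    (t^-1 * (expR (z ^+ 2 / (2 * t)) * (heat u 0 * hit (t - u) z))))%:E)%E.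
  apply: eq_integral => u _.
  have [u0|u0] := leP u 0.
    rewrite (heat_le0 _ u0) !mul0r; under eq_integral do rewrite !(mul0r, mulr0).
    by rewrite integral0.
  have [ut|ut] := leP t u.
    have tu : t - u <= 0 by rewrite subr_le0.
    rewrite !(heat_le0 _ tu) mulr0 subrr mulr0.
    by under eq_integral do rewrite /hit (heat_le0 _ tu) !mulr0; rewrite integral0.
  transitivity (\int[mu]_(z in `]`|y|%R, b[) ((expR (- y ^+ 2 / (2 * t)) * (heat u 0 / u))%:E *
      (u / t * (expR (z ^+ 2 / (2 * t)) * hit (t - u) z))%:E))%E; last first.
    by apply: eq_integral => z _; rewrite -EFinM; congr EFin; field; rewrite !gt_eqF.
  have u00 : 0 <= u / t by rewrite divr_ge0 // ltW.
  rewrite ge0_integralZl//; last 3 first.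
  - by apply: measurable_funTS; heat_meas.
  - move=> z /=; rewrite in_itv/= => /andP[z0 _].
    have z0' : 0 <= z by apply: le_trans (ltW z0).
    by rewrite lee_fin mulr_ge0// mulr_ge0 ?expR_ge0 ?hit_ge0.
  - by rewrite lee_fin !mulr_ge0 ?expR_ge0 ?heat_ge0// invr_ge0 ltW.
  rewrite FTC ?u0// -EFinM; congr EFin.
  rewrite /D heat_abs -yE mulNr [(b ^+ 2 - y ^+ 2) / _]mulrBl.
  rewrite [expR (_ - _)]expRD [RHS]mulrC !mulrBl !mulrBr.
  have e1 : expR (- (y ^+ 2 / (2 * t))) * expR (y ^+ 2 / (2 * t)) = 1.
    by rewrite -expRD addNr expR0.
  rewrite -[heat u 0 / u * heat (t - u) y]mul1r -{1}e1; ring.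
pose i z : R := \1_(`]`|y|%R, b[%classic) z.
transitivity (\int[mu]_u \int[mu]_z (i z * (expR (- y ^+ 2 / (2 * t)) *
    (t^-1 * (expR (z ^+ 2 / (2 * t)) * (heat u 0 * hit (t - u) z)))))%:E)%E.
  apply: eq_integral => u _; rewrite integral_mkcond; apply: eq_integral => z _.
  by rewrite patchE /i indicE; case: ifPn => _; rewrite ?mul1r ?mul0r.
rewrite tonelli; last 2 first.
- by rewrite /i; heat_meas; exact: measurable_itv.
- move=> u z; rewrite lee_fin /i indicE; case: (boolP (z \in _)) => [|_]; last by rewrite mul0r.
  rewrite inE/= in_itv/= => /andP[z0 _].
  have z0' : 0 <= z by apply: le_trans (ltW z0).
  rewrite mul1r mulr_ge0 ?expR_ge0// mulr_ge0 ?invr_ge0 ?(ltW t0)//.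
  by rewrite mulr_ge0 ?expR_ge0// mulr_ge0 ?heat_ge0 ?hit_ge0.
transitivity (\int[mu]_z ((expR (- y ^+ 2 / (2 * t)) / t * heat t 0)%:E * (i z)%:E))%E.
  apply: eq_integral => z _; rewrite /i indicE; case: (boolP (z \in _)) => [|_]; last first.
    rewrite mule0; under eq_integral do rewrite mul0r; exact: integral0.
  rewrite inE/= in_itv/= => /andP[z0 _]; have z0' : 0 < z by apply: le_lt_trans z0.
  transitivity (\int[mu]_u ((expR (- y ^+ 2 / (2 * t)) * (t^-1 * expR (z ^+ 2 / (2 * t))))%:E *
      (heat u 0 * hit (t - u) z)%:E))%E.
    by apply: eq_integral => u _; rewrite mul1r -EFinM; congr EFin; ring.
  rewrite ge0_integralZl//; last 3 first.
  - by heat_meas.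
  - by move=> u _; rewrite lee_fin mulr_ge0 ?heat_ge0// hit_ge0// ltW.
  - by rewrite lee_fin !mulr_ge0 ?expR_ge0// invr_ge0 ltW.
  rewrite integral_heat_hit// addr0 mule1 -EFinM; congr EFin.
  have -> : heat t 0 = expR (z ^+ 2 / (2 * t)) * heat t z; last by ring.
  rewrite /heat expr0n/= mul0r oppr0 expR0 mulr1.
  by rewrite mulrCA -expRD subrr expR0 mulr1.
rewrite ge0_integralZl//; last 3 first.
- by rewrite /i; heat_meas; exact: measurable_itv.
- by move=> z _; rewrite lee_fin /i.
- by rewrite lee_fin !mulr_ge0 ?expR_ge0 ?heat_ge0// invr_ge0 ltW.
have -> : (\int[mu]_z (i z)%:E = (b - `|y|)%:E)%E.
  rewrite /i integral_indic// setIT.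
  rewrite -[RHS](_ : (if (`|y|%:E < b%:E)%E then (b%:E - `|y|%:E)%E else 0%E) = _).
    exact: (lebesgue_measure_itv (Interval (BRight `|y|) (BLeft b))).
  rewrite lte_fin.
  by case: ltP => // h; rewrite (le_anti (introT andP (conj yb h))) subrr.
rewrite -EFinM; congr EFin; rewrite /heat expr0n/= mul0r oppr0 expR0 mulr1 mulNr.
by ring.
Qed.

End lebesgue_integrals.

(** * Gaussian integrals *)

Section gaussian_integrals.
Context {R : realType}.
Implicit Types (c t u v x y z m g : R).

(** Completing the square: a Gaussian weight contracts variance and mean by the same factor
    [1 + 2 g v]. *)
Lemma heat_tilt v m g x : 0 < v -> 0 <= g ->
  expR (- (g * x ^+ 2)) * heat v (x - m) =
  (Num.sqrt (1 + 2 * g * v))^-1 * expR (- (g / (1 + 2 * g * v) * m ^+ 2)) *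
  heat (v / (1 + 2 * g * v)) (x - m / (1 + 2 * g * v)).
Proof.
move=> v0 g0; set s := 1 + 2 * g * v.
have s0 : 0 < s by rewrite /s ltr_pwDl// !mulr_ge0// ltW.
have -> : heat (v / s) (x - m / s) = Num.sqrt s * ((Num.sqrt (2 * pi))^-1 *
    (Num.sqrt v)^-1 * expR (- ((x - m / s) ^+ 2 / (2 * (v / s))))).
  by rewrite /heat [Num.sqrt (v / s)]sqrtrM ?ltW// sqrtrV ?ltW// invfM invrK; ring.
have r0 : Num.sqrt s != 0 by rewrite gt_eqF// sqrtr_gt0.
transitivity ((Num.sqrt (2 * pi))^-1 * (Num.sqrt v)^-1 *
   (expR (- (g / s * m ^+ 2)) * expR (- ((x - m / s) ^+ 2 / (2 * (v / s)))))).
  rewrite -expRD /heat mulrCA -expRD; congr (_ * expR _).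
  have s1 : s != 0 by rewrite gt_eqF.
  have v1 : v != 0 by rewrite gt_eqF.
  have gE : g = (s - 1) / (2 * v) by rewrite /s; field.
  clearbody s; rewrite gE; field.
  by rewrite v1 s1.
rewrite [in RHS]mulrACA [(Num.sqrt s)^-1 * Num.sqrt s]mulVf//; ring.
Qed.

Lemma heat_scale v x : 0 < v -> heat 1 (x / Num.sqrt v) / Num.sqrt v = heat v x.
Proof.
move=> v0; rewrite /heat sqrtr1 invr1 mulr1 mulrAC; congr (_ * expR _).
rewrite expr_div_n sqr_sqrtr ?ltW//; field; rewrite gt_eqF//.
Qed.

Lemma der_Phi_scale v m x : 0 < v ->
  isder x (fun y => Phi ((y - m) / Num.sqrt v)) (heat v (x - m)).
Proof.
move=> v0; eapply der_eq.
  exact: (der_comp (f := Phi) (g := fun y => (y - m) / Num.sqrt v) (der_Phi _)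
    (der_M (der_D (der_id x) (der_cst (- m) x)) (der_cst (Num.sqrt v)^-1 x))).
by rewrite /= -[in RHS]heat_scale//; ring.
Qed.

Lemma cvg_Phi_scale v m : 0 < v -> Phi ((y - m) / Num.sqrt v) @[y --> +oo] --> (1 : R).
Proof.
move=> v0; have s0 : 0 < Num.sqrt v by rewrite sqrtr_gt0.
apply: (cvg_comp (fun y => (y - m) / Num.sqrt v) _ _ cvg_Phiy).
apply/cvgryPge => A; near=> y; rewrite ler_pdivlMr// lerBrDr.
by near: y; apply: nbhs_pinfty_ge; rewrite num_real.
Unshelve. all: end_near. Qed.

Lemma cvg_mul_heaty v : 0 < v -> y * heat v y @[y --> +oo] --> (0 : R).
Proof.
move=> v0; pose K := (Num.sqrt (2 * pi))^-1 * (Num.sqrt v)^-1 : R.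
have K0 : 0 <= K by rewrite mulr_ge0// invr_ge0 sqrtr_ge0.
apply/cvgr0Pnorm_le => e e0; near=> y.
have y0 : 0 < y by near: y; apply: nbhs_pinfty_gt; rewrite num_real.
rewrite ger0_norm; last by rewrite mulr_ge0 ?heat_ge0// ltW.
have h : expR (- (y ^+ 2 / (2 * v))) <= 2 * v / y ^+ 2.
  rewrite expRN -[leRHS]invrK lef_pV2 ?posrE ?expR_gt0//; last first.
    by rewrite invr_gt0 divr_gt0 ?mulr_gt0// exprn_gt0.
  by rewrite invf_div; apply: le_trans (expR_ge1Dx _); rewrite lerDr.
apply: (@le_trans _ _ (K * (2 * v) / y)).
  rewrite /heat -/K mulrCA -mulrA; apply: ler_wpM2l => //.
  apply: (@le_trans _ _ (y * (2 * v / y ^+ 2))); first by apply: ler_wpM2l => //; exact: ltW.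
  by rewrite le_eqVlt; apply/orP; left; apply/eqP; field; rewrite gt_eqF.
rewrite ler_pdivrMr// -ler_pdivrMl//.
Unshelve. all: end_near. Qed.

Lemma cvg_heaty v m : 0 < v -> heat v (y - m) @[y --> +oo] --> (0 : R).
Proof.
move=> v0; apply: (cvg_comp (fun y => y - m) (heat v) (_ : _ @[y --> +oo] --> +oo)).
  apply/cvgryPge => A; near=> y; rewrite lerBrDr.
  by near: y; apply: nbhs_pinfty_ge; rewrite num_real.
apply/cvgr0Pnorm_le => e e0.
have := cvg_mul_heaty v0 => /cvgr0Pnorm_le/(_ _ e0) h.
near=> y; have y1 : 1 <= y by near: y; apply: nbhs_pinfty_ge; rewrite num_real.
have hy : `|y * heat v y| <= e by near: y.
apply: (le_trans _ hy); rewrite [`|y * _|]normrM (ger0_norm (le_trans ler01 y1)).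
by apply: ler_peMl.
Unshelve. all: end_near. Qed.

Lemma integral_FTCy (f F : R -> R) (l : R) : (forall x, 0 <= x -> 0 <= f x) ->
  continuous f -> (forall x, isder x F (f x)) ->
  F x @[x --> +oo] --> l -> (\int[mu]_(x in `[0%R, +oo[) (f x)%:E = (l - F 0)%:E)%E.
Proof.
move=> f0 cf dF Fl; rewrite EFinB; apply: ge0_continuous_FTC2y => //.
- by apply: continuous_in_subspaceT => x _; exact: cf.
- by apply: cvg_at_right_filter; exact: der_continuous (dF 0).
- by move=> x _; exact: der_derive1.
Qed.

Lemma continuous_heatB v m : continuous (fun y : R => heat v (y - m)).
Proof.
move=> x; apply: (@continuous_comp _ _ _ (fun y : R => y - m) (heat v)); last exact: continuous_heat.
by apply: cvgB; [exact: cvg_id|exact: cvg_cst].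
Qed.

Lemma der_heatB v m x :
  isder x (fun y => heat v (y - m)) (- ((x - m) / v) * heat v (x - m)).
Proof.
eapply der_eq.
  exact: (der_comp (f := heat v) (g := fun y => y - m) (der_heat _ _)
    (der_D (der_id x) (der_cst (- m) x))).
by rewrite /=; ring.
Qed.

Lemma heat_subadd v x m : 0 <= x -> 0 <= m -> heat v (x + m) <= heat v (x - m).
Proof.
move=> x0 m0; have [v0|v0] := leP v 0; first by rewrite !heat_le0.
rewrite /heat ler_wpM2l ?mulr_ge0 ?invr_ge0 ?sqrtr_ge0// ler_expR lerN2.
rewrite ler_pM2r ?invr_gt0 ?mulr_gt0// -subr_ge0.
have -> : (x + m) ^+ 2 - (x - m) ^+ 2 = 4 * (x * m) by ring.
by rewrite !mulr_ge0.
Qed.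

(** The function [y] is invariant for Brownian motion killed at 0; this is why the Bessel process is
    a transform of the killed process. *)
Lemma integral_killed_mean v m : 0 < v -> 0 <= m ->
  (\int[mu]_(y in `[0%R, +oo[) (y * (heat v (y - m) - heat v (y + m)))%:E = m%:E)%E.
Proof.
move=> v0 m0.
have dm x : isder x (fun y => heat v (y + m)) (- ((x + m) / v) * heat v (x + m)).
  by have := der_heatB v (- m) x; rewrite opprK.
have dPm x : isder x (fun y => Phi ((y + m) / Num.sqrt v)) (heat v (x + m)).
  by have := der_Phi_scale (- m) x v0; rewrite opprK.
pose F y := v * (- heat v (y - m) + heat v (y + m)) +
  m * (Phi ((y - m) / Num.sqrt v) + Phi ((y + m) / Num.sqrt v)).
transitivity ((v * (- 0 + 0) + m * (1 + 1) - F 0)%:E); first apply: integral_FTCy.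
- by move=> x x0; rewrite mulr_ge0// subr_ge0 heat_subadd.
- move=> x; apply: cvgM; first exact: cvg_id.
  apply: cvgB; first exact: continuous_heatB.
  exact: der_continuous (dm x).
- move=> x.
  have d := der_D (der_M (der_cst v x) (der_D (der_N (der_heatB v m x)) (dm x)))
    (der_M (der_cst m x) (der_D (der_Phi_scale m x v0) (dPm x))).
  by apply: (der_eq d); rewrite /=; field; rewrite gt_eqF.
- have P1 := cvg_Phi_scale (- m) v0; have h1 := cvg_heaty (- m) v0.
  rewrite opprK in P1, h1.
  apply: cvgD; apply: cvgMr; apply: cvgD.
  + by apply: cvgN; exact: cvg_heaty.
  + exact: h1.
  + exact: cvg_Phi_scale.
  + exact: P1.
- rewrite /F !(sub0r, add0r) heatN addNr mulr0 add0r mulNr.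
  by rewrite [Phi (- _) + _]addrC PhiN; congr EFin; ring.
Qed.

Lemma integral_half_variance v : 0 < v ->
  (\int[mu]_(y in `[0%R, +oo[) (2 * y ^+ 2 * heat v y)%:E = v%:E)%E.
Proof.
move=> v0.
have dP x : isder x (fun y => Phi (y / Num.sqrt v)) (heat v x).
  have := der_Phi_scale 0 x v0; rewrite subr0.
  by rewrite (_ : (fun y => Phi ((y - 0) / Num.sqrt v)) = fun y => Phi (y / Num.sqrt v))//;
    apply/funext => y; rewrite subr0.
pose F y := 2 * v * (- (y * heat v y) + Phi (y / Num.sqrt v)).
transitivity ((2 * v * (- 0 + 1) - F 0)%:E); first apply: integral_FTCy.
- by move=> x x0; rewrite !mulr_ge0 ?sqr_ge0 ?heat_ge0.
- move=> x; apply: cvgM; last exact: continuous_heat.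
  exact: (der_continuous (der_M (der_cst 2 x) (der_sqr (der_id x)))).
- move=> x.
  have d := der_M (der_cst (2 * v) x) (der_D (der_N (der_M (der_id x) (der_heat v x))) (dP x)).
  by apply: (der_eq d); rewrite /=; field; rewrite gt_eqF.
- apply: cvgMr; apply: cvgD; first by apply: cvgN; exact: cvg_mul_heaty.
  have := cvg_Phi_scale 0 v0.
  by under eq_fun do rewrite subr0.
- by rewrite /F !mul0r oppr0 !add0r Phi0; congr EFin; field.
Qed.

Lemma integral_half_heat v : 0 < v ->
  (\int[mu]_(y in `[0%R, +oo[) (heat v y)%:E = (2^-1)%:E)%E.
Proof.
move=> v0.
pose F y := Phi ((y - 0) / Num.sqrt v).
transitivity ((1 - F 0)%:E); first apply: integral_FTCy; rewrite /F.
- by move=> x _; exact: heat_ge0.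
- exact: continuous_heat.
- by move=> x; have := der_Phi_scale 0 x v0; rewrite subr0.
- exact: cvg_Phi_scale.
- by rewrite subrr mul0r Phi0; congr EFin; field.
Qed.

Lemma integral_half_mul_heat v : 0 < v ->
  (\int[mu]_(y in `[0%R, +oo[) (y * heat v y)%:E = (v * heat v 0)%:E)%E.
Proof.
move=> v0.
pose F y := - v * heat v y.
transitivity ((- v * 0 - F 0)%:E); first apply: integral_FTCy; rewrite /F.
- by move=> x x0; rewrite mulr_ge0 ?heat_ge0.
- by move=> x; apply: cvgM; [exact: cvg_id|exact: continuous_heat].
- by move=> x; eapply der_eq; [hder|rewrite /=; field; rewrite gt_eqF].
- apply: cvgMr; have := cvg_heaty 0 v0.
  by under eq_fun do rewrite subr0.
- by congr EFin; ring.
Qed.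

End gaussian_integrals.

(** * Characteristic function of the normal law *)

Section gaussian_cosine.
Context {R : realType}.
Implicit Types (c t u v x y z m g th : R).
Variable v : R.
Hypothesis v0 : 0 < v.
Let H : set R := `[0, +oo[%classic.
Let mH : measurable H. Proof. exact: measurable_itv. Qed.

Let integrableH (f : R -> R) A : meas_fun f -> (forall x, 0 <= x -> 0 <= f x) ->
  (\int[mu]_(x in H) (f x)%:E = A%:E)%E -> mu.-integrable H (EFin \o f).
Proof.
move=> mf f0 hf; apply/integrableP; split; first by apply: measurable_funTS; exact/measurable_EFinP.
rewrite (_ : integral _ _ _ = A%:E) ?ltry// -hf; apply: eq_integral => x.
by rewrite inE /H/= in_itv/= andbT => x0; rewrite ger0_norm ?f0.
Qed.

Let ih : mu.-integrable H (EFin \o heat v).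
Proof.
by apply: integrableH (integral_half_heat v0); [heat_meas|move=> x _; exact: heat_ge0].
Qed.

Let ixh : mu.-integrable H (EFin \o (fun x => x * heat v x)).
Proof.
apply: integrableH (integral_half_mul_heat v0); first by heat_meas.
by move=> x x0; rewrite mulr_ge0 ?heat_ge0.
Qed.

Let ibd (f : R -> R) (g : R -> R) : meas_fun g -> mu.-integrable H (EFin \o f) ->
  (forall x, 0 <= x -> `|g x| <= f x) -> mu.-integrable H (EFin \o g).
Proof.
move=> mg intf gf; apply: le_integrable intf => //.
  by apply: measurable_funTS; exact/measurable_EFinP.
move=> x; rewrite /H/= in_itv/= andbT => x0; rewrite lee_fin.
by apply: le_trans (gf _ x0) _; exact: ler_norm.
Qed.

Let mcos c : meas_fun (fun x : R => cos (c * x) * heat v x).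
Proof. by heat_meas. Qed.

Let msin c : meas_fun (fun x : R => sin (c * x) * heat v x).
Proof.
apply: mfM; last by heat_meas.
apply: (measurableT_comp (f := sin) (g := fun x : R => c * x)); last by heat_meas.
by apply: continuous_measurable_fun; exact: continuous_sin.
Qed.

Let icos c : mu.-integrable H (EFin \o (fun x => cos (c * x) * heat v x)).
Proof.
apply: (ibd _ ih) => // x _; rewrite normrM [`|heat _ _|]ger0_norm ?heat_ge0//.
by apply: ler_piMl; [exact: heat_ge0|rewrite ler_norml cos_geN1 cos_le1].
Qed.

Let ixsin c : mu.-integrable H (EFin \o (fun x => x * (sin (c * x) * heat v x))).
Proof.
apply: (ibd _ ixh); first by apply: mfM => //; exact: msin.
move=> x x0; rewrite normrM (ger0_norm x0); apply: ler_wpM2l => //.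
rewrite [`|sin _ * _|]normrM [`|heat _ _|]ger0_norm ?heat_ge0//.
by apply: ler_piMl; [exact: heat_ge0|rewrite ler_norml sin_geN1 sin_le1].
Qed.

Let C c := (\int[mu]_(x in H) (cos (c * x) * heat v x))%R.
Let S c := (\int[mu]_(x in H) (x * (sin (c * x) * heat v x)))%R.

(** Integration by parts, read off the derivative of [v sin (c x) heat v x]. *)
Let ibp c : S c = c * v * C c.
Proof.
(* The last summand makes [f] nonnegative, as [integral_FTCy] requires; its integral is known and
   cancels at the end. *)
pose f x := c * v * (cos (c * x) * heat v x) - x * (sin (c * x) * heat v x) +
  (`|c * v| * heat v x + x * heat v x).
pose F x := v * (sin (c * x) * heat v x) + (`|c * v| * Phi ((x - 0) / Num.sqrt v) + - v * heat v x).
have dsin x : isder x (fun x => sin (c * x)) (cos (c * x) * c).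
  by apply: (der_eq (der_sin (der_M (der_cst c x) (der_id x)))); ring.
have dF x : isder x F (f x).
  have d := der_D (der_M (der_cst v x) (der_M (dsin x) (der_heat v x)))
    (der_D (der_M (der_cst `|c * v| x) (der_Phi_scale 0 x v0)) (der_M (der_cst (- v) x) (der_heat v x))).
  apply: (der_eq d); rewrite /f /= subr0.
  by move: (heat v x) (sin _) (cos _) `|c * v| => h s k a; field; rewrite gt_eqF.
have E : (\int[mu]_(x in H) (f x)%:E = (`|c * v| / 2 + v * heat v 0)%:E)%E.
  transitivity (((v * 0 + (`|c * v| * 1 + - v * 0)) - F 0)%:E)%E; first apply: integral_FTCy.
  - move=> x x0; rewrite /f.
    have h0 := heat_ge0 v x.
    have c1 : - `|c * v| * heat v x <= c * v * (cos (c * x) * heat v x).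
      rewrite mulrA; apply: ler_wpM2r => //.
      have : `|c * v * cos (c * x)| <= `|c * v|.
        by rewrite normrM; apply: ler_piMr => //; rewrite ler_norml cos_geN1 cos_le1.
      by rewrite ler_norml => /andP[].
    have s1 : x * (sin (c * x) * heat v x) <= x * heat v x.
      by apply: ler_wpM2l => //; apply: ler_piMl => //; exact: sin_le1.
    lra.
  - move=> x.
    have d1 := der_M (der_cst (c * v) x) (der_M (der_cos (der_M (der_cst c x) (der_id x))) (der_heat v x)).
    have d2 := der_M (der_id x) (der_M (dsin x) (der_heat v x)).
    have d3 := der_D (der_M (der_cst `|c * v| x) (der_heat v x)) (der_M (der_id x) (der_heat v x)).
    exact: (der_continuous (der_D (der_D d1 (der_N d2)) d3)).
  - have h0 : heat v x @[x --> +oo] --> (0 : R).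
      by have := cvg_heaty 0 v0; under eq_fun do rewrite subr0.
    apply: cvgD; [apply: cvgMr|apply: cvgD; apply: cvgMr].
    + apply: (@squeeze_cvgr _ _ _ _ (fun x => - heat v x) (heat v)).
      * apply: nearW => x; rewrite -ler_norml normrM (ger0_norm (heat_ge0 v x)).
        by apply: ler_piMl; [exact: heat_ge0|rewrite ler_norml sin_geN1 sin_le1].
      * by rewrite -oppr0; apply: cvgN.
      * exact: h0.
    + exact: cvg_Phi_scale.
    + exact: h0.
  - have e0 : (0 - 0) / Num.sqrt v = 0 by rewrite subrr mul0r.
    by congr EFin; rewrite /F e0 (mulr0 c) sin0 Phi0; field.
have i1 := @integrableZl _ _ R mu H mH (c * v) _ (icos c).
have i3 := @integrableZl _ _ R mu H mH `|c * v| _ ih.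
have Rf : (\int[mu]_(x in H) f x)%R = (c * v * C c - S c) + (`|c * v| * 2^-1 + v * heat v 0).
  rewrite /f RintegralD//; last 2 first.
  - by apply: (@integrableB _ _ _ mu H _ _ _ i1 (ixsin c)).
  - by apply: (@integrableD _ _ _ mu H _ _ _ i3 ixh).
  rewrite RintegralB// RintegralZl// RintegralD// RintegralZl//; congr (_ + (_ * _ + _)).
  - by rewrite /Rintegral (integral_half_heat v0).
  - by rewrite /Rintegral (integral_half_mul_heat v0).
have : (\int[mu]_(x in H) f x)%R = `|c * v| / 2 + v * heat v 0 by rewrite /Rintegral E.
by rewrite Rf; lra.
Qed.

(** Differentiation under the integral and [ibp] give a linear differential equation, which [CE]
    integrates. *)
Let dC c : isder c C (- (c * v * C c)).
Proof.
pose f c x := cos (c * x) * heat v x.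
have df x y : isder x (f ^~ y) (- (y * (sin (x * y) * heat v y))).
  apply: (der_eq (der_M (der_cos (der_M (der_id x) (der_cst y x))) (der_cst (heat v y) x))).
  by ring.
have cc : `]c - 1, c + 1[%classic c by rewrite /= in_itv/= ltrBlDr ltrDl ltr01.
have intf x : `]c - 1, c + 1[%classic x -> mu.-integrable H (EFin \o f x) by move=> _; exact: icos.
have derf x y : `]c - 1, c + 1[%classic x -> H y -> derivable (f ^~ y) x 1.
  by move=> _ _; have [] := df x y.
pose G (x : R) := `|x| * heat v x.
have G0 x : 0 <= G x by rewrite /G mulr_ge0 ?heat_ge0.
have iG : mu.-integrable H (EFin \o G).
  apply: (ibd _ ixh); first by rewrite /G; heat_meas.
  by move=> x x0; rewrite ger0_norm// /G ger0_norm.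
have Gub x y : `]c - 1, c + 1[%classic x -> H y -> `|partial1of2 f x y| <= G y.
  move=> _ _; rewrite /partial1of2 (der_derive1 (df x y)) normrN normrM /G.
  apply: ler_wpM2l => //; rewrite [`|sin _ * _|]normrM [`|heat _ _|]ger0_norm ?heat_ge0//.
  by apply: ler_piMl; [exact: heat_ge0|rewrite ler_norml sin_geN1 sin_le1].
have dd := @derivable_under_integral R _ _ mu f H mH c _ _ cc intf derf G G0 iG Gub.
split; first exact: dd.
rewrite -derive1E.
rewrite (@differentiation_under_integral R _ _ mu f H mH c _ _ cc intf derf G G0 iG Gub).
rewrite -ibp /S -mulN1r -RintegralZl//.
apply: eq_Rintegral => x _; rewrite /partial1of2 (der_derive1 (df c x)); ring.
Qed.

Let CE c : C c = expR (- (c ^+ 2 * v / 2)) / 2.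
Proof.
have C0 : C 0 = 2^-1.
  rewrite /C /Rintegral; under eq_integral do rewrite mul0r cos0 mul1r.
  by rewrite (integral_half_heat v0).
have h x : isder x (fun c => C c * expR (c ^+ 2 * v / 2)) 0.
  have d : isder x (fun c => c ^+ 2 * v / 2) (x * v).
    apply: (der_eq (der_M (der_M (der_sqr (der_id x)) (der_cst v x)) (der_cst 2^-1 x))).
    by rewrite /=; field.
  by apply: (der_eq (der_M (dC x) (der_exp d))); ring.
have := is_derive_0_is_cst c 0 h.
rewrite C0 expr0n/= !mul0r expR0 mulr1 => hc.
apply: (mulIf (lt0r_neq0 (expR_gt0 (c ^+ 2 * v / 2)))).
by rewrite hc mulrAC -expRD addNr expR0 mul1r.
Qed.

Let integral_even (f : R -> R) : meas_fun f -> (forall x, 0 <= f x) ->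
  (forall x, f (- x) = f x) ->
  (\int[mu]_x (f x)%:E = \int[mu]_(x in H) (f x)%:E + \int[mu]_(x in H) (f x)%:E)%E.
Proof.
move=> mf f0 fN.
have mf' : meas_fun (EFin \o f) by exact/measurable_EFinP.
have E := @ge0_integration_by_substitution0 R (EFin \o f) mf' (fun x => f0 x).
rewrite {1}E; under [in RHS]eq_integral do rewrite /= fN.
rewrite (_ : setT = `]-oo, 0[%classic `|` `[0, +oo[%classic :> set R); last first.
  apply/seteqP; split => x //= _; rewrite !in_itv/= andbT.
  by case: (ltP x 0) => h; [left|right].
rewrite ge0_integral_setU//=; last 3 first.
- exact: measurable_funTS.
- by move=> x _; rewrite lee_fin.
- rewrite disj_set2E; apply/eqP/seteqP; split => x //=; rewrite !in_itv/= andbT => -[].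
  by move=> h1 h2; move: (le_lt_trans h2 h1); rewrite ltxx.
by rewrite integral_itv_bndo_bndc//; exact: measurable_funTS.
Qed.

Let integral_cos_even c :
  (\int[mu]_x ((1 + cos (c * x)) * heat v x)%:E = (1 + expR (- (c ^+ 2 * v / 2)))%:E)%E.
Proof.
rewrite integral_even; last 3 first.
- by heat_meas.
- by move=> x; rewrite mulr_ge0 ?heat_ge0// -lerBlDl sub0r cos_geN1.
- by move=> x; rewrite mulrN cosN heatN.
have -> : (\int[mu]_(x in H) ((1 + cos (c * x)) * heat v x)%:E = (2^-1 + C c)%:E)%E.
  under eq_integral do rewrite mulrDl mul1r EFinD.
  rewrite integralD//; [|exact: icos].
  rewrite integral_half_heat// EFinD /C /Rintegral fineK//.
  by apply: integrable_fin_num => //; exact: icos.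
by rewrite CE -EFinD; congr EFin; field.
Qed.

Lemma integral_cos_heat c th m :
  (\int[mu]_x ((1 + cos (c * x + th)) * heat v (x - m))%:E =
   (1 + cos (c * m + th) * expR (- (c ^+ 2 * v / 2)))%:E)%E.
Proof.
have cge0 z : 0 <= 1 + cos z :> R by rewrite -lerBlDl sub0r cos_geN1.
set B := c * m + th.
have E1 : (\int[mu]_x ((1 + cos (c * x + th)) * heat v (x - m))%:E =
    \int[mu]_x ((1 + cos (c * x + B)) * heat v x)%:E)%E.
  rewrite -[LHS](integral_shift m); last 2 first.
  - by heat_meas.
  - by move=> x; rewrite lee_fin mulr_ge0 ?heat_ge0.
  by apply: eq_integral => x _; rewrite addrK /B; congr (((1 + cos _) * _)%:E); ring.
(* Averaging the integral with its reflection removes the sine part of [cos (c x + B)] and leaves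
   the even integral already computed. *)
have E2 : (\int[mu]_x ((1 + cos (c * x + B)) * heat v x)%:E =
    \int[mu]_x ((1 + cos (- (c * x) + B)) * heat v x)%:E)%E.
  rewrite -[LHS](integral_reflect 0); last 2 first.
  - by heat_meas.
  - by move=> x; rewrite lee_fin mulr_ge0 ?heat_ge0.
  by apply: eq_integral => x _; rewrite sub0r heatN mulrN.
have [A EA] : exists A : R, (\int[mu]_x ((1 + cos (c * x + B)) * heat v x)%:E = A%:E)%E.
  exists (fine (\int[mu]_x ((1 + cos (c * x + B)) * heat v x)%:E)%E).
  rewrite fineK// ge0_fin_numE; last first.
    by apply: integral_ge0 => x _; rewrite lee_fin mulr_ge0 ?heat_ge0.
  apply: (@le_lt_trans _ _ (\int[mu]_x (2 * heat v (x - 0))%:E)%E).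
    apply: ge0_le_integral => //.
    - by move=> x _; rewrite lee_fin mulr_ge0 ?heat_ge0.
    - by heat_meas.
    - by heat_meas.
    - move=> x _; rewrite subr0 lee_fin ler_wpM2r ?heat_ge0//.
      by have := cos_le1 (c * x + B); lra.
  under eq_integral do rewrite EFinM.
  rewrite ge0_integralZl//; last 2 first.
  - by heat_meas.
  - by move=> x _; rewrite lee_fin heat_ge0.
  by rewrite integral_heat// mule1 ltry.
have h1 := integral_lincomb 2^-1 2^-1 _ _ _ _ EA (etrans (esym E2) EA).
have h2 := integral_lincomb (1 - cos B) (cos B) _ _ _ _ (integral_heat 0 v0)
  (integral_cos_even c).
rewrite E1 EA (_ : A = 2^-1 * A + 2^-1 * A); last by field.
rewrite -h1; last 4 first.
- by heat_meas.
- by heat_meas.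
- by move=> x; rewrite mulr_ge0 ?heat_ge0.
- by move=> x; rewrite mulr_ge0 ?heat_ge0.
transitivity (((1 - cos B) * 1 + cos B * (1 + expR (- (c ^+ 2 * v / 2))))%:E)%E; last first.
  by congr EFin; ring.
rewrite -h2; last 4 first.
- by heat_meas.
- by heat_meas.
- by move=> x; rewrite heat_ge0.
- by move=> x; rewrite mulr_ge0 ?heat_ge0.
apply: eq_integral => x _; congr EFin.
by rewrite subr0 [c * x + B]addrC [- (c * x) + B]addrC !cosD cosN sinN; field.
Qed.

End gaussian_cosine.

(** Cameron-Martin formula at a single time: an exponential factor shifts the mean. *)
Lemma heat_girsanov {R : realType} (t x c : R) : 0 < t ->
  heat t x * expR (c * x - c ^+ 2 * t / 2) = heat t (x - c * t).
Proof.
move=> t0; rewrite /heat -[LHS]mulrA -expRD; congr (_ * expR _).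
by field; rewrite gt_eqF.
Qed.

Lemma hitE {R : realType} (t x : R) : hit t x = x / t * heat t x.
Proof. by []. Qed.

Opaque heat hit.

(** * Chains of kernels and first passage decompositions *)

Section chains.
Context {R : realType}.
Implicit Types (t u v x y z r c rho : R) (f : R -> R) (s : seq (R * (R -> R))).

(** Reflection principle: transition density of Brownian motion killed at 0, extended by 0 to
    nonpositive heights. *)
Definition killed t x y : R :=
  if (0 < x) && (0 < y) then heat t (x - y) - heat t (x + y) else 0.

Lemma killed_ge0 t x y : 0 <= killed t x y.
Proof.
rewrite /killed; case: ifPn => // /andP[x0 y0].
by rewrite subr_ge0 heat_subadd// ltW.
Qed.

Lemma killed_sym t x y : killed t x y = killed t y x.
Proof. by rewrite /killed andbC heatBC [y + x]addrC. Qed.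

Lemma killed_le t x y : killed t x y <= heat t (x - y).
Proof.
by rewrite /killed; case: ifPn => _; rewrite ?heat_ge0// gerBl heat_ge0.
Qed.

Lemma killed_le0 t x y : t <= 0 -> killed t x y = 0.
Proof. by move=> t0; rewrite /killed !heat_le0// subrr; case: ifP. Qed.

Lemma killed_npos t x y : y <= 0 -> killed t x y = 0.
Proof. by move=> y0; rewrite /killed [0 < y]ltNge y0 andbF. Qed.

Lemma measurable_killed d (T : measurableType d) (t x y : T -> R) :
  meas_fun t -> meas_fun x -> meas_fun y ->
  meas_fun (fun a => killed (t a) (x a) (y a)).
Proof. by move=> mt mx my; rewrite /killed; heat_meas. Qed.

(* A test attaches a nonnegative weight to each of finitely many times, given as decreasing
   remaining times before the end of the path. *)
Fixpoint tests r s : Prop :=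
  if s is (rho, f) :: s' then
    [/\ 0 < rho < r, meas_fun f, forall y, 0 <= f y & tests rho s']
  else True.

(* Weighted density of a Markov chain with transition density [k r x rho y] from [x] at remaining
   time [r] to [y] at remaining time [rho]. *)
Fixpoint chain (k : R -> R -> R -> R -> R) (e : R -> R -> R) s r x : \bar R :=
  if s is (rho, f) :: s' then
    (\int[mu]_y ((k r x rho y * f y)%:E * chain k e s' rho y))%E
  else (e r x)%:E.

Definition mker2 (e : R -> R -> R) := forall d (T : measurableType d) (r x : T -> R),
  meas_fun r -> meas_fun x ->
  meas_fun (fun a => e (r a) (x a)).

Definition mker4 (k : R -> R -> R -> R -> R) :=
  forall d (T : measurableType d) (r x rho y : T -> R),
  meas_fun r -> meas_fun x ->
  meas_fun rho -> meas_fun y ->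
  meas_fun (fun a => k (r a) (x a) (rho a) (y a)).

Lemma chain_ge0 k e s r' r x : (forall r x rho y, 0 <= k r x rho y) ->
  (forall r x, 0 <= e r x) -> tests r' s -> (0 <= chain k e s r x)%E.
Proof.
move=> k0 e0; elim: s r' r x => [|[rho f] s IH] r' r x /=; first by rewrite lee_fin.
move=> [_ _ f0 ts]; apply: integral_ge0 => y _.
by rewrite mule_ge0 ?lee_fin ?mulr_ge0//; exact: IH ts.
Qed.

Section chain_theory.
Variables (k : R -> R -> R -> R -> R -> R) (e : R -> R -> R -> R).
Hypotheses (k0 : forall m r x rho y, 0 <= k m r x rho y) (e0 : forall m r x, 0 <= e m r x).
Hypotheses (mk : forall d (T : measurableType d) (m r x rho y : T -> R),
  meas_fun m -> meas_fun r -> meas_fun x ->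
  meas_fun rho -> meas_fun y ->
  meas_fun (fun a => k (m a) (r a) (x a) (rho a) (y a))).
Hypothesis (me : forall d (T : measurableType d) (m r x : T -> R),
  meas_fun m -> meas_fun r -> meas_fun x ->
  meas_fun (fun a => e (m a) (r a) (x a))).

(** The parameter [m] serves chains whose killing level or target value is itself a variable of
    integration. *)
Lemma measurable_chain_param s r0 d (T : measurableType d) (m r x : T -> R) : tests r0 s ->
  meas_fun m -> meas_fun r -> meas_fun x ->
  meas_fun (fun a => chain (k (m a)) (e (m a)) s (r a) (x a)).
Proof.
elim: s r0 d T m r x => [|[rho f] s IH] r0 d T m r x /=.
  by move=> _ mm mr mx; apply: mfE; exact: me.
move=> [_ mf f0 ts] mm mr mx.
apply: (measurable_int_param mu (fun a y =>
  (k (m a) (r a) (x a) rho y * f y)%:E * chain (k (m a)) (e (m a)) s rho y)%E).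
  have mm' : meas_fun (fun z : T * R => m z.1) by meas.
  apply: mfeM.
    apply: mfE; apply: mfM.
      by apply: mk; meas.
    by meas.
  by apply: IH ts _ _ _; meas.
move=> a y; rewrite mule_ge0 ?lee_fin ?mulr_ge0//; exact: (chain_ge0 _ _ _ _ ts).
Qed.

End chain_theory.

Lemma measurable_chain k e (k0 : forall r x rho y, 0 <= k r x rho y) (mk : mker4 k)
  (me : mker2 e) (e0 : forall r x, 0 <= e r x) s r0 d (T : measurableType d) (r x : T -> R) :
  tests r0 s -> meas_fun r -> meas_fun x ->
  meas_fun (fun a => chain k e s (r a) (x a)).
Proof.
move=> ts mr mx.
by apply: (measurable_chain_param (fun=> k0) (fun=> e0) _ _ ts mr mr mx) => *; [exact: mk|exact: me].
Qed.

Definition k0 r x rho y := killed (r - rho) x y.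

Lemma k0_ge0 r x rho y : 0 <= k0 r x rho y.
Proof. exact: killed_ge0. Qed.

Lemma mk0 : mker4 k0.
Proof. by move=> d T r x rho y mr mx mrho my; apply: measurable_killed => //; meas. Qed.

(** [hit] is negative at negative heights; truncation gives a nonnegative final factor. *)
Definition hit' r x : R := if 0 < x then hit r x else 0.

Lemma hit'_ge0 r x : 0 <= hit' r x.
Proof. by rewrite /hit'; case: ifPn => // x0; rewrite hit_ge0// ltW. Qed.

Lemma hit'E r x : 0 < x -> hit' r x = hit r x.
Proof. by move=> x0; rewrite /hit' x0. Qed.

Lemma mhit' : mker2 hit'.
Proof. by move=> d T r x mr mx; rewrite /hit'; heat_meas. Qed.

Local Notation chain0 := (chain k0 hit').

Section line_crossing.
(* [- (c0 + c1 * r)] is the height, at remaining time [r], of a line below which the path is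
   killed. *)
Variables (c0 c1 : R).
Let h r := c0 + c1 * r.

(** Transition density of Brownian motion killed at the line: the height [x + h r] above it is a
    Brownian motion with drift [- c1] killed at 0, and Girsanov's factor accounts for the drift. *)
Definition kL r x rho y :=
  killed (r - rho) (x + h r) (y + h rho) *
  expR (c1 * (x - y) + c1 ^+ 2 * (r - rho) / 2).

(** Density of first reaching the line exactly at the end, again with Girsanov's factor for the
    drift [- c1]. *)
Definition eL r x :=
  hit' r (x + h r) * expR (c1 * (x + h r) - c1 ^+ 2 * r / 2).

Lemma kL_ge0 r x rho y : 0 <= kL r x rho y.
Proof. by rewrite /kL mulr_ge0 ?killed_ge0 ?expR_ge0. Qed.

Lemma eL_ge0 r x : 0 <= eL r x.
Proof.
by rewrite /eL mulr_ge0 ?expR_ge0 ?hit'_ge0.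
Qed.

Lemma mkL : mker4 kL.
Proof.
move=> d T r x rho y mr mx mrho my; rewrite /kL /h; apply: mfM; last by meas.
by apply: measurable_killed; meas.
Qed.

Lemma meL : mker2 eL.
Proof.
by move=> d T r x mr mx; rewrite /eL /h; apply: mfM; [apply: mhit'; meas|meas].
Qed.

Lemma eLE v z : 0 < v -> 0 < z + h v -> eL v z = (z + h v) / v * heat v (z + c0).
Proof.
move=> v0 zv; rewrite /eL hit'E// hitE -mulrA heat_girsanov//.
by congr (_ * heat _ _); rewrite /h; ring.
Qed.

Lemma kLE v z rho y : rho < v -> 0 < z + h v -> 0 < y + h rho ->
  kL v z rho y = heat (v - rho) (z - y) -
    expR (- (2 * c1 * (y + h rho))) * heat (v - rho) (z + (y + 2 * h rho)).
Proof.
move=> rv zv yr; have t0 : 0 < v - rho by rewrite subr_gt0.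
rewrite /kL /killed zv yr/= mulrBl; congr (_ - _).
  rewrite -[in RHS](_ : z + h v - (y + h rho) - c1 * (v - rho) = z - y); last by rewrite /h; ring.
  by rewrite -heat_girsanov//; congr (_ * expR _); rewrite /h; field.
rewrite -[in RHS](_ : z + h v + (y + h rho) - c1 * (v - rho) = z + (y + 2 * h rho)); last first.
  by rewrite /h; ring.
by rewrite -heat_girsanov// mulrCA -expRD; congr (_ * expR _); rewrite /h; field.
Qed.

(** The same weights as functions of the height above the line. *)
Definition shift s : seq (R * (R -> R)) := [seq (p.1, fun y => p.2 (y - h p.1)) | p <- s].

Lemma tests_shift r s : tests r s -> tests r (shift s).
Proof.
elim: s r => //= -[rho f] s IH r [rr mf f0 ts]; split => //; last exact: IH.
by meas.
Qed.

(** Induction step common to chains started above the line and to Bessel chains started on it: the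
    variable is shifted by [h rho], and the Girsanov factor of the tail is absorbed into the first
    kernel. *)
Lemma shift_step rho f s (a : R -> R) (E : R) : meas_fun f ->
  (forall y, 0 <= f y) -> tests rho s -> meas_fun a -> (forall y, 0 <= a y) ->
  (forall y, y <= 0 -> a y = 0) -> 0 <= E ->
  (forall y, 0 < y + h rho -> chain kL eL s rho y =
    ((expR (c1 * (y + h rho) - c1 ^+ 2 * rho / 2))%:E *
     chain0 (shift s) rho (y + h rho))%E) ->
  (E%:E * \int[mu]_y ((a y * f (y - h rho))%:E * chain0 (shift s) rho y) =
   \int[mu]_y ((E * expR (- (c1 * (y + h rho) - c1 ^+ 2 * rho / 2)) * a (y + h rho) * f y)%:E *
     chain kL eL s rho y))%E.
Proof.
move=> mf f0 ts ma a0 an E0 IH.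
have tsh := tests_shift ts.
pose g y : \bar R := ((a y * f (y - h rho))%:E * chain0 (shift s) rho y)%E.
have g0 y : (0 <= g y)%E.
  by rewrite mule_ge0 ?lee_fin ?mulr_ge0//; exact: (chain_ge0 _ _ k0_ge0 hit'_ge0 tsh).
have mg : meas_fun g.
  apply: mfeM; last by apply: (measurable_chain k0_ge0 mk0 mhit' hit'_ge0 tsh); meas.
  apply: mfE; apply: mfM => //.
  by meas.
rewrite -/(g _) -[in LHS](integral_shift (h rho) mg g0) -ge0_integralZl//; last first.
  apply: (measurableT_comp (f := g) (g := fun y : R => y + h rho) mg).
  by meas.
apply: eq_integral => y _; rewrite /g addrK.
have [yr|yr] := leP (y + h rho) 0; first by rewrite an// !(mulr0, mul0r) !mul0e mule0.
rewrite IH// muleA [in RHS]muleA -!EFinM; congr (_%:E * _)%E.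
set A := c1 * _ - _; rewrite -[a _ * f y]mul1r -(expRxMexpNx_1 A); ring.
Qed.

(** The Girsanov factors of successive kernels telescope; only that of the starting point
    survives. *)
Lemma chain_shift s r0 r x : 0 < x + h r -> tests r0 s ->
  chain kL eL s r x = ((expR (c1 * (x + h r) - c1 ^+ 2 * r / 2))%:E *
     chain0 (shift s) r (x + h r))%E.
Proof.
elim: s r0 r x => [|[rho f] s IH] r0 r x xr /=.
  by move=> _; rewrite /eL -EFinM mulrC.
move=> [rr mf f0 ts].
rewrite (@shift_step rho f s (k0 r (x + h r) rho))//.
- apply: eq_integral => y _; congr (_%:E * _)%E; rewrite /kL /k0.
  rewrite (_ : c1 * (x - y) + c1 ^+ 2 * (r - rho) / 2 = c1 * (x + h r) - c1 ^+ 2 * r / 2 -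
    (c1 * (y + h rho) - c1 ^+ 2 * rho / 2)); last by rewrite /h; field.
  by rewrite expRD; ring.
- by apply: mk0; meas.
- by move=> y; exact: k0_ge0.
- by move=> y y0; exact: killed_npos.
- by move=> y yr; exact: (IH rho).
Qed.

(** By [kLE] the kernel is a source at [y] minus a weighted image at [- (y + 2 h rho)]. Seen from 0,
    the source depends only on [|y|] and the image lies at or below 0, so [integral_hit_heat]
    applies to both. *)
Lemma kernel_first_passage r x rho y : 0 < x -> rho < r ->
  (forall v, rho <= v <= r -> 0 <= h v) -> (forall v, rho < v < r -> 0 < h v) ->
  ((kL r x rho y)%:E = (killed (r - rho) x y)%:E +
    \int[mu]_u (hit u x * kL (r - u) 0 rho y)%:E)%E.
Proof.
move=> x0 rr hge0 hgt0; set t := r - rho.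
have t0 : 0 < t by rewrite subr_gt0.
have hr0 : 0 <= h rho by rewrite hge0// lexx ltW.
have [yr|yr] := leP (y + h rho) 0.
  have y0 : y <= 0 by apply: le_trans yr; rewrite lerDl.
  rewrite /kL killed_npos// mul0r killed_npos// add0e integral0_eq// => u _.
  by rewrite /kL killed_npos// mul0r mulr0.
have xr : 0 < x + h r by rewrite ltr_pwDl// hge0// lexx ltW.
rewrite kLE// -/t; set w := y + 2 * h rho; set e := expR _.
have w0 : 0 <= w by rewrite /w mulrDl mul1r addrA addr_ge0// ltW.
have I1 := integral_hit_heat t0 x0 (normr_ge0 y).
have I2 := integral_hit_heat t0 x0 w0.
have -> : (\int[mu]_u (hit u x * kL (r - u) 0 rho y)%:E =
    (heat t (x + `|y|) - e * heat t (x + w))%:E)%E.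
  transitivity ((1 * heat t (x + `|y|) + - e * heat t (x + w))%:E)%E.
    rewrite -(integral_lincomb 1 (- e) _ _ _ _ I1 I2); last 4 first.
    - by heat_meas.
    - by heat_meas.
    - by move=> u; rewrite mulr_ge0 ?hit_ge0 ?heat_ge0// ltW.
    - by move=> u; rewrite mulr_ge0 ?hit_ge0 ?heat_ge0// ltW.
    apply: eq_integral => u _; congr EFin.
    have [u0|u0] := leP u 0; first by rewrite !(hit_le0 _ u0) !mul0r !mulr0 addr0.
    have [ut|ut] := leP t u.
      have tu : t - u <= 0 by rewrite subr_le0.
      have ru : r - u - rho <= 0 by move: tu; rewrite /t; lra.
      by rewrite /kL killed_le0// !(heat_le0 _ tu) !(mul0r, mulr0) addr0.
    rewrite kLE ?add0r//; last 2 first.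
    - by rewrite /t in ut; lra.
    - by apply: hgt0; rewrite /t in ut; lra.
    have -> : r - u - rho = t - u by rewrite /t; ring.
    by rewrite heatN heat_abs /e /w; ring.
  by rewrite mul1r mulNr.
rewrite -EFinD; congr EFin; have [y0|y0] := leP y 0.
  by rewrite killed_npos// ler0_norm//; ring.
by rewrite /killed x0 y0/= gtr0_norm//; ring.
Qed.

(** If [c0 = 0] the line ends at 0, and the path may reach it at the end without an earlier visit of
    0; this is the extra term. *)
Lemma end_first_passage r x : 0 < x -> 0 < r -> 0 <= c0 ->
  (forall v, 0 < v < r -> 0 < h v) -> 0 <= h r ->
  ((eL r x)%:E = (if c0 == 0 then hit' r x else 0)%:E +
    \int[mu]_u (hit u x * eL (r - u) 0)%:E)%E.
Proof.
move=> x0 r0 c00 hgt0 hr; rewrite hit'E//.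
have eLE0 v : 0 < v < r -> eL v 0 = hit v c0 + c1 * heat v c0.
  move=> vr; have /andP[v0 _] := vr; rewrite eLE ?add0r//; last exact: hgt0.
  by rewrite /h hitE; field; rewrite gt_eqF.
have I2 := integral_hit_heat r0 x0 c00.
have [A [mA0 EA]] : exists A, (\int[mu]_u (hit u x * hit (r - u) c0)%:E = A%:E)%E /\
    eL r x = (if c0 == 0 then hit r x else 0) + (A + c1 * heat r (x + c0)).
  rewrite eLE//; last by rewrite ltr_pwDl.
  move: c00; rewrite le_eqVlt => /predU1P[c00|c00].
    exists 0; split.
      by rewrite integral0_eq// => u _; rewrite -c00 [hit _ 0]hitE !mul0r mulr0.
    by rewrite -c00 eqxx addr0 /h -c00 hitE; field; rewrite gt_eqF.
  exists (hit r (x + c0)); split; first exact: integral_hit_hit.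
  by rewrite gt_eqF// /h hitE; field; rewrite gt_eqF.
rewrite EA EFinD; congr (_ + _)%E.
rewrite -[in LHS](mul1r A) -(integral_lincomb 1 c1 _ _ _ _ mA0 I2); last 4 first.
- by heat_meas.
- by heat_meas.
- by move=> u; rewrite mulr_ge0 ?hit_ge0// ltW.
- by move=> u; rewrite mulr_ge0 ?hit_ge0 ?heat_ge0// ltW.
apply: eq_integral => u _; congr EFin.
have [u0|u0] := leP u 0; first by rewrite !(hit_le0 _ u0) !mul0r !mulr0 addr0.
have [ur|ur] := leP r u.
  have ru : r - u <= 0 by rewrite subr_le0.
  rewrite /eL /hit' !(hit_le0 _ ru) (heat_le0 _ ru).
  by case: ifP => _; rewrite !(mul0r, mulr0) addr0.
by rewrite eLE0; [ring|lra].
Qed.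

(** [v] is the remaining time at a visit of 0. Tests before the visit are timed relative to it, and
    [after] keeps the later ones as they are; a test exactly at [v] goes to [after], which matters
    only for finitely many [v]. *)
Definition before v s : seq (R * (R -> R)) := [seq (p.1 - v, p.2) | p <- s & v < p.1].
Definition after v s : seq (R * (R -> R)) := [seq p <- s | p.1 <= v].
(** Weighted density of a first passage through 0 at the remaining time [v]; the chain [C] up to the
    passage is either killed or Bessel. *)
Definition crossing (C : seq (R * (R -> R)) -> R -> R -> \bar R) v s r x : \bar R :=
  (C (before v s) (r - v)%R x * chain kL eL (after v s) v 0)%E.

Lemma tests_before v r s : tests r s -> tests (r - v) (before v s).
Proof.
rewrite /before; elim: s r => // -[rho f] s IH r /= [/andP[r0 rr] mf f0 ts].
case: ifPn => [vr|vr] /=.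
  by split => //; [lra|exact: IH].
have := IH _ ts; suff -> : [seq p <- s | v < p.1] = [::] by [].
elim: s rho r0 rr vr ts {IH} => // -[rho' f'] s IH rho r0 rr vr /= [/andP[h1 h2] _ _ ts].
by rewrite ifN; [apply: (IH rho') => //|]; rewrite -?leNgt in vr *; lra.
Qed.

Lemma tests_after v r s : tests r s -> tests r (after v s).
Proof.
rewrite /after; elim: s r => // -[rho f] s IH r /= [/andP[r0 rr] mf f0 ts].
case: ifPn => [vr|vr] /=; first by split => //; [rewrite r0 rr|exact: IH].
have : tests r s; last exact: IH.
case: s ts {IH} => // -[rho' f'] s /= [/andP[h1 h2] ? ? ?]; split => //.
by rewrite h1 (lt_trans h2).
Qed.

Lemma after_all r v s : tests r s -> r <= v -> before v s = [::] /\ after v s = s.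
Proof.
rewrite /before /after; elim: s r => // -[rho f] s IH r /= [/andP[_ rr] _ _ ts] rv.
have [h1 h2] := IH _ ts (le_trans (ltW rr) rv).
have rv' : rho <= v by rewrite ltW// (lt_le_trans rr).
by rewrite ltNge rv'/= h1 h2.
Qed.

(** Either the first test precedes the passage, or the passage precedes all tests. Both terms can be
    added without a case distinction because the kernels vanish for nonpositive durations. *)
Lemma crossing_cons (C : seq (R * (R -> R)) -> R -> R -> \bar R) (a b : R -> R) v r rho f s x :
  tests r ((rho, f) :: s) ->
  (v < rho -> (C (before v ((rho, f) :: s)) (r - v)%R x =
     \int[mu]_y ((a y * f y)%:E * chain0 (before v s) (rho - v)%R y))%E) ->
  C [::] (r - v) x = (b (r - v))%:E ->
  (forall y, 0 <= a y) -> meas_fun a ->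
  crossing C v ((rho, f) :: s) r x =
  (\int[mu]_y ((a y * f y)%:E * crossing chain0 v s rho y) +
   (b (r - v)%R)%:E * chain kL eL ((rho, f) :: s) v 0)%E.
Proof.
move=> /= [/andP[rho0 rr] mf f0 ts] Cc Cn a0 ma.
have [vr|vr] := ltP v rho.
  rewrite [X in (_ + _ * X)%E]integral0_eq; last first.
    move=> y _; rewrite /kL killed_le0 ?mul0r ?mul0e//.
    by rewrite subr_le0 ltW.
  rewrite mule0 adde0 /crossing Cc// {2}/after /= leNgt vr/= -/(after v s).
  rewrite -ge0_integralZr//.
  - by apply: eq_integral => y _; rewrite muleA.
  - apply: mfeM; first by apply: mfE; exact: mfM.
    by apply: (measurable_chain k0_ge0 mk0 mhit' hit'_ge0 (tests_before v ts)); meas.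
  - move=> y _; rewrite mule_ge0 ?lee_fin ?mulr_ge0//.
    exact: (chain_ge0 _ _ k0_ge0 hit'_ge0 (tests_before v ts)).
  - exact: (chain_ge0 _ _ kL_ge0 eL_ge0 (tests_after v ts)).
rewrite integral0_eq ?add0e; last first.
  move=> y _; rewrite /crossing; have [-> ->] := after_all ts vr => /=.
  by rewrite /hit' hit_le0 ?subr_le0//; case: ifP; rewrite mul0e mule0.
have [h1 h2] := after_all ts vr.
by rewrite /crossing /before /after /= ltNge vr /= -/(before v s) -/(after v s) h1 h2 Cn.
Qed.

Lemma crossing_chain_cons v r rho f s x : tests r ((rho, f) :: s) ->
  crossing chain0 v ((rho, f) :: s) r x =
  (\int[mu]_y ((k0 r x rho y * f y)%:E * crossing chain0 v s rho y) +
   (hit' (r - v)%R x)%:E * chain kL eL ((rho, f) :: s) v 0)%E.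
Proof.
move=> ts; apply: (crossing_cons (b := hit' ^~ x) ts) => //.
- move=> vr; rewrite /before/= vr/= -/(before v s); apply: eq_integral => y _.
  by congr ((killed _ _ _ * _)%:E * _)%E; ring.
- by move=> y; exact: k0_ge0.
- by apply: mk0; meas.
Qed.

Lemma crossing_ge0 C v r s x : (forall s, tests (r - v) s -> 0 <= C s (r - v)%R x)%E ->
  tests r s -> (0 <= crossing C v s r x)%E.
Proof.
move=> C0 ts; rewrite /crossing mule_ge0//; first by apply: C0; exact: tests_before.
exact: (chain_ge0 _ _ kL_ge0 eL_ge0 (tests_after v ts)).
Qed.

Lemma crossing_chain_ge0 v r s x : tests r s -> (0 <= crossing chain0 v s r x)%E.
Proof.
by apply: crossing_ge0 => s' ts; exact: (chain_ge0 _ _ k0_ge0 hit'_ge0 ts).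
Qed.

Lemma measurable_crossing r s d (T : measurableType d) (v x : T -> R) : tests r s ->
  meas_fun v -> meas_fun x ->
  meas_fun (fun a => crossing chain0 (v a) s r (x a)).
Proof.
elim: s r d T v x => [|[rho f] s IH] r d T v x ts mv mx.
  rewrite /crossing/=; apply: mfeM; apply: mfE; first by apply: mhit'; meas.
  by apply: meL; meas.
under eq_fun do rewrite crossing_chain_cons//.
move: ts => /= ts; have [rr mf f0 ts'] := ts.
apply: mfeD.
  apply: (measurable_int_param mu (fun a y =>
    (k0 r (x a) rho y * f y)%:E * crossing chain0 (v a) s rho y)%E).
    apply: mfeM.
      apply: mfE; apply: mfM; last by meas.
      by apply: mk0; meas; meas.
    by apply: IH => //; meas; meas.
  by move=> a y; rewrite mule_ge0 ?lee_fin ?mulr_ge0 ?k0_ge0 ?crossing_chain_ge0.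
apply: mfeM; first by apply: mfE; apply: mhit'; meas.
exact: (measurable_chain kL_ge0 mkL meL eL_ge0 (s := (rho, f) :: s) ts).
Qed.

(** Induction step shared by starts at [x > 0] and at 0: up to the first test, [a] is the kernel of
    staying positive, [aL] that of staying above the line, and [b] is the density of the first
    passage time through 0. *)
Lemma crossing_step r rho f s (a b aL : R -> R) :
  tests r ((rho, f) :: s) ->
  meas_fun a -> (forall y, 0 <= a y) -> (forall y, y <= 0 -> a y = 0) ->
  meas_fun b -> (forall y, 0 <= b y) ->
  (forall y, 0 < y -> chain kL eL s rho y =
    ((if c0 == 0%R then chain0 s rho y else 0) +
     \int[mu]_v crossing chain0 v s rho y)%E) ->
  (forall y, (aL y)%:E = (a y)%:E + \int[mu]_u (b u * kL (r - u) 0 rho y)%:E)%E ->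
  (\int[mu]_y ((aL y * f y)%:E * chain kL eL s rho y) =
   (if c0 == 0%R then \int[mu]_y ((a y * f y)%:E * chain0 s rho y) else 0) +
   \int[mu]_v (\int[mu]_y ((a y * f y)%:E * crossing chain0 v s rho y) +
     (b (r - v)%R)%:E * chain kL eL ((rho, f) :: s) v 0))%E.
Proof.
move=> /= ts ma a0 an mb b0 IH aLE; have [rr mf f0 ts'] := ts.
have C0 y : (0 <= chain kL eL s rho y)%E by exact: (chain_ge0 _ _ kL_ge0 eL_ge0 ts').
have K0 y : (0 <= chain0 s rho y)%E by exact: (chain_ge0 _ _ k0_ge0 hit'_ge0 ts').
have mC : meas_fun (fun y : R => chain kL eL s rho y).
  by apply: (measurable_chain kL_ge0 mkL meL eL_ge0 ts'); meas.
have mK : meas_fun (fun y : R => chain0 s rho y).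
  by apply: (measurable_chain k0_ge0 mk0 mhit' hit'_ge0 ts'); meas.
have maf : meas_fun (fun y : R => (a y * f y)%:E) by apply: mfE; exact: mfM.
have af0 y : (0 <= (a y * f y)%:E)%E by rewrite lee_fin mulr_ge0.
have mbk : meas_fun (fun z : R * R => b z.1 * kL (r - z.1) 0 rho z.2).
  by apply: mfM; [meas|apply: mkL; meas].
have bk0 y u : (0 <= (b u * kL (r - u) 0 rho y)%:E)%E by rewrite lee_fin mulr_ge0 ?kL_ge0.
have mbks y : meas_fun (fun u : R => (b u * kL (r - u) 0 rho y)%:E).
  by apply: mfE; apply: mfM => //; apply: mkL; meas.
pose J y : \bar R := (\int[mu]_u (b u * kL (r - u) 0 rho y)%:E)%E.
have J0 y : (0 <= J y)%E by exact: integral_ge0.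
have mJ : meas_fun J.
  apply: (measurable_int_param mu (fun y u => (b u * kL (r - u) 0 rho y)%:E)) => //.
  exact: (mfE (measurable_swap (f := fun u y => b u * kL (r - u) 0 rho y) mbk)).
transitivity (\int[mu]_y ((a y * f y)%:E * chain kL eL s rho y) +
  \int[mu]_y (J y * ((f y)%:E * chain kL eL s rho y)))%E.
  rewrite -ge0_integralD//; last 4 first.
  - by move=> y _; rewrite mule_ge0.
  - exact: mfeM.
  - by move=> y _; rewrite !mule_ge0 ?lee_fin.
  - by meas.
  apply: eq_integral => y _; rewrite EFinM aLE -/(J y) ge0_muleDl ?lee_fin//.
  by rewrite ge0_muleDl ?mule_ge0 ?lee_fin// EFinM muleA.
have -> : (\int[mu]_y (J y * ((f y)%:E * chain kL eL s rho y)) =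
    \int[mu]_v ((b (r - v)%R)%:E * chain kL eL ((rho, f) :: s) v 0))%E.
  transitivity (\int[mu]_y \int[mu]_u ((b u * kL (r - u) 0 rho y)%:E *
      ((f y)%:E * chain kL eL s rho y)))%E.
    apply: eq_integral => y _; rewrite ge0_integralZr//; first exact: mbks.
    by rewrite mule_ge0 ?lee_fin.
  rewrite tonelli; last 2 first.
  - apply: mfeM.
      exact: (mfE (measurable_swap (f := fun u y => b u * kL (r - u) 0 rho y) mbk)).
    by meas.
  - by move=> y u; rewrite mule_ge0 ?bk0// mule_ge0 ?lee_fin.
  transitivity (\int[mu]_u ((b u)%:E * chain kL eL ((rho, f) :: s) (r - u)%R 0))%E.
    apply: eq_integral => u _ /=; rewrite -ge0_integralZl ?lee_fin//.
    - by apply: eq_integral => y _; rewrite !EFinM !muleA.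
    - by apply: mfeM => //; apply: mfE; apply: mfM => //; apply: mkL; meas.
    - by move=> y _; rewrite mule_ge0// lee_fin mulr_ge0 ?kL_ge0.
  (* From the time [u] elapsed at the passage to the remaining time [v = r - u]. *)
  rewrite -[LHS](integral_reflect r).
  - by apply: eq_integral => u _; rewrite subKr.
  - apply: mfeM; first exact: mfE.
    by apply: (measurable_chain kL_ge0 mkL meL eL_ge0 (s := (rho, f) :: s) ts); meas.
  - move=> u; rewrite mule_ge0 ?lee_fin//.
    exact: (chain_ge0 (s := (rho, f) :: s) _ _ kL_ge0 eL_ge0 ts).
have mcr : meas_fun (fun z : R * R => crossing chain0 z.2 s rho z.1).
  by apply: measurable_crossing => //; meas.
have cr0 y v : (0 <= crossing chain0 v s rho y)%E by exact: crossing_chain_ge0.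
have -> : (\int[mu]_y ((a y * f y)%:E * chain kL eL s rho y) =
    (if c0 == 0%R then \int[mu]_y ((a y * f y)%:E * chain0 s rho y) else 0) +
    \int[mu]_v \int[mu]_y ((a y * f y)%:E * crossing chain0 v s rho y))%E.
  rewrite -(tonelli mu mu (fun y v => (a y * f y)%:E * crossing chain0 v s rho y)%E);
    last 2 first.
  - by meas.
  - by move=> y v; rewrite mule_ge0.
  have mI : meas_fun (fun y : R => \int[mu]_v crossing chain0 v s rho y)%E.
    by apply: (measurable_int_param mu (fun y v => crossing chain0 v s rho y)).
  transitivity (\int[mu]_y ((if c0 == 0%R then (a y * f y)%:E * chain0 s rho y else 0) +
      (a y * f y)%:E * \int[mu]_v crossing chain0 v s rho y))%E.
    apply: eq_integral => y _; have [y0|y0] := leP y 0.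
      by rewrite an// mul0r !mul0e adde0; case: ifP.
    rewrite IH// ge0_muleDr//; first by case: ifP => _; rewrite ?mule0.
    - by case: ifP.
    - exact: integral_ge0.
  rewrite ge0_integralD//; last 4 first.
  - by move=> y _; case: ifP => _; rewrite ?mule_ge0.
  - by meas.
  - by move=> y _; rewrite mule_ge0//; exact: integral_ge0.
  - exact: mfeM.
  congr (_ + _)%E; first by case: ifP => // _; rewrite integral0.
  apply: eq_integral => y _; rewrite ge0_integralZl//.
  by apply: measurable_crossing => //; meas.
rewrite -addeA; congr (_ + _)%E; rewrite -ge0_integralD//.
- by move=> v _; apply: integral_ge0 => y _; rewrite mule_ge0.
- apply: (measurable_int_param mu (fun v y =>
    (a y * f y)%:E * crossing chain0 v s rho y)%E); last by move=> v y; rewrite mule_ge0.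
  apply: mfeM; first by meas.
  by apply: measurable_crossing => //; meas.
- move=> v _; rewrite mule_ge0 ?lee_fin//.
  exact: (chain_ge0 (s := (rho, f) :: s) _ _ kL_ge0 eL_ge0 ts).
- apply: mfeM; first by apply: mfE; meas.
  by apply: (measurable_chain kL_ge0 mkL meL eL_ge0 (s := (rho, f) :: s) ts); meas.
Qed.

(* First passage decomposition: a path killed at the line and started at [x > 0] either stays
   positive or visits 0. *)
Lemma first_passage_chain r s x : tests r s -> 0 < r -> 0 < x -> 0 <= c0 -> 0 <= h r ->
  (forall v, 0 < v < r -> 0 < h v) ->
  (chain kL eL s r x = (if c0 == 0%R then chain0 s r x else 0) +
    \int[mu]_v crossing chain0 v s r x)%E.
Proof.
elim: s r x => [|[rho f] s IH] r x ts r0 x0 c00 hr hgt0.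
  rewrite /crossing/= end_first_passage//; congr (_ + _)%E; first by case: ifP.
  rewrite -[LHS](integral_reflect r).
  - apply: eq_integral => v _; rewrite -EFinM subKr; congr (_ * _)%:E.
    by rewrite hit'E.
  - by apply: mfE; apply: mfM; [heat_meas|apply: meL; meas].
  - by move=> u; rewrite lee_fin mulr_ge0 ?eL_ge0// hit_ge0// ltW.
move: (ts) => /= [/andP[rho0 rr] mf f0 ts'].
have hge0 v : rho <= v <= r -> 0 <= h v.
  move=> /andP[v1]; rewrite le_eqVlt => /predU1P[->//|v2].
  by apply/ltW/hgt0; rewrite v2 (lt_le_trans rho0).
rewrite (@crossing_step r rho f s (k0 r x rho) (hit' ^~ x))//; last 7 first.
- by apply: mk0; meas.
- by move=> y; exact: k0_ge0.
- by move=> y y0; exact: killed_npos.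
- by apply: mhit'; meas.
- by move=> y; exact: hit'_ge0.
- move=> y y0; apply: IH => //; first by rewrite hge0// lexx ltW.
  by move=> v /andP[v0 v1]; apply: hgt0; rewrite v0 (lt_trans v1).
- move=> y; rewrite (@kernel_first_passage r x rho y)//.
    by congr (_ + _)%E; apply: eq_integral => u _; rewrite hit'E.
  by move=> v /andP[v1 v2]; apply: hgt0; rewrite v2 (lt_trans rho0).
congr (_ + _)%E; apply: eq_integral => v _.
by rewrite crossing_chain_cons.
Qed.

(* The chain of a three-dimensional Bessel bridge to 0, up to the factor [x], which makes it
   continuous at [x = 0]. *)
Definition bessel s r x : \bar R :=
  if 0 < x then ((x^-1)%:E * chain0 s r x)%E else
  if s is (rho, f) :: s' then
    (\int[mu]_y ((2 * hit' (r - rho) y * f y)%:E * chain0 s' rho y))%E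
  else (heat r 0 / r)%:E.

Section line_through_start.
Variable r : R.
Hypotheses (r0 : 0 < r) (hr : h r = 0) (c1n : c1 < 0).

Let c0E : c0 = - c1 * r.
Proof. by have := hr; rewrite /h; lra. Qed.

Let hE v : h v = - c1 * (r - v).
Proof. by rewrite /h c0E; ring. Qed.

Let h_gt0 v : v < r -> 0 < h v.
Proof. by move=> vr; rewrite hE mulr_gt0 ?oppr_gt0// subr_gt0. Qed.

(** For a line through the starting point, [kernel_first_passage] at [x = 0] is trivial; this is its
    limit after division by [x]. The first passage density becomes [heat u 0 / u], whose singularity
    [integral_heat_defect] absorbs. *)
Lemma kernel_first_passage_start rho y : rho < r ->
  ((2 * hit' (r - rho) (y + h rho) * expR (- c1 * (y + h rho) - c1 ^+ 2 * (r - rho) / 2))%:E =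
   (2 * hit' (r - rho) y)%:E + \int[mu]_u (heat u 0 / u * kL (r - u) 0 rho y)%:E)%E.
Proof.
move=> rr; have t0 : 0 < r - rho by rewrite subr_gt0.
have hrho := h_gt0 rr; set t := r - rho in t0 *; set b := y + h rho.
have [b0|b0] := leP b 0.
  rewrite /hit' ltNge b0/= ltNge (le_trans _ b0) ?lerDl ?(ltW hrho)//= !(mulr0, mul0r) add0e.
  by rewrite integral0_eq// => u _; rewrite /kL killed_npos// mul0r mulr0.
have yE : y = b + c1 * t by rewrite /b hE /t; ring.
set B := b - c1 * t.
have ct : c1 * t < 0 by rewrite nmulr_rlt0.
have B0 : 0 < B by rewrite /B; lra.
have yB : `|y| <= B by rewrite ler_norml /B yE; lra.
have -> : (\int[mu]_u (heat u 0 / u * kL (r - u) 0 rho y)%:E = ((B - `|y|) / t * heat t y)%:E)%E.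
  rewrite -(integral_heat_defect t0 yB B0); apply: eq_integral => u _; congr EFin.
  have [u0|u0] := leP u 0; first by rewrite !(heat_le0 _ u0) !mul0r.
  have [ut|ut] := leP t u.
    have tu : t - u <= 0 by rewrite subr_le0.
    have ru : r - u - rho <= 0 by move: tu; rewrite /t; lra.
    by rewrite /kL killed_le0// !(heat_le0 _ tu) !(mul0r, mulr0) subrr mulr0.
  have ur : u < r - rho by [].
  rewrite kLE ?add0r//; last 2 first.
  - by lra.
  - by apply: h_gt0; lra.
  have -> : r - u - rho = t - u by rewrite /t; ring.
  rewrite heatN; congr (_ * (_ - expR _ * heat _ _)).
    by rewrite -/b /B yE; field; rewrite gt_eqF.
  by rewrite /B /b hE /t; ring.
rewrite hit'E// -EFinD; congr EFin; rewrite hitE.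
transitivity (2 * (b / t) * heat t y).
  have <- : heat t b * expR (- c1 * b - c1 ^+ 2 * t / 2) = heat t y.
    by have := heat_girsanov b (- c1) t0; rewrite sqrrN => ->; rewrite yE; congr (heat _ _); ring.
  by ring.
have [y0|y0] := leP y 0.
  rewrite /hit' ltNge y0/= mulr0 add0r ler0_norm//; congr (_ * _).
  by rewrite {1}yE /B; field; rewrite gt_eqF.
rewrite hit'E// hitE gtr0_norm// /B; move: (heat t y) => H.
by rewrite yE; field; rewrite gt_eqF.
Qed.

(** The corresponding limit of [end_first_passage]; here [c0 > 0], so there is no extra term. *)
Lemma end_first_passage_start :
  ((expR (- (c1 ^+ 2 * r / 2)) * (heat r 0 / r))%:E =
   \int[mu]_u (heat u 0 / u * eL (r - u) 0)%:E)%E.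
Proof.
have c00 : 0 < c0 by rewrite c0E mulr_gt0// oppr_gt0.
transitivity ((r^-1)%:E * \int[mu]_u (heat u 0 * hit (r - u) c0)%:E)%E.
  rewrite integral_heat_hit// addr0 -EFinM; congr EFin.
  by have := heat_girsanov 0 c1 r0; rewrite mulr0 !sub0r c0E mulNr => <-; ring.
rewrite -ge0_integralZl//; last 3 first.
- by heat_meas.
- by move=> u _; rewrite lee_fin mulr_ge0 ?heat_ge0// hit_ge0// ltW.
- by rewrite lee_fin invr_ge0 ltW.
apply: eq_integral => u _; rewrite -EFinM; congr EFin.
have [u0|u0] := leP u 0; first by rewrite (heat_le0 _ u0) !(mul0r, mulr0).
have [ur|ur] := leP r u.
  have ru : r - u <= 0 by rewrite subr_le0.
  by rewrite /eL /hit' !(hit_le0 _ ru) if_same !(mul0r, mulr0).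
have ru0 : 0 < r - u by rewrite subr_gt0.
rewrite eLE ?add0r//; last by apply: h_gt0; lra.
rewrite hE hitE {1}c0E subKr; move: (heat _ _) (heat _ _) => A C.
by field; rewrite !gt_eqF.
Qed.

(** The path ends on the line, at [- c0 < 0], so it must come back through 0: unlike in
    [first_passage_chain], there is no term without passage. On the left is the Bessel bridge
    lowered by the line, with the Girsanov factor of its start. *)
Lemma first_passage_bessel s : tests r s ->
  ((expR (- (c1 ^+ 2 * r / 2)))%:E * bessel (shift s) r 0 =
   \int[mu]_v crossing bessel v s r 0)%E.
Proof.
have c00 : 0 < c0 by rewrite c0E mulr_gt0// oppr_gt0.
have b00 u : 0 <= heat u 0 / u.
  have [u0|u0] := leP u 0; first by rewrite heat_le0// mul0r.
  by rewrite divr_ge0 ?heat_ge0// ltW.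
case: s => [_|[rho f] s ts].
  rewrite /crossing /bessel/= ltxx -EFinM end_first_passage_start.
  rewrite -[LHS](integral_reflect r).
  - by apply: eq_integral => v _; rewrite -EFinM subKr.
  - by apply: mfE; apply: mfM; [heat_meas|apply: meL; meas].
  - by move=> u; rewrite lee_fin mulr_ge0 ?eL_ge0.
move: (ts) => /= [/andP[rho0 rr] mf f0 ts'].
rewrite {1}/bessel ltxx /=.
rewrite (@shift_step rho f s (fun y => 2 * hit' (r - rho) y))//; last 4 first.
- by apply: mfM => //; apply: mhit'; meas.
- by move=> y; rewrite mulr_ge0 ?hit'_ge0.
- by move=> y y0; rewrite /hit' ltNge y0 mulr0.
- by move=> y yr; exact: (chain_shift yr ts').
have c0F : (c0 == 0) = false by rewrite gt_eqF.
pose aL y := 2 * hit' (r - rho) (y + h rho) * expR (- c1 * (y + h rho) - c1 ^+ 2 * (r - rho) / 2).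
transitivity (\int[mu]_y ((aL y * f y)%:E * chain kL eL s rho y))%E.
  apply: eq_integral => y _; congr (_%:E * _)%E; rewrite /aL.
  rewrite (_ : - c1 * (y + h rho) - c1 ^+ 2 * (r - rho) / 2 =
    - (c1 ^+ 2 * r / 2) + - (c1 * (y + h rho) - c1 ^+ 2 * rho / 2)); last by field.
  by rewrite expRD; ring.
rewrite (@crossing_step r rho f s (fun y => 2 * hit' (r - rho) y) (fun u => heat u 0 / u))//; last 6 first.
- by apply: mfM => //; apply: mhit'; meas.
- by move=> y; rewrite mulr_ge0 ?hit'_ge0.
- by move=> y y0; rewrite /hit' ltNge y0 mulr0.
- by heat_meas.
- move=> y y0; apply: first_passage_chain => //; first exact: ltW.
    by apply/ltW/h_gt0.
  by move=> v /andP[v0 v1]; apply: h_gt0; exact: lt_trans rr.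
- by move=> y; exact: kernel_first_passage_start.
rewrite c0F add0e; apply: eq_integral => v _; apply/esym.
apply: (crossing_cons (b := fun u => heat u 0 / u) ts) => //.
- move=> vr; rewrite /before/= vr/= -/(before v s) {1}/bessel ltxx; apply: eq_integral => y _.
  by congr ((2 * hit' _ _ * _)%:E * _)%E; ring.
- by rewrite /bessel ltxx.
- by move=> y; rewrite mulr_ge0 ?hit'_ge0.
- by apply: mfM => //; apply: mhit'; meas.
Qed.

End line_through_start.

End line_crossing.

End chains.

Local Notation chain0 := (chain k0 hit').

Transparent heat hit.

Lemma integral_probability_cst d (T : measurableType d) (R : realType)
  (P : probability T R) (c : R) : (\int[P]_t c%:E = c%:E)%E.
Proof. by rewrite integral_cst// [X in (_ * X)%E](probability_setT P) mule1. Qed.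

(** * Laws given by a density and a random element *)

Section weighted_laws.
Context {R : realType}.

Section one_law.
Context d1 d2 (T : measurableType d1) (X : measurableType d2).
Variables (nu : {measure set T -> \bar R}) (G : T -> R) (Z : T -> X).
Hypotheses (mG : meas_fun G) (G0 : forall t, 0 <= G t)
  (mZ : meas_fun Z).

Let Q t : {measure set X -> \bar R} := mscale (NngNum (G0 t)) (dirac (Z t)).

Let QE t A : Q t A = (G t * \1_A (Z t))%:E.
Proof. by rewrite /Q /mscale/= /dirac EFinM indicE. Qed.

Let mI A : measurable A -> meas_fun (fun t => \1_A (Z t) : R).
Proof.
by move=> mA; apply: (measurableT_comp (f := \1_A : X -> R) (g := Z)).
Qed.

Let mQ A : measurable A -> meas_fun (fun t => Q t A).
Proof. by move=> mA; under eq_fun do rewrite QE; apply: mfE; apply: mfM => //; exact: mI. Qed.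

(** Being a mixture of scaled Dirac masses, the law of [Z] under the density [G] is a measure by
    construction. *)
Definition weighted : {measure set X -> \bar R} := mixture nu mQ.

Lemma weightedE A : measurable A ->
  (weighted A = \int[nu]_t (G t * \1_A (Z t))%:E)%E.
Proof. by move=> mA; apply: eq_integral => t _; rewrite -QE. Qed.

Import HBNNSimple.

Let weighted_nnsfun (f : {nnsfun X >-> R}) :
  (\int[weighted]_x (f x)%:E = \int[nu]_t (G t * f (Z t))%:E)%E.
Proof.
have mf r : measurable (f @^-1` [set r]) by exact: measurable_funPTI.
under eq_integral do rewrite fimfunE -fsumEFin//.
rewrite ge0_integral_fsum//; last 2 first.
  - by move=> r; exact/measurable_EFinP/measurableT_comp.
  - by move=> r z _; rewrite EFinM nnfun_muleindic_ge0.
under [in RHS]eq_integral.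
  move=> t _; rewrite fimfunE EFinM -fsumEFin// ge0_mule_fsumr; last first.
    by move=> r; rewrite EFinM nnfun_muleindic_ge0.
  over.
rewrite /= ge0_integral_fsum//; last 2 first.
  - move=> r; apply: mfeM; first exact: mfE.
    by apply: mfE; apply: mfM => //; exact: mI.
  - move=> r t _; rewrite mule_ge0 ?lee_fin//.
    by have := nnfun_muleindic_ge0 f r (Z t); rewrite -EFinM lee_fin.
apply: eq_fsbigr => r _.
have [r0|r0] := leP 0 r; last first.
  rewrite preimage_nnfun0// !integral0_eq//.
    by move=> x _; rewrite indic0 mulr0.
  by move=> t _; rewrite indic0 mulr0 mule0.
under [in LHS]eq_integral do rewrite EFinM.
rewrite ge0_integralZl//; last by apply/measurable_EFinP.
rewrite integral_indic// setIT weightedE// -ge0_integralZl//.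
- by apply: eq_integral => t _; rewrite -!EFinM mulrCA.
- by apply: mfE; apply: mfM => //; exact: mI.
- by move=> t _; rewrite lee_fin mulr_ge0// indicE.
Qed.

Lemma integral_weighted (h : X -> \bar R) : meas_fun h ->
  (forall x, 0 <= h x)%E ->
  (\int[weighted]_x h x = \int[nu]_t ((G t)%:E * h (Z t)))%E.
Proof.
move=> mh h0; pose f_ := nnsfun_approx measurableT mh.
transitivity (limn (fun n => \int[weighted]_x (f_ n x)%:E))%E.
  rewrite -monotone_convergence//=.
  - by apply: eq_integral => x _; apply/esym/cvg_lim => //=; exact: cvg_nnsfun_approx.
  - by move=> n; exact/measurable_EFinP.
  - by move=> n x _; rewrite lee_fin.
  - by move=> x _ a b ab; rewrite lee_fin//; exact/lefP/nd_nnsfun_approx.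
under eq_fun do rewrite weighted_nnsfun.
rewrite -monotone_convergence//=.
- apply: eq_integral => t _.
  under eq_fun do rewrite EFinM.
  rewrite limeMl//; first by congr (_ * _)%E; apply/cvg_lim => //; exact: cvg_nnsfun_approx.
  apply/ereal_nondecreasing_is_cvgn => a b ab.
  by rewrite lee_fin//; exact/lefP/nd_nnsfun_approx.
- by move=> n; apply: mfE; apply: mfM => //; exact: measurableT_comp.
- by move=> n t _; rewrite lee_fin mulr_ge0.
- move=> t _ a b ab; rewrite lee_fin ler_wpM2l//.
  by have /lefP := nd_nnsfun_approx measurableT mh ab; exact.
Qed.

End one_law.

Lemma weighted_eq d1 d2 d3 (T1 : measurableType d1) (T2 : measurableType d2)
  (X : measurableType d3) (nu1 : {measure set T1 -> \bar R}) (nu2 : {measure set T2 -> \bar R})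
  (G1 : T1 -> R) (Z1 : T1 -> X) (G2 : T2 -> R) (Z2 : T2 -> X) (h : X -> \bar R) :
  meas_fun G1 -> (forall t, 0 <= G1 t) -> meas_fun Z1 ->
  meas_fun G2 -> (forall t, 0 <= G2 t) -> meas_fun Z2 ->
  (forall A, measurable A -> (\int[nu1]_t (G1 t * \1_A (Z1 t))%:E =
     \int[nu2]_t (G2 t * \1_A (Z2 t))%:E)%E) ->
  meas_fun h -> (forall x, 0 <= h x)%E ->
  (\int[nu1]_t ((G1 t)%:E * h (Z1 t)) = \int[nu2]_t ((G2 t)%:E * h (Z2 t)))%E.
Proof.
move=> mG1 G10 mZ1 mG2 G20 mZ2 E mh h0.
rewrite -(integral_weighted nu1 mG1 G10 mZ1 mh h0) -(integral_weighted nu2 mG2 G20 mZ2 mh h0).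
by apply: eq_measure_integral => A mA _; rewrite !weightedE// E.
Qed.

(** Both total masses are 1, so the constant in [1 + cos] can be subtracted and [cpath_trig_unique]
    applies. *)
Lemma weighted_cos_unique d1 d2 (T1 : measurableType d1) (T2 : measurableType d2)
  (nu1 : {measure set T1 -> \bar R}) (nu2 : {measure set T2 -> \bar R})
  (G1 : T1 -> R) (Z1 : T1 -> cpath R) (G2 : T2 -> R) (Z2 : T2 -> cpath R) :
  meas_fun G1 -> (forall t, 0 <= G1 t) -> meas_fun Z1 ->
  meas_fun G2 -> (forall t, 0 <= G2 t) -> meas_fun Z2 ->
  (\int[nu1]_t (G1 t)%:E = 1)%E -> (\int[nu2]_t (G2 t)%:E = 1)%E ->
  (forall s th, times01 s ->
     (\int[nu1]_t (G1 t * (1 + cos (lin s (Z1 t) + th)))%:E =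
      \int[nu2]_t (G2 t * (1 + cos (lin s (Z2 t) + th)))%:E)%E) ->
  forall A, measurable A -> (\int[nu1]_t (G1 t * \1_A (Z1 t))%:E =
     \int[nu2]_t (G2 t * \1_A (Z2 t))%:E)%E.
Proof.
move=> mG1 G10 mZ1 mG2 G20 mZ2 E1 E2 H A mA.
rewrite -(weightedE nu1 mG1 G10 mZ1 mA) -(weightedE nu2 mG2 G20 mZ2 mA).
set M1 := weighted _ _ _ _; set M2 := weighted _ _ _ _.
have M1T : M1 setT = 1%E.
  by rewrite weightedE// -E1; apply: eq_integral => t _; rewrite indicT mulr1.
have M2T : M2 setT = 1%E.
  by rewrite weightedE// -E2; apply: eq_integral => t _; rewrite indicT mulr1.
have cge0 z : 0 <= 1 + cos z :> R by rewrite -lerBlDl sub0r cos_geN1.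
apply: (cpath_trig_unique (m := M1) (m' := M2)) => //; rewrite ?M1T ?M2T ?ltry//.
move=> s th ts.
have mc : meas_fun (fun w : cpath R => (1 + cos (lin s w + th) : R)).
  by meas; exact: measurable_lin.
have icos (M : {measure set (cpath R) -> \bar R}) : M setT = 1%E ->
    (\int[M]_w (1 + cos (lin s w + th))%:E = 1 + \int[M]_w (cos (lin s w + th))%:E)%E.
  move=> MT.
  under eq_integral do rewrite EFinD.
  rewrite integralD//.
  - by rewrite integral_cst// mul1e; congr (_ + _)%E.
  - by apply: (@integrable01 _ _ R M (fun=> 1)) => //; rewrite ?MT ?ltry// => x; rewrite ler01 lexx.
  - have i1 : M.-integrable setT (EFin \o (fun=> 1)).
      by apply: (@integrable01 _ _ R M (fun=> 1)) => //; rewrite ?MT ?ltry// => x; rewrite ler01 lexx.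
    apply: le_integrable i1 => //; first by apply: mfE; meas; exact: measurable_lin.
    by move=> x _; rewrite lee_fin normr1 ler_norml cos_geN1 cos_le1.
have h0 (w : cpath R) : (0 <= (1 + cos (lin s w + th))%:E)%E by rewrite lee_fin.
have mh : meas_fun (fun w : cpath R => (1 + cos (lin s w + th))%:E) by exact: mfE.
have := H s th ts.
have e1 := integral_weighted nu1 mG1 G10 mZ1 mh h0.
have e2 := integral_weighted nu2 mG2 G20 mZ2 mh h0.
under [LHS]eq_integral do rewrite EFinM.
under [RHS]eq_integral do rewrite EFinM.
rewrite -e1 -e2 -/M1 -/M2 !icos// => h.
have := congr1 (fun z => z - 1)%E h.
by rewrite /= ![(1 + _)%E]addeC !addeK.
Qed.

End weighted_laws.

(** * Brownian bridges and their Markov property *)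

Section bridges.
Context {R : realType}.
Implicit Types (s : seq (R * R)) (w : cpath R).

Definition lin_mean (f : R -> R) s : R := \sum_(p <- s) p.1 * f p.2.
Definition lin_var (K : R -> R -> R) s : R := \sum_(p <- s) \sum_(q <- s) p.1 * q.1 * K p.2 q.2.

(** Existence of the bridge forces the sign. A negative variance has square root 0, and
    [normal_prob] with standard deviation 0 is the uniform law on [0, 1]; but a variable and its
    double cannot both be uniform on [0, 1]. *)
Lemma bridge_var_ge0 d (T : measurableType d) (P : probability T R) (a b l : R)
  (X : T -> cpath R) n (t c : 'I_n -> R) : brownian_bridge P a b l X ->
  (forall i, 0 <= t i <= l) ->
  0 <= \sum_i \sum_j c i * c j * (Num.min (t i) (t j) - t i * t j / l).
Proof.
move=> hB ht; set v := \sum_i _; rewrite leNgt; apply/negP => v0.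
have u01 (m : R) (U : set R) : measurable U -> normal_prob m (Num.sqrt v) U =
    lebesgue_measure (U `&` `[0, 1]%classic).
  move=> mU; rewrite /normal_prob ler0_sqrtr ?ltW// /normal_pdf eqxx.
  by rewrite integral_indic// setIC.
have h1 := hB n t c ht; have h2 := hB n t (fun i => 2 * c i) ht.
have v2 : \sum_i \sum_j 2 * c i * (2 * c j) * (Num.min (t i) (t j) - t i * t j / l) = 4 * v.
  rewrite /v mulr_sumr; apply: eq_bigr => i _; rewrite mulr_sumr; apply: eq_bigr => j _; ring.
have mU1 : measurable (`]2^-1, 1] : set R) by exact: measurable_itv.
have mU2 : measurable (`]1, 2] : set R) by exact: measurable_itv.
have := h1 _ mU1; rewrite -/v /gaussian_law lt_eqF// u01//.
have := h2 _ mU2; rewrite v2 /gaussian_law lt_eqF ?pmulr_rlt0//.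
have -> : Num.sqrt (4 * v) = Num.sqrt v.
  by rewrite !ler0_sqrtr// ?ltW// pmulr_rlt0.
rewrite u01//.
rewrite (_ : [set omega | _] = [set omega | (`]2^-1, 1]%classic : set R) (\sum_i c i * X omega (t i))]); last first.
  apply/seteqP; split => omega /=.
    under eq_bigr do rewrite -mulrA; rewrite -mulr_sumr !in_itv/= => /andP[? ?].
    by lra.
  rewrite !in_itv/= => /andP[? ?]; under eq_bigr do rewrite -mulrA; rewrite -mulr_sumr.
  by lra.
move=> -> .
rewrite (_ : `]1, 2] `&` `[0, 1] = set0)%classic; last first.
  apply/seteqP; split => x //=; rewrite !in_itv/= => -[/andP[h _] /andP[_ h']].
  by move: (lt_le_trans h h'); rewrite ltxx.
rewrite (_ : `]2^-1, 1] `&` `[0, 1] = `]2^-1, 1])%classic; last first.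
  apply/seteqP; split => x /=; rewrite !in_itv/=; first by case.
  by move=> /andP[h h']; split; rewrite ?h//; lra.
rewrite measure0 lebesgue_measure_itv/= lte_fin ifT; last by lra.
by rewrite -EFinB => /eqP; rewrite eqe; apply/negP; lra.
Qed.

Lemma bridge_cos d (T : measurableType d) (P : probability T R) (a b l : R)
  (X : T -> cpath R) s th : brownian_bridge P a b l X -> meas_fun X -> l <= 1 ->
  (forall p, p \in s -> 0 <= p.2 <= l) ->
  (\int[P]_omega (1 + cos (lin s (X omega) + th))%:E =
   (1 + cos (lin_mean (fun t => a + (b - a) * t / l) s + th) *
    expR (- (lin_var (fun t u => Num.min t u - t * u / l) s / 2)))%:E)%E.
Proof.
move=> hB mX l1 hs.
set m := lin_mean _ s; set v := lin_var _ s.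
pose t i := (tnth (in_tuple s) i).2; pose c i := (tnth (in_tuple s) i).1.
have ht i : 0 <= t i <= l by apply: hs; exact: mem_tnth.
have linE w : lin s w = \sum_i c i * w (t i) by rewrite /lin big_tnth.
have mE : m = \sum_i c i * (a + (b - a) * t i / l) by rewrite /m /lin_mean big_tnth.
have vE : v = \sum_i \sum_j c i * c j * (Num.min (t i) (t j) - t i * t j / l).
  by rewrite /v /lin_var big_tnth; apply: eq_bigr => i _; rewrite big_tnth.
have s01 : times01 s by move=> p /hs /andP[-> pl]; rewrite (le_trans pl).
have mY : meas_fun (fun om => lin s (X om)).
  by apply: (measurableT_comp (f := lin s)) => //; exact: measurable_lin.
have law U : measurable U -> P [set om | U (lin s (X om))] = gaussian_law m v U.
  by move=> mU; rewrite mE vE -hB//; congr (P _); apply/seteqP; split => om /=; rewrite linE.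
have mh : meas_fun (fun y : R => (1 + cos (y + th))%:E) by meas.
have h0 (y : R) : (0 <= (1 + cos (y + th))%:E)%E by rewrite lee_fin -lerBlDl sub0r cos_geN1.
have PE U : measurable U ->
    (\int[P]_om ((fun=> 1) om * \1_U (lin s (X om)))%:E = gaussian_law m v U)%E.
  move=> mU; rewrite -law//.
  transitivity (\int[P]_om (\1_[set om | U (lin s (X om))] om)%:E)%E.
    by apply: eq_integral => om _; rewrite mul1r.
  rewrite integral_indic// ?setIT//.
  by rewrite -[X in measurable X]setTI; exact: mY.
transitivity (\int[P]_om (((fun=> 1) om)%:E * (1 + cos (lin s (X om) + th))%:E))%E.
  by apply: eq_integral => om _; rewrite mul1e.
have : 0 <= v by rewrite vE; exact: bridge_var_ge0 hB ht.
rewrite le_eqVlt => /predU1P[v0|v0].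
  transitivity (\int[P]_om (((fun=> 1) om)%:E * (1 + cos (m + th))%:E))%E.
    apply: (@weighted_eq R _ _ _ T T R P P (fun=> 1) (fun om => lin s (X om)) (fun=> 1)
      (fun=> m) (fun y => (1 + cos (y + th))%:E)) => //.
    move=> U mU; rewrite PE// /gaussian_law -v0 eqxx.
    under eq_integral do rewrite mul1r.
    by rewrite integral_probability_cst diracE indicE.
  under eq_integral do rewrite mul1e.
  by rewrite integral_probability_cst -v0 mul0r oppr0 expR0 mulr1.
transitivity (\int[lebesgue_measure]_x ((heat v (x - m))%:E * (1 + cos (x + th))%:E))%E.
  apply: (@weighted_eq R _ _ _ T (measurableTypeR R) R P lebesgue_measure (fun=> 1) (fun om => lin s (X om))
    (fun x => heat v (x - m)) (fun x => x) (fun y => (1 + cos (y + th))%:E)) => //.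
  - by heat_meas.
  - by move=> x; exact: heat_ge0.
  - move=> U mU; rewrite PE// /gaussian_law gt_eqF// /normal_prob [LHS]integral_mkcond.
    apply: eq_integral => x _; rewrite patchE heat_normal// indicE.
    by case: ifPn => _; rewrite ?mulr1 ?mulr0.
have := integral_cos_heat v0 1 th m; rewrite mul1r expr1n mul1r => <-.
by apply: eq_integral => x _; rewrite -EFinM mulrC mul1r.
Qed.

Lemma lin_var_cat K s1 s2 : (forall p q, p \in s1 ++ s2 -> q \in s2 -> K p.2 q.2 = 0) ->
  (forall p q, p \in s2 -> q \in s1 ++ s2 -> K p.2 q.2 = 0) ->
  lin_var K (s1 ++ s2) = lin_var K s1.
Proof.
move=> h1 h2; rewrite /lin_var big_cat/= [X in _ + X]big_seq [X in _ + X]big1 ?addr0.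
  rewrite big_seq [RHS]big_seq; apply: eq_bigr => p ps.
  rewrite big_cat/= [X in _ + X]big_seq [X in _ + X]big1 ?addr0// => q qs.
  by rewrite h1 ?mulr0// mem_cat ps.
by move=> p ps; rewrite big_seq big1// => q qs; rewrite h2 ?mulr0.
Qed.

(* The bridge of length [l] from [x] to 0, built from a path [w] on [0, 1] which is first pinned
   at both ends. *)
Definition gam (x l : R) w : cpath R := to_cpath (fun t : R =>
  x * (1 - clip (t / l)) + Num.sqrt l *
  (w (clip (t / l)) - (1 - clip (t / l)) * w 0 - clip (t / l) * w 1)).

Lemma gamE x l w t : gam x l w t = x * (1 - clip (t / l)) + Num.sqrt l *
  (w (clip (t / l)) - (1 - clip (t / l)) * w 0 - clip (t / l) * w 1).
Proof.
rewrite /gam to_cpathE// => {}t.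
have cc : {for t, continuous (fun t : R => clip (t / l))}.
  apply: continuous_comp; last exact: continuous_clip.
  by apply: cvgM; [exact: cvg_id|exact: cvg_cst].
have c1 : {for t, continuous (fun t : R => 1 - clip (t / l))}.
  by apply: cvgB; [exact: cvg_cst|exact: cc].
apply: cvgD; first by apply: cvgM; [exact: cvg_cst|exact: c1].
apply: cvgM; first exact: cvg_cst.
apply: cvgB; last by apply: cvgM; [exact: cc|exact: cvg_cst].
apply: cvgB; last by apply: cvgM; [exact: c1|exact: cvg_cst].
exact: (cvg_comp _ _ cc (@continuous_path R w (clip (t / l)))).
Qed.

Lemma gam_start x l w : gam x l w 0 = x.
Proof. by rewrite gamE mul0r clip_lt0// subr0 mul0r subr0 !mul1r mulr1 subrr mulr0 addr0. Qed.

Lemma gam_end x l w t : 0 < l -> l <= t -> gam x l w t = 0.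
Proof.
move=> l0 lt; rewrite gamE clip_gt1 ?ler_pdivlMr ?mul1r// subrr !mulr0 mul0r subr0 add0r.
by rewrite subrr mulr0.
Qed.

Lemma measurable_gam d (T : measurableType d) (x l : T -> R) (w : T -> cpath R) :
  meas_fun x -> meas_fun l -> meas_fun w ->
  meas_fun (fun a => gam (x a) (l a) (w a)).
Proof.
move=> mx ml mw; apply: measurable_into_cpath => t _.
under eq_fun do rewrite gamE.
have mc : meas_fun (fun a => clip (t / l a)) by apply: measurable_clip; meas.
have mw' : meas_fun (fun a => w a (clip (t / l a))).
  by apply: measurable_eval => // a; exact: clip_itv.
have mw0 : meas_fun (fun a => w a 0).
  by apply: (measurable_eval (g := fun=> 0)) => // a; rewrite lexx ler01.
have mw1 : meas_fun (fun a => w a 1).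
  by apply: (measurable_eval (g := fun=> 1)) => // a; rewrite lexx ler01.
apply: mfD; first by apply: mfM => //; meas.
apply: mfM; first by meas.
by meas.
Qed.

Section gam_law.
Variables (beta : probability (cpath R) R).
Hypothesis hbeta : brownian_bridge beta 0 0 1 id.

Lemma gam_cos x l s th : 0 < l ->
  (\int[beta]_w (1 + cos (lin s (gam x l w) + th))%:E =
   (1 + cos (x * lin_mean (fun u => 1 - clip (u / l)) s + th) *
    expR (- (l * lin_var (fun u u' => Num.min (clip (u / l)) (clip (u' / l)) -
      clip (u / l) * clip (u' / l)) s / 2)))%:E)%E.
Proof.
move=> l0; set A := lin_mean _ s; set V := lin_var _ s.
pose r := Num.sqrt l; pose sg (u : R) := clip (u / l).
pose s1 := [seq (r * p.1, sg p.2) | p <- s].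
(* [s2] collects the pinning terms, at the times 0 and 1. The covariance of the bridge vanishes
   there, so they contribute neither to the mean nor to the variance. *)
pose s2 := [seq (- (r * p.1 * (1 - sg p.2)), 0 : R) | p <- s] ++
           [seq (- (r * p.1 * sg p.2), 1 : R) | p <- s].
have linE w : lin s (gam x l w) = lin (s1 ++ s2) w + x * A.
  rewrite !lin_cat /lin /A /lin_mean !big_map mulr_sumr -!big_split/=; apply: eq_bigr => p _.
  by rewrite gamE -/(sg _) -/r; ring.
have hs p : p \in s1 ++ s2 -> 0 <= p.2 <= 1.
  rewrite !mem_cat => /or3P[] /mapP[q _ ->]/=; rewrite ?lexx ?ler01//.
  exact: clip_itv.
have K2 p q : p \in s1 ++ s2 -> q \in s2 -> Num.min p.2 q.2 - p.2 * q.2 / 1 = 0.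
  move=> /hs /andP[p0 p1]; rewrite mem_cat => /orP[] /mapP[q' _ ->]/=.
    by rewrite min_r// mulr0 mul0r subrr.
  by rewrite min_l// mulr1 divr1 subrr.
have := bridge_cos (s := s1 ++ s2) (x * A + th) hbeta (@measurable_id _ _ _) (lexx 1) hs.
under [in X in X -> _]eq_integral do rewrite addrA -linE.
move=> ->; congr (1 + cos _ * expR _)%:E.
  rewrite (_ : lin_mean _ _ = 0) ?add0r//.
  by rewrite /lin_mean big1// => p _; rewrite oppr0 !mul0r addr0 mulr0.
rewrite lin_var_cat//; last first.
  by move=> p q ps qs; rewrite minC [p.2 * _]mulrC; exact: K2.
congr (- (_ / 2)); rewrite /lin_var big_map mulr_sumr; apply: eq_bigr => p _.
rewrite big_map mulr_sumr; apply: eq_bigr => q _ /=.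
rewrite divr1 -/(sg p.2) -/(sg q.2).
have lE : l = r ^+ 2 by rewrite sqr_sqrtr// ltW.
by rewrite {1}lE; ring.
Qed.

(** The value at the remaining time [rho] is Gaussian with mean [x rho / l] and variance
    [(l - rho) rho / l], and from there on the path is again a bridge to 0. Comparing characteristic
    functions is enough. *)
Lemma gam_markov x l rho (h : cpath R -> \bar R) : 0 < rho < l -> l <= 1 ->
  meas_fun h -> (forall w, 0 <= h w)%E ->
  (\int[beta]_w h (time_shift (l - rho) (gam x l w)) =
   \int[lebesgue_measure]_y ((heat ((l - rho) * rho / l) (y - x * rho / l))%:E *
     \int[beta]_w h (gam y rho w)))%E.
Proof.
move=> /andP[rho0 rl] l1 mh h0.
have l0 : 0 < l by exact: lt_trans rl.
set t := l - rho; set v := t * rho / l; set m := x * rho / l.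
have t0 : 0 < t by rewrite subr_gt0.
have v0 : 0 < v by rewrite divr_gt0 ?mulr_gt0.
pose Y := (measurableTypeR R * cpath R)%type.
pose nu : {measure set Y -> \bar R} := (@lebesgue_measure R \x beta)%E.
pose G (z : Y) := heat v ((z.1 : R) - m).
pose Z (z : Y) := gam z.1 rho z.2.
have mG : meas_fun G by rewrite /G; heat_meas.
have G0 z : 0 <= G z by exact: heat_ge0.
have mZ : meas_fun Z by apply: measurable_gam; meas.
have mZ1 : meas_fun (fun w => time_shift t (gam x l w)).
  apply: measurable_into_cpath => u u01; under eq_fun do rewrite time_shiftE gamE.
  have mc (c : R) : 0 <= c <= 1 -> meas_fun (fun w : cpath R => w c).
    by move=> hc; exact: measurable_ev.
  apply: mfD; first by meas.
  apply: mfM; first by meas.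
  apply: mfD; first (apply: mfD; first by apply: mc; exact: clip_itv);
    by apply: mfN; apply: mfM; [meas|apply: mc; rewrite ?lexx ?ler01].
have iter (f : Y -> \bar R) : meas_fun f -> (forall z, 0 <= f z)%E ->
    (\int[nu]_z f z = \int[lebesgue_measure]_y \int[beta]_w f (y, w))%E.
  by move=> mf f0; rewrite /nu fubini_tonelli1.
have hit1 : (\int[beta]_w h (time_shift t (gam x l w)) =
    \int[beta]_w (((fun=> 1) w)%:E * h (time_shift t (gam x l w))))%E.
  by apply: eq_integral => w _; rewrite mul1e.
rewrite hit1 (_ : (\int[lebesgue_measure]_y _)%E = (\int[nu]_z ((G z)%:E * h (Z z)))%E); last first.
  rewrite iter//.
  - apply: eq_integral => y _; rewrite /G/= ge0_integralZl//.
    + by meas.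
    + by rewrite lee_fin heat_ge0.
  - by meas.
  - by move=> z; rewrite mule_ge0 ?lee_fin.
apply: weighted_eq => //.
apply: weighted_cos_unique => //.
- exact: integral_probability_cst.
- rewrite iter; [|exact: mfE|by move=> z; rewrite lee_fin].
  rewrite -(integral_heat m v0); apply: eq_integral => y _ /=.
  by rewrite /G/= integral_probability_cst.
move=> s th s01.
have cge0 z : 0 <= 1 + cos z :> R by rewrite -lerBlDl sub0r cos_geN1.
have mcos : meas_fun (fun w : cpath R => 1 + cos (lin s w + th)).
  by meas; exact: measurable_lin.
rewrite iter; last 2 first.
- by apply: mfE; apply: mfM => //; apply: (measurableT_comp mcos).
- by move=> z; rewrite lee_fin mulr_ge0.
pose s' := [seq (p.1, t + p.2) | p <- s].
have ls' w : lin s (time_shift t (gam x l w)) = lin s' (gam x l w).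
  by rewrite /lin big_map; apply: eq_bigr => p _; rewrite time_shiftE.
under eq_integral do rewrite mul1r ls'.
rewrite gam_cos//; set A1 := lin_mean _ s'; set V1 := lin_var _ s'.
pose A2 := lin_mean (fun u => 1 - clip (u / rho)) s.
pose V2 := lin_var (fun u u' => Num.min (clip (u / rho)) (clip (u' / rho)) -
      clip (u / rho) * clip (u' / rho)) s.
pose e := expR (- (rho * V2 / 2)).
have sgE p : p \in s -> 1 - clip ((t + p.2) / l) = (1 - clip (p.2 / rho)) * (rho / l).
  move=> /s01 /andP[p0 _]; have [pr|pr] := leP p.2 rho.
    rewrite !clip_id; first by rewrite /t; field; rewrite !gt_eqF.
      by rewrite divr_ge0//= ?ler_pdivrMr ?mul1r// ltW.
    apply/andP; split; first by rewrite divr_ge0 ?(ltW l0)// addr_ge0// ltW.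
    by rewrite ler_pdivrMr// mul1r /t; lra.
  rewrite !clip_gt1 ?subrr ?mul0r// ler_pdivlMr// mul1r; first exact: ltW.
  by rewrite /t; lra.
have A12 : x * A1 = A2 * m.
  rewrite /A1 /A2 /lin_mean big_map mulr_sumr mulr_suml big_seq [RHS]big_seq.
  by apply: eq_bigr => p ps /=; rewrite sgE// /m; ring.
(* The covariance splits into that of the bridge of length [rho] and the part carried by the
   intermediate value. *)
have V12 : l * V1 = rho * V2 + A2 ^+ 2 * v.
  have -> : A2 ^+ 2 * v = \sum_(p <- s) \sum_(q <- s)
      p.1 * q.1 * ((1 - clip (p.2 / rho)) * (1 - clip (q.2 / rho)) * v).
    rewrite expr2 {1}/A2 /lin_mean !mulr_suml; apply: eq_bigr => p _.
    by rewrite /A2 /lin_mean mulr_sumr mulr_suml; apply: eq_bigr => q _; ring.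
  rewrite /V1 /V2 /lin_var big_map !mulr_sumr -big_split/=.
  rewrite big_seq [RHS]big_seq; apply: eq_bigr => p ps.
  rewrite big_map !mulr_sumr -big_split/= big_seq [RHS]big_seq; apply: eq_bigr => q qs.
  have e1 := sgE p ps; have e2 := sgE q qs => /=.
  set P1 := clip ((t + p.2) / l) in e1 *; set Q1 := clip ((t + q.2) / l) in e2 *.
  set P2 := clip (p.2 / rho) in e1 *; set Q2 := clip (q.2 / rho) in e2 *.
  have k0 : 0 <= rho / l by rewrite divr_ge0 ?ltW.
  have {e1} -> : P1 = 1 - (1 - P2) * (rho / l) by rewrite -e1; ring.
  have {e2} -> : Q1 = 1 - (1 - Q2) * (rho / l) by rewrite -e2; ring.
  have -> : Num.min (1 - (1 - P2) * (rho / l)) (1 - (1 - Q2) * (rho / l)) =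
      1 - (1 - Num.min P2 Q2) * (rho / l).
    have [pq|pq] := leP P2 Q2.
      by rewrite min_l// lerD2l lerN2 ler_wpM2r// lerD2l lerN2.
    by rewrite min_r// lerD2l lerN2 ler_wpM2r// lerD2l lerN2 ltW.
  by move: (Num.min P2 Q2) => M; rewrite /v /t; field; rewrite gt_eqF.
have E2 y : (\int[beta]_w (G (y, w) * (1 + cos (lin s (Z (y, w)) + th)))%:E =
    ((1 - e) * heat v (y - m) + e * ((1 + cos (A2 * y + th)) * heat v (y - m)))%:E)%E.
  under eq_integral do rewrite EFinM /G/=.
  rewrite ge0_integralZl//; last 2 first.
  - by apply: mfE; apply: (measurableT_comp mcos); apply: measurable_gam; meas.
  - by rewrite lee_fin heat_ge0.
  rewrite /Z/= gam_cos// -EFinM; congr EFin; rewrite -/A2 -/V2 -/e.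
  by rewrite [A2 * y]mulrC; ring.
under [RHS]eq_integral do rewrite E2.
rewrite (integral_lincomb _ _ _ _ _ _ (integral_heat m v0) (integral_cos_heat v0 A2 th m)).
- congr EFin; rewrite A12 V12 (_ : - ((rho * V2 + A2 ^+ 2 * v) / 2) =
    - (rho * V2 / 2) + - (A2 ^+ 2 * v / 2)); last by field.
  by rewrite expRD -/e; ring.
- by heat_meas.
- by heat_meas.
- by move=> y; exact: heat_ge0.
- by move=> y; rewrite mulr_ge0 ?heat_ge0.
Qed.

End gam_law.

End bridges.

(** * Chains of Brownian bridges and Gaussian weights *)

Section path_functionals.
Context {R : realType}.
Implicit Types (l r x y rho : R) (s : seq (R * (R -> R))) (w : cpath R).

Definition prodt l s w : R := \prod_(p <- s) p.2 (w (l - p.1)).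

Lemma prodt_nil l w : prodt l [::] w = 1.
Proof. exact: big_nil. Qed.

Lemma prodt_cons l p s w : prodt l (p :: s) w = p.2 (w (l - p.1)) * prodt l s w.
Proof. exact: big_cons. Qed.

Lemma prodt_cat l s1 s2 w : prodt l (s1 ++ s2) w = prodt l s1 w * prodt l s2 w.
Proof. exact: big_cat. Qed.

Lemma prodt_ge0 l r s w : tests r s -> 0 <= prodt l s w.
Proof.
elim: s r => [|[rho f] s IH] r; first by rewrite prodt_nil.
by move=> [_ _ f0 ts]; rewrite prodt_cons mulr_ge0//; exact: IH ts.
Qed.

Lemma measurable_prodt l r s d (T : measurableType d) (X : T -> cpath R) :
  r <= l <= 1 -> tests r s -> meas_fun X ->
  meas_fun (fun a => prodt l s (X a)).
Proof.
move=> /andP[+ l1]; elim: s r => [|[rho f] s IH] r rl.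
  by move=> _ _; under eq_fun do rewrite prodt_nil; exact: measurable_cst.
move=> [/andP[rho0 rr] mf f0 ts] mX; under eq_fun do rewrite prodt_cons /=.
apply: mfM; last by apply: IH ts mX; rewrite (le_trans (ltW rr)).
apply: (measurableT_comp mf); apply: (measurableT_comp (f := fun w : cpath R => w (l - rho))) => //.
by apply: measurable_ev; lra.
Qed.

Lemma prodt_test l s : l <= 1 -> tests l s ->
  meas_fun (fun w => (prodt l s w)%:E) /\ forall w, (0 <= (prodt l s w)%:E)%E.
Proof.
move=> l1 ts; split => [|w]; last by rewrite lee_fin (prodt_ge0 _ _ ts).
by apply: mfE; apply: measurable_prodt ts _; [rewrite lexx|meas].
Qed.

Definition kh r x rho y : R := heat (r - rho) (x - y).

Lemma kh_ge0 r x rho y : 0 <= kh r x rho y.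
Proof. exact: heat_ge0. Qed.

Lemma mkh : mker4 kh.
Proof. by move=> d T r x rho y mr mx mrho my; rewrite /kh; heat_meas. Qed.

Lemma mheat : mker2 (@heat R).
Proof. by move=> d T r x mr mx; heat_meas. Qed.

(** Bayes' formula: the density of the bridge at an intermediate time is the product of the two heat
    kernels over the total one. *)
Lemma heat_bridge l rho x y : 0 < rho < l ->
  heat l x * heat ((l - rho) * rho / l) (y - x * rho / l) = heat (l - rho) (x - y) * heat rho y.
Proof.
move=> /andP[rho0 rl]; have l0 : 0 < l by exact: lt_trans rl.
have t0 : 0 < l - rho by rewrite subr_gt0.
set t := l - rho in t0 *.
have -> : heat (t * rho / l) (y - x * rho / l) = (Num.sqrt (2 * pi))^-1 *
    ((Num.sqrt t)^-1 * (Num.sqrt rho)^-1 * Num.sqrt l) *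
    expR (- ((y - x * rho / l) ^+ 2 / (2 * (t * rho / l)))).
  rewrite /heat [Num.sqrt (t * rho / l)]sqrtrM ?mulr_ge0 ?(ltW t0) ?(ltW rho0)//.
  by rewrite [Num.sqrt (t * rho)]sqrtrM ?(ltW t0)// sqrtrV ?(ltW l0)// !invfM invrK !mulrA.
rewrite /heat.
have e : - (x ^+ 2 / (2 * l)) + - ((y - x * rho / l) ^+ 2 / (2 * (t * rho / l))) =
   - ((x - y) ^+ 2 / (2 * t)) + - (y ^+ 2 / (2 * rho)).
  by rewrite (_ : l = t + rho); [field|rewrite /t; ring]; rewrite !gt_eqF//= addr_gt0.
have := congr1 expR e; rewrite !expRD.
move: (expR _) (expR _) (expR _) (expR _) => e1 e2 e3 e4 ee.
have sl : Num.sqrt l != 0 by rewrite gt_eqF// sqrtr_gt0.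
transitivity ((Num.sqrt (2 * pi))^-1 * (Num.sqrt (2 * pi))^-1 * (Num.sqrt t)^-1 *
    (Num.sqrt rho)^-1 * ((Num.sqrt l)^-1 * Num.sqrt l) * (e4 * e3)); first by ring.
by rewrite ee mulVf//; ring.
Qed.

Section brownian.
Variables (beta : probability (cpath R) R).
Hypothesis hbeta : brownian_bridge beta 0 0 1 id.

Lemma gam_chain s l x : 0 < l <= 1 -> tests l s ->
  ((heat l x)%:E * \int[beta]_w (prodt l s (gam x l w))%:E = chain kh (@heat R) s l x)%E.
Proof.
elim: s l x => [|[rho f] s IH] l x /andP[l0 l1].
  by under eq_integral do rewrite prodt_nil; rewrite integral_probability_cst mule1.
move=> /= ts; have [/andP[rho0 rl] mf f0 ts'] := ts.
pose h w : \bar R := (f (w 0) * prodt rho s w)%:E.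
have rho1 : rho <= 1 by rewrite (le_trans (ltW rl)).
have mp : meas_fun (fun w : cpath R => prodt rho s w).
  by apply: measurable_prodt ts' _; [rewrite lexx|meas].
have mh : meas_fun h.
  apply: mfE; apply: mfM => //; apply: (measurableT_comp mf).
  by apply: measurable_ev; rewrite lexx ler01.
have p0 w : 0 <= prodt rho s w by exact: prodt_ge0 ts'.
have h0 w : (0 <= h w)%E by rewrite lee_fin mulr_ge0.
have rhol : 0 < rho < l by rewrite rho0 rl.
transitivity ((heat l x)%:E * \int[beta]_w h (time_shift (l - rho) (gam x l w)))%E.
  congr (_ * _)%E; apply: eq_integral => w _; rewrite /h prodt_cons/= time_shiftE addr0.
  congr (_ * _)%:E; apply: eq_bigr => p _; rewrite time_shiftE; congr (p.2 (gam x l w _)).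
  by ring.
rewrite (gam_markov hbeta x rhol l1 mh h0) -ge0_integralZl//; last 3 first.
- apply: mfeM; first by apply: mfE; heat_meas.
  apply: (measurable_int_param beta (fun y w => h (gam y rho w))).
    by apply: (measurableT_comp mh); apply: measurable_gam; meas.
  by move=> y w.
- by move=> y _; rewrite mule_ge0 ?lee_fin ?heat_ge0//; exact: integral_ge0.
- by rewrite lee_fin heat_ge0.
apply: eq_integral => y _; rewrite muleA -EFinM heat_bridge//.
rewrite -(IH rho y) ?rho0// muleA -EFinM.
have -> : (\int[beta]_w h (gam y rho w) = (f y)%:E * \int[beta]_w (prodt rho s (gam y rho w))%:E)%E.
  rewrite -ge0_integralZl ?lee_fin//.
  - by apply: eq_integral => w _; rewrite /h gam_start EFinM.
  - by apply: mfE; apply: (measurableT_comp mp); apply: measurable_gam; meas.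
  - by move=> w _; rewrite lee_fin.
by rewrite muleA -EFinM; congr (_%:E * _)%E; rewrite /kh; ring.
Qed.

(* Gaussian weights [exp (- a y^2)] keep the one-dimensional and the Bessel chains explicit: the
   latter is, up to [2 pi], the cube of the former. *)
Definition gweights (s : seq (R * R)) : seq (R * (R -> R)) :=
  [seq (p.1, fun y => expR (- (p.2 * y ^+ 2))) | p <- s].

(** Each step of the one-dimensional chain contributes a factor [D] by [heat_tilt]. In the killed
    chain the invariant function [x] is in addition contracted by [1/q = D^2], which makes the
    factor [D^3] and explains the cube. *)
Lemma gaussian_chains (s : seq (R * R)) r : tests r (gweights s) -> 0 < r ->
  (forall p, p \in s -> 0 <= p.2) ->
  exists C b : R, [/\ 0 < C, 0 <= b,
    forall x, chain kh (@heat R) (gweights s) r x = (C * expR (- (b * x ^+ 2)))%:E,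
    forall x, 0 < x -> chain0 (gweights s) r x =
      (2 * pi * C ^+ 3 * (x * expR (- (b * x ^+ 2))))%:E &
    bessel (gweights s) r 0 = (2 * pi * C ^+ 3)%:E].
Proof.
have pi0 : 0 < 2 * pi :> R by rewrite mulr_gt0 ?pi_gt0.
have sp0 : Num.sqrt (2 * pi) != 0 :> R by rewrite gt_eqF ?sqrtr_gt0.
elim: s r => [|[rho al] s IH] r /=.
  move=> _ r0 _; exists ((Num.sqrt (2 * pi))^-1 * (Num.sqrt r)^-1), (2 * r)^-1.
  have hE x : heat r x = (Num.sqrt (2 * pi))^-1 * (Num.sqrt r)^-1 * expR (- ((2 * r)^-1 * x ^+ 2)).
    by rewrite /heat [_^-1 * x ^+ 2]mulrC.
  have sr0 : Num.sqrt r != 0 by rewrite gt_eqF ?sqrtr_gt0.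
  have CE : 2 * pi * ((Num.sqrt (2 * pi))^-1 * (Num.sqrt r)^-1) ^+ 3 =
      (Num.sqrt (2 * pi))^-1 * (Num.sqrt r)^-1 / r.
    rewrite -{1}(sqr_sqrtr (ltW pi0)) -{3}(sqr_sqrtr (ltW r0)).
    by field; rewrite sp0 sr0.
  split.
  - by rewrite mulr_gt0// invr_gt0 ?sqrtr_gt0.
  - by rewrite invr_ge0 mulr_ge0// ltW.
  - by move=> x; rewrite hE.
  - by move=> x x0; rewrite /= hit'E// hitE hE CE; congr EFin; ring.
  - by rewrite /bessel ltxx /= hE expr0n/= mulr0 oppr0 expR0 mulr1 CE.
move=> [/andP[rho0 rr] mf f0 ts] r0 s0.
have [|C [b [C0 b0 h1 h2 _]]] := IH _ ts rho0.
  by move=> p ps; apply: s0; rewrite inE ps orbT.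
have al0 : 0 <= al by apply: (s0 (rho, al)); rewrite inE eqxx.
pose g := al + b; have g0 : 0 <= g by rewrite addr_ge0.
set t := r - rho; have t0 : 0 < t by rewrite subr_gt0.
pose q := 1 + 2 * g * t; have q0 : 0 < q by rewrite /q ltr_pwDl// !mulr_ge0// ltW.
pose v := t / q; have v0 : 0 < v by rewrite divr_gt0.
pose D := (Num.sqrt q)^-1; have D0 : 0 < D by rewrite invr_gt0 sqrtr_gt0.
have D2 : D ^+ 2 = q^-1 by rewrite exprVn sqr_sqrtr// ltW.
have expg y : expR (- (al * y ^+ 2)) * expR (- (b * y ^+ 2)) = expR (- (g * y ^+ 2)).
  by rewrite -expRD; congr expR; rewrite /g; ring.
have tilt x y : expR (- (g * y ^+ 2)) * heat t (y - x) =
    D * expR (- (g / q * x ^+ 2)) * heat v (y - x / q) by exact: heat_tilt.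
exists (C * D), (g / q); split.
- by rewrite mulr_gt0.
- by rewrite divr_ge0// ltW.
- move=> x; transitivity (\int[mu]_y ((C * D * expR (- (g / q * x ^+ 2)))%:E *
      (heat v (y - x / q))%:E))%E.
    apply: eq_integral => y _; rewrite h1 /kh -!EFinM heatBC; congr EFin.
    transitivity (C * (expR (- (al * y ^+ 2)) * expR (- (b * y ^+ 2)) * heat t (y - x))); first by ring.
    by rewrite expg tilt; ring.
  rewrite ge0_integralZl//.
  + by rewrite integral_heat// mule1.
  + by heat_meas.
  + by move=> y _; rewrite lee_fin heat_ge0.
  + by rewrite lee_fin !mulr_ge0 ?expR_ge0// ltW.
- move=> x x0; have m0 : 0 <= x / q by rewrite divr_ge0// ltW.
  set c := 2 * pi * C ^+ 3 * (D * expR (- (g / q * x ^+ 2))).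
  have c0 : 0 <= c by rewrite /c !mulr_ge0 ?exprn_ge0 ?expR_ge0 ?pi_ge0// ltW.
  transitivity (c%:E * \int[mu]_(y in `[0%R, +oo[)
      (y * (heat v (y - x / q) - heat v (y + x / q)))%:E)%E; last first.
    rewrite integral_killed_mean// -EFinM; congr EFin; rewrite /c exprMn.
    by rewrite -[D ^+ 3]/(D * (D * D)) -expr2 D2; ring.
  rewrite -ge0_integralZl//; last 2 first.
  + by apply: measurable_funTS; heat_meas.
  + move=> y; rewrite /= in_itv/= andbT => y0.
    by rewrite lee_fin mulr_ge0// subr_ge0 heat_subadd.
  rewrite (@integral_supp _ `[0, +oo[%classic)//; last first.
    move=> y /=; rewrite in_itv/= andbT => /negP; rewrite -ltNge => /ltW y0.
    by rewrite /k0 killed_npos// !mul0r mul0e.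
  apply: eq_integral => y; rewrite inE/= in_itv/= andbT le_eqVlt => /predU1P[<-|y0].
    by rewrite /k0 killed_npos// !mul0r mul0e mule0.
  rewrite h2// /k0 /killed x0 y0/= -/t -!EFinM; congr EFin.
  have t1 := tilt x y; have t2 := tilt (- x) y.
  rewrite opprK mulNr opprK sqrrN in t2.
  transitivity (2 * pi * C ^+ 3 * y * (expR (- (al * y ^+ 2)) * expR (- (b * y ^+ 2)) * heat t (y - x) -
    expR (- (al * y ^+ 2)) * expR (- (b * y ^+ 2)) * heat t (y + x))).
    by rewrite [heat t (x - y)]heatBC [x + y]addrC; ring.
  by rewrite expg t1 t2 /c; ring.
- set c := 2 * pi * C ^+ 3 * D / t.
  have c0 : 0 <= c by rewrite /c !mulr_ge0 ?invr_ge0 ?exprn_ge0 ?pi_ge0// ltW.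
  rewrite /bessel ltxx /=.
  transitivity (c%:E * \int[mu]_(y in `[0%R, +oo[) (2 * y ^+ 2 * heat v y)%:E)%E; last first.
    rewrite integral_half_variance// -EFinM; congr EFin; rewrite /c /v exprMn.
    by rewrite -[D ^+ 3]/(D * (D * D)) -expr2 D2; field; rewrite !gt_eqF.
  rewrite -ge0_integralZl//; last 2 first.
  + by apply: measurable_funTS; heat_meas.
  + by move=> y; rewrite /= in_itv/= andbT => y0; rewrite lee_fin !mulr_ge0 ?heat_ge0 ?sqr_ge0.
  rewrite (@integral_supp _ `[0, +oo[%classic)//; last first.
    move=> y /=; rewrite in_itv/= andbT => /negP; rewrite -ltNge => y0.
    by rewrite /hit' ltNge (ltW y0)/= mulr0 mul0r mul0e.
  apply: eq_integral => y; rewrite inE/= in_itv/= andbT le_eqVlt => /predU1P[<-|y0].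
    by rewrite /hit' ltxx mulr0 mul0r mul0e expr0n/= mulr0 mul0r mule0.
  rewrite h2// hit'E// hitE -/t -!EFinM; congr EFin.
  have t1 := tilt 0 y; rewrite mul0r !subr0 expr0n/= mulr0 oppr0 expR0 mulr1 in t1.
  transitivity (2 * pi * C ^+ 3 * y * (2 * y / t) *
    (expR (- (al * y ^+ 2)) * expR (- (b * y ^+ 2)) * heat t y)); first by ring.
  by rewrite expg t1 /c; ring.
Qed.

End brownian.
End path_functionals.

(** * Bessel bridges as norms of three bridges *)

Section bessel_law.
Context {R : realType}.
Implicit Types (l r x y rho v m : R) (s : seq (R * (R -> R))) (f : R -> R).

Lemma chain_killed_ge0 s r0 r x : tests r0 s -> (0 <= chain0 s r x)%E.
Proof. exact: (chain_ge0 _ _ k0_ge0 hit'_ge0). Qed.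

Lemma measurable_chain_killed s r0 d (T : measurableType d) (r x : T -> R) : tests r0 s ->
  meas_fun r -> meas_fun x ->
  meas_fun (fun a => chain0 s (r a) (x a)).
Proof. exact: (measurable_chain k0_ge0 mk0 mhit' hit'_ge0). Qed.

Lemma chain_killed_npos s r x : x <= 0 -> chain0 s r x = 0%E.
Proof.
move=> x0; case: s => [|[rho f] s] /=; first by rewrite /hit' ltNge x0.
by rewrite integral0_eq// => y _; rewrite /k0 killed_sym killed_npos// mul0r mul0e.
Qed.

Lemma tests_prefix s1 s2 r : tests r (s1 ++ s2) -> tests r s1.
Proof.
by elim: s1 r => //= -[rho f] s1 IH r [? ? ? ts]; split => //; exact: IH.
Qed.

Lemma tests_suffix s1 s2 v f r : tests r (s1 ++ (v, f) :: s2) ->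
  [/\ 0 < v < r, meas_fun f, forall y, 0 <= f y & tests v s2].
Proof.
elim: s1 r => [|[rho g] s1 IH] r //= [/andP[_ rr] _ _ ts].
by have [/andP[-> h] ? ? ?] := IH _ ts; split => //; exact: lt_trans rr.
Qed.

Lemma tests_replace s1 s2 v f (g : R -> R) r : tests r (s1 ++ (v, f) :: s2) ->
  meas_fun g -> (forall y, 0 <= g y) -> tests r (s1 ++ (v, g) :: s2).
Proof.
move=> + mg g0; elim: s1 r => [|[rho h] s1 IH] r /= [? ? ? ts]; split => //.
exact: IH.
Qed.

(** Weighted transition density to the value [m] at the remaining time [v]. *)
Definition chain_to v m s r x := chain k0 (fun r y => k0 r y v m) s r x.

Lemma chain_to_ge0 v m s r0 r x : tests r0 s -> (0 <= chain_to v m s r x)%E.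
Proof. exact: (chain_ge0 _ _ k0_ge0 (fun r y => k0_ge0 r y v m)). Qed.

Lemma measurable_chain_to v s r0 d (T : measurableType d) (m r x : T -> R) : tests r0 s ->
  meas_fun m -> meas_fun r -> meas_fun x ->
  meas_fun (fun a => chain_to v (m a) s (r a) (x a)).
Proof.
move=> ts mm mr mx.
apply: (measurable_chain_param (k := fun=> k0) (e := fun m r y => k0 r y v m)
  (fun=> k0_ge0) (fun m r y => k0_ge0 r y v m) _ _ ts mm mr mx) => *; first exact: mk0.
by apply: mk0.
Qed.

(** Chapman-Kolmogorov relation singling out the test at [v]. *)
Lemma chain_prefix s1 s2 v f r x : tests r (s1 ++ (v, f) :: s2) ->
  chain0 (s1 ++ (v, f) :: s2) r x =
  (\int[mu]_m (chain_to v m s1 r x * ((f m)%:E * chain0 s2 v m)))%E.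
Proof.
elim: s1 r x => [|[rho g] s1 IH] r x /= ts.
  by apply: eq_integral => m _; rewrite EFinM muleA.
have [rr mg g0 ts'] := ts; have ts1 := tests_prefix ts'.
have [vr mf f0 ts2] := tests_suffix ts'.
have mt : meas_fun (fun m : R => (f m)%:E * chain0 s2 v m)%E.
  by apply: mfeM; [exact: mfE|apply: (measurable_chain_killed ts2); meas].
have t0 m : (0 <= (f m)%:E * chain0 s2 v m)%E.
  by rewrite mule_ge0 ?lee_fin//; exact: chain_killed_ge0 ts2.
have kg0 y : (0 <= (k0 r x rho y * g y)%:E)%E by rewrite lee_fin mulr_ge0 ?k0_ge0.
have mkg : meas_fun (fun y : R => (k0 r x rho y * g y)%:E).
  by apply: mfE; apply: mfM => //; apply: mk0; meas.
transitivity (\int[mu]_y \int[mu]_m ((k0 r x rho y * g y)%:E *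
    (chain_to v m s1 rho y * ((f m)%:E * chain0 s2 v m))))%E.
  apply: eq_integral => y _; rewrite IH// ge0_integralZl//.
  - by apply: mfeM => //; apply: (measurable_chain_to _ ts1); meas.
  - by move=> m _; rewrite mule_ge0//; exact: chain_to_ge0 ts1.
rewrite (tonelli mu mu (fun y m => (k0 r x rho y * g y)%:E *
    (chain_to v m s1 rho y * ((f m)%:E * chain0 s2 v m)))%E); last 2 first.
- apply: mfeM; first by apply: (measurableT_comp mkg); meas.
  by apply: mfeM; [apply: (measurable_chain_to _ ts1)|apply: (measurableT_comp mt)]; meas.
- by move=> y m; rewrite mule_ge0// mule_ge0//; exact: chain_to_ge0 ts1.
apply: eq_integral => m _; rewrite -ge0_integralZr//.
- by apply: eq_integral => y _; rewrite muleA.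
- by apply: mfeM => //; apply: (measurable_chain_to _ ts1); meas.
- by move=> y _; rewrite mule_ge0//; exact: chain_to_ge0 ts1.
Qed.

Definition reflect_times c s : seq (R * (R -> R)) := [seq (c - p.1, p.2) | p <- s].

(* Time reversal, by symmetry of the killed heat kernel. *)
Lemma chain_reverse c v m s s' rho f : rho < c -> tests rho s -> tests (c - rho) s' ->
  meas_fun f -> (forall y, 0 <= f y) ->
  (\int[mu]_x (chain0 s' (c - rho)%R x * ((f x)%:E * chain_to v m s rho x)) =
   chain0 (catrev (reflect_times c s) (((c - rho)%R, f) :: s')) (c - v)%R m)%E.
Proof.
elim: s s' rho f => [|[rho' f'] s IH] s' rho f rc ts ts' mf f0 /=.
  apply: eq_integral => x _; rewrite muleA muleC /chain_to/= EFinM muleA.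
  rewrite muleAC; congr (_%:E * _ * _)%E.
  by rewrite /k0 killed_sym; congr killed; ring.
have [/andP[r0 rr] mf' f0' ts2] := ts.
rewrite -(IH _ rho') ?(lt_trans rr)//; last first.
  by split => //; lra.
have mC : meas_fun (fun x : R => chain0 s' (c - rho) x).
  by apply: (measurable_chain_killed ts'); meas.
have C0 x : (0 <= chain0 s' (c - rho)%R x)%E by exact: chain_killed_ge0 ts'.
have mT : meas_fun (fun y : R => (f' y)%:E * chain_to v m s rho' y)%E.
  by apply: mfeM; [exact: mfE|apply: (measurable_chain_to _ ts2); meas].
have T0 y : (0 <= (f' y)%:E * chain_to v m s rho' y)%E.
  by rewrite mule_ge0 ?lee_fin//; exact: chain_to_ge0 ts2.
have mk : meas_fun (fun z : R * R => (k0 rho z.1 rho' z.2 * f z.1)%:E).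
  apply: mfE; apply: mfM; first by apply: mk0; meas.
  by meas.
have kk0 x y : (0 <= (k0 rho x rho' y * f x)%:E)%E by rewrite lee_fin mulr_ge0 ?k0_ge0.
have mkx x : meas_fun (fun y : R => (k0 rho x rho' y * f x)%:E).
  by apply: (measurableT_comp (f := fun z : R * R => (k0 rho z.1 rho' z.2 * f z.1)%:E)
    (g := fun y => (x, y)) mk); meas.
have mky y : meas_fun (fun x : R => (k0 rho x rho' y * f x)%:E).
  by apply: (measurableT_comp (f := fun z : R * R => (k0 rho z.1 rho' z.2 * f z.1)%:E)
    (g := fun x => (x, y)) mk); meas.
transitivity (\int[mu]_x \int[mu]_y (chain0 s' (c - rho)%R x *
    ((k0 rho x rho' y * f x)%:E * ((f' y)%:E * chain_to v m s rho' y))))%E.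
  apply: eq_integral => x _; rewrite ge0_integralZl//; last 2 first.
  - by apply: mfeM => //; exact: mkx.
  - by move=> y _; rewrite mule_ge0.
  congr (_ * _)%E; rewrite /chain_to/= -ge0_integralZl ?lee_fin//; last 2 first.
  - apply: mfeM; first by apply: mfE; apply: mfM => //; apply: mk0; meas.
    by apply: (measurable_chain_to _ ts2); meas.
  - by move=> y _; rewrite mule_ge0 ?lee_fin ?mulr_ge0 ?k0_ge0//; exact: chain_to_ge0 ts2.
  apply: eq_integral => y _; rewrite !EFinM !muleA; congr (_ * _ * _)%E.
  by rewrite muleC.
rewrite (tonelli mu mu (fun x y => chain0 s' (c - rho)%R x *
    ((k0 rho x rho' y * f x)%:E * ((f' y)%:E * chain_to v m s rho' y)))%E); last 2 first.
- apply: mfeM; first by apply: (measurableT_comp mC); meas.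
  by apply: mfeM => //; apply: (measurableT_comp mT); meas.
- by move=> x y; rewrite mule_ge0// mule_ge0.
apply: eq_integral => y _.
transitivity (\int[mu]_x ((k0 rho x rho' y * f x)%:E * chain0 s' (c - rho)%R x *
  ((f' y)%:E * chain_to v m s rho' y)))%E.
  by apply: eq_integral => x _; rewrite muleA [X in (X * _)%E]muleC.
rewrite [LHS]ge0_integralZr; last 4 first.
- exact: measurableT.
- by apply: mfeM; [exact: mky|exact: mC].
- by move=> x _; rewrite mule_ge0.
- exact: T0.
suff -> : chain0 (((c - rho)%R, f) :: s') (c - rho')%R y =
    (\int[mu]_x ((k0 rho x rho' y * f x)%:E * chain0 s' (c - rho)%R x))%E by [].
apply: eq_integral => x _; rewrite (_ : k0 (c - rho') y (c - rho) x = k0 rho x rho' y)//.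
by rewrite /k0 killed_sym; congr killed; ring.
Qed.

Fixpoint le1 s : Prop := if s is p :: s' then (forall y, p.2 y <= 1) /\ le1 s' else True.

Lemma le1_cat s1 s2 : le1 (s1 ++ s2) <-> le1 s1 /\ le1 s2.
Proof. by elim: s1 => [|p s1 IH] /=; [tauto|rewrite IH; tauto]. Qed.

Lemma le1_filter (b : pred (R * (R -> R))) s : le1 s -> le1 (seq.filter b s).
Proof. by elim: s => //= p s IH [h /IH]; case: ifP. Qed.

Lemma le1_map (F : R * (R -> R) -> R * (R -> R)) s :
  (forall p, (forall y, p.2 y <= 1) -> forall y, (F p).2 y <= 1) -> le1 s -> le1 (map F s).
Proof. by move=> hF; elim: s => //= p s IH [h /IH]; split => //; exact: hF. Qed.

Lemma le1_catrev s1 s2 : le1 s1 -> le1 s2 -> le1 (catrev s1 s2).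
Proof. by elim: s1 s2 => //= p s1 IH s2 [h1 h2] h3; exact: IH. Qed.

Lemma le1_gweights (gs : seq (R * R)) : (forall p, p \in gs -> 0 <= p.2) -> le1 (gweights gs).
Proof.
elim: gs => //= p gs IH gs0; split; last first.
  by apply: IH => q qs; apply: gs0; rewrite inE qs orbT.
by move=> y; rewrite -expR0 ler_expR oppr_le0 mulr_ge0 ?sqr_ge0// gs0 ?mem_head.
Qed.

Lemma prodt_le1 l r s (w : cpath R) : tests r s -> le1 s -> prodt l s w <= 1.
Proof.
elim: s r => [|[rho f] s IH] r; first by rewrite prodt_nil.
move=> [_ _ f0 ts] [f1 hs]; rewrite prodt_cons mulr_ile1//; last exact: IH ts hs.
exact: prodt_ge0 ts.
Qed.

(** First kernel of a Bessel chain; its value at [x = 0] is the limit of [k0 r x rho y / x]. *)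
Definition bessel_start r x rho y : R := if 0 < x then x^-1 * k0 r x rho y else 2 * hit' (r - rho) y.

Lemma bessel_start_ge0 r x rho y : 0 <= bessel_start r x rho y.
Proof.
rewrite /bessel_start; case: ifP => x0; first by rewrite mulr_ge0 ?k0_ge0// invr_ge0 ltW.
by rewrite mulr_ge0 ?hit'_ge0.
Qed.

Lemma measurable_bessel_start r x rho : meas_fun (bessel_start r x rho).
Proof.
rewrite /bessel_start; case: (0 < x); first by apply: mfM => //; apply: mk0; meas.
by apply: mfM => //; apply: mhit'; meas.
Qed.

Lemma bessel_cons rho f s r x : tests r ((rho, f) :: s) -> bessel ((rho, f) :: s) r x =
  (\int[mu]_y ((bessel_start r x rho y * f y)%:E * chain0 s rho y))%E.
Proof.
move=> /= [_ mf f0 ts]; rewrite /bessel /bessel_start; case: ifP => // x0.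
rewrite -ge0_integralZl//.
- by apply: eq_integral => y _; rewrite muleA -EFinM mulrA.
- apply: mfeM; last by apply: (measurable_chain_killed ts); meas.
  by apply: mfE; apply: mfM => //; apply: mk0; meas.
- move=> y _; rewrite mule_ge0 ?lee_fin ?mulr_ge0 ?k0_ge0//.
  exact: chain_killed_ge0 ts.
- by rewrite lee_fin invr_ge0 ltW.
Qed.

Lemma bessel_ge0 s r x : 0 <= r -> tests r s -> (0 <= bessel s r x)%E.
Proof.
case: s => [|[rho f] s] r0 ts.
  rewrite /bessel/=; case: ifP => x0; last by rewrite lee_fin divr_ge0 ?heat_ge0.
  by rewrite mule_ge0 ?lee_fin ?hit'_ge0// invr_ge0 ltW.
rewrite bessel_cons//; move: ts => /= [_ _ f0 ts]; apply: integral_ge0 => y _.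
rewrite mule_ge0 ?lee_fin ?mulr_ge0 ?bessel_start_ge0//.
exact: chain_killed_ge0 ts.
Qed.

(** The density [D] does not depend on [f], which is what replacing one weight at a time by means of
    Laplace transforms requires. *)
Lemma bessel_prefix s1 s2 v r x : tests r (s1 ++ (v, fun=> 1) :: s2) ->
  exists D : R -> \bar R, [/\ meas_fun D, forall y, (0 <= D y)%E,
    forall y, y <= 0 -> D y = 0%E &
    forall f, meas_fun f -> (forall y, 0 <= f y) ->
      (bessel (s1 ++ (v, f) :: s2) r x = \int[mu]_y (D y * (f y)%:E))%E].
Proof.
move=> ts; have [vr _ _ ts2] := tests_suffix ts.
have mC : meas_fun (fun y : R => chain0 s2 v y).
  by apply: (measurable_chain_killed ts2); meas.
have C0 y : (0 <= chain0 s2 v y)%E by exact: chain_killed_ge0 ts2.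
case: s1 ts => [|[rho g] s1] ts.
  exists (fun y => (bessel_start r x v y)%:E * chain0 s2 v y)%E; split.
  - by apply: mfeM => //; apply: mfE; exact: measurable_bessel_start.
  - by move=> y; rewrite mule_ge0 ?lee_fin ?bessel_start_ge0.
  - by move=> y y0; rewrite chain_killed_npos// mule0.
  - move=> f mf f0; rewrite bessel_cons//.
    by apply: eq_integral => y _; rewrite EFinM muleAC.
move: (ts) => /= [rr mg g0 ts']; have ts1 := tests_prefix ts'.
pose B y := (bessel_start r x rho y * g y)%:E.
have B0 y : (0 <= B y)%E by rewrite lee_fin mulr_ge0 ?bessel_start_ge0.
have mB : meas_fun B by apply: mfE; apply: mfM => //; exact: measurable_bessel_start.
pose J y : \bar R := (\int[mu]_z (B z * chain_to v y s1 rho z))%E.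
have J0 y : (0 <= J y)%E.
  by apply: integral_ge0 => z _; rewrite mule_ge0//; exact: chain_to_ge0 ts1.
have mJ : meas_fun J.
  apply: (measurable_int_param mu (fun y z => B z * chain_to v y s1 rho z)%E).
    by apply: mfeM; [apply: (measurableT_comp mB)|apply: (measurable_chain_to _ ts1)]; meas.
  by move=> y z; rewrite mule_ge0//; exact: chain_to_ge0 ts1.
exists (fun y => J y * chain0 s2 v y)%E; split.
- exact: mfeM.
- by move=> y; rewrite mule_ge0.
- by move=> y y0; rewrite chain_killed_npos// mule0.
move=> f mf f0; have tsf := tests_replace ts' mf f0.
rewrite /= bessel_cons//.
have mt : meas_fun (fun y : R => (f y)%:E * chain0 s2 v y)%E.
  by meas.
have t0 y : (0 <= (f y)%:E * chain0 s2 v y)%E by rewrite mule_ge0 ?lee_fin.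
transitivity (\int[mu]_z \int[mu]_y (B z *
    (chain_to v y s1 rho z * ((f y)%:E * chain0 s2 v y))))%E.
  apply: eq_integral => z _; rewrite chain_prefix// -ge0_integralZl//.
  - by apply: mfeM => //; apply: (measurable_chain_to _ ts1); meas.
  - by move=> y _; rewrite mule_ge0//; exact: chain_to_ge0 ts1.
  - exact: B0.
rewrite (tonelli mu mu (fun z y => B z *
    (chain_to v y s1 rho z * ((f y)%:E * chain0 s2 v y)))%E); last 2 first.
- apply: mfeM; first by apply: (measurableT_comp mB); meas.
  by apply: mfeM; [apply: (measurable_chain_to _ ts1)|apply: (measurableT_comp mt)]; meas.
- by move=> z y; rewrite mule_ge0// mule_ge0//; exact: chain_to_ge0 ts1.
apply: eq_integral => y _; rewrite -muleA [X in (_ = _ * X)%E]muleC -ge0_integralZr//.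
- by apply: eq_integral => z _; rewrite muleA.
- by apply: mfeM => //; apply: (measurable_chain_to _ ts1); meas.
- by move=> z _; rewrite mule_ge0//; exact: chain_to_ge0 ts1.
Qed.

Section three_bridges.
Variables (beta : probability (cpath R) R).
Hypothesis hbeta : brownian_bridge beta 0 0 1 id.

Definition paths3 := (cpath R * cpath R * cpath R)%type.

Definition beta2 : probability (cpath R * cpath R)%type R := (beta \x beta)%E.
Definition beta3 : probability paths3 R := (beta2 \x beta)%E.

Lemma integral_beta3 (f : paths3 -> \bar R) : meas_fun f -> (forall w, 0 <= f w)%E ->
  (\int[beta3]_w f w = \int[beta]_a \int[beta]_b \int[beta]_c f (a, b, c))%E.
Proof.
move=> mf f0; pose F (z : cpath R * cpath R) : \bar R := (\int[beta]_c f (z, c))%E.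
have F0 z : (0 <= F z)%E by apply: integral_ge0 => c _; exact: f0.
have mF : meas_fun F.
  apply: (measurable_int_param beta (fun w c => f (w, c))) => //.
  by meas.
rewrite [LHS](@fubini_tonelli1 _ _ _ _ R beta2 beta f mf f0).
exact: (@fubini_tonelli1 _ _ _ _ R beta beta F mF F0).
Qed.

Definition bes x l (w : paths3) : cpath R := norm3 (gam x l w.1.1, gam 0 l w.1.2, gam 0 l w.2).

Lemma besE x l w t : bes x l w t =
  Num.sqrt (gam x l w.1.1 t ^+ 2 + gam 0 l w.1.2 t ^+ 2 + gam 0 l w.2 t ^+ 2).
Proof. exact: norm3E. Qed.

Lemma bes_ge0 x l w t : 0 <= bes x l w t.
Proof. by rewrite besE. Qed.

Lemma bes_start x l w : 0 <= x -> bes x l w 0 = x.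
Proof. by move=> x0; rewrite besE !gam_start expr0n/= !addr0 sqrtr_sqr ger0_norm. Qed.

Lemma bes_end x l w t : 0 < l -> l <= t -> bes x l w t = 0.
Proof. by move=> l0 lt; rewrite besE !gam_end// expr0n/= !addr0 sqrtr0. Qed.

Lemma measurable_norm3 : meas_fun (@norm3 R).
Proof.
apply: measurable_into_cpath => t t01.
rewrite (_ : (fun w : paths3 => norm3 w t) = (fun w => Num.sqrt
  (w.1.1 t ^+ 2 + w.1.2 t ^+ 2 + w.2 t ^+ 2))); last by apply/funext => w; exact: norm3E.
have m (f : paths3 -> cpath R) : meas_fun f -> meas_fun (fun w => f w t).
  by move=> mf; apply: (measurableT_comp (measurable_ev t01) mf).
meas; [apply: (m (fun w => w.1.1))|apply: (m (fun w => w.1.2))|apply: (m (fun w => w.2))]; meas.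
Qed.

Lemma measurable_bes d (T : measurableType d) (x l : T -> R) (w : T -> paths3) :
  meas_fun x -> meas_fun l -> meas_fun w ->
  meas_fun (fun a => bes (x a) (l a) (w a)).
Proof.
move=> mx ml mw; apply: (measurableT_comp measurable_norm3).
by meas; apply: measurable_gam; meas.
Qed.

Lemma sqr_heat0 l : 0 < l -> heat l 0 ^+ 2 = (2 * pi * l)^-1.
Proof.
move=> l0; rewrite /heat expr0n/= mul0r oppr0 expR0 mulr1 exprMn !exprVn.
by rewrite !sqr_sqrtr ?mulr_ge0 ?pi_ge0 ?(ltW l0)// -invfM.
Qed.

Lemma tests_gweights_prodt l (gs : seq (R * R)) (w : paths3) x :
  prodt l (gweights gs) (bes x l w) = prodt l (gweights gs) (gam x l w.1.1) *
   (prodt l (gweights gs) (gam 0 l w.1.2) * prodt l (gweights gs) (gam 0 l w.2)).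
Proof.
elim: gs => [|p gs IH] /=; first by rewrite !prodt_nil !mul1r.
rewrite !prodt_cons/= IH besE sqr_sqrtr ?addr_ge0 ?sqr_ge0// !mulrDr !opprD !expRD.
move: (prodt _ _ _) (prodt _ _ _) (prodt _ _ _) => p1 p2 p3.
by move: (expR _) (expR _) (expR _) => e1 e2 e3; ring.
Qed.

(** A Gaussian weight of the norm is the product of the Gaussian weights of the three coordinates,
    so the three means multiply to the cube of [gaussian_chains]. *)
Lemma bes_gaussian (gs : seq (R * R)) l x : 0 < l <= 1 -> 0 <= x -> tests l (gweights gs) ->
  (forall p, p \in gs -> 0 <= p.2) ->
  ((heat l x / l)%:E * \int[beta3]_w (prodt l (gweights gs) (bes x l w))%:E =
   bessel (gweights gs) l x)%E.
Proof.
move=> /andP[l0 l1] x0 ts gs0.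
have [C [b [C0 b0 h1 h2 h3]]] := gaussian_chains ts l0 gs0.
have mean y : (\int[beta]_w (prodt l (gweights gs) (gam y l w))%:E =
    (C * expR (- (b * y ^+ 2)) / heat l y)%:E)%E.
  have := gam_chain hbeta y (introT andP (conj l0 l1)) ts; rewrite h1 => e.
  have hy : heat l y != 0 by rewrite gt_eqF ?heat_gt0.
  by rewrite mulrC EFinM -e muleA -EFinM mulVf// mul1e.
have p0 w : 0 <= prodt l (gweights gs) w by exact: prodt_ge0 ts.
have mp y : meas_fun (fun w : cpath R => (prodt l (gweights gs) (gam y l w))%:E).
  apply: mfE; apply: measurable_prodt ts _; first by rewrite lexx.
  by apply: measurable_gam; meas.
rewrite integral_beta3; last 2 first.
- apply: mfE; apply: measurable_prodt ts _; first by rewrite lexx.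
  by apply: measurable_bes; meas.
- by move=> w; rewrite lee_fin.
have mean0 := mean 0; set c0 := C * expR (- (b * 0 ^+ 2)) / heat l 0 in mean0.
have c00 : 0 <= c0 by rewrite divr_ge0 ?heat_ge0// mulr_ge0 ?expR_ge0// ltW.
have E a c : (\int[beta]_z (prodt l (gweights gs) (bes x l (a, c, z)))%:E =
    (prodt l (gweights gs) (gam x l a))%:E * ((prodt l (gweights gs) (gam 0 l c))%:E * c0%:E))%E.
  rewrite -mean0 muleA -EFinM -ge0_integralZl//; last 3 first.
  - exact: mp.
  - by move=> z _; rewrite lee_fin.
  - by rewrite lee_fin mulr_ge0.
  by apply: eq_integral => z _; rewrite tests_gweights_prodt/= mulrA.
under eq_integral => a _ do under eq_integral => c _ do rewrite E.
have E2 a : (\int[beta]_c ((prodt l (gweights gs) (gam x l a))%:E * ((prodt l (gweights gs) (gam 0 l c))%:E *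
    c0%:E)) = (prodt l (gweights gs) (gam x l a))%:E * (c0 * c0)%:E)%E.
  rewrite [in RHS]EFinM -{2}mean0 ge0_integralZl ?lee_fin//.
  - congr (_ * _)%E; apply: ge0_integralZr => //; first exact: mp.
    by move=> z _; rewrite lee_fin.
  - by apply: mfeM => //; exact: mp.
  - by move=> c _; rewrite mule_ge0 ?lee_fin.
under eq_integral do rewrite E2.
rewrite ge0_integralZr//; last 3 first.
- exact: mp.
- by move=> a _; rewrite lee_fin.
- by rewrite lee_fin mulr_ge0.
rewrite mean -!EFinM.
have hx : heat l x != 0 by rewrite gt_eqF ?heat_gt0.
(* [1/l] supplies the normalizations of the two coordinates that start at 0. *)
have lE : l^-1 = 2 * pi * heat l 0 ^+ 2.
  by rewrite sqr_heat0// invfM mulVKf// gt_eqF// mulr_gt0// pi_gt0.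
have h0 : heat l 0 != 0 by rewrite gt_eqF ?heat_gt0.
have -> : heat l x / l * (C * expR (- (b * x ^+ 2)) / heat l x * (c0 * c0)) =
   2 * pi * C ^+ 3 * expR (- (b * x ^+ 2)).
  rewrite /c0 lE expr0n/= mulr0 oppr0 expR0; move: (expR _) => ex.
  by field; rewrite hx h0.
move: x0; rewrite le_eqVlt => /predU1P[<-|x0].
  by rewrite h3 expr0n/= mulr0 oppr0 expR0 mulr1.
rewrite /bessel x0 h2// -EFinM; congr EFin.
by field; rewrite gt_eqF.
Qed.

Lemma measurable_prodt_bes l r s x d (T : measurableType d) (l' : T -> R) (w : T -> paths3) :
  r <= l <= 1 -> tests r s -> meas_fun l' -> meas_fun w ->
  meas_fun (fun a => prodt l s (bes x (l' a) (w a))).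
Proof.
move=> rl ts ml mw; apply: (measurable_prodt rl ts).
by apply: measurable_bes => //; meas.
Qed.

(* The weights are made general one by one: a measure on [R] is determined by its integrals of
   the functions [exp (- a y^2)]. *)
Lemma bes_chain_mixed s (gs : seq (R * R)) l x : 0 < l <= 1 -> 0 <= x ->
  tests l (s ++ gweights gs) -> le1 s -> (forall p, p \in gs -> 0 <= p.2) ->
  ((heat l x / l)%:E * \int[beta3]_w (prodt l (s ++ gweights gs) (bes x l w))%:E =
   bessel (s ++ gweights gs) l x)%E.
Proof.
move=> l01 x0; have /andP[l0 l1] := l01; have ll : l <= l <= 1 by rewrite lexx.
(* General weights come first and Gaussian ones last. The last general weight, at [rho], is
   determined by its Gaussian replacements, for which the induction hypothesis holds. *)
elim/last_ind: s gs => [|s [rho f] IH] gs; first by move=> ts _; exact: bes_gaussian.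
rewrite cat_rcons => ts; rewrite -cats1 => /le1_cat[hs1 [/= f1 _]] gs0.
have [/andP[rho0 rl] mf f0 ts2] := tests_suffix ts; have ts1 := tests_prefix ts.
set s2 := gweights gs in ts ts2 *.
have m1 : meas_fun (fun _ : R => 1 : R) by exact: measurable_cst.
have [D [mD D0 Dn hD]] := bessel_prefix x (tests_replace ts m1 (fun=> ler01)).
pose c := heat l x / l; have c0 : 0 <= c by rewrite divr_ge0 ?heat_ge0// ltW.
pose G1 w := c * (prodt l s (bes x l w) * prodt l s2 (bes x l w)).
pose Z1 w := bes x l w (l - rho).
have p1 w : 0 <= prodt l s w by exact: prodt_ge0 ts1.
have p2 w : 0 <= prodt l s2 w by exact: prodt_ge0 ts2.
have q1 w : prodt l s w <= 1 by exact: prodt_le1 ts1 hs1.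
have q2 w : prodt l s2 w <= 1 by apply: (prodt_le1 _ _ ts2); exact: le1_gweights.
have G10 w : 0 <= G1 w by rewrite mulr_ge0// mulr_ge0.
have mG1 : meas_fun G1.
  apply: mfM => //; apply: mfM; first by apply: (measurable_prodt_bes _ ll ts1); meas.
  by apply: (measurable_prodt_bes _ _ ts2); meas; rewrite (ltW rl).
have mZ1 : meas_fun Z1.
  apply: (measurableT_comp (f := fun w : cpath R => w (l - rho)) (g := fun w => bes x l w)).
    by apply: measurable_ev; lra.
  by apply: measurable_bes; meas.
have pE g w : prodt l (s ++ (rho, g) :: s2) w = g (w (l - rho)) * (prodt l s w * prodt l s2 w).
  by rewrite prodt_cat prodt_cons/=; ring.
have E1 (g : R -> R) : meas_fun g -> (forall y, 0 <= g y) ->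
    (c%:E * \int[beta3]_w (prodt l (s ++ (rho, g) :: s2) (bes x l w))%:E =
     \int[beta3]_w ((G1 w)%:E * (g (Z1 w))%:E))%E.
  move=> mg g0; rewrite -ge0_integralZl//; last 2 first.
  - by apply: mfE; apply: (measurable_prodt_bes _ ll (tests_replace ts mg g0)); meas.
  - by move=> w _; rewrite lee_fin pE !mulr_ge0.
  apply: eq_integral => w _; rewrite pE -!EFinM; congr EFin.
  by rewrite /G1 /Z1; ring.
have mexp al : meas_fun (fun y : R => expR (- (al * y ^+ 2))) by meas.
have L (al : R) : 0 <= al -> (\int[beta3]_w ((G1 w)%:E * (expR (- (al * Z1 w ^+ 2)))%:E) =
    \int[mu]_y (D y * (expR (- (al * y ^+ 2)))%:E))%E.
  move=> al0; rewrite -(E1 (fun y => expR (- (al * y ^+ 2))))//.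
  rewrite -hD//.
  have := IH ((rho, al) :: gs); apply => //.
  - by have := tests_replace ts (mexp al) (fun y => expR_ge0 _).
  - by move=> p; rewrite inE => /predU1P[->//|]; exact: gs0.
have G1fin : (\int[beta3]_w (G1 w)%:E < +oo)%E.
  apply: (@le_lt_trans _ _ (\int[beta3]_w c%:E)%E); last by rewrite integral_probability_cst ltry.
  apply: ge0_le_integral => //; [by move=> w _; rewrite lee_fin|exact: mfE|].
  by move=> w _; rewrite lee_fin ler_piMr// mulr_ile1.
have Dfin : (\int[mu]_y D y < +oo)%E.
  have := L 0 (lexx 0); under [RHS]eq_integral do rewrite mul0r oppr0 expR0 mule1.
  move=> <-; under eq_integral do rewrite mul0r oppr0 expR0 mule1.
  exact: G1fin.
(* [D] has a finite integral by the case [al = 0], so it is finite almost everywhere and has this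
   real version. *)
pose G2 y := fine (D y).
have mG2 : meas_fun G2 by exact: measurableT_comp.
have G20 y : 0 <= G2 y by rewrite fine_ge0.
have iD : mu.-integrable setT D.
  by apply/integrableP; split => //; under eq_integral => y _ do rewrite gee0_abs//.
have DE (g : R -> R) : meas_fun g -> (forall y, 0 <= g y) ->
    (\int[mu]_y (D y * (g y)%:E) = \int[mu]_y ((G2 y)%:E * (g y)%:E))%E.
  move=> mg g0; apply: ge0_ae_eq_integral => //.
  - by meas.
  - by meas.
  - by move=> y _; rewrite mule_ge0 ?lee_fin.
  - by move=> y _; rewrite mule_ge0 ?lee_fin.
  - have := integrable_ae measurableT iD; apply: filterS => y /(_ Logic.I) fD _.
    by rewrite /G2 fineK.
have mid : meas_fun (fun y : R => y) by meas.
have M2 : forall A, measurable A -> (\int[beta3]_w (G1 w * \1_A (Z1 w))%:E =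
    \int[mu]_y (G2 y * \1_A y)%:E)%E.
  move=> A mA.
  rewrite -(weightedE beta3 mG1 G10 mZ1 mA) -(weightedE (T := measurableTypeR R) mu mG2 G20 mid mA).
  have fin2 : weighted (T := measurableTypeR R) mu mG2 G20 mid setT = (\int[mu]_y D y)%E.
    rewrite weightedE//; have := DE (fun=> 1) m1 (fun=> ler01).
    under [LHS]eq_integral do rewrite mule1.
    by move=> ->; apply: eq_integral => y _; rewrite indicT EFinM.
  apply: squared_laplace_unique => //.
  - rewrite weightedE//; under eq_integral do rewrite indicT mulr1.
    exact: G1fin.
  - by rewrite fin2.
  - rewrite weightedE ?integral0_eq//.
    by move=> w _; rewrite indicE memNset ?mulr0// /= in_itv/= ltNge bes_ge0.
  - rewrite weightedE ?integral0_eq//.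
    move=> y _; rewrite indicE; case: (boolP (y \in _)) => [|_]; last by rewrite mulr0.
    by rewrite inE/= in_itv/= => y0; rewrite /G2 Dn ?ltW//= mul0r.
  - move=> al al0.
    have h0 (y : R) : (0 <= (expR (- al * y ^+ 2))%:E)%E by rewrite lee_fin expR_ge0.
    have mh : meas_fun (fun y : R => (expR (- al * y ^+ 2))%:E) by meas.
    rewrite (integral_weighted beta3 mG1 G10 mZ1 mh h0).
    rewrite (integral_weighted (T := measurableTypeR R) mu mG2 G20 mid mh h0).
    under eq_integral do rewrite mulNr; under [RHS]eq_integral do rewrite mulNr.
    by rewrite L// DE// => y; exact: expR_ge0.
rewrite -/c E1// hD// DE//.
apply: (@weighted_eq R _ _ _ paths3 (measurableTypeR R) R beta3 mu G1 Z1 G2 (fun y => y)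
  (fun y => (f y)%:E)) => //.
exact: mfE.
Qed.

Lemma bes_chain s l x : 0 < l <= 1 -> 0 <= x -> tests l s -> le1 s ->
  ((heat l x / l)%:E * \int[beta3]_w (prodt l s (bes x l w))%:E = bessel s l x)%E.
Proof. by move=> l01 x0 ts hs; have := @bes_chain_mixed s [::] l x; rewrite cats0; exact. Qed.

End three_bridges.
End bessel_law.

(** * From chains to laws of paths *)

Section path_laws.
Context {R : realType}.
Implicit Types (l r x y rho v : R) (s : seq (R * (R -> R))).

Lemma measurable_between (a b : R) : meas_fun (fun v : R => a < v < b).
Proof.
by apply: mf_and; apply: mf_lt; (exact: measurable_cst || exact: measurable_id).
Qed.

Lemma prod_bool (I : Type) (r : seq I) (P b : pred I) :
  \prod_(i <- r | P i) (b i)%:R = (all (fun i => P i ==> b i) r)%:R :> R.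
Proof.
elim: r => [|i r IH]; first by rewrite big_nil.
by rewrite big_cons /= IH; case: (P i) => //=; case: (b i); rewrite /= ?mul1r ?mul0r.
Qed.

Section grid_tests.
Variables (l : R) (n : nat) (A : nat -> set R).
Hypotheses (l0 : 0 < l) (mA : forall k, measurable (A k)).
Let K k : R := k%:R / 2 ^+ n.

(** Only grid times strictly between 0 and [l] are tested; the values at 0 and from [l] on are
    prescribed. *)
Definition grid_tests : seq (R * (R -> R)) :=
  [seq (l - K k, \1_(A k)) | k <- iota 1 (2 ^ n) & K k < l].

Lemma tests_grid : tests l grid_tests.
Proof.
rewrite /grid_tests; set j := (2 ^ n)%N.
have : l - K 1%N < l by rewrite gtrBl divr_gt0// exprn_gt0.
have KS k : K k < K k.+1 by rewrite ltr_pM2r ?invr_gt0 ?exprn_gt0// ltr_nat.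
elim: j 1%N {2 3}l => // j IH k r /= h.
case: ifPn => kl /=; last by apply: IH; apply: lt_trans h; rewrite ltrD2l ltrN2.
split.
- by rewrite subr_gt0 kl.
- by meas.
- by move=> y; rewrite indicE.
- by apply: IH; rewrite ltrD2l ltrN2.
Qed.

Lemma le1_grid : le1 grid_tests.
Proof.
rewrite /grid_tests; by elim: [seq k <- _ | _] => //= k r IH; split => // y.
Qed.

(** The boolean gathers the constraints at the times where the path is prescribed; it does not
    depend on the path. *)
Lemma grid_prodt x e : l <= 1 -> exists b : bool, forall w : cpath R, w 0 = x ->
  (forall t, l <= t <= 1 -> w t = e) -> \1_(grid_set n A) w = b%:R * prodt l grid_tests w.
Proof.
move=> l1; exists (`[< A 0%N x /\ forall k, (k <= 2 ^ n)%N -> l <= K k -> A k e >]) => w w0 wl.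
have -> : prodt l grid_tests w =
    (all (fun k => (K k < l) ==> (w (K k) \in A k)) (iota 1 (2 ^ n)))%:R.
  rewrite -prod_bool /prodt /grid_tests big_map big_filter; apply: eq_bigr => k _ /=.
  by rewrite subKr indicE.
rewrite -natrM mulnb indicE; congr (nat_of_bool _)%:R.
apply/idP/andP => [|[/asboolP[h0 h1] /allP h2]].
  rewrite inE => h; split.
    apply/asboolP; split => [|k kn lk]; first by have := h 0%N isT; rewrite mul0r w0.
    have := h k kn; rewrite wl// lk/=.
    by have /andP[] := @grid_itv R n k kn.
  apply/allP => k; rewrite mem_iota => /andP[k1 kn]; apply/implyP => _; rewrite inE.
  by apply: h; rewrite -ltnS -add1n.
rewrite inE => k kn; case: k kn => [_|k kn]; first by rewrite mul0r w0.
have [lk|kl] := leP l (K k.+1).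
  by rewrite wl ?lk/=; [exact: h1|have /andP[] := @grid_itv R n k.+1 kn].
have : (K k.+1 < l) ==> (w (K k.+1) \in A k.+1) by apply: h2; rewrite mem_iota/= add1n ltnS.
by rewrite kl/= inE.
Qed.

End grid_tests.

(* A path which is constant after time [l] has its law determined by the values of products of
   weights at times in the open interval. *)
Lemma path_law_unique d1 d2 (T1 : measurableType d1) (T2 : measurableType d2)
  (nu1 : {measure set T1 -> \bar R}) (nu2 : {measure set T2 -> \bar R})
  (G1 : T1 -> R) (Z1 : T1 -> cpath R) (G2 : T2 -> R) (Z2 : T2 -> cpath R) (l x e : R) :
  0 < l <= 1 ->
  meas_fun G1 -> (forall t, 0 <= G1 t) -> meas_fun Z1 ->
  meas_fun G2 -> (forall t, 0 <= G2 t) -> meas_fun Z2 ->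
  (\int[nu1]_t (G1 t)%:E < +oo)%E ->
  (forall t, Z1 t 0 = x /\ forall u, l <= u <= 1 -> Z1 t u = e) ->
  (forall t, G2 t != 0 -> Z2 t 0 = x /\ forall u, l <= u <= 1 -> Z2 t u = e) ->
  (forall s, tests l s -> le1 s ->
     (\int[nu1]_t (G1 t * prodt l s (Z1 t))%:E = \int[nu2]_t (G2 t * prodt l s (Z2 t))%:E)%E) ->
  forall A, measurable A ->
    (\int[nu1]_t (G1 t * \1_A (Z1 t))%:E = \int[nu2]_t (G2 t * \1_A (Z2 t))%:E)%E.
Proof.
move=> /andP[l0 l1] mG1 G10 mZ1 mG2 G20 mZ2 fin h1 h2 H A mA.
rewrite -(weightedE nu1 mG1 G10 mZ1 mA) -(weightedE nu2 mG2 G20 mZ2 mA).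
apply: grid_unique => //.
  by rewrite weightedE//; under eq_integral do rewrite indicT mulr1.
move=> n C mC; rewrite !weightedE//; try exact: measurable_grid_set.
have [b hb] := grid_prodt (l := l) n C x e l1.
have E1 t : G1 t * \1_(grid_set n C) (Z1 t) = b%:R * (G1 t * prodt l (grid_tests l n C) (Z1 t)).
  by have [z0 zl] := h1 t; rewrite hb//; ring.
have E2 t : G2 t * \1_(grid_set n C) (Z2 t) = b%:R * (G2 t * prodt l (grid_tests l n C) (Z2 t)).
  have [->|/h2[z0 zl]] := eqVneq (G2 t) 0; first by rewrite !mul0r mulr0.
  by rewrite hb//; ring.
under eq_integral do rewrite E1; under [RHS]eq_integral do rewrite E2.
case: (b) => /=.
  under eq_integral do rewrite mul1r; under [RHS]eq_integral do rewrite mul1r.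
  by apply: H; [exact: tests_grid|exact: le1_grid].
by under eq_integral do rewrite mul0r; under [RHS]eq_integral do rewrite mul0r; rewrite !integral0.
Qed.

Section lowered_paths.
Variables (c0 c1 l : R).
Let h r := c0 + c1 * r.

(** Adds the line [- h] at the remaining time [l - t]; [clip] freezes the line after the time
    [l]. *)
Definition lower (w : cpath R) : cpath R := to_cpath (fun t => w t - h (clip (l - t))).

Lemma lowerE (w : cpath R) t : lower w t = w t - h (clip (l - t)).
Proof.
rewrite /lower to_cpathE// => {}t; apply: cvgB; first exact: continuous_path.
apply: cvgD; first exact: cvg_cst.
apply: cvgM; first exact: cvg_cst.
have c : {for t, continuous (fun t : R => l - t)} by apply: cvgB; [exact: cvg_cst|exact: cvg_id].
exact: (continuous_comp c (@continuous_clip R _)).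
Qed.

Lemma measurable_lower d (T : measurableType d) (X : T -> cpath R) :
  meas_fun X -> meas_fun (fun a => lower (X a)).
Proof.
move=> mX; apply: measurable_into_cpath => t t01.
under eq_fun do rewrite lowerE.
apply: mfD; last by meas.
exact: (measurableT_comp (f := fun w : cpath R => w t) (measurable_ev t01) mX).
Qed.

Lemma prodt_lower r s w : 0 < l <= 1 -> r <= l -> tests r s ->
  prodt l s (lower w) = prodt l (shift c0 c1 s) w.
Proof.
move=> /andP[l0 l1]; elim: s r => [|[rho f] s IH] r rl; first by rewrite !prodt_nil.
move=> /= [/andP[rho0 rr] mf f0 ts].
rewrite !prodt_cons/= (IH rho)//; last by rewrite (le_trans (ltW rr)).
by rewrite lowerE subKr clip_id// ltW//= (le_trans (ltW rr))// (le_trans rl).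
Qed.

(** The path [w] up to the time [l - v], then [w'] lowered by the line. The sum makes continuity and
    measurability immediate: the bracket vanishes before [l - v] if [w'] starts at [h v], and [w]
    vanishes afterwards. *)
Definition glue v (w w' : cpath R) : cpath R := to_cpath (fun t =>
  w t + (w' (clip (t - (l - v))) - h (Num.min v (clip (l - t))))).

Lemma glueE v (w w' : cpath R) t :
  glue v w w' t = w t + (w' (clip (t - (l - v))) - h (Num.min v (clip (l - t)))).
Proof.
rewrite /glue to_cpathE// => {}t; apply: cvgD; first exact: continuous_path.
have c : {for t, continuous (fun t : R => l - t)} by apply: cvgB; [exact: cvg_cst|exact: cvg_id].
have c' : {for t, continuous (fun t : R => t - (l - v))}.
  by apply: cvgB; [exact: cvg_id|exact: cvg_cst].
have cc := continuous_comp c (@continuous_clip R _).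
have cc' := continuous_comp c' (@continuous_clip R _).
apply: cvgB; first exact: (cvg_comp _ _ cc' (@continuous_path R w' _)).
apply: cvgD; first exact: cvg_cst.
apply: cvgM; first exact: cvg_cst.
exact: (@continuous_min R R (cst v) (fun t : R => clip (l - t)) t (@cvg_cst _ _ _ _ _) cc).
Qed.

Lemma glue_before v (w w' : cpath R) (t : R) : 0 < l <= 1 -> 0 < v < l -> w' 0 = h v -> 0 <= t <= l - v ->
  glue v w w' t = w t.
Proof.
move=> /andP[l0 l1] /andP[v0 vl] w'0 /andP[t0 tl].
rewrite glueE clip_lt0 ?subr_le0// w'0 clip_id; last by lra.
by rewrite min_l ?subrr ?addr0//; lra.
Qed.

Lemma glue_after v (w w' : cpath R) (t : R) : 0 < l <= 1 -> 0 < v < l ->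
  (forall u, l - v <= u -> w u = 0) -> l - v <= t <= l ->
  glue v w w' t = w' (t - (l - v)) - h (l - t).
Proof.
move=> /andP[l0 l1] /andP[v0 vl] wl /andP[t0 tl].
rewrite glueE wl// add0r !clip_id; last 2 first.
- by lra.
- by lra.
by rewrite min_r//; lra.
Qed.

Lemma measurable_glue d (T : measurableType d) (v : T -> R) (X Y : T -> cpath R) :
  meas_fun v -> meas_fun X -> meas_fun Y ->
  meas_fun (fun a => glue (v a) (X a) (Y a)).
Proof.
move=> mv mX mY; apply: measurable_into_cpath => t t01.
under eq_fun do rewrite glueE.
apply: mfD; first exact: (measurableT_comp (f := fun w : cpath R => w t) (measurable_ev t01) mX).
apply: mfD; last by rewrite /h; meas.
apply: (measurable_eval (g := fun a => clip (t - (l - v a)))) => //.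
  by meas.
by move=> a; exact: clip_itv.
Qed.

Lemma prodt_glue v s (w w' : cpath R) : 0 < l <= 1 -> 0 < v < l -> tests l s ->
  w' 0 = h v -> (forall u, l - v <= u -> w u = 0) ->
  prodt l s (glue v w w') =
  prodt (l - v) (before v s) w * prodt v (shift c0 c1 (after v s)) w'.
Proof.
move=> l01 vl ts w0 wl; have /andP[v0 vl'] := vl.
suff : forall r, r <= l -> tests r s -> prodt l s (glue v w w') =
  prodt (l - v) (before v s) w * prodt v (shift c0 c1 (after v s)) w' by apply; rewrite ?lexx.
elim: s {ts} => [|[rho f] s IH] r rl /=; first by rewrite !prodt_nil mulr1.
move=> [/andP[rho0 rr] mf f0 ts].
rewrite prodt_cons/= (IH rho)//; last by rewrite (le_trans (ltW rr)).
rewrite /before /after /=; case: ltP => vr /=.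
  rewrite prodt_cons/= -/(before v s) -/(after v s) mulrA; congr (f _ * _ * _).
  rewrite glue_before//; last by lra.
  by congr (w _); ring.
rewrite prodt_cons/= -/(before v s) -/(after v s) mulrCA; congr (_ * (f _ * _)).
rewrite glue_after//; last by lra.
by rewrite subKr; congr (w' _ - _); ring.
Qed.

End lowered_paths.

Lemma le1_shift (c0 c1 : R) s : @le1 R s -> @le1 R (shift c0 c1 s).
Proof. by apply: le1_map => p hp y /=. Qed.

Lemma le1_before v s : @le1 R s -> @le1 R (before v s).
Proof. by move=> h; apply: le1_map => //; exact: le1_filter. Qed.

Lemma le1_after v s : @le1 R s -> @le1 R (after v s).
Proof. exact: le1_filter. Qed.

Definition bessel_end r x : R := if 0 < x then x^-1 * hit' r x else heat r 0 / r.

Lemma bessel_nil r x : bessel [::] r x = (bessel_end r x)%:E.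
Proof. by rewrite /bessel /bessel_end; case: ifP => // _; rewrite -EFinM. Qed.

Lemma crossing_bessel_cons c0 c1 v r rho f s x : tests r ((rho, f) :: s) ->
  crossing c0 c1 bessel v ((rho, f) :: s) r x =
  (\int[mu]_y ((bessel_start r x rho y * f y)%:E * crossing c0 c1 chain0 v s rho y) +
   (bessel_end (r - v)%R x)%:E * chain (kL c0 c1) (eL c0 c1) ((rho, f) :: s) v 0)%E.
Proof.
move=> ts; apply: (crossing_cons (b := bessel_end ^~ x) _ _ ts) => //.
- move=> vr; have tb := tests_before v ts; move: tb; rewrite /before/= vr/= -/(before v s) => tb.
  have e y : bessel_start (r - v) x (rho - v) y = bessel_start r x rho y.
    rewrite /bessel_start /k0 (_ : r - v - (rho - v) = r - rho)//; ring.
  by rewrite (bessel_cons x tb); apply: eq_integral => y _; rewrite e.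
- exact: bessel_nil.
- by move=> y; exact: bessel_start_ge0.
- exact: measurable_bessel_start.
Qed.

Lemma measurable_crossing_bessel c0 c1 r s x d (T : measurableType d) (v : T -> R) :
  tests r s -> meas_fun v ->
  meas_fun (fun a => crossing c0 c1 bessel (v a) s r x).
Proof.
have mend (w : T -> R) : meas_fun w -> meas_fun (fun a => bessel_end (w a) x).
  move=> mw; rewrite /bessel_end; case: (0 < x); last by heat_meas.
  by apply: mfM => //; apply: mhit'; meas.
case: s => [|[rho f] s] ts mv.
  rewrite /crossing; apply: mfeM.
    by under eq_fun do rewrite bessel_nil; apply: mfE; apply: mend; meas.
  by apply: mfE; apply: meL; meas.
under eq_fun do rewrite crossing_bessel_cons//.
move: (ts) => /= [rr mf f0 ts']; apply: mfeD; last first.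
  apply: mfeM; first by apply: mfE; apply: mend; meas.
  exact: (measurable_chain (@kL_ge0 _ c0 c1) (@mkL _ c0 c1) (@meL _ c0 c1) (@eL_ge0 _ c0 c1)
    (s := (rho, f) :: s) ts).
apply: (measurable_int_param mu (fun a y =>
    (bessel_start r x rho y * f y)%:E * crossing c0 c1 chain0 (v a) s rho y)%E).
  apply: mfeM.
    apply: mfE; apply: mfM; last by meas.
    by apply: (measurableT_comp (measurable_bessel_start r x rho)); meas.
  by apply: measurable_crossing => //; meas; meas.
by move=> a y; rewrite mule_ge0 ?lee_fin ?mulr_ge0 ?bessel_start_ge0 ?crossing_chain_ge0.
Qed.

Lemma tests_after_notin v r s : tests r s -> v \notin [seq p.1 | p <- s] -> tests v (after v s).
Proof.
elim: s r => // -[rho f] s IH r /= [/andP[r0 rr] mf f0 ts].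
rewrite inE negb_or eq_sym => /andP[vr vs]; rewrite /after/=; case: ifPn => [rv|_] /=.
  by split => //; [rewrite r0 lt_neqAle vr|exact: tests_after ts].
exact: IH ts vs.
Qed.

Section first_passage_law.
Variables (beta : probability (cpath R) R) (c0 c1 l x q : R).
Hypothesis hbeta : brownian_bridge beta 0 0 1 id.
Let h r := c0 + c1 * r.
Hypotheses (l01 : 0 < l <= 1) (x0 : 0 <= x) (q0 : 0 <= q)
  (h_gt0 : forall v, 0 < v < l -> 0 < h v) (qc0 : q != 0 -> c0 = 0).
Notation beta3 := (beta3 beta).
Notation P3 := (cpath R * cpath R * cpath R)%type.

(** Unnormalized density of the passage at the remaining time [v]: normalization of a Bessel bridge
    from [x] of length [l - v], times the density of reaching the line from 0 in the time [v], with
    its Girsanov factor. *)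
Definition crossing_density v : R :=
  heat (l - v) x / (l - v) * (expR (c1 * h v - c1 ^+ 2 * v / 2) * hit v (h v)).

Definition crossing_path v (w w' : P3) : cpath R :=
  glue c0 c1 l v (bes x (l - v) w) (bes (h v) v w').

Lemma crossing_density_ge0 v : 0 < v < l -> 0 <= crossing_density v.
Proof.
move=> vl; have /andP[v0 vl'] := vl; rewrite mulr_ge0//.
  by rewrite divr_ge0 ?heat_ge0// subr_ge0 ltW.
by rewrite mulr_ge0 ?expR_ge0// hit_ge0// ltW// h_gt0.
Qed.

Lemma measurable_crossing_density : meas_fun crossing_density.
Proof. by rewrite /crossing_density /h; heat_meas. Qed.

Lemma measurable_crossing_path d (T : measurableType d) (v : T -> R) (X Y : T -> P3) :
  meas_fun v -> meas_fun X -> meas_fun Y ->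
  meas_fun (fun a => crossing_path (v a) (X a) (Y a)).
Proof.
by move=> mv mX mY; apply: measurable_glue => //; apply: measurable_bes; rewrite /h; meas.
Qed.

(** Each of the two pieces is a Bessel bridge, from [x] and from [h v]. A test at [v] itself would
    not be at an interior time of the second piece, hence its exclusion. *)
Lemma crossing_law v s : 0 < v < l -> tests l s -> le1 s -> v \notin [seq p.1 | p <- s] ->
  crossing c0 c1 bessel v s l x = ((crossing_density v)%:E *
    \int[beta3]_w \int[beta3]_w' (prodt l s (crossing_path v w w'))%:E)%E.
Proof.
move=> vl ts hs vs; have /andP[v0 vl'] := vl; have /andP[l0 l1] := l01.
have hv := h_gt0 vl; have hv0 : 0 < 0 + h v by rewrite add0r.
have tb := tests_before v ts; have ta : tests v (after v s) by exact: tests_after_notin ts vs.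
have tsa := tests_shift c0 c1 ta.
have lv : 0 < l - v <= 1 by lra.
have v1 : 0 < v <= 1 by rewrite v0/= (le_trans (ltW vl')).
rewrite /crossing (chain_shift hv0 ta) add0r.
have -> : chain0 (shift c0 c1 (after v s)) v (c0 + c1 * v) =
    ((h v)%:E * bessel (shift c0 c1 (after v s)) v (h v))%E.
  by rewrite /bessel hv muleA -EFinM mulfV ?gt_eqF// mul1e.
rewrite -(bes_chain hbeta lv x0 tb (le1_before v hs)).
rewrite -(bes_chain hbeta v1 (ltW hv) tsa (le1_shift c0 c1 (le1_after v hs))).
rewrite ![in X in (_ * X)%E]muleA -!EFinM muleACA -EFinM.
set K := (X in X%:E); have {K} -> : K = crossing_density v.
  by rewrite /K /crossing_density hitE /h; ring.
suff -> : (\int[beta3]_w (prodt (l - v) (before v s) (bes x (l - v) w))%:E *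
    \int[beta3]_w (prodt v (shift c0 c1 (after v s)) (bes (h v) v w))%:E =
    \int[beta3]_w \int[beta3]_w' (prodt l s (crossing_path v w w'))%:E)%E by [].
have m1 : meas_fun (fun w : P3 => (prodt (l - v) (before v s) (bes x (l - v) w))%:E).
  by apply: mfE; apply: (measurable_prodt_bes _ _ tb); meas; rewrite lexx; have /andP[] := lv.
have m2 : meas_fun (fun w : P3 =>
    (prodt v (shift c0 c1 (after v s)) (bes (h v) v w))%:E).
  by apply: mfE; apply: (measurable_prodt_bes _ _ tsa); meas; rewrite lexx; have /andP[] := v1.
have p1 w : 0 <= prodt (l - v) (before v s) w by exact: prodt_ge0 tb.
have p2 w : 0 <= prodt v (shift c0 c1 (after v s)) w by exact: prodt_ge0 tsa.
rewrite -ge0_integralZr; last 4 first.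
- exact: measurableT.
- exact: m1.
- by move=> w _; rewrite lee_fin.
- by apply: integral_ge0 => w _; rewrite lee_fin.
apply: eq_integral => w _; rewrite -ge0_integralZl; last 4 first.
- exact: measurableT.
- exact: m2.
- by move=> w' _; rewrite lee_fin.
- by rewrite lee_fin.
apply: eq_integral => w' _; rewrite -EFinM (prodt_glue _ vl ts)//.
- by rewrite bes_start// ltW.
- by move=> u lu; rewrite bes_end//; have /andP[] := lv.
Qed.

Lemma crossing_out v s : tests l s -> ~ (0 < v < l) -> crossing c0 c1 bessel v s l x = 0%E.
Proof.
move=> ts vl; rewrite /crossing; have [v0|v0] := leP v 0.
  have -> : after v s = [::].
    elim: s l {vl} ts => // -[rho f] s IH r /= [/andP[rho0 rr] _ _ ts].
    by rewrite /after/= leNgt (le_lt_trans v0 rho0)/= -/(after v s) (IH rho).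
  by rewrite /= /eL /hit' hit_le0// if_same mul0r mule0.
have lv : l <= v by rewrite leNgt; apply/negP => vl'; apply: vl; rewrite v0.
have [-> _] := after_all ts lv.
have -> : bessel [::] (l - v) x = 0%E; last by rewrite mul0e.
rewrite /bessel/= /hit' !(hit_le0, heat_le0) ?subr_le0//.
by rewrite !mul0r if_same mule0 if_same.
Qed.

Lemma measurable_crossing_mean (F : cpath R -> \bar R) : meas_fun F ->
  (forall w, 0 <= F w)%E -> meas_fun (fun v : R =>
    (\int[beta3]_w \int[beta3]_w' F (crossing_path v w w'))%E).
Proof.
move=> mF F0.
apply: (measurable_int_param beta3 (fun v w =>
  \int[beta3]_w' F (crossing_path v w w')))%E; last by move=> v w; exact: integral_ge0.
apply: (measurable_int_param beta3 (fun (z : measurableTypeR R * P3) w' =>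
  F (crossing_path z.1 z.2 w'))) => //.
by apply: (measurableT_comp mF); apply: measurable_crossing_path; meas.
Qed.

Let T2 := (measurableTypeR R * (P3 * P3))%type.
Let beta6 : probability (P3 * P3)%type R := (beta3 \x beta3)%E.
Let nu2 : {measure set T2 -> \bar R} := (@lebesgue_measure R \x beta6)%E.

(** Passage and absence of passage are put on one space: [v] runs over []0, l[] in the first case,
    and the mass [q] of the second is spread over []-1, 0[], an interval of length 1. *)
Let weight v : R := if 0 < v < l then crossing_density v else if -1 < v < 0 then q else 0.
Let path (z : T2) : cpath R :=
  if 0 < (z.1 : R) < l then crossing_path z.1 z.2.1 z.2.2 else bes x l z.2.1.

Let weight_ge0 v : 0 <= weight v.
Proof.
rewrite /weight; case: ifPn => [|_]; first exact: crossing_density_ge0.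
by case: ifP.
Qed.

Let mweight : meas_fun (fun z : T2 => weight z.1).
Proof.
rewrite /weight; apply: mf_if; [by meas| |by meas].
by apply: (measurableT_comp measurable_crossing_density); meas.
Qed.

Let mpath : meas_fun path.
Proof.
rewrite /path; apply: measurable_fun_ifT; first by meas.
  by apply: measurable_crossing_path; meas.
by apply: measurable_bes; meas.
Qed.

Let disintegrate (F : cpath R -> \bar R) : meas_fun F -> (forall w, 0 <= F w)%E ->
  (\int[nu2]_z ((weight z.1)%:E * F (path z)) = q%:E * \int[beta3]_w F (bes x l w) +
   \int[mu]_(v in `]0%R, l[) ((crossing_density v)%:E *
     \int[beta3]_w \int[beta3]_w' F (crossing_path v w w')))%E.
Proof.
move=> mF F0.
pose f (z : T2) := ((weight z.1)%:E * F (path z))%E.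
have mf : meas_fun f.
  by apply: mfeM; [exact: mfE|exact: (measurableT_comp mF)].
have f0 z : (0 <= f z)%E by rewrite mule_ge0 ?lee_fin.
pose I v : \bar R := (\int[beta3]_w \int[beta3]_w' F (crossing_path v w w'))%E.
have mI : meas_fun I by exact: measurable_crossing_mean.
have I0 v : (0 <= I v)%E by apply: integral_ge0 => w _; exact: integral_ge0.
pose J1 v : \bar R := if 0 < v < l then ((crossing_density v)%:E * I v)%E else 0%E.
pose c : \bar R := (q%:E * \int[beta3]_w F (bes x l w))%E.
have c_ge0 : (0 <= c)%E by rewrite mule_ge0 ?lee_fin//; exact: integral_ge0.
pose J2 (v : R) : \bar R := if -1 < v < 0 then c else 0%E.
have J10 v : (0 <= J1 v)%E.
  by rewrite /J1; case: ifPn => // vl; rewrite mule_ge0 ?lee_fin ?crossing_density_ge0.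
have J20 v : (0 <= J2 v)%E by rewrite /J2; case: ifP.
have mJ1 : meas_fun J1.
  rewrite /J1; apply: mfe_if; [exact: measurable_between| |exact: measurable_cst].
  by apply: mfeM => //; apply: mfE; exact: measurable_crossing_density.
have mJ2 : meas_fun J2.
  by rewrite /J2; apply: mfe_if; [exact: measurable_between|exact: measurable_cst..].
transitivity (\int[mu]_v (J1 v + J2 v))%E; last first.
  rewrite ge0_integralD// addeC; congr (_ + _)%E.
    transitivity (\int[mu]_(v in `](-1)%R, 0%R[) c)%E.
      rewrite (@integral_supp _ `](-1)%R, 0%R[%classic)//; last first.
        by move=> v /=; rewrite in_itv/= /J2 => /negP/negbTE ->.
      by apply: eq_integral => v; rewrite inE/= in_itv/= /J2 => ->.
    rewrite integral_cst//= lebesgue_measure_itv/= lte_fin ltrN10 -EFinD opprK add0r mule1.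
    by [].
  rewrite (@integral_supp _ `]0, l[%classic)//; last first.
    by move=> v /=; rewrite in_itv/= /J1 => /negP/negbTE ->.
  by apply: eq_integral => v; rewrite inE/= in_itv/= /J1 => ->.
rewrite [LHS](@fubini_tonelli1 _ _ _ _ R (@lebesgue_measure R) beta6 f mf f0).
apply: eq_integral => v _; rewrite /fubini_F.
have mfv : meas_fun (fun p : P3 * P3 => f (v, p)) by meas.
rewrite [LHS](@fubini_tonelli1 _ _ _ _ R beta3 beta3 _ mfv (fun p => f0 (v, p))).
rewrite /fubini_F /f /weight /path /J1 /J2 /=.
case: ifPn => [vl|nvl].
  have /andP[v0 _] := vl; rewrite [v < 0]ltNge (ltW v0) andbF adde0 -/(I v).
  rewrite -ge0_integralZl//; last 3 first.
  - apply: (measurable_int_param beta3 (fun w w' => F (crossing_path v w w'))) => //.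
    by apply: (measurableT_comp mF); apply: measurable_crossing_path; meas.
  - by move=> w _; exact: integral_ge0.
  - by rewrite lee_fin crossing_density_ge0.
  apply: eq_integral => w _; rewrite ge0_integralZl//.
  - by apply: (measurableT_comp mF); apply: measurable_crossing_path; meas.
  - by rewrite lee_fin crossing_density_ge0.
rewrite add0e; case: ifPn => _; last first.
  by rewrite integral0_eq// => w _; rewrite integral0_eq// => w' _; rewrite mul0e.
rewrite /c -ge0_integralZl//; last by apply: (measurableT_comp mF); apply: measurable_bes; meas.
apply: eq_integral => w _.
by rewrite integral_cst// [X in (_ * X)%E](probability_setT beta3) mule1.
Qed.

(* [lower] turns the path started at [X] into a path above the line; up to the factor [k], it
   either is positive until the end or first returns to 0 at the remaining time [v]. *)
Lemma first_passage_law (X k : R) : 0 <= k -> 0 <= X -> X = x + h l ->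
  (forall s, tests l s -> le1 s ->
    (k%:E * \int[beta3]_w (prodt l s (lower c0 c1 l (bes X l w)))%:E =
     q%:E * \int[beta3]_w (prodt l s (bes x l w))%:E +
     \int[mu]_v crossing c0 c1 bessel v s l x)%E) ->
  forall F : cpath R -> \bar R, meas_fun F -> (forall w, 0 <= F w)%E ->
  (k%:E * \int[beta3]_w F (lower c0 c1 l (bes X l w)) = q%:E * \int[beta3]_w F (bes x l w) +
   \int[mu]_(v in `]0%R, l[) ((crossing_density v)%:E *
     \int[beta3]_w \int[beta3]_w' F (crossing_path v w w')))%E.
Proof.
move=> k0 X0 XE H F mF F0; rewrite -disintegrate//.
have /andP[l0 l1] := l01.
have mlow : meas_fun (fun w => lower c0 c1 l (bes X l w)).
  by apply: measurable_lower; apply: measurable_bes; meas.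

rewrite -ge0_integralZl//; last by apply: (measurableT_comp mF).
apply: (@weighted_eq R _ _ _ P3 T2 (cpath R) beta3 nu2 (fun=> k) (fun w => lower c0 c1 l (bes X l w))
  (fun z => weight z.1) path F) => //.
apply: (@path_law_unique _ _ P3 T2 beta3 nu2 (fun=> k) (fun w => lower c0 c1 l (bes X l w))
  (fun z => weight z.1) path l x (- c0)) => //.
- by rewrite integral_probability_cst ltry.
- move=> w; split => [|u /andP[lu u1]]; rewrite lowerE.
    by rewrite bes_start// subr0 clip_id ?(ltW l0)// XE /h; ring.
  by rewrite bes_end// clip_lt0 ?subr_le0// mulr0 addr0 sub0r.
- move=> z; rewrite /weight /path; case: ifPn => [vl _|_].
    have /andP[v0 vl'] := vl; split => [|u /andP[lu u1]].
      rewrite /crossing_path glue_before//; last by rewrite lexx subr_ge0 ltW.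
      + by rewrite bes_start.
      + by rewrite bes_start// ltW// h_gt0.
    rewrite /crossing_path glueE !bes_end//; last 3 first.
    + by rewrite clip_id; [lra|lra].
    + by rewrite subr_gt0.
    + by lra.
    rewrite clip_lt0 ?subr_le0// min_r ?(ltW v0)// mulr0 addr0; ring.
  case: ifPn => [_ /qc0 c00|_]; last by rewrite eqxx.
  by rewrite bes_start// c00 oppr0; split => // u /andP[lu _]; rewrite bes_end.
- move=> s ts hs.
  have [mp p0] := prodt_test l1 ts.
  under [RHS]eq_integral do rewrite EFinM.
  rewrite (disintegrate mp p0).
  under eq_integral do rewrite EFinM.
  rewrite ge0_integralZl//; last by apply: (measurableT_comp mp).
  rewrite H//; congr (_ + _)%E.
  rewrite (@integral_supp _ `]0, l[%classic)//; last first.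
    by move=> v /=; rewrite in_itv/= => vl; exact: crossing_out.
  apply: ge0_ae_eq_integral => //.
  + apply: measurable_funTS.
    by apply: measurable_crossing_bessel => //; meas.
  + apply: measurable_funTS; apply: mfeM; first by apply: mfE; exact: measurable_crossing_density.
    exact: (measurable_crossing_mean mp p0).
  + move=> v /=; rewrite in_itv/= => /andP[v0 vl]; apply: crossing_ge0 => // s' ts'.
    by apply: bessel_ge0 ts'; rewrite subr_ge0 ltW.
  + move=> v /=; rewrite in_itv/= => vl; rewrite mule_ge0 ?lee_fin ?crossing_density_ge0//.
    by apply: integral_ge0 => w _; exact: integral_ge0.
  (* The tested times are finitely many, so [crossing_law] covers almost every [v]. *)
  exists [set` [seq p.1 | p <- s]]; split.
  + by apply: countable_measurable => //; apply: finite_set_countable; exact: finite_seq.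
  + exact: (countable_lebesgue_measure0 (finite_set_countable (finite_seq _))).
  + move=> v /= nv; apply: contrapT => vs; apply: nv; rewrite in_itv/= => vl.
    by apply: crossing_law => //; apply/negP.
Qed.

End first_passage_law.
End path_laws.

(** * The drifting excursion at its first return to 0 *)

Section drifting_excursion.
Context {R : realType}.
Implicit Types (a l r x y rho v : R) (s : seq (R * (R -> R))).
Notation P3 := (cpath R * cpath R * cpath R)%type.

(** Density of the first return to 0 of the excursion with drift [- a]; biased by [t] and normalized
    it becomes [first_return_density]. *)
Definition return_density a (t : R) : R :=
  a / Num.sqrt (2 * pi * t * (1 - t) ^+ 3) * expR (- (a ^+ 2 * t / (2 * (1 - t)))).

Lemma return_density_ge0 a t : 0 <= a -> 0 <= return_density a t.
Proof. by move=> a0; rewrite mulr_ge0 ?expR_ge0// divr_ge0. Qed.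

Lemma measurable_return_density a : meas_fun (return_density a).
Proof. by rewrite /return_density; meas. Qed.

Lemma integral_if_between (a b : R) (g : R -> \bar R) :
  (\int[mu]_u (if (a < u < b)%R then g u else 0) = \int[mu]_(u in `]a, b[) g u)%E.
Proof.
rewrite [RHS]integral_mkcond; apply: eq_integral => u _; rewrite patchE.
by rewrite mem_setE in_itv.
Qed.

Lemma return_densityE a t : 0 < t < 1 ->
  return_density a t = a / (Num.sqrt (2 * pi) * Num.sqrt t * ((1 - t) * Num.sqrt (1 - t))) *
    expR (- (a ^+ 2 * t / (2 * (1 - t)))).
Proof.
move=> /andP[t0 t1]; have s0 : 0 < 1 - t by rewrite subr_gt0.
rewrite /return_density; congr (_ / _ * _).
rewrite [LHS]sqrtrM ?mulr_ge0 ?pi_ge0 ?(ltW t0)// [Num.sqrt (2 * pi * t)]sqrtrM ?mulr_ge0 ?pi_ge0//.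
congr (_ * _); rewrite -[in LHS](sqr_sqrtr (ltW s0)) -exprM.
by rewrite (_ : (2 * 3 = 3 * 2)%N)// exprM sqrtr_sqr ger0_norm ?exprn_ge0// exprSr sqr_sqrtr// ltW.
Qed.

Lemma return_density_gt0 a t : 0 < a -> 0 < t < 1 -> 0 < return_density a t.
Proof.
move=> a0 /andP[t0 t1]; rewrite mulr_gt0 ?expR_gt0// divr_gt0// sqrtr_gt0.
by rewrite !mulr_gt0 ?pi_gt0 ?exprn_gt0 ?subr_gt0.
Qed.

Section with_bridge.
Variables (beta : probability (cpath R) R) (a : R).
Hypothesis hbeta : brownian_bridge beta 0 0 1 id.
Hypothesis a0 : 0 < a.
Notation beta3 := (beta3 beta).

(** With [c0 = a] and [c1 = - a], the line at the remaining time [1 - t] is [- a t]; it passes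
    through the starting point. *)
Definition drifting_path (w : P3) : cpath R := lower a (- a) 1 (bes 0 1 w).

Definition return_path (u : R) (w w' : P3) : cpath R := crossing_path a (- a) 1 0 (1 - u) w w'.

Let h_gt0 v : 0 < v < 1 -> 0 < a + - a * v.
Proof.
by move=> /andP[v0 v1]; rewrite mulNr -[X in X - _]mulr1 -mulrBr mulr_gt0// subr_gt0.
Qed.

Lemma measurable_drifting_path : meas_fun drifting_path.
Proof. by apply: measurable_lower; apply: measurable_bes; meas. Qed.

Lemma measurable_return_path d (T : measurableType d) (u : T -> R) (w w' : T -> P3) :
  meas_fun u -> meas_fun w -> meas_fun w' ->
  meas_fun (fun z => return_path (u z) (w z) (w' z)).
Proof. by move=> mu' mw mw'; apply: measurable_crossing_path; meas. Qed.

Let densityE v : 0 < v < 1 -> crossing_density a (- a) 1 0 v =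
  expR (- (a ^+ 2 / 2)) * heat 1 0 * return_density a (1 - v).
Proof.
move=> /andP[v0 v1]; have u0 : 0 < 1 - v by rewrite subr_gt0.
rewrite return_densityE; last by lra.
rewrite subKr /crossing_density hitE; set u := 1 - v in u0 *.
have vE : v = 1 - u by rewrite /u; ring.
have hE : a + - a * v = a * u by rewrite /u; ring.
rewrite hE /heat expr0n/= !mul0r !oppr0 !expR0 !mulr1 sqrtr1 invr1 mulr1.
have e : - a * (a * u) - (- a) ^+ 2 * v / 2 + - ((a * u) ^+ 2 / (2 * v)) =
    - (a ^+ 2 / 2) + - (a ^+ 2 * u / (2 * v)).
  by rewrite /u; field; rewrite gt_eqF.
have := congr1 expR e; rewrite !expRD.
move: (expR _) (expR _) (expR _) (expR _) (expR _) => e1 e2 e3 e4 e5 ee.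
have p0 : Num.sqrt (2 * pi) != 0 :> R by rewrite gt_eqF ?sqrt2pi_gt0.
have su : Num.sqrt u != 0 by rewrite gt_eqF ?sqrtr_gt0.
have sv : Num.sqrt v != 0 by rewrite gt_eqF ?sqrtr_gt0.
transitivity ((Num.sqrt (2 * pi))^-1 / Num.sqrt u / u * (a * u / v) *
  ((Num.sqrt (2 * pi))^-1 / Num.sqrt v) * (e5 * e4 * e3)); first by ring.
by rewrite ee; field; rewrite p0 su sv !gt_eqF.
Qed.

(** [first_passage_law] with [q = 0], since a path ending at [- a] has to return, and with the
    remaining time [v] replaced by [u = 1 - v]. *)
Lemma drifting_law (F : cpath R -> \bar R) : meas_fun F -> (forall w, 0 <= F w)%E ->
  (\int[beta3]_w F (drifting_path w) = \int[mu]_(u in `]0%R, 1%R[) ((return_density a u)%:E *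
     \int[beta3]_w \int[beta3]_w' F (return_path u w w')))%E.
Proof.
move=> mF F0; set k := expR (- (a ^+ 2 / 2)) * heat 1 0.
have k_gt0 : 0 < k by rewrite mulr_gt0 ?expR_gt0 ?heat_gt0.
have l01 : 0 < (1 : R) <= 1 by rewrite ltr01 lexx.
have hr : a + - a * 1 = 0 :> R by ring.
have aN : - a < 0 by rewrite oppr_lt0.
have H s : tests 1 s -> le1 s ->
  (k%:E * \int[beta3]_w (prodt 1 s (lower a (- a) 1 (bes 0 1 w)))%:E =
   0%:E * \int[beta3]_w (prodt 1 s (bes 0 1 w))%:E + \int[mu]_v crossing a (- a) bessel v s 1 0)%E.
  move=> ts hs; rewrite mul0e add0e -(first_passage_bessel ltr01 hr aN ts).
  rewrite -(bes_chain hbeta l01 (lexx 0) (tests_shift a (- a) ts) (le1_shift a (- a) hs)).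
  rewrite muleA -EFinM divr1 mulr1 sqrrN.
  by under eq_integral do rewrite (prodt_lower a (- a) _ l01 (lexx 1) ts).
have q0c : (0 : R) != 0 -> a = 0 by rewrite eqxx.
have X0 : 0 = 0 + (a + - a * 1) :> R by rewrite hr addr0.
have := first_passage_law hbeta l01 (lexx 0) (lexx 0) h_gt0 q0c (ltW k_gt0) (lexx 0) X0 H mF F0.
rewrite mul0e add0e => E.
pose I u : \bar R := (\int[beta3]_w \int[beta3]_w' F (return_path u w w'))%E.
have I0 u : (0 <= I u)%E by apply: integral_ge0 => w _; exact: integral_ge0.
have mI : meas_fun I.
  by apply: (measurableT_comp (measurable_crossing_mean beta a (- a) 1 0 mF F0)); meas.
pose f u : \bar R := if 0 < u < 1 then ((return_density a u)%:E * I u)%E else 0%E.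
have f0 u : (0 <= f u)%E.
  by rewrite /f; case: ifP => // _; rewrite mule_ge0 ?lee_fin ?return_density_ge0// ltW.
have mf : meas_fun f.
  rewrite /f; apply: mfe_if; [exact: measurable_between| |exact: measurable_cst].
  by apply: mfeM => //; apply: mfE; exact: measurable_return_density.
rewrite -integral_if_between -/f.
have : (k%:E * \int[mu]_u f u = k%:E * \int[beta3]_w F (drifting_path w))%E.
  rewrite E -ge0_integralZl// ?lee_fin ?(ltW k_gt0)//.
  rewrite -(integral_reflect 1); last 2 first.
  - exact: mfeM.
  - by move=> u; rewrite mule_ge0 ?lee_fin ?(ltW k_gt0).
  rewrite -integral_if_between; apply: eq_integral => v _.
  rewrite /f (_ : (0 < 1 - v < 1) = (0 < v < 1)); last first.
    by rewrite subr_gt0 gtrBl andbC.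
  case: (boolP (0 < v < 1)) => v01; last exact: mule0.
  by rewrite densityE// -/k muleA -EFinM /I /return_path subKr.
move=> /(congr1 (fun z => (k^-1)%:E * z)%E); rewrite !muleA -EFinM mulVf ?gt_eqF// !mul1e.
by move=> ->.
Qed.

(** First passage decomposition for the line ending at 0: the passages are killed by [F], and what
    is left is the Bessel bridge from [a z]. Its weight [z] is the probability that the lowered
    bridge from [a] stays positive. *)
Lemma survival_law z (F : cpath R -> \bar R) : 0 < z < 1 ->
  meas_fun F -> (forall w, 0 <= F w)%E ->
  (forall (w : cpath R) (t : R), 0 < t < 1 - z -> w t = 0 -> F w = 0%E) ->
  (\int[beta3]_w F (lower 0 a (1 - z) (bes a (1 - z) w)) =
   z%:E * \int[beta3]_w F (bes (a * z) (1 - z) w))%E.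
Proof.
move=> /andP[z0 z1] mF F0 Fv; set l := 1 - z; set x := a * z.
have l0 : 0 < l by rewrite subr_gt0.
have l1 : l <= 1 by rewrite gerBl ltW.
have l01 : 0 < l <= 1 by rewrite l0.
have x0 : 0 < x by rewrite mulr_gt0.
pose e := expR (a * (x + (0 + a * l)) - a ^+ 2 * l / 2).
have xh : x + (0 + a * l) = a by rewrite /x /l; ring.
have eh : e * heat l a = heat l x.
  have := heat_girsanov a a l0; rewrite (_ : a - a * l = x); last by rewrite /x /l; ring.
  by rewrite /e xh mulrC.
set q := heat l x / l.
have q_gt0 : 0 < q by rewrite divr_gt0 ?heat_gt0.
(* The normalization of the lowered bridge, [(a / x) e heat l a / l], equals [q / z] by Girsanov's
   formula and [x = a z]. *)
pose k := q / z; have k_gt0 : 0 < k by rewrite divr_gt0.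
have hv v : 0 < v < l -> 0 < 0 + a * v by move=> /andP[v0 _]; rewrite add0r mulr_gt0.
have H s : tests l s -> le1 s ->
  (k%:E * \int[beta3]_w (prodt l s (lower 0 a l (bes a l w)))%:E =
   q%:E * \int[beta3]_w (prodt l s (bes x l w))%:E + \int[mu]_v crossing 0 a bessel v s l x)%E.
  move=> ts hs.
  have hl : 0 <= 0 + a * l by rewrite add0r mulr_ge0// ltW.
  have := first_passage_chain ts l0 x0 (lexx 0) hl hv.
  rewrite eqxx (chain_shift _ ts); last by rewrite ltr_wpDr.
  rewrite xh.
  have bE y s' : 0 < y -> chain0 s' l y = (y%:E * bessel s' l y)%E.
    by move=> y0; rewrite /bessel y0 muleA -EFinM mulfV ?gt_eqF// mul1e.
  rewrite !bE//.
  rewrite -(bes_chain hbeta l01 (ltW a0) (tests_shift 0 a ts) (le1_shift 0 a hs)).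
  rewrite -(bes_chain hbeta l01 (ltW x0) ts hs).
  have -> : (\int[mu]_v crossing 0 a chain0 v s l x =
      x%:E * \int[mu]_v crossing 0 a bessel v s l x)%E.
    rewrite -ge0_integralZl//.
    - apply: eq_integral => v _; rewrite /crossing muleA; congr (_ * _)%E.
      by rewrite /bessel x0 muleA -EFinM mulfV ?gt_eqF// mul1e.
    - by apply: measurable_crossing_bessel; meas.
    - move=> v _; have [vl|vl] := leP v l.
        apply: crossing_ge0 => // s' ts'; apply: bessel_ge0 ts'.
        by rewrite subr_ge0.
      by rewrite (crossing_out _ _ _ ts)// => /andP[_]; rewrite ltNge (ltW vl).
    - by rewrite lee_fin ltW.
  have cr0 : (0 <= \int[mu]_v crossing 0 a bessel v s l x)%E.
    apply: integral_ge0 => v _; have [vl|vl] := leP v l.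
      apply: crossing_ge0 => // s' ts'; apply: bessel_ge0 ts'.
      by rewrite subr_ge0.
    by rewrite (crossing_out _ _ _ ts)// => /andP[_]; rewrite ltNge (ltW vl).
  have pr0 : (0 <= \int[beta3]_w (prodt l s (bes x l w))%:E)%E.
    by apply: integral_ge0 => w _; rewrite lee_fin (prodt_ge0 _ _ ts).
  rewrite -ge0_muleDr ?mule_ge0 ?lee_fin ?(ltW q_gt0)// => E.
  have := congr1 (fun z => (x^-1)%:E * z)%E E; rewrite !muleA -!EFinM mulVf ?gt_eqF// mul1e => <-.
  under eq_integral do rewrite (prodt_lower 0 a _ l01 (lexx l) ts).
  suff -> : k = x^-1 * expR (a * a - a ^+ 2 * l / 2) * a * (heat l a / l) by [].
  by rewrite /k /q -eh /e xh /x; field; rewrite !gt_eqF.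
have qc0 : q != 0 -> 0 = 0 :> R by [].
have := first_passage_law hbeta l01 (ltW x0) (ltW q_gt0) hv qc0 (ltW k_gt0) (ltW a0) (esym xh) H mF F0.
rewrite [X in (_ + X)%E]integral0_eq ?adde0; last first.
  move=> v /=; rewrite in_itv/= => vl; have /andP[v0 vl'] := vl.
  rewrite integral0_eq ?mule0// => w _; rewrite integral0_eq// => w' _.
  apply: (Fv _ (l - v)); first by rewrite -/l subr_gt0 vl'/= gtrBl.
  rewrite /crossing_path glue_after//.
  - rewrite subrr bes_start; last by rewrite ltW// hv.
    by rewrite subKr subrr.
  - by move=> u lu; rewrite bes_end// subr_gt0.
  - by rewrite lexx/= gerBl ltW.
move=> /(congr1 (fun A : \bar R => (k^-1)%:E * A)%E); rewrite !muleA -!EFinM mulVf ?gt_eqF// mul1e => ->.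
suff -> : k^-1 * q = z by [].
by rewrite /k; field; rewrite !gt_eqF.
Qed.

Lemma integral_return_density : (\int[mu]_(u in `]0%R, 1%R[) (return_density a u)%:E = 1)%E.
Proof.
have := @drifting_law (fun=> 1%E) (measurable_cst _) (fun=> lee01).
rewrite integral_probability_cst => /esym <-; apply: eq_integral => u _.
by rewrite !integral_probability_cst mule1.
Qed.

End with_bridge.

Let J a : \bar R := (\int[mu]_(s in `[a, +oo[) (expR (- (s ^+ 2 / 2)))%:E)%E.

Let JE a : (J a = (Num.sqrt (2 * pi))%:E * \int[mu]_(y in `[0%R, +oo[) (heat 1 (y + a))%:E)%E.
Proof.
have m1 : meas_fun (fun y : R => (heat 1 y)%:E) by heat_meas.
pose f (s : R) : \bar R := if a <= s then (expR (- (s ^+ 2 / 2)))%:E else 0%E.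
have mf : meas_fun f.
  apply: mfe_if; [|by meas|exact: measurable_cst].
  by apply: mf_le; [exact: measurable_cst|exact: measurable_id].
have f0 y : (0 <= f y)%E by rewrite /f; case: ifP; rewrite ?lee_fin ?expR_ge0.
transitivity (\int[mu]_s f s)%E.
  rewrite (@integral_supp _ `[a, +oo[%classic)//; last first.
    by move=> s /=; rewrite in_itv/= andbT /f => /negP/negbTE ->.
  by apply: eq_integral => s; rewrite inE/= in_itv/= andbT /f => ->.
rewrite -(integral_shift a mf f0) -ge0_integralZl//; last 2 first.
- by apply: measurable_funTS; heat_meas.
- by move=> y _; rewrite lee_fin heat_ge0.
rewrite (@integral_supp _ `[0, +oo[%classic)//; last first.
  by move=> y /=; rewrite in_itv/= andbT /f lerDr => /negP/negbTE ->.
apply: eq_integral => y; rewrite inE/= in_itv/= andbT /f lerDr => ->.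
rewrite -EFinM /heat sqrtr1 invr1 mulr1 mulrA mulfV ?mul1r ?gt_eqF ?sqrt2pi_gt0//.
by rewrite mulr1.
Qed.

(** Up to a constant the integrand is [heat u 0 * heat (1 - u) a]. Writing [heat v a] as the
    integral of [hit v] over heights above [a] makes the convolution explicit, and a Gaussian tail
    remains. *)
Lemma integral_return_defect a : 0 < a ->
  (\int[mu]_(u in `]0%R, 1%R[) ((1 - u) * return_density a u)%:E =
   (a * expR (a ^+ 2 / 2))%:E * J a)%E.
Proof.
move=> a0.
have hE v : 0 < v -> ((heat v a)%:E = \int[mu]_(y in `[0%R, +oo[) (hit v (y + a))%:E)%E.
  move=> v0.
  have d0 (y : R) : isder y (fun y => y + a) 1.
    by apply: (der_eq (der_D (der_id y) (der_cst a y))); rewrite addr0.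
  have dh y := @der_comp R (heat v) (fun y => y + a) y _ _ (der_heat v (y + a)) (d0 y).
  have df y : isder y (fun y => hit v (y + a)) ((1 / v) * heat v (y + a) +
      ((y + a) / v) * (- ((y + a) / v) * heat v (y + a))).
    have d2 := der_M (der_M (d0 y) (der_cst v^-1 y)) (dh y).
    by apply: (der_eq d2); rewrite /=; ring.
  have dF y : isder y (fun y => - heat v (y + a)) (hit v (y + a)).
    by apply: (der_eq (der_N (dh y))); rewrite hitE; ring.
  have f0 y : 0 <= y -> 0 <= hit v (y + a) by move=> y0; rewrite hit_ge0// addr_ge0// ltW.
  have l0 : - heat v (y + a) @[y --> +oo] --> - (0 : R).
    by apply: cvgN; have := cvg_heaty (- a) v0; under eq_fun do rewrite opprK; exact.
  rewrite (integral_FTCy f0 (fun y => der_continuous (df y)) dF l0).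
  by rewrite add0r opprK oppr0 add0r.
have K (u : R) : 0 < u < 1 -> (1 - u) * return_density a u =
    a * Num.sqrt (2 * pi) * expR (a ^+ 2 / 2) * (heat u 0 * heat (1 - u) a).
  move=> u01; have /andP[u0 u1] := u01; have v0 : 0 < 1 - u by rewrite subr_gt0.
  rewrite return_densityE// /heat expr0n/= mul0r oppr0 expR0 mulr1.
  have e : a ^+ 2 / 2 + - (a ^+ 2 / (2 * (1 - u))) = - (a ^+ 2 * u / (2 * (1 - u))).
    by field; rewrite gt_eqF.
  rewrite -e expRD; move: (expR _) (expR _) => e1 e2.
  have p0 : Num.sqrt (2 * pi) != 0 :> R by rewrite gt_eqF ?sqrt2pi_gt0.
  have su : Num.sqrt u != 0 by rewrite gt_eqF ?sqrtr_gt0.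
  have sv : Num.sqrt (1 - u) != 0 by rewrite gt_eqF ?sqrtr_gt0.
  by field; rewrite p0 su sv gt_eqF.
set c := a * Num.sqrt (2 * pi) * expR (a ^+ 2 / 2) in K.
have c0 : 0 <= c by rewrite !mulr_ge0 ?expR_ge0// ltW.
transitivity (c%:E * \int[mu]_u (heat u 0 * heat (1 - u) a)%:E)%E.
  rewrite -ge0_integralZl//; last 2 first.
  - by heat_meas.
  - by move=> u _; rewrite lee_fin mulr_ge0 ?heat_ge0.
  rewrite (@integral_supp _ `]0, 1[%classic)//; last first.
    move=> u /=; rewrite in_itv/= => /negP; rewrite negb_and -!leNgt => /orP[u0|u1].
      by rewrite (heat_le0 _ u0) mul0r mule0.
    by rewrite (@heat_le0 _ (1 - u))// ?subr_le0// mulr0 mule0.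
  by apply: eq_integral => u; rewrite inE/= in_itv/= => u01; rewrite K// EFinM.
have -> : (\int[mu]_u (heat u 0 * heat (1 - u) a)%:E =
    \int[mu]_(y in `[0%R, +oo[) (heat 1 (y + a))%:E)%E.
  pose f (u y : R) : \bar R := if 0 <= y then (heat u 0 * hit (1 - u) (y + a))%:E else 0%E.
  have f0 u y : (0 <= f u y)%E.
    by rewrite /f; case: ifP => // y0; rewrite lee_fin mulr_ge0 ?heat_ge0// hit_ge0// addr_ge0// ltW.
  have mf : meas_fun (fun z : R * R => f z.1 z.2).
    by rewrite /f; apply: mfe_if; [apply: mf_le| |]; heat_meas.
  transitivity (\int[mu]_u \int[mu]_y f u y)%E.
    apply: eq_integral => u _.
    have [u1|u1] := leP 1 u.
      rewrite (@heat_le0 _ (1 - u)) ?subr_le0// mulr0 integral0_eq// => y _.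
      by rewrite /f hit_le0 ?subr_le0// mulr0 if_same.
    rewrite EFinM hE ?subr_gt0// -ge0_integralZl//; last 3 first.
    - by apply: measurable_funTS; heat_meas.
    - by move=> y /=; rewrite in_itv/= andbT => y0; rewrite lee_fin hit_ge0// addr_ge0// ltW.
    - by rewrite lee_fin heat_ge0.
    rewrite [RHS](@integral_supp _ `[0, +oo[%classic)//; last first.
      by move=> y /=; rewrite in_itv/= andbT /f => /negP/negbTE ->.
    by apply: eq_integral => y; rewrite inE/= in_itv/= andbT /f => ->; rewrite EFinM.
  rewrite (tonelli mu mu f mf f0).
  rewrite (@integral_supp _ `[0, +oo[%classic)//; last first.
    move=> y /=; rewrite in_itv/= andbT => /negP/negbTE y0.
    by rewrite integral0_eq// => u _; rewrite /f y0.
  apply: eq_integral => y; rewrite inE/= in_itv/= andbT => y0.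
  have ay : 0 < y + a by rewrite ltr_wpDl.
  have := integral_heat_hit ay (lexx 0) ltr01; rewrite addr0 => <-.
  by apply: eq_integral => u _; rewrite /f y0.
by rewrite JE muleA -EFinM; congr (_%:E * _)%E; rewrite /c; ring.
Qed.

(** Origin of [c_const]: total mass 1 minus the mean of [1 - u]. It is positive because the
    integrand is. *)
Lemma integral_return_mean (beta : probability (cpath R) R) a :
  brownian_bridge beta 0 0 1 id -> 0 < a ->
  (\int[mu]_(u in `]0%R, 1%R[) (u * return_density a u)%:E = (c_const (- a))%:E)%E /\
  0 < c_const (- a).
Proof.
move=> hbeta a0; have I1 := integral_return_density hbeta a0.
have I2 := integral_return_defect a0.
have g0 u : 0 <= return_density a u by rewrite return_density_ge0// ltW.
have md := measurable_return_density a.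
have I12 : (\int[mu]_(u in `]0%R, 1%R[) (u * return_density a u)%:E +
    \int[mu]_(u in `]0%R, 1%R[) ((1 - u) * return_density a u)%:E = 1)%E.
  rewrite -ge0_integralD//; last 4 first.
  - by move=> u /=; rewrite in_itv/= => /andP[u0 _]; rewrite lee_fin mulr_ge0// ltW.
  - by apply: measurable_funTS; apply: mfE; apply: mfM => //; meas.
  - by move=> u /=; rewrite in_itv/= => /andP[_ u1]; rewrite lee_fin mulr_ge0// subr_ge0 ltW.
  - by apply: measurable_funTS; apply: mfE; apply: mfM => //; meas.
  by rewrite -I1; apply: eq_integral => u _; rewrite -EFinD; congr EFin; ring.
have u0 : (0 <= \int[mu]_(u in `]0%R, 1%R[) (u * return_density a u)%:E)%E.
  by apply: integral_ge0 => u /=; rewrite in_itv/= => /andP[h _]; rewrite lee_fin mulr_ge0// ltW.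
have J0 : (0 <= J a)%E by apply: integral_ge0 => s _; rewrite lee_fin expR_ge0.
have k0 : 0 < a * expR (a ^+ 2 / 2) by rewrite mulr_gt0 ?expR_gt0.
have Jfin : J a \is a fin_num.
  rewrite ge0_fin_numE//; rewrite ltey; apply/eqP => Joo; move: I12.
  by rewrite I2 Joo gt0_muley ?lte_fin// addey// gt_eqF// (lt_le_trans _ u0)// ltNye.
have cE : c_const (- a) = 1 - a * expR (a ^+ 2 / 2) * fine (J a).
  by rewrite /c_const normrN gtr0_norm// sqrrN.
have IE : (\int[mu]_(u in `]0%R, 1%R[) (u * return_density a u)%:E = (c_const (- a))%:E)%E.
  move: I12; rewrite I2 -[J a]fineK// -EFinM cE => h.
  have := congr1 (fun z => z - (a * expR (a ^+ 2 / 2) * fine (J a))%:E)%E h.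
  by rewrite /= addeK.
split => //; rewrite lt_neqAle -lee_fin -IE u0 andbT.
apply/negP => /eqP c0; move: IE; rewrite -c0 => I0.
have mug : measurable_fun (`]0, 1[%classic : set R) (fun u : R => (u * return_density a u)%:E).
  by apply: measurable_funTS; apply: mfE; apply: mfM => //; meas.
have : (\int[mu]_(u in `]0%R, 1%R[) `|(u * return_density a u)%:E| = 0)%E.
  rewrite -[RHS]I0; apply: eq_integral => u; rewrite inE/= in_itv/= => /andP[h _].
  by rewrite /= ger0_norm// mulr_ge0// ltW.
move=> /(ae_eq_integral_abs mu (measurable_itv _) mug) [N [mN N0 sub]].
have : (mu (`]0%R, 1%R[)%classic <= mu N)%E.
  apply: le_measure; rewrite ?inE//; apply: subset_trans sub => u /= u01 h.
  have [ ] := h u01; apply/eqP; rewrite gt_eqF//.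
  move: u01; rewrite in_itv/= => u01; have /andP[u0' _] := u01.
  by rewrite mulr_gt0// return_density_gt0.
by rewrite N0 lebesgue_measure_itv/= lte_fin ltr01 oppr0 adde0 lee_fin ler10.
Qed.

End drifting_excursion.

(** * Bessel bridges are positive inside their interval *)

Section positivity.
Context {R : realType}.
Implicit Types (l r x y rho : R) (s : seq (R * (R -> R))).
Notation P3 := (cpath R * cpath R * cpath R)%type.

Lemma integral_k0_le1 r x rho : rho < r -> (\int[mu]_y (k0 r x rho y)%:E <= 1)%E.
Proof.
move=> rr; have t0 : 0 < r - rho by rewrite subr_gt0.
rewrite -(integral_heat x t0); apply: ge0_le_integral => //.
- by move=> y _; rewrite lee_fin k0_ge0.
- by apply: mfE; apply: mk0; meas.
- by heat_meas.
- by move=> y _; rewrite lee_fin heatBC; exact: killed_le.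
Qed.

Lemma heat0_le (d t : R) : 0 < d -> d <= t -> heat t 0 <= heat d 0.
Proof.
move=> d0 dt; have t0 := lt_le_trans d0 dt.
rewrite /heat expr0n/= !mul0r !oppr0 !expR0 !mulr1 ler_wpM2l// lef_pV2 ?posrE ?sqrtr_gt0//.
by rewrite ler_wsqrtr.
Qed.

Lemma hit'_le (d e t y : R) : 0 < d -> d <= t -> 0 <= e -> y <= e -> hit' t y <= e / d * heat d 0.
Proof.
move=> d0 dt e0 ye; have t0 := lt_le_trans d0 dt.
rewrite /hit'; case: ifPn => y0; last by rewrite mulr_ge0 ?heat_ge0// divr_ge0// ltW.
rewrite hitE ler_pM ?heat_ge0 ?divr_ge0 ?(ltW y0) ?(ltW t0)//.
  by rewrite ler_pM ?invr_ge0 ?(ltW y0) ?(ltW t0)// lef_pV2.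
exact: le_trans (heat_le t y) (heat0_le d0 dt).
Qed.

Lemma integral_bessel_start_pos r x rho : 0 < x -> rho < r ->
  (\int[mu]_y (bessel_start r x rho y)%:E <= (x^-1)%:E)%E.
Proof.
move=> x0 rr; rewrite /bessel_start x0; under eq_integral do rewrite EFinM.
rewrite ge0_integralZl//.
- by rewrite -[leRHS]mule1 lee_wpmul2l ?lee_fin ?invr_ge0 ?(ltW x0)//; exact: integral_k0_le1.
- by apply: mfE; apply: mk0; meas.
- by move=> y _; rewrite lee_fin k0_ge0.
- by rewrite lee_fin invr_ge0 ltW.
Qed.

Lemma integral_bessel_start_le (d : R) r x rho : 0 < d -> d <= r - rho ->
  (\int[mu]_y (bessel_start r x rho y)%:E <= (if 0 < x then x^-1 else 2 * heat d 0)%:E)%E.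
Proof.
move=> d0 dr; have rr : rho < r by rewrite -subr_gt0 (lt_le_trans d0).
have [x0|x0] := ltP 0 x; first exact: integral_bessel_start_pos.
rewrite /bessel_start ltNge x0/=.
set t := r - rho in dr *; have t0 := lt_le_trans d0 dr.
have -> : (\int[mu]_y (2 * hit' t y)%:E = (2 * heat t 0)%:E)%E; last first.
  by rewrite lee_fin ler_wpM2l// heat0_le.
transitivity ((2 / t)%:E * \int[mu]_(y in `[0%R, +oo[) (y * heat t y)%:E)%E; last first.
  by rewrite integral_half_mul_heat// -EFinM; congr EFin; field; rewrite gt_eqF.
rewrite -ge0_integralZl//; last 3 first.
- by apply: measurable_funTS; heat_meas.
- by move=> y /=; rewrite in_itv/= andbT => y0; rewrite lee_fin mulr_ge0 ?heat_ge0.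
- by rewrite lee_fin divr_ge0// ltW.
rewrite (@integral_supp _ `[0, +oo[%classic)//; last first.
  move=> y /=; rewrite in_itv/= andbT => /negP; rewrite -ltNge => y0.
  by rewrite /hit' ltNge (ltW y0)/= mulr0.
apply: eq_integral => y; rewrite inE/= in_itv/= andbT le_eqVlt => /predU1P[<-|y0].
  by rewrite /hit' ltxx mulr0 mul0r mule0.
by rewrite hit'E// hitE -EFinM; congr EFin; ring.
Qed.

Lemma bessel_start_npos r x rho y : y <= 0 -> bessel_start r x rho y = 0.
Proof.
move=> y0; rewrite /bessel_start; case: ifP => _; first by rewrite /k0 killed_npos// mulr0.
by rewrite /hit' ltNge y0 mulr0.
Qed.

Section grid_bound.
Variables (beta : probability (cpath R) R).
Hypothesis hbeta : brownian_bridge beta 0 0 1 id.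
Notation beta3 := (beta3 beta).

(** A Chapman-Kolmogorov relation read off [bes_chain] with a weight equal to 1, instead of a
    computation. *)
Lemma bessel_chapman r x rho : 0 < rho < r -> r <= 1 -> 0 <= x ->
  (\int[mu]_y (bessel_start r x rho y * hit' rho y)%:E = (heat r x / r)%:E)%E.
Proof.
move=> rr r1 x0; have /andP[rho0 rr'] := rr.
have r0 : 0 < r <= 1 by rewrite (lt_trans rho0).
have ts : tests r [:: (rho, fun=> 1)] by [].
have hs : @le1 R [:: (rho, fun=> 1)] by split.
have := bes_chain hbeta r0 x0 ts hs.
rewrite bessel_cons//=; under eq_integral do rewrite prodt_cons prodt_nil/= mulr1.
rewrite integral_probability_cst mule1 => ->.
by apply: eq_integral => y _; rewrite mulr1 EFinM.
Qed.

Variables (d e : R).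
Hypotheses (d0 : 0 < d) (e0 : 0 <= e).
Let B := e / d * heat d 0.

Let B0 : 0 <= B. Proof. by rewrite mulr_ge0 ?heat_ge0// divr_ge0// ltW. Qed.

(** Weights that can only detect values at most [e], at remaining times at least [d]. *)
Fixpoint one_above s : Prop :=
  if s is p :: s' then [/\ d <= p.1, forall y, e < y -> p.2 y = 1 & one_above s'] else True.

Let step (K : R -> R) rho (f : R -> R) s : (forall y, 0 <= K y) -> (forall y, y <= 0 -> K y = 0) ->
  meas_fun K -> meas_fun f -> (forall y, 0 <= f y) -> tests rho s ->
  d <= rho -> (forall y, e < y -> f y = 1) ->
  (forall y, (0 < y)%R -> (hit' rho y)%:E <= chain0 s rho y + B%:E)%E ->
  (\int[mu]_y (K y * hit' rho y)%:E <=
   \int[mu]_y ((K y * f y)%:E * chain0 s rho y) + B%:E * \int[mu]_y (K y)%:E)%E.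
Proof.
move=> K0 Kn mK mf f0 ts dr f1 IH.
have C0 y : (0 <= chain0 s rho y)%E by exact: chain_killed_ge0 ts.
have mC : meas_fun (fun y : R => chain0 s rho y).
  by apply: (measurable_chain_killed ts); meas.
have mKf : meas_fun (fun y : R => (K y * f y)%:E) by apply: mfE; exact: mfM.
rewrite -ge0_integralZl//; last 2 first.
- exact: mfE.
- by move=> y _; rewrite lee_fin.
rewrite -ge0_integralD//; last 4 first.
- by move=> y _; rewrite mule_ge0 ?lee_fin ?mulr_ge0.
- exact: mfeM.
- by move=> y _; rewrite mule_ge0 ?lee_fin.
- by meas.
apply: ge0_le_integral => //.
- by move=> y _; rewrite lee_fin mulr_ge0 ?hit'_ge0.
- by apply: mfE; apply: mfM => //; apply: mhit'; meas.
- by apply: mfeD; [exact: mfeM|apply: mfeM => //; exact: mfE].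
move=> y _; have [y0|y0] := leP y 0; first by rewrite Kn// !mul0r mul0e mule0 adde0.
have [ye|ye] := leP y e.
  apply: (@le_trans _ _ (B%:E * (K y)%:E)%E).
    by rewrite -EFinM lee_fin [leLHS]mulrC ler_wpM2r// hit'_le.
  by rewrite leeDr// mule_ge0 ?lee_fin ?mulr_ge0.
rewrite f1// mulr1 -EFinM [B * _]mulrC [in X in (_ + X)%E]EFinM -ge0_muleDr//.
by rewrite EFinM lee_wpmul2l ?lee_fin//; exact: IH.
Qed.

(** [hit'] is preserved by the killed kernels, and it is at most [B] at heights up to [e] and
    remaining times at least [d]. As in a maximal inequality, the loss is counted at the first low
    value, so it is at most [B] whatever the number of tests. *)
Lemma chain_one_above s r x : tests r s -> one_above s -> r <= 1 -> 0 < x ->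
  ((hit' r x)%:E <= chain0 s r x + B%:E)%E.
Proof.
elim: s r x => [|[rho f] s IH] r x ts; first by move=> _ _ _; rewrite /= leeDl ?lee_fin.
move: (ts) => /= [/andP[rho0 rr] mf f0 ts'] [dr f1 hs] r1 x0.
have rho1 : rho <= 1 by rewrite (le_trans (ltW rr)).
have H := step (fun y => bessel_start_ge0 r x rho y) (fun y h => bessel_start_npos r x rho h)
  (measurable_bessel_start r x rho) mf f0 ts' dr f1 (fun y h => IH rho y ts' hs rho1 h).
have rr' : 0 < rho < r by rewrite rho0.
move: H; rewrite (bessel_chapman rr' r1 (ltW x0)) -bessel_cons// => H.
rewrite -/(chain0 ((rho, f) :: s) r x).
have -> : chain0 ((rho, f) :: s) r x = (x%:E * bessel ((rho, f) :: s) r x)%E.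
  by rewrite /bessel x0 muleA -EFinM mulfV ?gt_eqF// mul1e.
have -> : hit' r x = x * (heat r x / r) by rewrite hit'E// hitE; ring.
have be0 : (0 <= bessel ((rho, f) :: s) r x)%E by rewrite bessel_ge0// (le_trans (ltW rho0))// ltW.
have -> : B = x * (B * x^-1) by rewrite mulrCA mulfV ?mulr1// gt_eqF.
rewrite EFinM [in X in (_ + X)%E]EFinM -ge0_muleDr//; last by rewrite lee_fin divr_ge0// ltW.
rewrite lee_wpmul2l ?lee_fin ?(ltW x0)//; apply: le_trans H _.
by rewrite leeD2l// [(B * _)%:E]EFinM lee_wpmul2l ?lee_fin//; exact: integral_bessel_start_pos.
Qed.

(** From 0, the mass of the first kernel is controlled only after a time [d], whence the condition
    on the first test. *)
Lemma bessel_one_above s r x : tests r s -> one_above s -> r <= 1 -> 0 <= x ->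
  (if s is p :: _ then p.1 <= r - d else True) ->
  ((heat r x / r)%:E <= bessel s r x + (B * (if (0 < x)%R then x^-1 else 2 * heat d 0))%:E)%E.
Proof.
case: s => [|[rho f] s] ts hs r1 x0 hr.
  have := bes_chain hbeta; have [r0|r0] := leP r 0.
    move=> _; rewrite heat_le0// mul0r adde_ge0//.
      rewrite /bessel; case: ifP => _ /=; first by rewrite /hit' hit_le0// if_same mule0.
      by rewrite heat_le0// mul0r.
    by rewrite lee_fin mulr_ge0//; case: ifP => [/ltW|_]; rewrite ?invr_ge0// mulr_ge0 ?heat_ge0.
  move=> /(_ [::] r x); rewrite r0 r1/= => /(_ isT x0 I I) <-.
  under eq_integral do rewrite prodt_nil; rewrite integral_probability_cst mule1 leeDl//.
  by rewrite lee_fin mulr_ge0//; case: ifP => [/ltW|_]; rewrite ?invr_ge0// mulr_ge0 ?heat_ge0.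
move: (ts) hs => /= [/andP[rho0 rr] mf f0 ts'] [dr f1 hs].
have rho1 : rho <= 1 by rewrite (le_trans (ltW rr)).
have H := step (fun y => bessel_start_ge0 r x rho y) (fun y h => bessel_start_npos r x rho h)
  (measurable_bessel_start r x rho) mf f0 ts' dr f1 (fun y h => chain_one_above ts' hs rho1 h).
have rr' : 0 < rho < r by rewrite rho0.
move: H; rewrite (bessel_chapman rr' r1 x0) -bessel_cons// => H.
apply: le_trans H _; rewrite leeD2l// [(B * _)%:E]EFinM lee_wpmul2l ?lee_fin//.
by apply: integral_bessel_start_le => //; move: hr => /=; lra.
Qed.

End grid_bound.

Lemma tests_weaken r r' s : r <= r' -> tests r s -> tests r' s.
Proof.
case: s => // -[rho f] s rr /= [/andP[h1 h2] ? ? ?]; split => //.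
by rewrite h1 (lt_le_trans h2).
Qed.

Lemma tests_filter (b : pred (R * (R -> R))) r s : tests r s -> tests r (seq.filter b s).
Proof.
elim: s r => // -[rho f] s IH r /= [rr mf f0 ts]; case: ifP => _ /=.
  by split => //; exact: IH.
by apply: (@tests_weaken rho); [have /andP[_ /ltW] := rr|exact: IH].
Qed.

Section bessel_positive.
Variables (beta : probability (cpath R) R) (l x : R).
Hypotheses (hbeta : brownian_bridge beta 0 0 1 id) (l01 : 0 < l <= 1) (x0 : 0 <= x).
Notation beta3 := (beta3 beta).
Let h := heat l x / l.
Let M (d : R) := if 0 < x then x^-1 else 2 * heat d 0.

Let l0 : 0 < l. Proof. by have /andP[] := l01. Qed.
Let l1 : l <= 1. Proof. by have /andP[] := l01. Qed.
Let h0 : 0 < h. Proof. by rewrite divr_gt0 ?heat_gt0. Qed.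

(** Indicators of values above [e] at the grid times at distance at least [d] from both ends. *)
Let inner_tests (d e : R) n :=
  seq.filter (fun p : R * (R -> R) => d <= p.1 <= l - d) (grid_tests l n (fun=> `]e, +oo[%classic)).

Let tests_inner d e n : tests l (inner_tests d e n).
Proof. by apply: tests_filter; apply: tests_grid => //= _; exact: measurable_itv. Qed.

Let le1_inner d e n : le1 (inner_tests d e n).
Proof. by apply: le1_filter; exact: le1_grid. Qed.

Let above_inner d e n : one_above d e (inner_tests d e n) /\
  (if inner_tests d e n is p :: _ then p.1 <= l - d else True).
Proof.
rewrite /inner_tests /grid_tests; elim: [seq k <- iota 1 (2 ^ n) | _] => //= k r [IH1 IH2].
case: ifPn => // /andP[h1 h2]; split => //=; split => // y ey.
by rewrite indicE mem_set//= in_itv/= ey.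
Qed.

(** The probability is at most the mean of [1 - p], where [p] is the product of the tests. The bound
    is linear in [e] and independent of [n]. *)
Let prob_vanish d e n : 0 < d -> 0 <= e ->
  (beta3 [set w | prodt l (inner_tests d e n) (bes x l w) = 0%R] <=
   (e * ((d^-1 * heat d 0) * M d / h))%:E)%E.
Proof.
move=> d0 e0; set s := inner_tests d e n; set D := [set w | _].
have ts : tests l s by exact: tests_inner.
have hs : le1 s by exact: le1_inner.
have [ho hf] := above_inner d e n.
pose p w := prodt l s (bes x l w).
have mp : meas_fun p.
  by apply: (measurable_prodt_bes _ _ ts); meas; rewrite lexx.
have p0 w : 0 <= p w by exact: prodt_ge0 ts.
have p1 w : p w <= 1 by exact: prodt_le1 ts hs.
have mD : measurable D.
  rewrite (_ : D = p @^-1` [set 0]); last by [].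
  by apply: measurable_pre => //; exact: measurable_set1.
have m1p : meas_fun (fun w => (1 - p w)%:E) by apply: mfE; apply: mfD => //; exact: mfN.
have le1 : (beta3 D <= \int[beta3]_w (1 - p w)%:E)%E.
  rewrite -[D in beta3 D]setIT -integral_indic//; apply: ge0_le_integral => //.
  - by meas.
  move=> w _; rewrite lee_fin indicE; case: (boolP (w \in D)) => [|_]; last by rewrite subr_ge0.
  by rewrite inE /D/= -/(p w) => ->; rewrite subr0.
have sum1 : (\int[beta3]_w (1 - p w)%:E + \int[beta3]_w (p w)%:E = 1)%E.
  rewrite -ge0_integralD//; last 3 first.
  - by move=> w _; rewrite lee_fin subr_ge0.
  - by move=> w _; rewrite lee_fin.
  - exact: mfE.
  rewrite -[RHS](integral_probability_cst beta3 1); apply: eq_integral => w _.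
  by rewrite -EFinD subrK.
have H := bessel_one_above hbeta d0 e0 ts ho l1 x0 hf.
move: H; rewrite -(bes_chain hbeta l01 x0 ts hs) -/h -/(M d).
set I := (\int[beta3]_w (p w)%:E)%E in sum1; rewrite -/I.
set J := (\int[beta3]_w (1 - p w)%:E)%E in sum1 le1.
have I0 : (0 <= I)%E by apply: integral_ge0 => w _; rewrite lee_fin.
have J0 : (0 <= J)%E by apply: integral_ge0 => w _; rewrite lee_fin subr_ge0.
have [Ifin Jfin] : I \is a fin_num /\ J \is a fin_num.
  rewrite !ge0_fin_numE//; have one : (1 < +oo :> \bar R)%E by rewrite ltry.
  by split; apply: le_lt_trans one; rewrite -sum1 ?leeDl// leeDr.
rewrite -(fineK Ifin) -(fineK Jfin) in sum1; rewrite -(fineK Ifin).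
have {}sum1 : fine J + fine I = 1 by apply: EFin_inj; rewrite EFinD.
rewrite -EFinM -EFinD lee_fin => H; apply: le_trans le1 _.
rewrite -(fineK Jfin) lee_fin -(ler_pM2l h0).
have -> : h * (e * (d^-1 * heat d 0 * M d / h)) = e / d * heat d 0 * M d.
  by field; rewrite !gt_eqF.
have : h * fine J + h * fine I = h by rewrite -mulrDr sum1 mulr1.
lra.
Qed.

Let vanish_near d e w : 0 < d -> 0 < e ->
  (exists2 t, 2 * d <= t <= l - 2 * d & bes x l w t <= 0) ->
  exists n0, forall n, (n0 <= n)%N -> prodt l (inner_tests d e n) (bes x l w) = 0.
Proof.
move=> d0 e0 [t /andP[dt tl] wt].
have t01 : 0 <= t <= 1 by apply/andP; split; have := l1; lra.
have c := @cvg_dyad_path R (bes x l w) t t01.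
have c2 := @cvg_dyad R t t01.
have lt_e : bes x l w t < e by exact: le_lt_trans e0.
have E1 : \forall n \near \oo, bes x l w (dyad n t) < e.
  exact: (cvgr_lt _ c _ lt_e).
have E2 : \forall n \near \oo, d < dyad n t by apply: (cvgr_gt _ c2); lra.
have [n0 _ Hn] := filterI E1 E2; exists n0 => n nn0.
have [h1 h2] := Hn n nn0.
have /andP[_ h3] := dyad_itv n t01.
pose k := Num.truncn (t * 2 ^+ n).
have kE : dyad n t = k%:R / 2 ^+ n by [].
have k0 : (0 < k)%N.
  rewrite lt0n; apply/eqP => k0; move: h2; rewrite kE k0 mul0r; apply/negP.
  by rewrite -leNgt ltW.
have p2 : 0 < (2 : R) ^+ n by rewrite exprn_gt0.
have kn : (k <= 2 ^ n)%N.
  rewrite -(ler_nat R) natrX -[leRHS]mul1r -ler_pdivrMr// -kE; have := l1; lra.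
rewrite /prodt /inner_tests /grid_tests big_filter big_map big_filter_cond/=.
apply/eqP; rewrite prodf_seq_eq0; apply/hasP; exists k; first by rewrite mem_iota k0 add1n ltnS.
rewrite -kE subKr indicE memNset ?eqxx ?andbT//=.
  by apply/and3P; split; lra.
by rewrite in_itv/= andbT; apply/negP; rewrite -leNgt ltW.
Qed.

Let measurable_inner d e n : measurable [set w | prodt l (inner_tests d e n) (bes x l w) = 0].
Proof.
have ts : tests l (inner_tests d e n) by exact: tests_inner.
have mp : meas_fun (fun w : P3 => prodt l (inner_tests d e n) (bes x l w)).
  by apply: (measurable_prodt_bes _ _ ts); meas; rewrite lexx.
exact: (measurable_pre mp (measurable_set1 0)).
Qed.

Let near_zero (d : R) : set P3 := [set w | exists2 t, 2 * d <= t <= l - 2 * d & bes x l w t <= 0].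

(** The sets [U e n] increase in [n], so their union still has measure at most [e C]. A path that
    reaches 0 lies in these unions for all [e], hence in a null set. *)
Let prob_near_zero d : 0 < d -> {ae beta3, forall w, ~ near_zero d w}.
Proof.
move=> d0; pose C := (d^-1 * heat d 0) * M d / h.
have C0 : 0 < C.
  have hd := heat_gt0 0 d0; rewrite /C divr_gt0//; apply: mulr_gt0.
    by apply: mulr_gt0 => //; rewrite invr_gt0.
  by rewrite /M; case: (ltP 0 x) => [h'|_]; [rewrite invr_gt0|apply: mulr_gt0].
pose D e n := [set w | prodt l (inner_tests d e n) (bes x l w) = 0].
pose U e n := \bigcap_(m in [set m | (n <= m)%N]) D e m.
have mU e n : measurable (U e n).
  by apply: bigcap_measurable => [|m _]; [exists n => /=|exact: measurable_inner].
have small e : 0 < e -> (beta3 (\bigcup_n U e n) <= (e * C)%:E)%E.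
  move=> e0; have mUU : measurable (\bigcup_n U e n) by exact: bigcupT_measurable.
  have ndU : nondecreasing_seq (U e).
    move=> m n mn; apply/subsetPset => w Uw k /= nk; apply: Uw => /=.
    exact: leq_trans nk.
  have cv := nondecreasing_cvg_mu (mU e) mUU ndU (mu := beta3).
  rewrite -(cvg_lim _ cv)//; apply: lime_le.
    by apply/cvg_ex; exists (beta3 (\bigcup_n U e n)).
  apply: nearW => n /=; apply: le_trans (prob_vanish n d0 (ltW e0)).
  apply: le_measure; rewrite ?inE//.
  by move=> w; apply => /=.
exists (\bigcap_k \bigcup_n U k.+1%:R^-1 n); split.
- by apply: bigcapT_measurable => k; exact: bigcupT_measurable.
- apply/eqP; rewrite eq_le measure_ge0 andbT; apply/lee_addgt0Pr => e e0.
  rewrite add0e; have [k kC] := ltr_add_invr (divr_gt0 e0 C0); rewrite add0r in kC.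
  have k0 : 0 < (k.+1%:R : R)^-1 by rewrite invr_gt0.
  apply: le_trans (le_trans (small _ k0) _).
    apply: le_measure; rewrite ?inE//.
    + by apply: bigcapT_measurable => m; exact: bigcupT_measurable.
    + exact: bigcupT_measurable.
    + exact: bigcap_inf.
  by rewrite lee_fin -ler_pdivlMr// ltW.
- move=> w /= /contrapT nz k _.
  have k0 : 0 < (k.+1%:R : R)^-1 by rewrite invr_gt0.
  have [n0 Hn] := vanish_near d0 k0 nz.
  by exists n0 => // m /= nm; exact: Hn.
Qed.

Lemma bes_positive : {ae beta3, forall w, forall t, 0 < t < l -> 0 < bes x l w t}.
Proof.
have : {ae beta3, forall w, forall k, ~ near_zero (l / 2 / k.+1%:R) w}.
  apply/ae_foralln => k; apply: prob_near_zero.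
  by rewrite !divr_gt0.
apply: filterS => w Hw t /andP[t0 tl]; rewrite ltNge; apply/negP => wt.
have lt0 : 0 < l - t by rewrite subr_gt0.
have [k kt] := ltr_add_invr (divr_gt0 t0 l0); have [k' kt'] := ltr_add_invr (divr_gt0 lt0 l0).
rewrite add0r ltr_pdivlMr// in kt; rewrite add0r ltr_pdivlMr// in kt'.
have hm n m : (n <= m)%N -> (m.+1%:R : R)^-1 * l <= n.+1%:R^-1 * l.
  by move=> nm; rewrite ler_wpM2r ?(ltW l0)// lef_pV2 ?posrE// ler_nat.
have h1 := hm _ _ (leq_maxl k k'); have h2 := hm _ _ (leq_maxr k k').
apply: (Hw (maxn k k')); exists t => //.
have -> : 2 * (l / 2 / (maxn k k').+1%:R) = (maxn k k').+1%:R^-1 * l by field.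
have := le_trans h1 (ltW kt); have := le_trans h2 (ltW kt').
set m := _^-1 * l => h3 h4; apply/andP; split; first exact: h4.
by rewrite lerBrDl -lerBrDr.
Qed.

End bessel_positive.
End positivity.

(** * Decomposition of the Brownian bridge at its minimum *)

Section minimum_decomposition.
Context {R : realType}.
Implicit Types (t u v x y m r rho : R) (s : seq (R * (R -> R))) (i : option R).
Local Open Scope ereal_scope.

Lemma integral_le_lt m (a : R -> \bar R) : meas_fun a -> (forall t, 0 <= a t) ->
  \int[mu]_t (if (t <= m)%R then a t else 0) = \int[mu]_t (if (t < m)%R then a t else 0).
Proof.
move=> ma a0; apply: ge0_ae_eq_integral => //.
- by meas.
- by meas.
- by move=> t _; case: ifP.
- by move=> t _; case: ifP.
exists [set m]; split; [exact: measurable_set1|exact: lebesgue_measure_set1|].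
move=> t /= h; apply: contrapT => tm; apply: h => _.
by rewrite le_eqVlt; have /negbTE -> : t != m by apply/eqP.
Qed.

(** Product rule in integral form: [A B] is the integral of [a B + A b], with [A] and [B] the
    partial integrals. The variable will be a killing level, and differentiation in the level
    produces the density of the minimum. *)
Lemma product_rule (a b : R -> \bar R) : meas_fun a -> meas_fun b ->
  (forall t, 0 <= a t) -> (forall t, 0 <= b t) ->
  (\int[mu]_t a t) * (\int[mu]_t b t) =
  \int[mu]_t (a t * (\int[mu]_u (if (u < t)%R then b u else 0)) +
    (\int[mu]_u (if (u < t)%R then a u else 0)) * b t).
Proof.
move=> ma mb a0 b0.
have mlt (c : R -> \bar R) : meas_fun c ->
    meas_fun (fun z : R * R => if (z.2 < z.1)%R then c z.2 else 0).
  by move=> mc; apply: mfe_if; [by meas|by meas|by meas].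
have mI (c : R -> \bar R) : meas_fun c -> (forall t, 0 <= c t) ->
    meas_fun (fun t => \int[mu]_u (if (u < t)%R then c u else 0)).
  move=> mc c0; apply: (measurable_int_param mu (fun t u => if (u < t)%R then c u else 0)).
    exact: mlt.
  by move=> t u; case: ifP.
have I0 (c : R -> \bar R) t : (forall t, 0 <= c t) -> 0 <= \int[mu]_u (if (u < t)%R then c u else 0).
  by move=> c0; apply: integral_ge0 => u _; case: ifP.
have mltt (c : R -> \bar R) t : meas_fun c -> meas_fun (fun u => if (u < t)%R then c u else 0).
  by move=> mc; apply: mfe_if => //; apply: mf_lt; [exact: measurable_id|exact: measurable_cst].
have mle (c : R -> \bar R) t : meas_fun c -> meas_fun (fun u => if (t <= u)%R then c u else 0).
  by move=> mc; apply: mfe_if => //; apply: mf_le; [exact: measurable_cst|exact: measurable_id].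
have split_b t : \int[mu]_u b u = \int[mu]_u (if (u < t)%R then b u else 0) +
    \int[mu]_u (if (t <= u)%R then b u else 0).
  rewrite -ge0_integralD//; first by apply: eq_integral => u _; case: ltP; rewrite ?addr0 ?adde0 ?add0e.
  - by move=> u _; case: ifP.
  - exact: mltt.
  - by move=> u _; case: ifP.
  - exact: mle.
rewrite -ge0_integralZr//; last exact: integral_ge0.
rewrite ge0_integralD//; last 4 first.
- by move=> t _; rewrite mule_ge0// I0.
- by apply: mfeM => //; exact: mI.
- by move=> t _; rewrite mule_ge0// I0.
- by apply: mfeM => //; exact: mI.
transitivity (\int[mu]_t (a t * (\int[mu]_u (if (u < t)%R then b u else 0)) +
    a t * (\int[mu]_u (if (t <= u)%R then b u else 0)))).
  apply: eq_integral => t _; rewrite (split_b t) ge0_muleDr//; first exact: I0.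
  by apply: integral_ge0 => u _; case: ifP.
have J0 t : 0 <= \int[mu]_u (if (t <= u)%R then b u else 0) by apply: integral_ge0 => u _; case: ifP.
have mJ2 : meas_fun (fun z : R * R => if (z.1 <= z.2)%R then b z.2 else 0).
  by meas.
have mJ : meas_fun (fun t => \int[mu]_u (if (t <= u)%R then b u else 0)).
  apply: (measurable_int_param mu (fun t u => if (t <= u)%R then b u else 0)) => //.
  by move=> t u; case: ifP.
rewrite ge0_integralD//; last 4 first.
- by move=> t _; rewrite mule_ge0// I0.
- by apply: mfeM => //; exact: mI.
- by move=> t _; rewrite mule_ge0.
- exact: mfeM.
congr (_ + _).
transitivity (\int[mu]_t \int[mu]_u (a t * (if (t <= u)%R then b u else 0))).
  apply: eq_integral => t _; rewrite ge0_integralZl//; first exact: mle.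
  by move=> u _; case: ifP.
rewrite (tonelli mu mu (fun t u => a t * (if (t <= u)%R then b u else 0))); last 2 first.
- by meas.
- by move=> t u; rewrite mule_ge0//; case: ifP.
apply: eq_integral => u _; rewrite -integral_le_lt// -ge0_integralZr//; last 2 first.
- by meas.
- by move=> t _; case: ifP.
by apply: eq_integral => t _; case: ifP; rewrite ?mule0 ?mul0e.
Qed.

(* [None] stands for the level at infinity, that is, for the absence of killing. *)
Definition below i t : bool := if i is Some m then (t < m)%R else true.

Lemma measurable_below i : meas_fun (below i).
Proof.
case: i => [m|]; last exact: measurable_cst.
by apply: mf_lt; [exact: measurable_id|exact: measurable_cst].
Qed.

Definition restrict i (g : R -> \bar R) t := if below i t then g t else 0.

Lemma restrict_ge0 i g t : (forall t, 0 <= g t) -> 0 <= restrict i g t.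
Proof. by rewrite /restrict; case: ifP. Qed.

Lemma measurable_restrict i g : meas_fun g -> meas_fun (restrict i g).
Proof. by move=> mg; apply: mfe_if => //; exact: measurable_below. Qed.

Lemma product_rule_restrict i (a b : R -> \bar R) :
  meas_fun a -> meas_fun b ->
  (forall t, 0 <= a t) -> (forall t, 0 <= b t) ->
  (\int[mu]_t restrict i a t) * (\int[mu]_t restrict i b t) =
  \int[mu]_t restrict i (fun t => a t * (\int[mu]_u restrict (Some t) b u) +
    (\int[mu]_u restrict (Some t) a u) * b t) t.
Proof.
move=> ma mb a0 b0; rewrite product_rule//; try exact: measurable_restrict; last 2 first.
- by move=> t; exact: restrict_ge0.
- by move=> t; exact: restrict_ge0.
apply: eq_integral => t _; rewrite {1 4}/restrict.
rewrite /restrict; case: (boolP (below i t)) => [it|_]; last by rewrite mul0e mule0 adde0.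
have E u : (u < t)%R -> below i u by case: i it => //= m tm ut; exact: lt_trans tm.
congr (_ * _ + _ * _); apply: eq_integral => u _ /=; case: ifP => // /E ->; done.
Qed.

(** The Brownian kernel restricted to paths whose minimum exceeds [- m]. *)
Definition level_kernel i t x y : R :=
  if i is Some m then killed t (x + m) (y + m) else heat t (x - y).

(** Density at [m] of minus the minimum between two values, split by the time [v] left when it is
    reached. *)
Definition minimum_kernel t x y m : \bar R :=
  2%:E * \int[mu]_v (hit' (t - v)%R (x + m)%R * hit' v (y + m)%R)%:E.

Lemma minimum_kernelE t x y m : minimum_kernel t x y m =
  (if (0 < x + m)%R && (0 < y + m)%R then 2 * hit t (x + y + 2 * m) else 0)%:E.
Proof.
rewrite /minimum_kernel; case: ifPn => [/andP[x0 y0]|].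
  under eq_integral do rewrite !hit'E// mulrC.
  rewrite integral_hit_hit// -EFinM; congr (_ * hit _ _)%:E; ring.
rewrite negb_and => h; rewrite integral0_eq ?mule0// => v _; rewrite /hit'.
by case/orP: h => /negbTE ->; rewrite ?mul0r ?mulr0.
Qed.

Lemma minimum_kernel_ge0 t x y m : 0 <= minimum_kernel t x y m.
Proof.
rewrite /minimum_kernel mule_ge0//; apply: integral_ge0 => v _.
by rewrite lee_fin mulr_ge0 ?hit'_ge0.
Qed.

Lemma measurable_minimum_kernel d (T : measurableType d) (t x y m : T -> R) :
  meas_fun t -> meas_fun x -> meas_fun y -> meas_fun m ->
  meas_fun (fun a => minimum_kernel (t a) (x a) (y a) (m a)).
Proof.
move=> mt mx my mm; under eq_fun do rewrite minimum_kernelE; apply: mfE.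
by apply: mf_if; [meas| |meas]; apply: mfM => //; apply: measurable_hit; meas.
Qed.

Lemma der_heat_double t (c : R) (z : R) :
  isder z (fun z => - heat t (c + 2 * z))%R (2 * hit t (c + 2 * z))%R.
Proof.
have D := der_N (der_comp (f := heat t) (g := (fun z => c + 2 * z)%R) (der_heat t (c + 2 * z)%R)
  (der_D (der_cst c z) (der_M (der_cst 2%R z) (der_id z)))).
by eapply der_eq; [exact: D|rewrite hitE /=; ring].
Qed.

(** The kernel killed at [- m] has the derivative [2 hit t (x + y + 2 m)] in [m], and vanishes until
    [m] exceeds [c], that is, until the level passes below both values. *)
Lemma integral_minimum_kernel i t x y : (0 < t)%R ->
  \int[mu]_m restrict i (minimum_kernel t x y) m = (level_kernel i t x y)%:E.
Proof.
move=> t0; pose c := Num.max (- x)%R (- y)%R.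
have cE m : (0 < x + m)%R && (0 < y + m)%R = (c < m)%R.
  by rewrite /c gt_max -![(- _ < m)%R]subr_gt0 !opprK ![(m + _)%R]addrC.
have dE : (x + y + 2 * c)%R = `|x - y|%R.
  by rewrite /c; case: (leP (- x)%R (- y)%R) => h; [rewrite ger0_norm|rewrite ltr0_norm]; lra.
pose F z := (- heat t (`|x - y| + 2 * z))%R; pose g z := (2 * hit t (`|x - y| + 2 * z))%R.
have dF z : isder z F (g z) by exact: der_heat_double.
have cF : continuous F by move=> z; exact: der_continuous (dF z).
have g0 z : (0 <= z)%R -> (0 <= g z)%R.
  by move=> z0; rewrite mulr_ge0// hit_ge0// addr_ge0 ?normr_ge0// mulr_ge0.
have cg : continuous g.
  move=> z; apply: cvgM; first exact: cvg_cst.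
  under eq_fun do rewrite hitE.
  have c1 : {for z, continuous (fun z : R => `|x - y| + 2 * z)%R}.
    by apply: cvgD; [exact: cvg_cst|apply: cvgM; [exact: cvg_cst|exact: cvg_id]].
  apply: cvgM; first by apply: cvgM => //; exact: cvg_cst.
  exact: (continuous_comp c1 (@continuous_heat R t _)).
have -> : \int[mu]_m restrict i (minimum_kernel t x y) m =
    \int[mu]_z (if (0 < z)%R && below i (z + c)%R then (g z)%:E else 0).
  rewrite -(integral_shift c); last 2 first.
  - by apply: measurable_restrict; apply: measurable_minimum_kernel; meas.
  - by move=> m; apply: restrict_ge0 => m'; exact: minimum_kernel_ge0.
  apply: eq_integral => z _; rewrite /restrict minimum_kernelE cE ltrDr andbC.
  case: (below _ _) => //=; case: ifP => // _.
  by rewrite /g -dE; congr (_ * hit _ _)%:E; ring.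
case: i => [m|] /=; last first.
  transitivity (\int[mu]_(z in `[0%R, +oo[) (g z)%:E).
    rewrite -integral_itv_obnd_cbnd; last by apply/measurable_EFinP; apply: measurable_funTS; exact: continuous_measurable_fun.
    rewrite (@integral_supp _ `]0%R, +oo[%classic)//; last first.
      by move=> z /=; rewrite in_itv/= andbT => /negP/negbTE ->.
    by apply: eq_integral => z; rewrite inE/= in_itv/= andbT => ->.
  rewrite (@integral_FTCy _ g F 0)//; first by rewrite sub0r /F opprK mulr0 addr0 heat_abs.
  rewrite -oppr0; apply: cvgN.
  apply: (cvg_comp (fun z => `|x - y| + 2 * z)%R (heat t) (_ : _ @[z --> +oo%R] --> +oo%R)).
    apply/cvgryPge => A; near=> z.
    rewrite -lerBlDl -ler_pdivrMl; last by [].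
    by near: z; apply: nbhs_pinfty_ge; rewrite num_real.
  by have := cvg_heaty 0 t0; under eq_fun do rewrite subr0.
have [mc|cm] := leP m c.
  rewrite integral0_eq; last first.
    move=> z _; case: ifP => // /andP[z0 zc]; exfalso; lra.
  by rewrite /killed cE ltNge mc.
rewrite /killed cE cm /=.
have e1 : (x + m - (y + m) = x - y)%R by ring.
have e2 : (x + m + (y + m) = `|x - y| + 2 * (m - c))%R by rewrite -dE; ring.
have mc0 : (0 < m - c)%R by rewrite subr_gt0.
rewrite e1 e2 -(heat_abs t (x - y)).
transitivity (\int[mu]_(z in `]0%R, (m - c)%R[) (g z)%:E).
  rewrite (@integral_supp _ `]0%R, (m - c)%R[%classic)//; last first.
    by move=> z /=; rewrite in_itv/= ltrBrDr => /negP/negbTE ->.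
  by apply: eq_integral => z; rewrite inE/= in_itv/= ltrBrDr => ->.
rewrite (@ge0_FTC_oo _ g F 0%R (m - c)%R (F 0%R) (F (m - c)%R))//.
- by rewrite /F mulr0 addr0 opprK addrC.
- by move=> z /andP[z0 _]; exact/g0/ltW.
- by move=> z _; exact: cg.
- exact: cvg_at_right_filter (cF _).
- exact: cvg_at_left_filter (cF _).
Unshelve. all: end_near. Qed.

Definition level_step i r x rho y : R := level_kernel i (r - rho) x y.
Definition level_end i r x : R := level_kernel i r x 0.

Lemma level_kernel_ge0 i t x y : (0 <= level_kernel i t x y)%R.
Proof. by case: i => [m|] /=; [exact: killed_ge0|exact: heat_ge0]. Qed.

Lemma measurable_level_kernel d (T : measurableType d) (m t x y : T -> R) :
  meas_fun m -> meas_fun t -> meas_fun x -> meas_fun y ->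
  meas_fun (fun a => level_kernel (Some (m a)) (t a) (x a) (y a)).
Proof. by move=> mm mt mx my /=; apply: measurable_killed; meas. Qed.

Definition level_chain i s r x := chain (level_step i) (level_end i) s r x.

Lemma level_chain_ge0 i s r0 r x : tests r0 s -> 0 <= level_chain i s r x.
Proof. by apply: chain_ge0 => *; exact: level_kernel_ge0. Qed.

Lemma measurable_level_chain s r0 d (T : measurableType d) (m r x : T -> R) : tests r0 s ->
  meas_fun m -> meas_fun r -> meas_fun x ->
  meas_fun (fun a => level_chain (Some (m a)) s (r a) (x a)).
Proof.
move=> ts mm mr mx.
apply: (measurable_chain_param (k := fun m => level_step (Some m)) (e := fun m => level_end (Some m))
  _ _ _ _ ts mm mr mx) => *; try exact: level_kernel_ge0.
  by apply: measurable_level_kernel; meas.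
by apply: measurable_level_kernel; meas.
Qed.

Definition minimum_end m r x : R := hit' r (x + m).

(** The chain starts on the killing level itself, where the killed kernel vanishes; its first kernel
    is replaced by a first hitting density. *)
Definition after_minimum m v s : \bar R :=
  if s is (rho, f) :: s' then
    \int[mu]_y ((hit' (v - rho)%R (y + m)%R * f y)%:E * level_chain (Some m) s' rho y)
  else (hit' v m)%:E.

Definition minimum_chain m v s r x : \bar R :=
  chain (level_step (Some m)) (minimum_end m) (before v s) (r - v)%R x *
  after_minimum m v (after v s).

Lemma after_minimum_ge0 m v s r : tests r s -> 0 <= after_minimum m v s.
Proof.
case: s => [|[rho f] s] /=; first by rewrite lee_fin hit'_ge0.
move=> [_ _ f0 ts]; apply: integral_ge0 => y _.
by rewrite mule_ge0 ?lee_fin ?mulr_ge0 ?hit'_ge0//; exact: level_chain_ge0 ts.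
Qed.

Lemma measurable_after_minimum s r d (T : measurableType d) (m v : T -> R) : tests r s ->
  meas_fun m -> meas_fun v ->
  meas_fun (fun a => after_minimum (m a) (v a) s).
Proof.
case: s => [|[rho f] s] /=; first by move=> _ mm mv; apply: mfE; apply: mhit'.
move=> [_ mf f0 ts] mm mv.
have mm' : meas_fun (fun z : T * R => m z.1) by meas.
have mv' : meas_fun (fun z : T * R => v z.1) by meas.
apply: (measurable_int_param mu (fun a y =>
  (hit' (v a - rho)%R (y + m a)%R * f y)%:E * level_chain (Some (m a)) s rho y)).
  apply: mfeM; last by apply: measurable_level_chain ts _ _ _; meas.
  apply: mfE; apply: mfM; first by apply: mhit'; meas.
  by meas.
by move=> a y; rewrite mule_ge0 ?lee_fin ?mulr_ge0 ?hit'_ge0//; exact: level_chain_ge0 ts.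
Qed.

Lemma minimum_chain_ge0 m v s r x : tests r s -> 0 <= minimum_chain m v s r x.
Proof.
move=> ts; rewrite mule_ge0//; last exact: after_minimum_ge0 (tests_after v ts).
apply: chain_ge0 (tests_before v ts) => *; first exact: level_kernel_ge0.
exact: hit'_ge0.
Qed.

Lemma minimum_chain_cons m v rho f s r x : tests r ((rho, f) :: s) ->
  minimum_chain m v ((rho, f) :: s) r x =
  \int[mu]_y ((level_step (Some m) r x rho y * f y)%:E * minimum_chain m v s rho y) +
   (hit' (r - v)%R (x + m)%R)%:E * after_minimum m v ((rho, f) :: s).
Proof.
move=> /= [/andP[rho0 rr] mf f0 ts].
have [vr|vr] := ltP v rho.
  rewrite [X in (_ + _ * X)]integral0_eq; last first.
    by move=> y _; rewrite /hit' hit_le0 ?if_same ?mul0r ?mul0e// subr_le0 ltW.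
  rewrite mule0 adde0 /minimum_chain {1}/before {1}/after /= vr leNgt vr/=.
  rewrite -/(before v s) -/(after v s) -ge0_integralZr//.
  - apply: eq_integral => y _; rewrite muleA; congr ((_ * _)%:E * _ * _).
    by rewrite /level_step/=; congr killed; ring.
  - apply: mfeM.
      by apply: mfE; apply: mfM => //; apply: measurable_level_kernel; meas.
    apply: (measurable_chain _ _ _ _ (tests_before v ts)); meas.
    + by move=> *; exact: level_kernel_ge0.
    + by move=> *; apply: measurable_level_kernel; meas.
    + by move=> *; apply: mhit'; meas.
    + by move=> *; exact: hit'_ge0.
  - move=> y _; rewrite mule_ge0 ?lee_fin ?mulr_ge0 ?killed_ge0//.
    by apply: chain_ge0 (tests_before v ts) => *; [exact: level_kernel_ge0|exact: hit'_ge0].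
  - exact: after_minimum_ge0 (tests_after v ts).
rewrite integral0_eq ?add0e; last first.
  move=> y _; rewrite /minimum_chain; have [-> ->] := after_all ts vr => /=.
  by rewrite /minimum_end /hit' hit_le0 ?subr_le0//; case: ifP; rewrite mul0e mule0.
have [h1 h2] := after_all ts vr.
by rewrite /minimum_chain /before /after /= ltNge vr /= -/(before v s) -/(after v s) h1 h2.
Qed.

Lemma measurable_minimum_chain s r d (T : measurableType d) (m v x : T -> R) : tests r s ->
  meas_fun m -> meas_fun v -> meas_fun x ->
  meas_fun (fun a => minimum_chain (m a) (v a) s r (x a)).
Proof.
elim: s r d T m v x => [|[rho f] s IH] r d T m v x ts mm mv mx.
  by apply: mfeM; apply: mfE; apply: mhit'; meas.
under eq_fun do rewrite minimum_chain_cons//.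
move: ts => /= ts; have [rr mf f0 ts'] := ts.
have mm' : meas_fun (fun z : T * R => m z.1) by meas.
have mv' : meas_fun (fun z : T * R => v z.1) by meas.
have mx' : meas_fun (fun z : T * R => x z.1) by meas.
apply: mfeD; last first.
  apply: mfeM; first by apply: mfE; apply: mhit'; meas.
  exact: (measurable_after_minimum (s := (rho, f) :: s) ts).
apply: (measurable_int_param mu (fun a y =>
  (level_step (Some (m a)) r (x a) rho y * f y)%:E * minimum_chain (m a) (v a) s rho y)).
  apply: mfeM; last by apply: IH => //; meas.
  apply: mfE; apply: mfM; last by meas.
  by apply: measurable_level_kernel; meas.
move=> a y; rewrite mule_ge0 ?lee_fin ?mulr_ge0 ?level_kernel_ge0//.
exact: minimum_chain_ge0 ts'.
Qed.

(** The kernel to the first tested value and the remaining chain are both integrals over levels.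
    [product_rule_restrict] splits their product according to whether the minimum is reached before
    or after that value. *)
Lemma level_chain_minimum i s r x : tests r s -> (0 < r)%R ->
  level_chain i s r x = \int[mu]_m restrict i (fun m => 2%:E * \int[mu]_v minimum_chain m v s r x) m.
Proof.
elim: s i r x => [|[rho f] s IH] i r x ts r0.
  transitivity (level_kernel i r x 0)%:E; first by [].
  rewrite -integral_minimum_kernel; last exact: r0.
  apply: eq_integral => m _.
  congr (if _ then _ * _ else _); apply: eq_integral => v _.
  by rewrite /minimum_chain/= add0r -EFinM.
move: (ts) => /= [/andP[rho0 rr] mf f0 ts']; have t0 : (0 < r - rho)%R by rewrite subr_gt0.
pose a y m := minimum_kernel (r - rho) x y m.
pose b y m := 2%:E * \int[mu]_v minimum_chain m v s rho y.
pose W m y := level_chain (Some m) s rho y.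
pose K m y := level_kernel (Some m) (r - rho) x y.
have E0 m v y : 0 <= minimum_chain m v s rho y by exact: minimum_chain_ge0 ts'.
have a0 y m : 0 <= a y m by exact: minimum_kernel_ge0.
have b0 y m : 0 <= b y m by rewrite mule_ge0//; exact: integral_ge0.
have W0 m y : 0 <= W m y by exact: level_chain_ge0 ts'.
have K0 m y : (0 <= K m y)%R by exact: level_kernel_ge0.
have mE d (T : measurableType d) (m v y : T -> R) : meas_fun m -> meas_fun v ->
    meas_fun y -> meas_fun (fun w => minimum_chain (m w) (v w) s rho (y w)).
  exact: measurable_minimum_chain.
have ma d (T : measurableType d) (m y : T -> R) : meas_fun m ->
    meas_fun y -> meas_fun (fun w => a (y w) (m w)).
  by move=> mm my; apply: measurable_minimum_kernel; meas.
have mb d (T : measurableType d) (m y : T -> R) : meas_fun m ->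
    meas_fun y -> meas_fun (fun w => b (y w) (m w)).
  move=> mm my; apply: mfeM; first exact: measurable_cst.
  apply: (measurable_int_param mu (fun w v => minimum_chain (m w) v s rho (y w))) => //.
  by apply: mE; [apply: (measurableT_comp mm)| |apply: (measurableT_comp my)]; meas.
have mW d (T : measurableType d) (m y : T -> R) : meas_fun m ->
    meas_fun y -> meas_fun (fun w => W (m w) (y w)).
  by move=> mm my; apply: (measurable_level_chain ts'); meas.
have mK d (T : measurableType d) (m y : T -> R) : meas_fun m ->
    meas_fun y -> meas_fun (fun w => K (m w) (y w)).
  by move=> mm my; apply: measurable_level_kernel; meas.
pose G y m := (f y)%:E * (a y m * W m y + (K m y)%:E * b y m).
have G0 y m : 0 <= G y m.
  apply: mule_ge0; first by rewrite lee_fin.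
  by apply: adde_ge0; apply: mule_ge0; rewrite ?lee_fin; [exact: a0|exact: W0|exact: K0|exact: b0].
have mG : meas_fun (fun z : R * R => G z.1 z.2).
  apply: mfeM; first by apply: mfE; meas.
  by apply: mfeD; apply: mfeM; [apply: ma|apply: mW|apply: mfE; apply: mK|apply: mb]; meas.
transitivity (\int[mu]_y \int[mu]_m restrict i (G y) m).
  apply: eq_integral => y _.
  transitivity ((level_step i r x rho y * f y)%:E * level_chain i s rho y); first by [].
  rewrite (IH i rho y ts' rho0) EFinM /level_step.
  rewrite -(integral_minimum_kernel i x y t0) [X in X * _]muleC -muleA.
  rewrite (product_rule_restrict i (a := a y) (b := b y)); last 4 first.
  - by apply: ma; meas.
  - by apply: mb; meas.
  - exact: a0.
  - exact: b0.
  rewrite -ge0_integralZl ?lee_fin//; last 2 first.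
  - apply: measurable_restrict; apply: mfeD; apply: mfeM; try (by apply: ma; meas); try (by apply: mb; meas).
    + under eq_fun do rewrite -IH//; by apply: mW; meas.
    + under eq_fun do rewrite integral_minimum_kernel//; by apply: mfE; apply: mK; meas.
  - move=> m _; apply: restrict_ge0 => m'; rewrite adde_ge0// mule_ge0//.
    + by apply: integral_ge0 => u _; exact: restrict_ge0.
    + by apply: integral_ge0 => u _; exact: restrict_ge0.
  have e m : (f y)%:E * (a y m * (\int[mu]_u restrict (Some m) (b y) u) +
      (\int[mu]_u restrict (Some m) (a y) u) * b y m) = G y m.
    by rewrite -(IH (Some m) rho y ts' rho0) (integral_minimum_kernel (Some m) x y t0).
  apply: eq_integral => m _; move: (e m); rewrite /restrict.
  case: (below i m) => [em|_]; [exact: em|by rewrite mule0].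
rewrite (tonelli mu mu (fun y m => restrict i (G y) m)); last 2 first.
- apply: mfe_if; [|exact: mG|exact: measurable_cst].
  by apply: (measurableT_comp (measurable_below i)); meas.
- by move=> y m; exact: restrict_ge0.
apply: eq_integral => m _; rewrite /restrict; case: (below i m); last by rewrite integral0.
under [in RHS]eq_integral do rewrite minimum_chain_cons//.
pose P v y := (K m y * f y)%:E * minimum_chain m v s rho y.
pose Q v y := (hit' (r - v) (x + m))%:E * ((hit' (v - rho) (y + m) * f y)%:E * W m y).
have P0 v y : 0 <= P v y by rewrite mule_ge0 ?lee_fin ?mulr_ge0.
have Q0 v y : 0 <= Q v y by rewrite !mule_ge0 ?lee_fin ?mulr_ge0 ?hit'_ge0.
have mP : meas_fun (fun z : R * R => P z.1 z.2).
  apply: mfeM; last by apply: mE; meas.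
  by apply: mfE; apply: mfM; [apply: mK|apply: (measurableT_comp mf)]; meas.
have mQ : meas_fun (fun z : R * R => Q z.1 z.2).
  apply: mfeM; first by apply: mfE; apply: mhit'; meas.
  apply: mfeM; last by apply: mW; meas.
  by apply: mfE; apply: mfM; [apply: mhit'|apply: (measurableT_comp mf)]; meas.
have mP' : meas_fun (fun z : R * R => P z.2 z.1).
  exact: (measurable_swap mP).
have mQ' : meas_fun (fun z : R * R => Q z.2 z.1).
  exact: (measurable_swap mQ).
have QE v : (hit' (r - v) (x + m))%:E * after_minimum m v ((rho, f) :: s) = \int[mu]_y Q v y.
  rewrite /= -ge0_integralZl ?lee_fin ?hit'_ge0//.
  - apply: mfeM; last by apply: mW; meas.
    by apply: mfE; apply: mfM; [apply: mhit'|]; meas.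
  - by move=> y _; apply: mule_ge0; [rewrite lee_fin mulr_ge0 ?hit'_ge0|exact: (W0 m y)].
transitivity (2%:E * \int[mu]_v (\int[mu]_y P v y + \int[mu]_y Q v y)); last first.
  by congr (_ * _); apply: eq_integral => v _; rewrite QE.
have iP := measurable_int_param mu P mP P0.
have iQ := measurable_int_param mu Q mQ Q0.
have iP' := measurable_int_param mu (fun y v => P v y) mP' (fun y v => P0 v y).
have iQ' := measurable_int_param mu (fun y v => Q v y) mQ' (fun y v => Q0 v y).
rewrite ge0_integralD; last 5 first.
- exact: measurableT.
- by move=> v _; apply: integral_ge0 => y _; exact: P0.
- exact: iP.
- by move=> v _; apply: integral_ge0 => y _; exact: Q0.
- exact: iQ.
rewrite (tonelli mu mu P mP P0) (tonelli mu mu Q mQ Q0).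
rewrite -ge0_integralD; last 5 first.
- exact: measurableT.
- by move=> y _; apply: integral_ge0 => v _; exact: P0.
- exact: iP'.
- by move=> y _; apply: integral_ge0 => v _; exact: Q0.
- exact: iQ'.
rewrite -ge0_integralZl; last 4 first.
- exact: measurableT.
- exact: (mfeD iP' iQ').
- by move=> y _; apply: adde_ge0; apply: integral_ge0 => v _; [exact: P0|exact: Q0].
- by rewrite lee_fin.
apply: eq_integral => y _.
rewrite /P ge0_integralZl//; last 2 first.
- by apply: mE; meas.
- by rewrite lee_fin mulr_ge0.
pose q v := (hit' (r - rho - v) (x + m) * hit' v (y + m))%:E.
have q0 v : 0 <= q v by rewrite lee_fin mulr_ge0 ?hit'_ge0.
have mq : meas_fun q by apply: mfE; apply: mfM; apply: mhit'; meas.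
have -> : \int[mu]_v Q v y = ((f y)%:E * W m y) * \int[mu]_v q v.
  rewrite -(integral_shift (- rho) mq q0) -ge0_integralZl//; last 2 first.
  - by meas.
  - by rewrite mule_ge0 ?lee_fin.
  apply: eq_integral => v _; rewrite /Q /q (_ : r - rho - (v - rho) = r - v)%R; last by ring.
  rewrite [in RHS]muleC !muleA -!EFinM; congr (_%:E * _); ring.
have I0 : 0 <= \int[mu]_v q v by exact: integral_ge0.
have J0 : 0 <= \int[mu]_v minimum_chain m v s rho y by exact: integral_ge0.
rewrite /G /a /b /minimum_kernel -/q ge0_muleDr ?mule_ge0 ?lee_fin//.
have Km0 := K0 m y; have Wm0 := W0 m y; have fy0 := f0 y.
move: (\int[mu]_v q v) (\int[mu]_v minimum_chain m v s rho y) (W m y) (K m y) (f y) I0 J0 Km0 Wm0 fy0.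
clear=> I J w k g I0 J0 k0 w0 g0.
rewrite [in RHS]ge0_muleDr; last 2 first.
- by apply: mule_ge0; rewrite ?lee_fin// mulr_ge0.
- by apply: mule_ge0 => //; apply: mule_ge0; rewrite ?lee_fin.
rewrite [RHS]addeC EFinM; congr (_ + _).
  by rewrite -!muleA muleCA [I * w]muleC.
by rewrite -!muleA [k%:E * (2%:E * J)]muleCA muleCA [g%:E * (k%:E * J)]muleCA.
Qed.

End minimum_decomposition.

(** * Vervaat's theorem *)

Section vervaat_law.
Context {R : realType}.
Implicit Types (t u v x y m r rho l : R) (s : seq (R * (R -> R))).
Notation P3 := (cpath R * cpath R * cpath R)%type.

Lemma level_chain_None s r x : level_chain None s r x = chain kh (@heat R) s r x.
Proof.
rewrite /level_chain (_ : level_end None = @heat R)//.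
by apply/funext => r'; apply/funext => y; rewrite /level_end/= subr0.
Qed.

(** Killing at the level [- m] is killing at 0 after a translation by [m], the case of slope 0 in
    [shift]. *)
Lemma chain_translate m (e e' : R -> R -> R) s r0 r x : mker2 e -> (forall r x, 0 <= e r x) ->
  (forall r x, e' r x = e r (x + m)) -> tests r0 s ->
  chain (level_step (Some m)) e' s r x = chain k0 e (shift m 0 s) r (x + m).
Proof.
move=> me e0 ee; elim: s r0 r x => [|[rho f] s IH] r0 r x /=; first by rewrite ee.
move=> [rr mf f0 ts].
pose g z : \bar R := ((k0 r (x + m) rho z * f (z - (m + 0 * rho)))%:E *
  chain k0 e (shift m 0 s) rho z)%E.
have tsh := tests_shift m 0 ts.
have mg : meas_fun g.
  apply: mfeM; last by apply: (measurable_chain k0_ge0 mk0 me e0 tsh); meas.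
  by apply: mfE; apply: mfM; [apply: mk0|apply: (measurableT_comp mf)]; meas.
have g0 z : (0 <= g z)%E.
  apply: mule_ge0; first by rewrite lee_fin mulr_ge0 ?k0_ge0.
  exact: (chain_ge0 _ _ k0_ge0 e0 tsh).
rewrite -[RHS]/(\int[mu]_z g z)%E -(integral_shift m mg g0); apply: eq_integral => y _.
rewrite /g (IH rho)// (_ : y + m - (m + 0 * rho) = y)//; ring.
Qed.

(** The tests of a path run backwards over a duration [v]. *)
Definition reversed v s : seq (R * (R -> R)) := catrev (reflect_times v s) [::].

Lemma tests_reversed c v s : 0 <= v < c -> tests c s -> all (fun p => v < p.1) s ->
  tests (c - v) (reversed c s).
Proof.
move=> /andP[v0 vc]; rewrite /reversed.
suff : forall rho s', v < rho <= c -> (forall rho', v <= rho' < rho -> tests (c - rho') s') ->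
    tests rho s -> all (fun p => v < p.1) s -> tests (c - v) (catrev (reflect_times c s) s').
  by apply => //; rewrite vc lexx.
elim: s => [|[rho1 f1] s IH] rho s' /andP[rho0 rhoc] hs' /=.
  by move=> _ _; apply: hs'; rewrite lexx.
move=> [/andP[rho10 rho1r] mf f0 ts] /andP[vr1 vs]; apply: (IH rho1) => //.
  by rewrite vr1 (le_trans (ltW rho1r)).
move=> rho' /andP[h1 h2]; split => //; first by lra.
by apply: hs'; rewrite (ltW vr1).
Qed.

Lemma le1_reversed c s : le1 s -> le1 (reversed c s).
Proof. by move=> hs; apply: le1_catrev => //; exact: le1_map. Qed.

Lemma prodt_reversed l c s (w : cpath R) :
  prodt l (reversed c s) w = \prod_(p <- s) p.2 (w (l - (c - p.1))).
Proof. by rewrite /prodt /reversed catrevE cats0 (perm_big _ (permEl (perm_rev _))) big_map. Qed.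

(** Run backwards, the part after the minimum is a killed chain from [m] that ends at 0, of the same
    kind as the part before the minimum. *)
Lemma after_minimum_reverse m v s : 0 < v -> tests v s ->
  after_minimum m v s = chain0 (reversed v (shift m 0 s)) v m.
Proof.
case: s => [|[rho f] s] v0 //= [/andP[rho0 rv] mf f0 ts].
have tsh := tests_shift m 0 ts.
pose F z := f (z - (m + 0 * rho)).
have mF : meas_fun F by apply: (measurableT_comp mf); meas.
transitivity (chain0 (catrev (reflect_times v (shift m 0 s)) [:: (v - rho, F)]) (v - 0) m);
  last by rewrite subr0.
rewrite -(@chain_reverse _ v 0 m (shift m 0 s) [::] rho F)//; last by move=> y; exact: f0.
pose g z : \bar R := ((hit' (v - rho)%R z)%:E * ((F z)%:E * chain_to 0 m (shift m 0 s) rho z))%E.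
have mg : meas_fun g.
  apply: mfeM; first by apply: mfE; apply: mhit'; meas.
  by apply: mfeM; [exact: mfE|apply: (measurable_chain_to _ tsh); meas].
have g0 z : (0 <= g z)%E.
  by rewrite !mule_ge0 ?lee_fin ?hit'_ge0 ?f0//; exact: (chain_to_ge0 _ _ _ _ tsh).
rewrite -[RHS]/(\int[mu]_z g z)%E -(integral_shift m mg g0); apply: eq_integral => y _.
rewrite /g /F (_ : y + m - (m + 0 * rho) = y); last by ring.
rewrite EFinM muleA; congr (_ * _)%E.
rewrite /level_chain (@chain_translate m (fun r y => k0 r y 0 m) _ _ rho)//.
- by move=> d T a b ma mb; apply: mk0; meas.
- by move=> a b; exact: k0_ge0.
- by move=> a b; rewrite /level_end /k0 /= subr0 add0r.
Qed.

Lemma bes_before m l (w : P3) t : 0 <= m -> 0 <= l -> t <= 0 -> bes m l w t = m.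
Proof.
move=> m0 l0 t0; have h x w' : gam x l w' t = x.
  by rewrite gamE clip_lt0 ?mulr_le0_ge0 ?invr_ge0// subr0 mulr1 mul1r mul0r subr0 subrr mulr0 addr0.
by rewrite besE !h expr0n/= !addr0 sqrtr_sqr ger0_norm.
Qed.

(** A weight equal to 1 is inserted at [v], unless there is a test at that time already. *)
Lemma tests_split v r s : tests r s -> le1 s -> 0 < v < r ->
  exists sb (g : R -> R) sa, [/\ tests r (sb ++ (v, g) :: sa), le1 (sb ++ (v, g) :: sa) &
    forall l (w : cpath R), prodt l s w = prodt l (sb ++ (v, g) :: sa) w].
Proof.
elim: s r => [|[rho f] s IH] r.
  by move=> _ _ vr; exists [::], (fun=> 1), [::]; split => // l w; rewrite prodt_cons !prodt_nil mulr1.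
move=> /= [/andP[rho0 rr] mf f0 ts] [f1 hs] /andP[v0 vr].
have [vrho|rhov|->] := ltgtP v rho.
- have vr' : 0 < v < rho by rewrite v0.
  have [sb [g [sa [h1 h2 h3]]]] := IH rho ts hs vr'.
  exists ((rho, f) :: sb), g, sa; split => //; first by split => //; rewrite rho0.
  by move=> l w; rewrite /= !prodt_cons h3.
- exists [::], (fun=> 1), ((rho, f) :: s); split => //=.
  + by rewrite v0 vr; split => //; split => //; rewrite rho0 rhov.
  + by move=> l w; rewrite [RHS]prodt_cons mul1r.
- by exists [::], f, s; split => //=; split => //; rewrite ?rho0 ?rr.
Qed.

(** Given its value [m] at an intermediate time, the excursion consists of two chains from [m] to 0,
    the first one run backwards. *)
Lemma bessel_split v g sb sa : tests 1 (sb ++ (v, g) :: sa) ->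
  bessel (sb ++ (v, g) :: sa) 1 0 = (\int[mu]_m (2%:E *
    (chain0 (reversed 1 sb) (1 - v)%R m * ((g m)%:E * chain0 sa v m))))%E.
Proof.
move=> ts; have [/andP[v0 v1] mg g0 ts2] := tests_suffix ts.
case: sb ts => [|[rho f] sb] ts.
  rewrite bessel_cons//; apply: eq_integral => m _.
  have -> : chain0 (reversed 1 [::]) (1 - v) m = (hit' (1 - v) m)%:E by [].
  by rewrite /bessel_start ltxx !muleA -!EFinM; congr (_%:E * _)%E; ring.
move: (ts) => /= [/andP[rho0 rho1] mf f0 ts']; have ts1 := tests_prefix ts'.
have B0 y : 0 <= bessel_start 1 0 rho y by exact: bessel_start_ge0.
have mgC : meas_fun (fun m : R => (g m)%:E * chain0 sa v m)%E.
  by apply: mfeM; [exact: mfE|apply: (measurable_chain_killed ts2); meas].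
have gC0 m : (0 <= (g m)%:E * chain0 sa v m)%E.
  by rewrite mule_ge0 ?lee_fin//; exact: chain_killed_ge0 ts2.
have T0 y m : (0 <= chain_to v m sb rho y)%E by exact: chain_to_ge0 ts1.
have mh : meas_fun (fun y : R => hit' (1 - rho) y) by apply: mhit'; meas.
pose G y m := ((2 * hit' (1 - rho) y * f y)%:E * (chain_to v m sb rho y *
  ((g m)%:E * chain0 sa v m)))%E.
have G0 y m : (0 <= G y m)%E.
  by apply: mule_ge0; [rewrite lee_fin !mulr_ge0 ?hit'_ge0|exact: mule_ge0].
have mG : meas_fun (fun z : R * R => G z.1 z.2).
  apply: mfeM.
    apply: mfE; apply: mfM; last by meas.
    by meas.
  apply: mfeM; last by apply: (measurableT_comp mgC); meas.
  by apply: (measurable_chain_to _ ts1); meas.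
transitivity (\int[mu]_y \int[mu]_m G y m)%E.
  rewrite /= bessel_cons//; apply: eq_integral => y _.
  rewrite chain_prefix// /G ge0_integralZl ?lee_fin ?mulr_ge0 ?hit'_ge0//.
  - by rewrite /bessel_start ltxx.
  - by apply: mfeM => //; apply: (measurable_chain_to _ ts1); meas.
  - by move=> m _; exact: mule_ge0.
rewrite (tonelli mu mu G mG G0); apply: eq_integral => m _.
rewrite /reversed /= -(@chain_reverse _ 1 v m sb [::] rho f)//=.
pose H y := ((hit' (1 - rho) y)%:E * ((f y)%:E * chain_to v m sb rho y))%E.
have H0 y : (0 <= H y)%E by rewrite !mule_ge0 ?lee_fin ?hit'_ge0 ?f0//; exact: T0.
have mH : meas_fun H.
  apply: mfeM; first exact: mfE.
  by apply: mfeM; [exact: mfE|apply: (measurable_chain_to _ ts1); meas].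
rewrite -/(\int[mu]_y H y)%E muleA -ge0_integralZl//.
rewrite -ge0_integralZr//; last 2 first.
- by apply: mfeM.
- by move=> y _; apply: mule_ge0; [rewrite lee_fin|exact: H0].
- by apply: eq_integral => y _; rewrite /G /H !EFinM !muleA.
- by move=> y _; exact: H0.
Qed.

(** The two bridges from [m] to 0 run away from the time [u] in both directions. Each equals [m] on
    the side of the other, whence the term [- m]. *)
Definition around_point m u (w w' : P3) : cpath R :=
  to_cpath (fun t => bes m u w (u - t) + bes m (1 - u) w' (t - u) - m).

(** The same two bridges, arranged to meet at their zeros at the time [1 - u], where the path takes
    the value [- m]. That this is a rotation of [around_point] is the geometric content of Vervaat's
    theorem. *)
Definition around_minimum m u (w w' : P3) : cpath R :=
  to_cpath (fun t => bes m (1 - u) w' t + bes m u w (1 - t) - m).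

(** Cyclic shift of increments for a path vanishing at 0 and 1: at each time [clip] makes one of the
    first two terms an end value. *)
Definition rotate u (e : cpath R) : cpath R :=
  to_cpath (fun t => e (clip (u + t)) + e (clip (u + t - 1)) - e (clip u)).

Let cont_subl c : continuous (fun t : R => c - t).
Proof. by move=> t; apply: cvgB; [exact: cvg_cst|exact: cvg_id]. Qed.

Let cont_subr c : continuous (fun t : R => t - c).
Proof. by move=> t; apply: cvgB; [exact: cvg_id|exact: cvg_cst]. Qed.

Lemma around_pointE m u w w' t :
  around_point m u w w' t = bes m u w (u - t) + bes m (1 - u) w' (t - u) - m.
Proof.
rewrite /around_point to_cpathE// => {}t; apply: cvgB; last exact: cvg_cst.
apply: cvgD; first by apply: (continuous_path_comp (g := fun t => u - t)); exact: cont_subl.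
by apply: (continuous_path_comp (g := fun t => t - u)); exact: cont_subr.
Qed.

Lemma around_minimumE m u w w' t :
  around_minimum m u w w' t = bes m (1 - u) w' t + bes m u w (1 - t) - m.
Proof.
rewrite /around_minimum to_cpathE// => {}t; apply: cvgB; last exact: cvg_cst.
apply: cvgD; first exact: continuous_path.
by apply: (continuous_path_comp (g := fun t => 1 - t)); exact: cont_subl.
Qed.

Lemma rotateE u (e : cpath R) t : rotate u e t = e (clip (u + t)) + e (clip (u + t - 1)) - e (clip u).
Proof.
have c1 : continuous (fun t : R => clip (u + t)).
  move=> x; have c : {for x, continuous (fun t : R => u + t)} by apply: cvgD; [exact: cvg_cst|exact: cvg_id].
  exact: (continuous_comp c (@continuous_clip R _)).
have c2 : continuous (fun t : R => clip (u + t - 1)).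
  move=> x; have c : {for x, continuous (fun t : R => u + t - 1)}.
    by apply: cvgB; [apply: cvgD; [exact: cvg_cst|exact: cvg_id]|exact: cvg_cst].
  exact: (continuous_comp c (@continuous_clip R _)).
rewrite /rotate to_cpathE// => {}t; apply: cvgB; last exact: cvg_cst.
by apply: cvgD; [exact: (continuous_path_comp c1)|exact: (continuous_path_comp c2)].
Qed.

Lemma measurable_rotate d (T : measurableType d) (u : T -> R) (e : T -> cpath R) :
  meas_fun u -> meas_fun e ->
  meas_fun (fun a => rotate (u a) (e a)).
Proof.
move=> mu' me; apply: measurable_into_cpath => t t01; under eq_fun do rewrite rotateE.
have h (g : T -> R) : meas_fun g -> meas_fun (fun a => e a (clip (g a))).
  move=> mg; apply: (measurable_eval (g := fun a => clip (g a))) => //.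
    by meas.
  by move=> a; exact: clip_itv.
by apply: mfD; [apply: mfD|apply: mfN]; apply: h; meas.
Qed.

Lemma bes_clip m l (w : P3) t : 0 <= l -> t <= 1 -> bes m l w t = bes m l w (clip t).
Proof.
move=> l0 t1; have [t0|t0] := leP 0 t; first by rewrite clip_id ?t0.
rewrite (clip_lt0 (ltW t0)) !besE; have h x w' : gam x l w' t = gam x l w' 0.
  by rewrite !gamE mul0r !clip_lt0// mulr_le0_ge0 ?invr_ge0// ltW.
by rewrite !h.
Qed.

Lemma measurable_around_point u d (T : measurableType d) (m : T -> R) (w w' : T -> P3) :
  0 < u < 1 -> meas_fun m -> meas_fun w -> meas_fun w' ->
  meas_fun (fun a => around_point (m a) u (w a) (w' a)).
Proof.
move=> /andP[u0 u1] mm mw mw'; apply: measurable_into_cpath => t /andP[t0 t1].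
under eq_fun do rewrite around_pointE.
have h (l t' : R) (w1 : T -> P3) : 0 <= l -> t' <= 1 -> meas_fun w1 ->
    meas_fun (fun a => bes (m a) l (w1 a) t').
  move=> l0 t'1 mw1; under eq_fun do rewrite (bes_clip _ _ l0 t'1).
  apply: (measurableT_comp (f := fun w : cpath R => w (clip t')) (g := fun a => bes (m a) l (w1 a))).
    by apply: measurable_ev; exact: clip_itv.
  by apply: measurable_bes; meas.
by apply: mfD; [apply: mfD; apply: h => //; lra|exact: mfN].
Qed.

Lemma rotate_around_point m u w w' t : 0 < u < 1 -> 0 <= m -> 0 <= t <= 1 ->
  rotate u (around_point m u w w') t = around_minimum m u w w' t.
Proof.
move=> /andP[u0 u1] m0 /andP[t0 t1]; have v0 : 0 < 1 - u by rewrite subr_gt0.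
have u01 : 0 <= u <= 1 by rewrite !ltW.
rewrite rotateE around_minimumE !around_pointE (clip_id u01).
have p1 z : z <= 0 -> bes m u w z = m by exact: bes_before m0 (ltW u0).
have p2 z : u <= z -> bes m u w z = 0 by exact: bes_end.
have q1 z : z <= 0 -> bes m (1 - u) w' z = m by exact: bes_before m0 (ltW v0).
have q2 z : 1 - u <= z -> bes m (1 - u) w' z = 0 by exact: bes_end.
move: (bes m u w) (bes m (1 - u) w') p1 p2 q1 q2 => p q p1 p2 q1 q2.
rewrite (p1 (u - u)) ?subrr// (q1 0)//.
have [tu|ut] := leP t (1 - u).
  have h1 : 0 <= u + t <= 1 by lra.
  have h2 : u + t - 1 <= 0 by lra.
  have h3 : u - (u + t) <= 0 by lra.
  have h4 : 0 - u <= 0 by lra.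
  have h5 : u <= 1 - t by lra.
  have e2 : u + t - u = t by ring.
  rewrite (clip_id h1) (clip_lt0 h2) e2 (p1 _ h3) (q1 _ h4) (p2 _ h5) subr0 (p2 _ (lexx u)).
  ring.
have h1 : 1 <= u + t by lra.
have h2 : 0 <= u + t - 1 <= 1 by lra.
have h3 : u - 1 <= 0 by lra.
have h4 : u + t - 1 - u <= 0 by lra.
have e2 : u - (u + t - 1) = 1 - t by ring.
rewrite (clip_gt1 h1) (clip_id h2) e2 (p1 _ h3) (q1 _ h4) (q2 _ (lexx _)) (q2 _ (ltW ut)).
ring.
Qed.

Lemma tests_times r s : tests r s -> all (fun p => 0 < p.1 < r) s.
Proof.
elim: s r => //= -[rho f] s IH r [/andP[h1 h2] _ _ ts]; rewrite h1 h2 /=.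
by apply: sub_all (IH _ ts) => p /andP[-> h]; exact: lt_trans h2.
Qed.

Lemma tests_times_prefix v g sb sa r : tests r (sb ++ (v, g) :: sa) -> all (fun p => v < p.1 < r) sb.
Proof.
elim: sb r => //= -[rho f] s IH r [/andP[_ h2] _ _ ts].
have [/andP[_ vr] _ _ _] := tests_suffix ts.
by rewrite vr h2 /=; apply: sub_all (IH _ ts) => p /andP[-> h]; exact: lt_trans h2.
Qed.

Lemma eq_prod_times (b : pred R) s (F G : R -> R) : all (fun p => b p.1) s ->
  (forall rho, b rho -> F rho = G rho) ->
  \prod_(p <- s) p.2 (F p.1) = \prod_(p <- s) p.2 (G p.1).
Proof.
move=> + FG; elim: s => [|p s IH]; first by rewrite !big_nil.
by move=> /= /andP[bp bs]; rewrite !big_cons IH// FG.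
Qed.

Lemma prodt_around_point m u g sb sa (w w' : P3) : 0 < u < 1 -> 0 <= m ->
  tests 1 (sb ++ (1 - u, g) :: sa) ->
  prodt 1 (sb ++ (1 - u, g) :: sa) (around_point m u w w') =
  prodt u (reversed 1 sb) (bes m u w) * (g m * prodt (1 - u) sa (bes m (1 - u) w')).
Proof.
move=> /andP[u0 u1] m0 ts; have v0 : 0 < 1 - u by rewrite subr_gt0.
have hb := tests_times_prefix ts.
have [_ _ _ /tests_times ha] := tests_suffix ts.
rewrite prodt_cat prodt_cons prodt_reversed /=.
have p1 z : z <= 0 -> bes m u w z = m by exact: bes_before m0 (ltW u0).
have q1 z : z <= 0 -> bes m (1 - u) w' z = m by exact: bes_before m0 (ltW v0).
have E := around_pointE m u w w'; move: (around_point _ _ _ _) E => e E.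
move: (bes m u w) (bes m (1 - u) w') p1 q1 E => p q p1 q1 E.
congr (_ * (_ * _)).
- apply: (eq_prod_times (b := fun rho => 1 - u < rho < 1) (F := fun rho => e (1 - rho))
    (G := fun rho => p (u - (1 - rho))) hb).
  move=> rho /= /andP[h1 h2]; have h3 : 1 - rho - u <= 0 by lra.
  by rewrite E (q1 _ h3) addrK.
- have h1 : u - (1 - (1 - u)) <= 0 by lra.
  have h2 : 1 - (1 - u) - u <= 0 by lra.
  by rewrite E (p1 _ h1) (q1 _ h2) addrK.
- apply: (eq_prod_times (b := fun rho => 0 < rho < 1 - u) (F := fun rho => e (1 - rho))
    (G := fun rho => q (1 - u - rho)) ha).
  move=> rho /= /andP[h1 h2]; have h3 : u - (1 - rho) <= 0 by lra.
  by rewrite E (p1 _ h3) addrAC subrr add0r; congr (q _); ring.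
Qed.

Lemma prodt_around_minimum m u s (w w' : P3) : 0 < u < 1 -> tests 1 s ->
  prodt 1 s (around_minimum m u w w') =
  prodt (1 - u) (shift m 0 (before u s)) (bes m (1 - u) w') *
  prodt u (reversed u (shift m 0 (after u s))) (bes m u w).
Proof.
move=> /andP[u0 u1] ts; have v0 : 0 < 1 - u by rewrite subr_gt0.
rewrite prodt_reversed /prodt /shift /before /after !big_map !big_filter.
rewrite (bigID (fun p => u < p.1)) /=.
have p2 z : u <= z -> bes m u w z = 0 by exact: bes_end.
have q2 z : 1 - u <= z -> bes m (1 - u) w' z = 0 by exact: bes_end.
have E := around_minimumE m u w w'; move: (around_minimum _ _ _ _) E => e E.
move: (bes m u w) (bes m (1 - u) w') p2 q2 E => p q p2 q2 E.
congr (_ * _).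
  apply: eq_bigr => z uz; have h : u <= 1 - (1 - z.1) by lra.
  by rewrite E (p2 _ h) mul0r !addr0; congr (z.2 (q _ - _)); ring.
under eq_bigl do rewrite -leNgt.
apply: eq_bigr => z uz; have h : 1 - u <= 1 - z.1 by lra.
by rewrite E (q2 _ h) mul0r add0r addr0; congr (z.2 (p _ - _)); ring.
Qed.

Lemma around_point_ends m u (w w' : P3) : 0 < u < 1 -> 0 <= m ->
  around_point m u w w' 0 = 0 /\ around_point m u w w' 1 = 0.
Proof.
move=> /andP[u0 u1] m0; have v0 : 0 < 1 - u by rewrite subr_gt0.
rewrite !around_pointE.
have h1 : bes m (1 - u) w' (0 - u) = m by apply: (bes_before _ m0 (ltW v0)); rewrite sub0r oppr_le0 ltW.
have h2 : bes m u w (u - 1) = m by apply: (bes_before _ m0 (ltW u0)); rewrite subr_le0 ltW.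
have h3 : bes m u w (u - 0) = 0 by apply: bes_end; rewrite ?subr0.
have h4 : bes m (1 - u) w' (1 - u) = 0 by exact: bes_end.
move: (bes m u w) (bes m (1 - u) w') h1 h2 h3 h4 => p q h1 h2 h3 h4.
by rewrite h1 h2 h3 h4 add0r addr0 subrr.
Qed.

Section with_bridge.
Variables (beta : probability (cpath R) R).
Hypothesis hbeta : brownian_bridge beta 0 0 1 id.
Notation beta3 := (beta3 beta).

Lemma chain_killed_bes l s x : 0 < l <= 1 -> 0 < x -> tests l s -> le1 s ->
  chain0 s l x = ((hit l x)%:E * \int[beta3]_w (prodt l s (bes x l w))%:E)%E.
Proof.
move=> l01 x0 ts hs; have := bes_chain hbeta l01 (ltW x0) ts hs.
rewrite /bessel x0 => /(congr1 (fun z => x%:E * z)%E).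
rewrite [in RHS]muleA -EFinM mulfV ?gt_eqF// mul1e => <-.
by rewrite muleA -EFinM; congr (_%:E * _)%E; rewrite hitE; ring.
Qed.

Lemma integral_product (f1 f2 : P3 -> R) : meas_fun f1 -> meas_fun f2 ->
  (forall w, 0 <= f1 w) -> (forall w, 0 <= f2 w) ->
  ((\int[beta3]_w (f1 w)%:E) * (\int[beta3]_w (f2 w)%:E) =
   \int[beta3]_w \int[beta3]_w' (f1 w * f2 w')%:E)%E.
Proof.
move=> m1 m2 f10 f20; rewrite -ge0_integralZr; last 4 first.
- exact: measurableT.
- exact: mfE.
- by move=> w _; rewrite lee_fin.
- by apply: integral_ge0 => w _; rewrite lee_fin.
apply: eq_integral => w _; rewrite -ge0_integralZl; last 4 first.
- exact: measurableT.
- exact: mfE.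
- by move=> w' _; rewrite lee_fin.
- by rewrite lee_fin.
by apply: eq_integral => w' _; rewrite -EFinM.
Qed.

Let mprodt l s x : 0 < l <= 1 -> tests l s -> meas_fun (fun w => prodt l s (bes x l w)).
Proof. by move=> /andP[_ l1] ts; apply: (measurable_prodt_bes _ _ ts); meas; rewrite lexx. Qed.

Lemma minimum_chain_bes m u s : 0 < u < 1 -> 0 < m -> tests 1 s -> le1 s ->
  u \notin [seq p.1 | p <- s] ->
  minimum_chain m u s 1 0 = ((hit u m * hit (1 - u) m)%:E *
    \int[beta3]_w \int[beta3]_w' (prodt 1 s (around_minimum m u w w'))%:E)%E.
Proof.
move=> u01 m0 ts hs us; have /andP[u0 u1] := u01; have v0 : 0 < 1 - u by rewrite subr_gt0.
have tb := tests_before u ts; have ta := tests_after_notin ts us.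
have tsb := tests_shift m 0 tb; have tsa := tests_shift m 0 ta.
have tr : tests u (reversed u (shift m 0 (after u s))).
  rewrite -{1}[u]subr0; apply: tests_reversed => //; first by rewrite lexx.
  by apply: sub_all (tests_times tsa) => p /andP[].
have v01 : 0 < 1 - u <= 1 by lra.
have u01' : 0 < u <= 1 by rewrite u0 ltW.
rewrite /minimum_chain after_minimum_reverse//.
rewrite (@chain_translate m hit' _ _ _ _ _ mhit' hit'_ge0 _ tb)// add0r.
rewrite (chain_killed_bes v01 m0 tsb); last exact/le1_shift/le1_before.
rewrite (chain_killed_bes u01' m0 tr); last exact/le1_reversed/le1_shift/le1_after.
rewrite muleACA -EFinM [hit _ _ * _]mulrC muleC [X in (X * _)%E]muleC.
rewrite integral_product; last 4 first.
- exact: mprodt.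
- exact: mprodt.
- by move=> w; exact: prodt_ge0 tr.
- by move=> w; exact: prodt_ge0 tsb.
rewrite muleC; congr (_ * _)%E.
apply: eq_integral => w _; apply: eq_integral => w' _.
by rewrite (prodt_around_minimum m w w' u01 ts) mulrC.
Qed.

(* The density at [m] of the value at the time [u] of the normalized excursion, and of minus the
   minimum of the bridge when it is reached at the time [1 - u], divided by the (constant)
   density of the latter time. *)
Definition point_density u m : R := 2 / heat 1 0 * (hit' u m * hit' (1 - u) m).

Lemma point_density_ge0 u m : 0 <= point_density u m.
Proof.
apply: mulr_ge0; first by apply: divr_ge0 => //; exact: heat_ge0.
by apply: mulr_ge0; exact: hit'_ge0.
Qed.

Lemma measurable_point_density d (T : measurableType d) (u m : T -> R) :
  meas_fun u -> meas_fun m ->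
  meas_fun (fun a => point_density (u a) (m a)).
Proof. by move=> mu' mm; apply: mfM => //; apply: mfM; apply: mhit'; meas. Qed.

Let T2 := (measurableTypeR R * (P3 * P3))%type.
Let beta6 : probability (P3 * P3)%type R := (beta3 \x beta3)%E.
Let nu2 : {measure set T2 -> \bar R} := (@lebesgue_measure R \x beta6)%E.

Section at_a_point.
Variable u : R.
Hypothesis u01 : 0 < u < 1.

Let path (z : T2) : cpath R := around_point z.1 u z.2.1 z.2.2.

Let mpath : meas_fun path.
Proof. by apply: measurable_around_point => //; meas. Qed.

Let disintegrate (F : cpath R -> \bar R) : meas_fun F -> (forall w, 0 <= F w)%E ->
  (\int[nu2]_z ((point_density u z.1)%:E * F (path z)) =
   \int[mu]_m ((point_density u m)%:E *
     \int[beta3]_w \int[beta3]_w' F (around_point m u w w')))%E.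
Proof.
move=> mF F0; pose f (z : T2) := ((point_density u z.1)%:E * F (path z))%E.
have mf : meas_fun f.
  apply: mfeM; last exact: (measurableT_comp mF).
  by apply: mfE; apply: measurable_point_density; meas.
have f0 z : (0 <= f z)%E by rewrite mule_ge0 ?lee_fin ?point_density_ge0.
rewrite [LHS](@fubini_tonelli1 _ _ _ _ R (@lebesgue_measure R) beta6 f mf f0).
apply: eq_integral => m _; rewrite /fubini_F.
have mfm : meas_fun (fun p : P3 * P3 => f (m, p)) by meas.
rewrite [LHS](@fubini_tonelli1 _ _ _ _ R beta3 beta3 _ mfm (fun p => f0 (m, p))).
rewrite /fubini_F /f /path /=.
have mFp : meas_fun (fun z : P3 * P3 => F (around_point m u z.1 z.2)).
  by apply: (measurableT_comp mF); apply: measurable_around_point => //; meas.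
rewrite -ge0_integralZl//; last 3 first.
- by apply: (measurable_int_param beta3 (fun w w' => F (around_point m u w w'))).
- by move=> w _; exact: integral_ge0.
- by rewrite lee_fin point_density_ge0.
apply: eq_integral => w _; rewrite ge0_integralZl//.
- by apply: (measurableT_comp mFp (f := fun z : P3 * P3 => F (around_point m u z.1 z.2))
    (g := fun w' => (w, w'))); meas.
- by rewrite lee_fin point_density_ge0.
Qed.

Let point_prodt s : tests 1 s -> le1 s ->
  (\int[beta3]_w (prodt 1 s (bes 0 1 w))%:E = \int[mu]_m ((point_density u m)%:E *
     \int[beta3]_w \int[beta3]_w' (prodt 1 s (around_point m u w w'))%:E))%E.
Proof.
move=> ts0 hs0; have /andP[u0 u1] := u01.
have v01 : 0 < 1 - u < 1 by lra.
have [sb [g [sa [ts hs E]]]] := tests_split ts0 hs0 v01.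
have /andP[v0 v1] := v01.
under eq_integral do rewrite E.
under [RHS]eq_integral => m _ do under eq_integral => w _ do under eq_integral => w' _ do rewrite E.
have one : 0 < (1 : R) <= 1 by rewrite ltr01 lexx.
have h0 : 0 < heat 1 (0 : R) by exact: heat_gt0.
have := bes_chain hbeta one (lexx 0) ts hs.
rewrite bessel_split// divr1 => /(congr1 (fun z => ((heat 1 0)^-1)%:E * z)%E).
rewrite muleA -EFinM mulVf ?gt_eqF// mul1e => ->.
have [_ mg g0 ta] := tests_suffix ts.
have tb : tests u (reversed 1 sb).
  rewrite -{1}[u](subKr 1); apply: tests_reversed; [by rewrite ltW|exact: tests_prefix ts|].
  by apply: sub_all (tests_times_prefix ts) => p /andP[].
have /le1_cat[hb [g1 ha]] := hs.
pose G m : \bar R := (2%:E * (chain0 (reversed 1 sb) (1 - (1 - u))%R m *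
  ((g m)%:E * chain0 sa (1 - u)%R m)))%E.
rewrite -/(\int[mu]_m G m)%E -ge0_integralZl//; last 3 first.
- apply: mfeM; first exact: measurable_cst.
  apply: mfeM; first by apply: (measurable_chain_killed tb); meas.
  by apply: mfeM; [exact: mfE|apply: (measurable_chain_killed ta); meas].
- move=> m _; rewrite mule_ge0// mule_ge0//; first exact: chain_killed_ge0 tb.
  by rewrite mule_ge0 ?lee_fin//; exact: chain_killed_ge0 ta.
- by rewrite lee_fin invr_ge0 ltW.
apply: eq_integral => m _; rewrite /G subKr.
have [m0|m0] := leP m 0.
  by rewrite chain_killed_npos// /point_density /hit' ltNge m0/= !mul0r mulr0 !(mul0e, mule0).
have u01' : 0 < u <= 1 by rewrite u0 ltW.
have v01' : 0 < 1 - u <= 1 by rewrite v0 ltW.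
rewrite (chain_killed_bes u01' m0 tb (le1_reversed 1 hb)) (chain_killed_bes v01' m0 ta ha).
under [in RHS]eq_integral => w _ do under eq_integral => w' _ do
  rewrite (prodt_around_point w w' u01 (ltW m0) ts).
rewrite -(@integral_product (fun w => prodt u (reversed 1 sb) (bes m u w))
  (fun w => g m * prodt (1 - u) sa (bes m (1 - u) w))); last 4 first.
- exact: mprodt.
- by apply: mfM => //; exact: mprodt.
- by move=> w; exact: prodt_ge0 tb.
- by move=> w; rewrite mulr_ge0//; exact: prodt_ge0 ta.
under [X in (_ = _ * (_ * X))%E]eq_integral do rewrite EFinM.
rewrite [X in (_ = _ * (_ * X))%E]ge0_integralZl ?lee_fin//; last 2 first.
- by apply: mfE; exact: mprodt.
- by move=> w _; rewrite lee_fin; exact: prodt_ge0 ta.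
have gen (I1 I2 : \bar R) : (((heat 1 0)^-1)%:E * (2%:E * ((hit u m)%:E * I1 *
    ((g m)%:E * ((hit (1 - u) m)%:E * I2)))) = (point_density u m)%:E * (I1 * ((g m)%:E * I2)))%E.
  rewrite [((g m)%:E * (_ * _))%E]muleCA muleACA; move: (I1 * _)%E => Y.
  rewrite /point_density !(hit'E _ m0) !muleA -!EFinM.
  by congr (_%:E * _)%E; ring.
exact: gen.
Qed.

Lemma bes_around_point (F : cpath R -> \bar R) : meas_fun F -> (forall w, 0 <= F w)%E ->
  (\int[beta3]_w F (bes 0 1 w) = \int[mu]_m ((point_density u m)%:E *
     \int[beta3]_w \int[beta3]_w' F (around_point m u w w')))%E.
Proof.
move=> mF F0; rewrite -disintegrate//; have /andP[u0 u1] := u01.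
have v0 : 0 < 1 - u by rewrite subr_gt0.
have mb : meas_fun (fun w : P3 => bes 0 1 w) by apply: measurable_bes; meas.
under [LHS]eq_integral do rewrite -[F _]mul1e.
apply: (@weighted_eq R _ _ _ P3 T2 (cpath R) beta3 nu2 (fun=> 1) (fun w => bes 0 1 w)
  (fun z => point_density u z.1) path F) => //.
- by apply: measurable_point_density; meas.
- by move=> z; exact: point_density_ge0.
apply: (@path_law_unique R _ _ P3 T2 beta3 nu2 (fun=> 1) (fun w => bes 0 1 w)
  (fun z => point_density u z.1) path 1 0 0) => //.
- by rewrite ltr01 lexx.
- by apply: measurable_point_density; meas.
- by move=> z; exact: point_density_ge0.
- by rewrite integral_probability_cst ltry.
- move=> w; split; first by rewrite bes_start.
  by move=> t /andP[t1 _]; rewrite bes_end.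
- move=> z; have [m0|m0] := leP (z.1 : R) 0.
    by rewrite /point_density /hit' ltNge m0/= !mul0r mulr0 eqxx.
  have [e0 e1] := around_point_ends z.2.1 z.2.2 u01 (ltW m0).
  move=> _; split => [|t ht]; first exact: e0.
  by have -> : t = 1 by apply/eqP; rewrite eq_le andbC.
- move=> s ts hs.
  have [mp p0] := prodt_test (lexx 1) ts.
  under [RHS]eq_integral do rewrite EFinM.
  rewrite (disintegrate mp p0) -point_prodt//.
  by under eq_integral do rewrite mul1r.
Qed.

End at_a_point.

Let minimum_chain_out u m s : tests 1 s -> ~ (0 < u < 1) -> minimum_chain m u s 1 0 = 0%E.
Proof.
move=> ts u01; rewrite /minimum_chain; have [u0|u0] := leP u 0.
  have -> : after u s = [::].
    rewrite /after; elim: s 1 {u01} ts => // -[rho f] s IH r /= [/andP[rho0 _] _ _ ts].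
    by rewrite leNgt (le_lt_trans u0 rho0)/= (IH rho).
  by rewrite /= /hit' hit_le0// if_same mule0.
have u1 : 1 <= u by rewrite leNgt; apply/negP => u1; apply: u01; rewrite u0.
have [-> _] := after_all ts u1.
by rewrite /= /minimum_end /hit' hit_le0 ?subr_le0// if_same mul0e.
Qed.

Let minimum_chain_npos u m s : tests 1 s -> m <= 0 -> minimum_chain m u s 1 0 = 0%E.
Proof.
move=> ts m0; have tb := tests_before u ts; rewrite /minimum_chain.
rewrite (@chain_translate m hit' _ _ _ _ _ mhit' hit'_ge0 _ tb)// add0r.
by rewrite chain_killed_npos// mul0e.
Qed.

Lemma measurable_rotated_mean (F : cpath R -> \bar R) : meas_fun F ->
  (forall w, 0 <= F w)%E ->
  meas_fun (fun u : R => \int[beta3]_w F (rotate u (bes 0 1 w)))%E.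
Proof.
move=> mF F0; apply: (measurable_int_param beta3 (fun u w => F (rotate u (bes 0 1 w)))) => //.
by apply: (measurableT_comp mF); apply: measurable_rotate; [|apply: measurable_bes]; meas.
Qed.

(** Both sides are integrals over [u] and [m] of the same pairs of Bessel bridges: on the left
    through the minimum [- m] of the bridge at [1 - u], on the right through the value [m] of the
    excursion at [u]. *)
Let rotated_prodt s : tests 1 s -> le1 s ->
  (\int[beta]_w (prodt 1 s (gam 0 1 w))%:E =
   \int[mu]_(u in `]0%R, 1%R[) \int[beta3]_w (prodt 1 s (rotate u (bes 0 1 w)))%:E)%E.
Proof.
move=> ts hs; have one : 0 < (1 : R) <= 1 by rewrite ltr01 lexx.
have h0 : 0 < heat 1 (0 : R) by exact: heat_gt0.
have := gam_chain hbeta 0 one ts.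
rewrite -level_chain_None (level_chain_minimum None 0 ts ltr01).
move=> /(congr1 (fun z => ((heat 1 0)^-1)%:E * z)%E).
rewrite muleA -EFinM mulVf ?gt_eqF// mul1e => ->.
pose G m u : \bar R := (((heat 1 0)^-1)%:E * (2%:E * minimum_chain m u s 1 0))%E.
have C0 m u : (0 <= minimum_chain m u s 1 0)%E by exact: minimum_chain_ge0 ts.
have hi0 : 0 <= (heat 1 (0 : R))^-1 by rewrite invr_ge0 ltW.
have G0 m u : (0 <= G m u)%E by rewrite mule_ge0 ?lee_fin// mule_ge0.
have mC d (T : measurableType d) (m u : T -> R) : meas_fun m -> meas_fun u ->
    meas_fun (fun a => minimum_chain (m a) (u a) s 1 0).
  by move=> mm mu'; apply: (measurable_minimum_chain ts); meas.
have mG d (T : measurableType d) (m u : T -> R) : meas_fun m -> meas_fun u ->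
    meas_fun (fun a => G (m a) (u a)).
  by move=> mm mu'; apply: mfeM; [exact: measurable_cst|apply: mfeM; [exact: measurable_cst|exact: mC]].
transitivity (\int[mu]_m \int[mu]_u G m u)%E.
  rewrite -ge0_integralZl ?lee_fin//; last 2 first.
  - apply: (measurable_restrict None); apply: mfeM; first exact: measurable_cst.
    apply: (measurable_int_param mu (fun m u => minimum_chain m u s 1 0)) => //.
    by apply: mC; meas.
  - by move=> m _; apply: restrict_ge0 => m'; rewrite mule_ge0//; exact: integral_ge0.
  apply: eq_integral => m _; rewrite /restrict /=.
  have m1 : meas_fun (fun u : R => minimum_chain m u s 1 0) by apply: mC; meas.
  rewrite -ge0_integralZl//.
  rewrite -ge0_integralZl ?lee_fin//.
  - by apply: mfeM.
  - by move=> u _; rewrite mule_ge0.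
rewrite (tonelli mu mu G); last 2 first.
- by apply: mG; meas.
- exact: G0.
rewrite (@integral_supp _ `]0, 1[%classic)//; last first.
  move=> u /=; rewrite in_itv/= => u01; rewrite integral0_eq// => m _.
  by rewrite /G minimum_chain_out// !mule0.
have mp : meas_fun (fun w : cpath R => (prodt 1 s w)%:E).
  by apply: mfE; apply: measurable_prodt ts _; [rewrite lexx|meas].
have p0 w : (0 <= (prodt 1 s w)%:E)%E by rewrite lee_fin (prodt_ge0 _ _ ts).
have mG' : meas_fun (fun z : R * R => G z.2 z.1) by apply: mG; meas.
have iG := measurable_int_param mu (fun u m => G m u) mG' (fun u m => G0 m u).
apply: ge0_ae_eq_integral.
- by meas.
- exact: measurable_funTS iG.
- exact: measurable_funTS (measurable_rotated_mean mp p0).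
- by move=> u _; apply: integral_ge0 => m _; exact: G0.
- by move=> u _; apply: integral_ge0 => w _; exact: p0.
exists [set` [seq p.1 | p <- s]]; split.
+ by apply: countable_measurable => //; apply: finite_set_countable; exact: finite_seq.
+ exact: (countable_lebesgue_measure0 (finite_set_countable (finite_seq _))).
move=> u /= nu; apply: contrapT => us; apply: nu; rewrite in_itv/= => u01.
rewrite (bes_around_point u01 (F := fun w => (prodt 1 s (rotate u w))%:E)); last 2 first.
- by apply: (measurableT_comp mp); apply: measurable_rotate; meas.
- by move=> w; exact: p0.
apply: eq_integral => m _; rewrite /G.
have [m0|m0] := leP m 0.
  by rewrite minimum_chain_npos// /point_density /hit' ltNge m0/= !mul0r mulr0 !(mul0e, mule0).
rewrite (minimum_chain_bes u01 m0 ts hs); last exact/negP.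
have eqI : (\int[beta3]_w \int[beta3]_w' (prodt 1 s (around_minimum m u w w'))%:E =
    \int[beta3]_w \int[beta3]_w' (prodt 1 s (rotate u (around_point m u w w')))%:E)%E.
  apply: eq_integral => w _; apply: eq_integral => w' _; congr EFin.
  have ht := tests_times ts; apply/esym.
  apply: (eq_prod_times (b := fun rho => 0 < rho < 1)
    (F := fun rho => rotate u (around_point m u w w') (1 - rho))
    (G := fun rho => around_minimum m u w w' (1 - rho)) ht) => rho /andP[h1 h2].
  have h3 : 0 <= 1 - rho <= 1 by lra.
  exact: (rotate_around_point w w' u01 (ltW m0) h3).
have gen (I : \bar R) : (((heat 1 0)^-1)%:E * (2%:E * ((hit u m * hit (1 - u) m)%:E * I)) =
    (point_density u m)%:E * I)%E.
  by rewrite /point_density !(hit'E _ m0) !muleA -!EFinM; congr (_%:E * _)%E; ring.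
exact: (etrans (congr1 (fun I => ((heat 1 0)^-1)%:E * (2%:E * (_ * I)))%E eqI) (gen _)).
Qed.

Let T3 := (measurableTypeR R * P3)%type.
Let nu3 : {measure set T3 -> \bar R} := (@lebesgue_measure R \x beta3)%E.
Let weight (z : T3) : R := if 0 < (z.1 : R) < 1 then 1 else 0.
Let rotated (z : T3) : cpath R := rotate z.1 (bes 0 1 z.2).

Let disintegrate3 (F : cpath R -> \bar R) : meas_fun F -> (forall w, 0 <= F w)%E ->
  (\int[nu3]_z ((weight z)%:E * F (rotated z)) =
   \int[mu]_(u in `]0%R, 1%R[) \int[beta3]_w F (rotate u (bes 0 1 w)))%E.
Proof.
move=> mF F0; pose f (z : T3) := ((weight z)%:E * F (rotated z))%E.
have mr : meas_fun (fun z : T3 => F (rotated z)).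
  by apply: (measurableT_comp mF); apply: measurable_rotate; [|apply: measurable_bes]; meas.
have mf : meas_fun f by apply: mfeM => //; apply: mfE; rewrite /weight; meas.
have f0 z : (0 <= f z)%E by rewrite mule_ge0// lee_fin /weight; case: ifP.
rewrite [LHS](@fubini_tonelli1 _ _ _ _ R (@lebesgue_measure R) beta3 f mf f0).
rewrite (@integral_supp _ `]0, 1[%classic)//; last first.
  move=> u /=; rewrite in_itv/= => u01; rewrite /fubini_F /f /weight integral0_eq// => w _ /=.
  by rewrite (negbTE (introN idP u01)) mul0e.
apply: eq_integral => u; rewrite inE/= in_itv/= => u01; rewrite /fubini_F /f /weight /=.
by under eq_integral do rewrite u01 mul1e.
Qed.

(* Vervaat's theorem: the bridge is the normalized excursion seen from an independent uniform
   time. *)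
Lemma bridge_rotate (F : cpath R -> \bar R) : meas_fun F -> (forall w, 0 <= F w)%E ->
  (\int[beta]_w F (gam 0 1 w) =
   \int[mu]_(u in `]0%R, 1%R[) \int[beta3]_w F (rotate u (bes 0 1 w)))%E.
Proof.
move=> mF F0; rewrite -disintegrate3//.
have mg : meas_fun (fun w : cpath R => gam 0 1 w) by apply: measurable_gam; meas.
have mw : meas_fun weight by rewrite /weight; meas.
have w0 z : 0 <= weight z by rewrite /weight; case: ifP.
have mr : meas_fun rotated.
  by apply: measurable_rotate; [|apply: measurable_bes]; meas.
under [LHS]eq_integral do rewrite -[F _]mul1e.
apply: (@weighted_eq R _ _ _ (cpath R) T3 (cpath R) beta nu3 (fun=> 1) (fun w => gam 0 1 w)
  weight rotated F) => //.
apply: (@path_law_unique R _ _ (cpath R) T3 beta nu3 (fun=> 1) (fun w => gam 0 1 w)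
  weight rotated 1 0 0) => //.
- by rewrite ltr01 lexx.
- by rewrite integral_probability_cst ltry.
- move=> w; split; first by rewrite gam_start.
  by move=> t /andP[t1 _]; rewrite gam_end.
- move=> z; rewrite /weight /rotated; case: ifPn => [/andP[u0 u1] _|]; last by rewrite eqxx.
  have b0 w : bes 0 1 w 0 = 0 by rewrite bes_start.
  have b1 w : bes 0 1 w 1 = 0 by rewrite bes_end.
  split => [|t ht].
    rewrite rotateE addr0 (clip_lt0 (s := (z.1 : R) - 1)) ?subr_le0 ?ltW// b0 addr0 subrr//.
  have -> : t = 1 by apply/eqP; rewrite eq_le andbC.
  rewrite rotateE addrK (clip_gt1 (s := (z.1 : R) + 1)) ?lerDr ?ltW// b1 add0r subrr//.
- move=> s ts hs.
  have [mp p0] := prodt_test (lexx 1) ts.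
  under [RHS]eq_integral do rewrite EFinM.
  rewrite (disintegrate3 mp p0) -rotated_prodt//.
  by under eq_integral do rewrite mul1r.
Qed.

End with_bridge.

End vervaat_law.

(** * Minimum, first return and first passage of a fixed path *)

Section path_functionals.
Context {R : realType}.
Implicit Types (t u s lambda z : R) (f X w : cpath R).

Lemma path_near f t (A : set R) : open A -> A (f t) ->
  exists2 e, 0 < e & forall t', `|t - t'| < e -> A (f t').
Proof.
move=> oA At; have c := @continuous_path R f t.
have /nbhs_ballP[e e0 he] := c A (open_nbhs_nbhs (conj oA At)).
by exists e => // t' ht; exact: he.
Qed.

(** The set of minimizers is nonempty by compactness, and by continuity its infimum is itself a
    minimizer, hence the first one. *)
Lemma argmin01P f : [/\ 0 <= argmin01 f <= 1,
  forall s, 0 <= s <= 1 -> f (argmin01 f) <= f s &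
  forall s, 0 <= s < argmin01 f -> f (argmin01 f) < f s].
Proof.
set S := [set t | 0 <= t <= 1 /\ forall s, 0 <= s <= 1 -> f t <= f s].
have [c c01 hc] := @EVT_min R f 0 1 ler01 (@continuous_subspaceT _ _ _ _ (@continuous_path R f)).
have {}c01 : 0 <= c <= 1 by move: c01; rewrite in_itv.
have {}hc s : 0 <= s <= 1 -> f c <= f s by move=> hs; apply: hc; rewrite in_itv.
have Sc : S c by [].
have lb0 : lbound S 0 by move=> t [/andP[]].
have hS : has_inf S by split; [exists c|exists 0].
have t0 : 0 <= argmin01 f by apply: lb_le_inf => //; exists c.
have tle t : S t -> argmin01 f <= t by move=> St; apply: ge_inf => //; exists 0.
have tc : argmin01 f <= c by exact: tle.
have t1 : argmin01 f <= 1 by apply: le_trans tc _; case/andP: c01.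
have fc : f (argmin01 f) <= f c.
  rewrite leNgt; apply/negP => h.
  have [e e0 he] := path_near (@open_gt R (f c)) h.
  have [t [t01 ht] te] := inf_adherent e0 hS.
  have : f c < f t.
    apply: he; rewrite distrC ger0_norm; first by rewrite ltrBlDl.
    by rewrite subr_ge0; apply: tle.
  by rewrite ltNge ht.
have hm s : 0 <= s <= 1 -> f (argmin01 f) <= f s by move=> hs; exact: le_trans fc (hc _ hs).
split => //; first by rewrite t0.
move=> s /andP[s0 st]; rewrite ltNge; apply/negP => h.
have : argmin01 f <= s.
  apply: tle; split; first by rewrite s0 (le_trans (ltW st)).
  by move=> s' hs'; exact: le_trans h (hm _ hs').
by rewrite leNgt st.
Qed.

Lemma argmin01_eq f t : 0 <= t <= 1 -> (forall s, 0 <= s <= 1 -> f t <= f s) ->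
  (forall s, 0 <= s < t -> f t < f s) -> argmin01 f = t.
Proof.
move=> /andP[t0 t1] h1 h2; have [/andP[a0 a1] h3 h4] := argmin01P f.
have [at_|ta|//] := ltgtP (argmin01 f) t.
- have := h2 (argmin01 f); rewrite a0 at_ => /(_ isT).
  by rewrite ltNge h3// t0.
- have := h4 t; rewrite t0 ta => /(_ isT).
  by rewrite ltNge h1// a0.
Qed.

Section vervaat_of_rotation.
Variables (lambda u : R) (X f : cpath R).
Hypotheses (lambda_lt0 : lambda < 0) (u01 : 0 < u < 1) (X1 : X 1 = lambda)
  (Xabove : forall s, 0 < s < 1 -> lambda * s < X s)
  (f_before : forall t, 0 <= t <= 1 - u -> f t = X (u + t) - X u)
  (f_after : forall t, 1 - u <= t <= 1 -> f t = X (u + t - 1) - X u + lambda).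

Let u0 : 0 < u. Proof. by have /andP[] := u01. Qed.
Let u1 : u < 1. Proof. by have /andP[] := u01. Qed.

Let X_gt s : 0 < s < 1 -> lambda < X s.
Proof.
move=> s01; apply: lt_trans (Xabove s01); have /andP[_ s1] := s01.
by rewrite -subr_gt0 -[X in _ - X]mulr1 -mulrBr nmulr_rgt0// subr_lt0.
Qed.

Let f0 : f 0 = 0.
Proof. by rewrite f_before ?addr0 ?subrr// lexx subr_ge0 ltW. Qed.

Let f1 : f 1 = lambda.
Proof. by rewrite f_after ?addrK ?subrr ?add0r// lexx andbT gerBl ltW. Qed.

Let fu : f (1 - u) = lambda - X u.
Proof. by rewrite f_before ?lexx ?subr_ge0 ?(ltW u1)// addrCA subrr addr0 X1. Qed.

Let f_ge s : 0 <= s <= 1 - u -> lambda - X u <= f s.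
Proof.
move=> /andP[s0 su]; rewrite f_before ?s0// lerD2r.
move: su; rewrite le_eqVlt => /predU1P[->|su]; first by rewrite addrCA subrr addr0 X1.
by apply/ltW/X_gt; apply/andP; split; have := u0; lra.
Qed.

(** [f] consists of the increments of [X] read from [u]. Its minimum is [lambda - X u], at [1 - u]:
    earlier values are larger since [X > lambda], later ones are not smaller since [X >= 0] up to
    [u]. Rotating there restores [X]. *)
Lemma vervaat_nonneg t : (forall s, 0 <= s <= u -> 0 <= X s) -> 0 <= t <= 1 -> vervaat f t = X t.
Proof.
move=> Xu /andP[t0 t1].
have tau : argmin01 f = 1 - u.
  apply: argmin01_eq; first by apply/andP; split; have := u0; have := u1; lra.
  - move=> s /andP[s0 s1]; rewrite fu; have [su|us] := leP s (1 - u); first by rewrite f_ge// s0.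
    rewrite f_after ?(ltW us)// addrAC -[leLHS]add0r addrA lerD2r lerD2r Xu//.
    by lra.
  - move=> s /andP[s0 su]; rewrite fu f_before ?s0 ?(ltW su)// ltrD2r.
    by apply: X_gt; apply/andP; split; have := u0; lra.
rewrite vervaatE// /vervaat_fun tau fu f1 subKr; have [tu|ut] := leP t u.
  rewrite f_after; last by apply/andP; split; have := u1; lra.
  by rewrite (_ : u + (1 - u + t) - 1 = t); ring.
rewrite f_before; last by apply/andP; split; have := u0; lra.
by rewrite (_ : u + (1 - u + t - 1) = t); ring.
Qed.

(** A negative value of [X] before [u] moves the minimum of [f] to some [tau > 1 - u], corresponding
    to a time [s] of [X]. At the time [1 - s] the transform takes the value [lambda - X s], which
    lies below the line because [X s] lies above it. *)
Lemma vervaat_negative s1 : 0 <= s1 <= u -> X s1 < 0 ->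
  ~ (forall t, 0 < t < 1 -> lambda * t < vervaat f t).
Proof.
move=> /andP[s10 s1u] Xs1 hV; have [/andP[t0 t1] hmin _] := argmin01P f.
set tau := argmin01 f in t0 t1 hmin.
have hu0 := u0; have hu1 := u1.
have tu : 1 - u < tau.
  rewrite ltNge; apply/negP => tu.
  have hs : 0 <= s1 + (1 - u) <= 1 by lra.
  have := hmin _ hs; rewrite leNgt => /negP; apply.
  apply: lt_le_trans (f_ge (introT andP (conj t0 tu))).
  rewrite f_after; last by lra.
  by rewrite (_ : u + (s1 + (1 - u)) - 1 = s1); [lra|ring].
pose s := tau + u - 1; have s01 : 0 < s < 1 by rewrite /s; lra.
have t01 : 0 < 1 - s < 1 by move: s01 => /andP[? ?]; lra.
have := hV _ t01; rewrite vervaatE// /vervaat_fun -/tau ifF; last first.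
  by apply/negP; rewrite /s; lra.
rewrite (_ : tau + (1 - s) - 1 = 1 - u); last by rewrite /s; ring.
rewrite fu f1 f_after; last by lra.
rewrite (_ : u + tau - 1 = s); last by rewrite /s; ring.
by have := Xabove s01; lra.
Qed.

End vervaat_of_rotation.

Lemma first_negative_geP X u : X 1 < 0 -> X 0 = 0 -> 0 <= u <= 1 ->
  u <= first_negative X <-> (forall s, 0 <= s <= u -> 0 <= X s).
Proof.
move=> X1 X0 /andP[u0 u1]; rewrite /first_negative; set N := [set t | _].
have N1 : N 1 by rewrite /N/= ltr01 lexx.
have lb0 : lbound N 0 by move=> t [/andP[/ltW]].
have leN t : N t -> inf N <= t by move=> Nt; apply: ge_inf => //; exists 0.
split => [uN s /andP[s0 su]|hX]; last first.
  apply: lb_le_inf; first by exists 1.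
  move=> t [/andP[t0 t1] Xt]; rewrite leNgt; apply/negP => tu.
  by have := hX t; rewrite (ltW t0) (ltW tu) leNgt Xt => /(_ isT).
rewrite leNgt; apply/negP => Xs.
have s_gt0 : 0 < s by rewrite lt_neqAle s0 andbT eq_sym; apply/eqP => se; move: Xs; rewrite se X0 ltxx.
have Ns : N s by split => //; rewrite s_gt0 (le_trans su).
have [e e0 he] := path_near (@open_lt R 0) Xs.
(* The case [s = u] would not contradict the infimum; by continuity [X] is already negative at
   [s - d]. *)
pose d := Num.min (s / 2) (e / 2).
have d0 : 0 < d by rewrite lt_min !divr_gt0.
have ds : d <= s / 2 by rewrite ge_min lexx.
have de : d <= e / 2 by rewrite ge_min lexx orbT.
have Nd : N (s - d).
  split; first by apply/andP; split; [lra|have := le_trans su u1; lra].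
  by apply: he; rewrite opprB addrCA subrr addr0 gtr0_norm//; lra.
have := leN _ Nd; have := le_trans su uN; lra.
Qed.

Lemma first_negative_itv X : X 1 < 0 -> 0 <= first_negative X <= 1.
Proof.
move=> X1; rewrite /first_negative; set N := [set t | _].
have N1 : N 1 by rewrite /N/= ltr01 lexx.
have lb0 : lbound N 0 by move=> t [/andP[/ltW]].
apply/andP; split; first by apply: lb_le_inf => //; exists 1.
by apply: ge_inf => //; exists 0.
Qed.

Lemma first_return_ge0 X : 0 <= first_return X.
Proof.
rewrite /first_return; set N := [set t | _].
have [[t Nt]|/set0P/negP/negPn/eqP ->] := pselect (N !=set0); last by rewrite inf0.
by apply: lb_le_inf; [exists t|move=> s [/andP[/ltW]]].
Qed.

Lemma first_return_le1 X : first_return X <= 1.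
Proof.
rewrite /first_return; set N := [set t | _].
have [[t [t01 Xt]]|/set0P/negP/negPn/eqP ->] := pselect (N !=set0); last by rewrite inf0.
apply: (@le_trans _ _ t); last by case/andP: t01.
by apply: ge_inf => //; exists 0 => s [/andP[/ltW]].
Qed.

Lemma first_return_eq X z : 0 < z <= 1 -> X z = 0 -> (forall t, 0 < t < z -> X t != 0) ->
  first_return X = z.
Proof.
move=> z01 Xz hX; rewrite /first_return; set N := [set t | _].
have Nz : N z by [].
apply/eqP; rewrite eq_le; apply/andP; split.
  by apply: ge_inf => //; exists 0 => s [/andP[/ltW]].
apply: lb_le_inf; first by exists z.
move=> t [/andP[t0 t1] Xt]; rewrite leNgt; apply/negP => tz.
by have := hX t; rewrite t0 tz Xt eqxx => /(_ isT).
Qed.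

(** Up to the first passage of [X] below 0, the larger path [X'] is positive. The infimum over an
    empty set being 0, a zero of [X'] has to exist, which the intermediate value theorem
    provides. *)
Lemma first_negative_le_return X X' : X 1 < 0 -> X 0 = 0 -> X' 1 < 0 ->
  (forall t, 0 < t <= 1 -> X t < X' t) -> first_negative X <= first_return X'.
Proof.
move=> X1 X0 X'1 XX'; have /andP[n0 n1] := first_negative_itv X1.
set n := first_negative X in n0 n1 *.
have [n0'|n_gt0] := leP n 0; first exact: le_trans n0' (first_return_ge0 X').
have pos t : 0 < t <= n -> 0 < X' t.
  move=> /andP[t0 tn]; have t1 : t <= 1 by exact: le_trans n1.
  apply: (@le_lt_trans _ _ (X t)); last by apply: XX'; rewrite t0.
  have t01 : 0 <= t <= 1 by rewrite (ltW t0).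
  by apply: (iffLR (first_negative_geP X1 X0 t01) tn); rewrite (ltW t0) lexx.
rewrite /first_return; set N := [set t | _].
apply: lb_le_inf; last first.
  move=> t [/andP[t0 t1] Xt]; rewrite leNgt; apply/negP => tn.
  by have := pos t; rewrite t0 (ltW tn) Xt ltxx => /(_ isT).
have [|c] := @IVT R X' n 1 0 n1 (@continuous_subspaceT _ _ _ _ (@continuous_path R X')).
  have Xn : 0 < X' n by apply: pos; rewrite n_gt0 lexx.
  by rewrite ge_min (ltW X'1) orbT le_max (ltW Xn).
rewrite in_itv/= => /andP[nc c1] Xc; exists c; split => //.
by rewrite (lt_le_trans n_gt0).
Qed.

Let cont_affine (p q : R) : continuous (fun t => clip (p + t * q)).
Proof.
move=> t; have c : {for t, continuous (fun t : R => p + t * q)}.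
  apply: cvgD; first exact: cvg_cst.
  by apply: cvgM; [exact: cvg_id|exact: cvg_cst].
exact: (continuous_comp c (@continuous_clip R _)).
Qed.

Let measurable_clip_ev t : meas_fun (fun w : cpath R => w (clip t)).
Proof. by apply: measurable_ev; exact: clip_itv. Qed.

Let affine_itv (p q t : R) : p <= t <= q -> exists2 s, 0 <= s <= 1 & t = p + s * (q - p).
Proof.
move=> /andP[pt tq]; have [pq|pq] := eqVneq q p.
  exists 0; first by rewrite lexx ler01.
  by apply/eqP; rewrite mul0r addr0 eq_le pt -pq tq.
have d0 : 0 < q - p by rewrite subr_gt0 lt_neqAle eq_sym pq (le_trans pt).
exists ((t - p) / (q - p)); last by rewrite divfK ?gt_eqF// addrC subrK.
apply/andP; split; first by rewrite divr_ge0 ?subr_ge0// ltW // -subr_gt0.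
by rewrite ler_pdivrMr// mul1r lerD2r.
Qed.

Let in_affine (p q s : R) : p <= q -> 0 <= s <= 1 -> p <= p + s * (q - p) <= q.
Proof.
move=> pq /andP[s0 s1]; have d0 : 0 <= q - p by rewrite subr_ge0.
by rewrite lerDl mulr_ge0//= -lerBrDl ler_piMl.
Qed.

Lemma measurable_zero_between (p q : R) : 0 <= p -> q <= 1 ->
  measurable [set w : cpath R | exists2 t, p <= t <= q & w t = 0].
Proof.
move=> p0 q1; have [pq|qp] := leP p q; last first.
  rewrite (_ : [set w | _] = set0)//; apply/seteqP; split => // w [t /andP[pt tq]] _.
  by have := le_trans pt tq; rewrite leNgt qp.
rewrite (_ : [set w | _] = ~` [set w : cpath R | forall s, 0 <= s <= 1 ->
    0 < `|w (clip (p + s * (q - p)))|]); last first.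
  apply/seteqP; split => w /=.
    move=> [t ptq wt] h; have [s s01 ts] := affine_itv ptq.
    have := h s s01; rewrite -ts clip_id ?wt ?normr0 ?ltxx//.
    by case/andP: ptq => pt tq; rewrite (le_trans p0 pt) (le_trans tq q1).
  apply: contra_notP => h s s01; rewrite normr_gt0; apply/eqP => ws; apply: h.
  exists (p + s * (q - p)); first exact: in_affine.
  rewrite -[X in w X]clip_id//; case/andP: (in_affine pq s01) => h1 h2.
  by rewrite (le_trans p0 h1) (le_trans h2 q1).
apply: measurableC; apply: (@measurable_all_gt0 _ _ _ (fun w : cpath R => fun s =>
  `|w (clip (p + s * (q - p)))|)) => [w|s]; last first.
  by apply: mf_norm; exact: measurable_clip_ev.
by move=> t; exact: (cvg_norm (@continuous_path_comp R w _ (@cont_affine p (q - p)) t)).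
Qed.

Lemma measurable_zero_lt (a : R) : 0 < a <= 1 ->
  measurable [set w : cpath R | exists2 t, 0 < t < a & w t = 0].
Proof.
move=> /andP[a0 a1]; rewrite (_ : [set w | _] = \bigcup_n [set w : cpath R |
    exists2 t, n.+1%:R^-1 <= t <= a - n.+1%:R^-1 & w t = 0]); last first.
  apply/seteqP; split => [w [t /andP[t0 ta] wt]|w [n _ [t /andP[h1 h2] wt]]]; last first.
    exists t => //; have n0 : 0 < (n.+1%:R : R)^-1 by rewrite invr_gt0.
    by rewrite (lt_le_trans n0 h1) (le_lt_trans h2)// gtrBl.
  have m0 : 0 < Num.min t (a - t) by rewrite lt_min t0 subr_gt0.
  have [n] := ltr_add_invr m0; rewrite add0r lt_min => /andP[h1 h2].
  by exists n => //; exists t => //; rewrite (ltW h1) lerBrDl -lerBrDr ltW.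
apply: bigcupT_measurable => n; apply: measurable_zero_between; first by rewrite invr_ge0.
by rewrite lerBlDr (le_trans a1)// lerDl invr_ge0.
Qed.

Lemma measurable_first_return : meas_fun (@first_return R).
Proof.
apply: measurable_fun_lt => a; have [a0|a0] := leP a 0.
  rewrite (_ : [set w | _] = set0)//; apply/seteqP; split => // w /=.
  by rewrite ltNge (le_trans a0 (first_return_ge0 w)).
have [a1|a1] := ltP 1 a.
  rewrite (_ : [set w | _] = setT)//; apply/seteqP; split => // w _ /=.
  exact: le_lt_trans (first_return_le1 w) a1.
have a01 : 0 < a <= 1 by rewrite a0.
(* The second set consists of the paths without zero in []0, 1]], whose first return is the infimum
   of the empty set, 0. *)
rewrite (_ : [set w | _] = [set w : cpath R | exists2 t, 0 < t < a & w t = 0] `|`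
    ~` ([set w : cpath R | exists2 t, 0 < t < 1 & w t = 0] `|`
        [set w : cpath R | exists2 t, 1 <= t <= 1 & w t = 0])); last first.
  apply/seteqP; split => w /=.
    move=> wa; have [|h] := pselect (exists2 t, 0 < t < a & w t = 0); first by left.
    right=> hz; move: wa; rewrite ltNge => /negP; apply.
    rewrite /first_return; set N := [set t | _].
    have Nne : N !=set0.
      case: hz => [[t /andP[t0 t1] wt]|[t /andP[t1 t1'] wt]]; exists t; split => //.
        by rewrite t0 ltW.
      by rewrite (lt_le_trans _ t1)// t1'.
    apply: lb_le_inf => // t [/andP[t0 t1] wt]; rewrite leNgt; apply/negP => ta.
    by apply: h; exists t => //; rewrite t0.
  move=> [[t /andP[t0 ta] wt]|hz].
    have t1 := le_trans (ltW ta) a1.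
    apply: le_lt_trans ta; apply: ge_inf; first by exists 0 => s [/andP[/ltW]].
    by split => //; rewrite t0.
  rewrite /first_return (_ : [set t | _] = set0) ?inf0//.
  apply/seteqP; split => // t [/andP[t0 t1] wt]; apply: hz.
  move: t1; rewrite le_eqVlt => /predU1P[te|t1]; last by left; exists t => //; rewrite t0.
  by right; exists t => //; rewrite te lexx.
apply: measurableU; first exact: measurable_zero_lt.
apply: measurableC; apply: measurableU; first by apply: measurable_zero_lt; rewrite ltr01 lexx.
exact: measurable_zero_between.
Qed.

Let measurable_nonneg_until (a : R) : 0 < a ->
  measurable [set w : cpath R | forall t, 0 < t <= 1 -> t < a -> 0 <= w t].
Proof.
move=> a0; pose b := Num.min a 1.
have b0 : 0 < b by rewrite lt_min a0 ltr01.
have b1 : b <= 1 by rewrite ge_min lexx orbT.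
have ba : b <= a by rewrite ge_min lexx.
rewrite (_ : [set w | _] = [set w : cpath R | forall s, 0 <= w (b * clip s)]).
  apply: (measurable_all_ge0 (F := fun (w : cpath R) s => w (b * clip s))) => [w|s].
    apply: continuous_path_comp => t; apply: cvgM; [exact: cvg_cst|exact: continuous_clip].
  apply: measurable_ev; have /andP[c0 c1] := clip_itv s.
  by rewrite mulr_ge0 ?(ltW b0)// mulr_ile1// ltW.
apply/seteqP; split => w /= h.
  move=> s; have /andP[c0 c1] := clip_itv s; set t := b * clip s.
  have t0 : 0 <= t by rewrite mulr_ge0// ltW.
  have tb : t <= b by rewrite ler_piMr// ltW.
  rewrite leNgt; apply/negP => wt; have [e e0 he] := path_near (@open_lt R 0) wt.
  have [t' ht' /andP[t'0 t'b]] : exists2 t', `|t - t'| < e & 0 < t' < b.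
    have [tlb|tlb] := ltP t b.
      exists (t + Num.min (e / 2) ((b - t) / 2)).
        rewrite opprD addrA subrr add0r normrN gtr0_norm.
          by apply: (@le_lt_trans _ _ (e / 2)); [rewrite ge_min lexx|lra].
        by rewrite lt_min !divr_gt0 ?subr_gt0.
      have m0 : 0 < Num.min (e / 2) ((b - t) / 2) by rewrite lt_min !divr_gt0 ?subr_gt0.
      have m1 : Num.min (e / 2) ((b - t) / 2) <= (b - t) / 2 by rewrite ge_min lexx orbT.
      by lra.
    have m0 : 0 < Num.min (e / 2) (b / 2) by rewrite lt_min !divr_gt0.
    have m1 : Num.min (e / 2) (b / 2) <= b / 2 by rewrite ge_min lexx orbT.
    exists (t - Num.min (e / 2) (b / 2)); last by lra.
    rewrite opprB addrCA subrr addr0 gtr0_norm//.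
    by apply: (@le_lt_trans _ _ (e / 2)); [rewrite ge_min lexx|lra].
  have : w t' < 0 := he t' ht'.
  rewrite ltNge => /negP; apply; apply: h; last exact: lt_le_trans ba.
  by rewrite t'0 (le_trans (ltW t'b)).
move=> t /andP[t0 t1] ta; have tb : t <= b by rewrite le_min (ltW ta) t1.
have := h (t / b); rewrite clip_id; first by rewrite mulrC divfK// gt_eqF.
by rewrite divr_ge0 ?(ltW t0) ?(ltW b0)//= ler_pdivrMr// mul1r.
Qed.

Lemma measurable_first_negative : meas_fun (@first_negative R).
Proof.
apply: measurable_fun_lt => a.
have lb0 (w : cpath R) : lbound [set t | 0 < t <= 1 /\ w t < 0] 0 by move=> s [/andP[/ltW]].
have [a0|a0] := leP a 0.
  rewrite (_ : [set w | _] = set0)//; apply/seteqP; split => // w /=; rewrite ltNge => /negP; apply.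
  apply: le_trans a0 _; rewrite /first_negative; set N := [set t | _].
  have [[t Nt]|/set0P/negP/negPn/eqP ->] := pselect (N !=set0); last by rewrite inf0.
  by apply: lb_le_inf; [exists t|exact: lb0].
pose M (a : R) := [set w : cpath R | forall t, 0 < t <= 1 -> t < a -> 0 <= w t].
(* [M 2] consists of the paths that are nowhere negative, for which the infimum over the empty set
   is 0. *)
rewrite (_ : [set w | _] = M 2 `|` ~` M a); last first.
  apply/seteqP; split => w /=.
    move=> wa; have [h|h] := pselect (M a w); last by right.
    left=> t t01 _; rewrite leNgt; apply/negP => wt.
    move: wa; rewrite ltNge => /negP; apply.
    apply: lb_le_inf; first by exists t.
    move=> s [s01 ws]; rewrite leNgt; apply/negP => sa.
    by have := h s s01 sa; rewrite leNgt ws.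
  move=> [h|h].
    rewrite /first_negative (_ : [set t | _] = set0) ?inf0//.
    apply/seteqP; split => // t [t01 wt]; have t2 : t < 2 by case/andP: t01; lra.
    by have := h t t01 t2; rewrite leNgt wt.
  rewrite ltNge; apply/negP => wa; apply: h => t t01 ta; rewrite leNgt; apply/negP => wt.
  move: ta; rewrite ltNge => /negP; apply; apply: le_trans wa _.
  by apply: ge_inf => //; exists 0.
by apply: measurableU; [|apply: measurableC]; exact: measurable_nonneg_until.
Qed.

Lemma measurable_above (g : R -> R) (l : R) : continuous g -> 0 < l <= 1 ->
  measurable [set w : cpath R | forall t, 0 < t < l -> g t < w t].
Proof.
move=> cg /andP[l0 l1]; pose p n := l / n.+2%:R.
have p0 n : 0 < p n by rewrite divr_gt0.
have p2 n : p n <= l - p n.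
  have : p n <= l / 2 by rewrite ler_wpM2l ?(ltW l0)// lef_pV2 ?posrE// ler_nat.
  lra.
rewrite (_ : [set w | _] = \bigcap_n [set w : cpath R | forall s, 0 <= s <= 1 ->
    0 < w (clip (p n + s * (l - p n - p n))) - g (clip (p n + s * (l - p n - p n)))]).
  apply: bigcapT_measurable => n.
  apply: (@measurable_all_gt0 _ _ _ (fun (w : cpath R) s =>
    w (clip (p n + s * (l - p n - p n))) - g (clip (p n + s * (l - p n - p n))))) => [w t|s].
    apply: cvgB; first exact: (continuous_path_comp (@cont_affine (p n) (l - p n - p n))).
    exact: (continuous_comp (@cont_affine (p n) (l - p n - p n) t) (cg _)).
  by apply: mfD => //; exact: measurable_clip_ev.
apply/seteqP; split => w /= h.
  move=> n _ s s01; have /andP[h1 h2] := in_affine (p2 n) s01.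
  have pn := p0 n.
  have c01 : 0 <= p n + s * (l - p n - p n) <= 1.
    by rewrite (le_trans (ltW pn) h1) (le_trans h2)// lerBlDr (le_trans l1)// lerDl ltW.
  rewrite (clip_id c01) subr_gt0; apply: h.
  by rewrite (lt_le_trans pn h1) (le_lt_trans h2)// gtrBl.
move=> t /andP[t0 tl].
have m0 : 0 < Num.min t (l - t) / l by rewrite divr_gt0// lt_min t0 subr_gt0.
have [n] := ltr_add_invr m0; rewrite add0r ltr_pdivlMr// lt_min => /andP[h1 h2].
have pn : p n <= n.+1%:R^-1 * l by rewrite mulrC ler_wpM2l ?(ltW l0)// lef_pV2 ?posrE// ler_nat.
have q1 := le_lt_trans pn h1; have q2 := le_lt_trans pn h2.
have tp : p n <= t <= l - p n by rewrite (ltW q1) lerBrDl -lerBrDr ltW.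
have [s s01 ts] := affine_itv tp.
have := h n Logic.I s s01; rewrite -ts clip_id ?subr_gt0//.
by lra.
Qed.

(** The minimum is first reached after [s] exactly when some value at a (truncated) rational time is
    strictly below all values on [0, s]. *)
Lemma measurable_argmin01 : meas_fun (@argmin01 R).
Proof.
rewrite (_ : @argmin01 R = fun f => - - argmin01 f); last by apply/funext => f; rewrite opprK.
apply: mfN; apply: measurable_fun_lt => a; set s := - a.
rewrite (_ : [set f | _] = [set f : cpath R | s < argmin01 f]); last first.
  by apply/seteqP; split => f /=; rewrite ltrNl.
have [s0|s0] := ltP s 0.
  rewrite (_ : [set f | _] = setT)//; apply/seteqP; split => // f _ /=.
  by have [/andP[h _] _ _] := argmin01P f; exact: lt_le_trans h.
have [s1|s1] := leP 1 s.
  rewrite (_ : [set f | _] = set0)//; apply/seteqP; split => // f /=; rewrite ltNge => /negP; apply.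
  by have [/andP[_ h] _ _] := argmin01P f; exact: le_trans s1.
rewrite (_ : [set f | _] = \bigcup_(q : rat) [set f : cpath R | forall t, 0 <= t <= 1 ->
    0 < f (clip (0 + t * s)) - f (clip (ratr q))]); last first.
  apply/seteqP; split => f /=; have [/andP[a0 a1] hmin hlt] := argmin01P f.
    move=> sa.
    have [c c01 hc] := @EVT_min R f 0 s s0 (@continuous_subspaceT _ _ _ _ (@continuous_path R f)).
    move: c01; rewrite in_itv/= => /andP[c0 cs].
    have fc : f (argmin01 f) < f c by apply: hlt; rewrite c0 (le_lt_trans cs).
    have [e e0 he] := path_near (@open_lt R (f c)) fc.
    have ee : argmin01 f - e < argmin01 f + e by lra.
    have [q] := rat_in_itvoo ee; rewrite in_itv/= => /andP[q1 q2]; exists q => // t /andP[t0 t1]; rewrite subr_gt0.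
    apply: (@lt_le_trans _ _ (f c)).
      apply: he; rewrite ltr_norml /clip; apply/andP; split.
        by rewrite ltrBrDl -ltrBrDr gt_max gt_min; apply/andP; split; [lra|rewrite opprK q2].
      rewrite ltrBlDl -ltrBlDr lt_max lt_min; apply/orP; right; lra.
    have ts0 : 0 <= t * s by exact: mulr_ge0.
    have ts : t * s <= s by rewrite ler_piMl.
    by rewrite add0r clip_id; [apply: hc; rewrite in_itv/= ts0|rewrite ts0 (le_trans ts)// ltW].
  move=> [q _ h]; rewrite ltNge; apply/negP => as_.
  have [t t01 te] := affine_itv (introT andP (conj a0 as_)).
  have := h t t01; rewrite -[s]subr0 -te clip_id ?a0// subr_gt0 ltNge => /negP; apply.
  by apply: hmin; exact: clip_itv.
apply: bigcupT_measurable_rat => q.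
apply: (@measurable_all_gt0 _ _ _ (fun (f : cpath R) t => f (clip (0 + t * s)) - f (clip (ratr q)))) => [f t|t].
  by apply: cvgB; [exact: (continuous_path_comp (@cont_affine 0 s))|exact: cvg_cst].
by apply: mfD; [|apply: mfN]; exact: measurable_clip_ev.
Qed.

(* For a path that does not start at 0, the Vervaat transform jumps where its two pieces meet. *)
Lemma vervaat_nonzero_start f t : f 0 != 0 -> vervaat f t = 0.
Proof.
move=> f0; rewrite /vervaat /to_cpath; case: pselect => // cV; exfalso.
have [/andP[a0 a1] _ _] := argmin01P f.
move/eqP: f0; apply; set c := 1 - argmin01 f.
have cR : vervaat_fun f x @[x --> c^'+] --> vervaat_fun f c by exact: cvg_at_right_filter (cV c).
have c0 : argmin01 f + c - 1 = 0 by rewrite /c; ring.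
have cf : f (argmin01 f + x - 1) + f 1 - f (argmin01 f) @[x --> c^'+] -->
    f (argmin01 f + c - 1) + f 1 - f (argmin01 f).
  apply: (@cvg_at_right_filter R _ (fun x => f (argmin01 f + x - 1) + f 1 - f (argmin01 f)) c).
  apply: cvgB; last exact: cvg_cst.
  apply: cvgD; last exact: cvg_cst.
  apply: (continuous_path_comp (g := fun x => argmin01 f + x - 1)) => x.
  by apply: cvgB; [apply: cvgD; [exact: cvg_cst|exact: cvg_id]|exact: cvg_cst].
rewrite c0 in cf.
have cV' : vervaat_fun f x @[x --> c^'+] --> f 0 + f 1 - f (argmin01 f).
  apply: cvg_trans cf; apply: near_eq_cvg; near=> x.
  have cx : c < x by near: x; exact: nbhs_right_gt.
  by rewrite /vervaat_fun -/c leNgt cx.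
have := cvg_unique _ cR cV'; rewrite /vervaat_fun -/c lexx /c addrCA subrr addr0.
by move=> h; apply: (@addIr _ (f 1 - f (argmin01 f))); rewrite add0r addrA -h.
Unshelve. all: end_near. Qed.

Lemma measurable_vervaat : meas_fun (@vervaat R).
Proof.
apply: measurable_into_cpath => t /andP[t0 t1].
have mt := measurable_argmin01.
have m0 : meas_fun (fun f : cpath R => f 0) by apply: measurable_ev; rewrite lexx ler01.
have m1 : meas_fun (fun f : cpath R => f 1) by apply: measurable_ev; rewrite ler01 lexx.
have mid : meas_fun (fun f : cpath R => f) by exact: measurable_id.
have me (g : cpath R -> R) : meas_fun g -> meas_fun (fun f : cpath R => f (clip (g f))).
  move=> mg; apply: (measurable_eval (g := fun f => clip (g f)) mid); first exact: measurable_clip.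
  by move=> f; exact: clip_itv.
rewrite (_ : (fun f => vervaat f t) = fun f : cpath R =>
    if (f 0 <= 0) && (0 <= f 0) then
      if t <= 1 - argmin01 f then f (clip (argmin01 f + t)) - f (clip (argmin01 f))
      else f (clip (argmin01 f + t - 1)) + f 1 - f (clip (argmin01 f))
    else 0).
  apply: mf_if; [by meas| |by meas].
  apply: mf_if; [by meas| |].
    by apply: mfD; [|apply: mfN]; apply: me; meas.
  by apply: mfD; [apply: mfD => //|apply: mfN]; apply: me; meas.
apply/funext => f; have [/andP[a0 a1] _ _] := argmin01P f.
rewrite -eq_le; have [f0|f0] := eqVneq (f 0) 0; last exact: vervaat_nonzero_start.
rewrite vervaatE// /vervaat_fun (clip_id (s := argmin01 f)) ?a0//; case: leP => h.
  by rewrite clip_id//; lra.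
by rewrite clip_id//; lra.
Qed.

End path_functionals.

Section integral_of_set_functions.
Import HBNNSimple.

(** The conditioned laws are plain set functions. Their integrals depend only on the values on
    measurable sets, so a genuine measure can be substituted. *)
Lemma eq_integral_law d (T : measurableType d) (R : realType) (m1 m2 : set T -> \bar R) D
  (f : T -> \bar R) : (forall A, measurable A -> m1 A = m2 A) ->
  (\int[m1]_(x in D) f x = \int[m2]_(x in D) f x)%E.
Proof.
move=> m12; rewrite /integral.
have E : (fun h : {nnsfun T >-> R} => sintegral m1 h) = (fun h => sintegral m2 h).
  apply/funext => h; apply: eq_fsbigr => r _; congr (_ * _)%E; apply: m12.
  by meas.
by rewrite E.
Qed.

End integral_of_set_functions.

(** * First return and first passage below 0 of the drifting excursion *)

Section drifting_excursion_functionals.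
Context {R : realType}.
Implicit Types (a l r x y t u v : R).
Notation P3 := (cpath R * cpath R * cpath R)%type.

Section one_drift.
Variable a : R.
Hypothesis a0 : 0 < a.

Lemma drifting_pathE (w : P3) t : 0 <= t <= 1 -> drifting_path a w t = bes 0 1 w t - a * t.
Proof.
move=> /andP[t0 t1]; rewrite /drifting_path lowerE clip_id; first by congr (_ - _); ring.
by rewrite subr_ge0 t1 lerBlDr lerDl.
Qed.

Lemma drifting_path0 (w : P3) : drifting_path a w 0 = 0.
Proof. by rewrite drifting_pathE ?lexx ?ler01// bes_start// mulr0 subrr. Qed.

Lemma drifting_path1 (w : P3) : drifting_path a w 1 = - a.
Proof. by rewrite drifting_pathE ?lexx ?ler01// bes_end// mulr1 sub0r. Qed.

Lemma drifting_path_above (w : P3) : (forall t, 0 < t < 1 -> 0 < bes 0 1 w t) ->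
  forall t, 0 < t < 1 -> - a * t < drifting_path a w t.
Proof.
move=> h t t01; have /andP[t0 t1] := t01.
by rewrite drifting_pathE ?(ltW t0) ?(ltW t1)// mulNr -subr_gt0 opprK subrK h.
Qed.

Section return_path.
Variables (u : R) (w w' : P3).
Hypothesis u01 : 0 < u < 1.

Let v01 : 0 < 1 - u < 1.
Proof. by move: u01 => /andP[? ?]; lra. Qed.

Let one : 0 < (1 : R) <= 1. Proof. by rewrite ltr01 lexx. Qed.

Let hE : a + - a * (1 - u) = a * u. Proof. by ring. Qed.

Lemma return_path_before t : 0 <= t <= u -> return_path a u w w' t = bes 0 u w t.
Proof.
move=> tu; have tu' : 0 <= t <= 1 - (1 - u) by rewrite subKr.
rewrite /return_path /crossing_path (glue_before _ one v01 _ tu') ?subKr//.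
by rewrite bes_start// hE mulr_ge0 ?(ltW a0)//; case/andP: u01 => /ltW.
Qed.

Lemma return_path_after t : u <= t <= 1 ->
  return_path a u w w' t = bes (a * u) (1 - u) w' (t - u) - a * t.
Proof.
move=> tu; have tu' : 1 - (1 - u) <= t <= 1 by rewrite subKr.
have /andP[u0 u1] := u01.
have w0 z : 1 - (1 - u) <= z -> bes 0 (1 - (1 - u)) w z = 0 by rewrite subKr; exact: bes_end.
rewrite /return_path /crossing_path (glue_after _ _ _ one v01 w0 tu') hE subKr.
by congr (_ - _); ring.
Qed.

Lemma return_path0 : return_path a u w w' 0 = 0.
Proof. by rewrite return_path_before ?bes_start// lexx; case/andP: u01 => /ltW. Qed.

Lemma return_path_return : return_path a u w w' u = 0.
Proof. by have /andP[u0 u1] := u01; rewrite return_path_before ?lexx ?bes_end// ltW. Qed.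

Lemma return_path1 : return_path a u w w' 1 = - a.
Proof.
have /andP[u0 u1] := u01; have v0 : 0 < 1 - u by rewrite subr_gt0.
by rewrite return_path_after ?lexx ?(ltW u1)// (bes_end _ _ v0 (lexx _)) mulr1 sub0r.
Qed.

Hypothesis wpos : forall t, 0 < t < u -> 0 < bes 0 u w t.

Lemma first_return_return_path : first_return (return_path a u w w') = u.
Proof.
have /andP[u0 u1] := u01; apply: first_return_eq; first by rewrite u0 ltW.
  exact: return_path_return.
move=> t /andP[t0 tu]; rewrite return_path_before ?(ltW t0) ?(ltW tu)// gt_eqF// wpos//.
by rewrite t0.
Qed.

Lemma first_negative_return_path : u <= first_negative (return_path a u w w').
Proof.
have /andP[u0 u1] := u01.
have u01' : 0 <= u <= 1 by rewrite !ltW.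
have e1 : return_path a u w w' 1 < 0 by rewrite return_path1 oppr_lt0.
apply/(first_negative_geP e1 return_path0 u01') => s su.
by rewrite return_path_before// bes_ge0.
Qed.

End return_path.

End one_drift.

Section with_bridge.
Variables (beta : probability (cpath R) R).
Hypothesis hbeta : brownian_bridge beta 0 0 1 id.
Notation beta3 := (beta3 beta).

(** The gluing time [u] is almost surely the first return, because the first piece is positive
    inside its interval. *)
Lemma drifting_return_law a (G : R -> cpath R -> \bar R) : 0 < a ->
  meas_fun (fun z : R * cpath R => G z.1 z.2) -> (forall u w, 0 <= G u w)%E ->
  (\int[beta3]_w G (first_return (drifting_path a w)) (drifting_path a w) =
   \int[mu]_(u in `]0%R, 1%R[) ((return_density a u)%:E *
     \int[beta3]_w \int[beta3]_w' G u (return_path a u w w')))%E.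
Proof.
move=> a0 mG G0; pose F (e : cpath R) : \bar R := G (first_return e) e.
have F0 e : (0 <= F e)%E by exact: G0.
have mid : meas_fun (fun e : cpath R => e) by exact: measurable_id.
have mF : meas_fun F.
  apply: (measurableT_comp (f := fun z : R * cpath R => G z.1 z.2)
    (g := fun e : cpath R => (first_return e, e)) mG).
  by apply: measurable_fun_pair => //; exact: measurable_first_return.
rewrite (drifting_law hbeta a0 (F := F) mF F0).
apply: eq_integral => u; rewrite inE/= in_itv/= => u01; congr (_ * _)%E.
have /andP[u0 u1] := u01; have u01' : 0 < u <= 1 by rewrite u0 ltW.
have mp : meas_fun (fun z : P3 * P3 => return_path a u z.1 z.2).
  by apply: measurable_return_path; meas.
have m1 : meas_fun (fun z : P3 * P3 => F (return_path a u z.1 z.2)).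
  by meas.
have m2 : meas_fun (fun z : P3 * P3 => G u (return_path a u z.1 z.2)).
  apply: (measurableT_comp (f := fun z : R * cpath R => G z.1 z.2)
    (g := fun z : P3 * P3 => (u, return_path a u z.1 z.2)) mG).
  by meas.
apply: ge0_ae_eq_integral.
- exact: measurableT.
- exact: (measurable_int_param beta3 (fun w w' => F (return_path a u w w')) m1
    (fun w w' => F0 _)).
- exact: (measurable_int_param beta3 (fun w w' => G u (return_path a u w w')) m2
    (fun w w' => G0 _ _)).
- by move=> w _; apply: integral_ge0 => w' _; exact: F0.
- by move=> w _; apply: integral_ge0 => w' _; exact: G0.
have := bes_positive hbeta u01' (lexx 0); apply: filterS => w hw _.
by apply: eq_integral => w' _; rewrite /F first_return_return_path.
Qed.

Let mreturn a : meas_fun (fun w : P3 => first_return (drifting_path a w)).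
Proof. exact: (measurableT_comp measurable_first_return (measurable_drifting_path a)). Qed.

Let mnegative a : meas_fun (fun w : P3 => first_negative (drifting_path a w)).
Proof. exact: (measurableT_comp measurable_first_negative (measurable_drifting_path a)). Qed.

Lemma integral_first_return a : 0 < a ->
  (\int[beta3]_w (first_return (drifting_path a w))%:E = (c_const (- a))%:E)%E.
Proof.
move=> a0; have [<- _] := integral_return_mean hbeta a0.
have mG : meas_fun (fun z : R * cpath R => (Num.max z.1 0)%:E : \bar R).
  by apply: mfE; meas.
have G0 (u : R) (w : cpath R) : (0 <= (Num.max u 0)%:E :> \bar R)%E.
  by rewrite lee_fin le_max lexx orbT.
have := drifting_return_law (G := fun u _ => (Num.max u 0)%:E) a0 mG G0.
under eq_integral do rewrite (max_l (first_return_ge0 _)).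
move=> ->; apply: eq_integral => u; rewrite inE/= in_itv/= => /andP[u0 _].
under eq_integral do rewrite integral_probability_cst.
by rewrite integral_probability_cst max_l ?(ltW u0)// -EFinM mulrC.
Qed.

Let j a : R := (\int[mu]_(s in `[a, +oo[) expR (- (s ^+ 2 / 2)))%R.

Let j_anti a b : b <= a -> j a <= j b.
Proof.
move=> ba; have e0 s : 0 <= expR (- (s ^+ 2 / 2)) :> R by exact: expR_ge0.
have me A : measurable_fun A (fun s : R => (expR (- (s ^+ 2 / 2)))%:E).
  by apply: measurable_funTS; apply: mfE; meas.
have hf (b' : R) : (\int[mu]_(s in `[b', +oo[) (expR (- (s ^+ 2 / 2)))%:E)%E \is a fin_num.
  have := @integrable_heat1 R `[b', +oo[%classic (measurable_itv _).
  move=> /(@integrableZl _ _ _ mu _ (measurable_itv _) (Num.sqrt (2 * pi))) h.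
  apply: integrable_fin_num => //; apply: eq_integrable h => // s _ /=.
  rewrite -EFinM/heat sqrtr1 invr1 !mulr1 mulrA divff ?mul1r// sqrtr_eq0 -ltNge.
  by rewrite mulr_gt0 ?pi_gt0.
rewrite /j /Rintegral fine_le//; apply: ge0_subset_integral => //.
  exact: me.
by apply: subset_itvr; rewrite bnd_simp.
Qed.

(** Only the tail integral is replaced by its value at [a]; the resulting bound is continuous in [b]
    without any continuity of [j]. *)
Lemma c_const_le a b : 0 < b <= a ->
  c_const (- b) <= 1 - b * expR (b ^+ 2 / 2) * j a.
Proof.
move=> /andP[b0 ba]; rewrite /c_const normrN gtr0_norm// sqrrN lerB//.
by rewrite ler_wpM2l ?j_anti// mulr_ge0 ?expR_ge0// ltW.
Qed.

(** The exceptional set [K] is measurable, and its measure is computed through [drifting_law], where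
    the glued path is nonnegative up to [u]. *)
Lemma first_return_le_negative a : 0 < a ->
  {ae beta3, forall w, first_return (drifting_path a w) <= first_negative (drifting_path a w)}.
Proof.
move=> a0; pose K : set (cpath R) := [set e | first_negative e < first_return e].
have mK : measurable K.
  by apply: measurable_lt_set; [exact: measurable_first_negative|exact: measurable_first_return].
have mI : meas_fun (fun e : cpath R => (\1_K e)%:E : \bar R).
  by meas.
have I0 e : (0 <= (\1_K e)%:E :> \bar R)%E by rewrite lee_fin.
have mK' : measurable ((@drifting_path R a) @^-1` K).
  exact: measurable_pre (measurable_drifting_path a) mK.
exists ((@drifting_path R a) @^-1` K); split => //; last first.
  by move=> w /= /negP; rewrite -ltNge.
pose K' := (@drifting_path R a) @^-1` K.
transitivity (\int[beta3]_w (\1_K' w)%:E)%E.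
  by rewrite -/K' -[K' in beta3 K']setIT -integral_indic.
rewrite (drifting_law hbeta a0 mI I0) integral0_eq// => u; rewrite /= in_itv/= => u01.
have /andP[u0 u1] := u01; have u01' : 0 < u <= 1 by rewrite u0 ltW.
suff -> : (\int[beta3]_w \int[beta3]_w' (\1_K (return_path a u w w'))%:E = 0)%E by rewrite mule0.
transitivity (\int[beta3]_w (0 : \bar R))%E; last by rewrite integral0.
have mp : meas_fun (fun z : P3 * P3 => return_path a u z.1 z.2).
  by apply: measurable_return_path; meas.
have m1 : meas_fun (fun z : P3 * P3 => (\1_K (return_path a u z.1 z.2))%:E : \bar R).
  exact: (measurableT_comp mI mp).
apply: ge0_ae_eq_integral.
- exact: measurableT.
- exact: (measurable_int_param beta3 (fun w w' => (\1_K (return_path a u w w'))%:E) m1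
    (fun w w' => I0 _)).
- by meas.
- by move=> w _; apply: integral_ge0 => w' _; exact: I0.
- by [].
have := bes_positive hbeta u01' (lexx 0); apply: filterS => w hw _.
rewrite integral0_eq// => w' _; rewrite indicE memNset//= => h.
have := first_negative_return_path a0 w w' u01; rewrite leNgt => /negP; apply.
by apply: lt_le_trans h _; rewrite first_return_return_path.
Qed.

Lemma first_negative_eq_return a : 0 < a ->
  {ae beta3, forall w, first_negative (drifting_path a w) = first_return (drifting_path a w)}.
Proof.
move=> a0; pose h (w : P3) := first_negative (drifting_path a w).
pose z (w : P3) := first_return (drifting_path a w).
(* [m] is almost surely [h], but [m - z] is nonnegative everywhere, so a vanishing mean makes it
   vanish almost surely. *)
pose m w := Num.max (h w) (z w).
have X1 b (w : P3) : 0 < b -> drifting_path b w 1 < 0 by rewrite drifting_path1 oppr_lt0.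
have h0 w : 0 <= h w by case/andP: (first_negative_itv (X1 a w a0)).
have z0 w : 0 <= z w by exact: first_return_ge0.
have mm : meas_fun m by apply: measurable_maxr; [exact: mnegative|exact: mreturn].
have mEh : meas_fun (fun w => (h w)%:E) by apply: mfE; exact: mnegative.
have mEz : meas_fun (fun w => (z w)%:E) by apply: mfE; exact: mreturn.
have mEm : meas_fun (fun w => (m w)%:E) by apply: mfE.
have hle b : 0 < b -> b < a -> (\int[beta3]_w (h w)%:E <= (1 - b * expR (b ^+ 2 / 2) * j a)%:E)%E.
  move=> b0 ba; apply: (@le_trans _ _ (c_const (- b))%:E); last first.
    by rewrite lee_fin c_const_le// b0 ltW.
  rewrite -integral_first_return//; apply: ge0_le_integral.
  - exact: measurableT.
  - by move=> w _; rewrite lee_fin.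
  - exact: mEh.
  - by apply: mfE; exact: mreturn.
  move=> w _; rewrite lee_fin; apply: first_negative_le_return.
  - exact: X1.
  - exact: drifting_path0.
  - exact: X1.
  move=> t /andP[t0 t1]; rewrite !drifting_pathE ?(ltW t0)// ltrD2l ltrN2 ltr_pM2r//.
have hc : (\int[beta3]_w (h w)%:E <= (c_const (- a))%:E)%E.
  have hfin : (\int[beta3]_w (h w)%:E)%E \is a fin_num.
    rewrite ge0_fin_numE; last by apply: integral_ge0 => w _; rewrite lee_fin.
    apply: le_lt_trans (hle (a / 2) _ _) (ltry _); first by rewrite divr_gt0.
    by rewrite ltr_pdivrMr// mulr_natr mulr2n ltrDl.
  rewrite -[leLHS]fineK// lee_fin /c_const normrN gtr0_norm// sqrrN -/(j a).
  pose g (b : R) := 1 - b * expR (b ^+ 2 / 2) * j a.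
  have cg : g b @[b --> a^'-] --> g a.
    apply: cvg_at_left_filter.
    have : continuous g.
      move=> b; apply: cvgB; first exact: cvg_cst.
      apply: cvgM; last exact: cvg_cst; apply: cvgM; first exact: cvg_id.
      apply: continuous_comp; last exact: continuous_expR.
      apply: cvgM; last exact: cvg_cst.
      exact: exprn_continuous.
    exact.
  rewrite -/(g a) -(cvg_lim _ cg)//; apply: limr_ge; first by apply/cvg_ex; exists (g a).
  near=> b; rewrite -lee_fin fineK//; apply: hle => //.
pose d w := m w - z w.
have d0 w : 0 <= d w by rewrite subr_ge0 le_max lexx orbT.
have md : meas_fun (fun w => (d w)%:E).
  by apply: mfE; apply: measurable_funB => //; exact: mreturn.
have hm : (\int[beta3]_w (h w)%:E = \int[beta3]_w (m w)%:E)%E.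
  apply: ge0_ae_eq_integral.
  - exact: measurableT.
  - exact: mEh.
  - exact: mEm.
  - by move=> w _; rewrite lee_fin.
  - by move=> w _; rewrite lee_fin le_max h0.
  have := first_return_le_negative a0; apply: filterS => w hw _.
  by rewrite /m max_l.
have mzd : (\int[beta3]_w (m w)%:E = (c_const (- a))%:E + \int[beta3]_w (d w)%:E)%E.
  rewrite -integral_first_return// -ge0_integralD//.
  - by apply: eq_integral => w _; rewrite -EFinD addrC subrK.
  - by move=> w _; rewrite lee_fin; exact: z0.
  - by move=> w _; rewrite lee_fin; exact: d0.
have dI : (\int[beta3]_w (d w)%:E = 0)%E.
  apply/eqP; rewrite eq_le; apply/andP; split; last by apply: integral_ge0 => w _; rewrite lee_fin.
  by move: hc; rewrite hm mzd -[leRHS]adde0 leeD2lE.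
have : (\int[beta3]_w `|(d w)%:E| = 0)%E.
  by rewrite -dI; apply: eq_integral => w _; rewrite /= ger0_norm.
move=> /(ae_eq_integral_abs beta3 measurableT md).
apply: filterS2 (first_return_le_negative a0) => w hw /(_ Logic.I) [].
by rewrite /d /m max_l// => /eqP; rewrite subr_eq0 => /eqP.
Unshelve. all: by end_near.
Qed.

End with_bridge.

Lemma cpath_ext (w w' : cpath R) : (forall t, w t = w' t) -> w = w'.
Proof. by move=> h; apply/continuousEP. Qed.

Lemma measurable_stop l : 0 <= l <= 1 -> meas_fun (@stop R l).
Proof.
move=> /andP[l0 l1]; apply: measurable_into_cpath => t /andP[t0 t1].
under eq_fun do rewrite stopE; apply: measurable_ev.
by rewrite le_min t0 l0 ge_min t1.
Qed.

Lemma measurable_add_drift c : meas_fun (@add_drift R c).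
Proof.
apply: measurable_into_cpath => t t01; under eq_fun do rewrite add_driftE.
by apply: mfD; [exact: measurable_ev|meas].
Qed.

Lemma measurable_add_const c : meas_fun (@add_const R c).
Proof.
apply: measurable_into_cpath => t t01; under eq_fun do rewrite add_constE.
by apply: mfD; [meas|exact: measurable_ev].
Qed.

Lemma stop_gam x l w : 0 < l -> stop l (gam x l w) = gam x l w.
Proof.
move=> l0; apply: cpath_ext => t; rewrite stopE; have [tl|lt] := leP t l; first by [].
by rewrite !gam_end// ltW.
Qed.

Lemma stop_norm3 l (w1 w2 w3 : cpath R) :
  norm3 (stop l w1, stop l w2, stop l w3) = stop l (norm3 (w1, w2, w3)).
Proof. by apply: cpath_ext => t; rewrite stopE !norm3E/= !stopE. Qed.

Lemma add_drift0 (w : cpath R) : add_drift 0 w = w.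
Proof. by apply: cpath_ext => t; rewrite add_driftE mul0r addr0. Qed.

(** * From the given laws to the models built on one bridge *)

Section with_bridge.
Variables (beta : probability (cpath R) R).
Hypothesis hbeta : brownian_bridge beta 0 0 1 id.
Notation beta3 := (beta3 beta).

(* A bridge between arbitrary values is an affine image of the standard one. *)
Lemma bridge_law d (T : measurableType d) (P : probability T R) x y l (X : T -> cpath R)
    (h : cpath R -> \bar R) :
  brownian_bridge P x y l X -> meas_fun X -> 0 < l <= 1 ->
  meas_fun h -> (forall w, 0 <= h w)%E ->
  (\int[P]_omega h (stop l (X omega)) =
   \int[beta]_w h (stop l (add_drift (y / l) (gam x l w))))%E.
Proof.
move=> hX mX /andP[l0 l1] mh h0; set c := y / l.
have l01 : 0 <= l <= 1 by rewrite ltW.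
pose Z1 omega := stop l (X omega); pose Z2 w := stop l (add_drift c (gam x l w)).
have mZ1 : meas_fun Z1 by apply: (measurableT_comp (measurable_stop l01) mX).
have mZ2 : meas_fun Z2.
  apply: (measurableT_comp (measurable_stop l01)).
  by apply: (measurableT_comp (measurable_add_drift c)); apply: measurable_gam; meas.
transitivity (\int[P]_omega (1%:E * h (Z1 omega)))%E.
  by apply: eq_integral => w _; rewrite mul1e.
transitivity (\int[beta]_w (1%:E * h (Z2 w)))%E; last first.
  by apply: eq_integral => w _; rewrite mul1e.
apply: (@weighted_eq R _ _ _ T (cpath R) (cpath R) P beta (fun=> 1) Z1 (fun=> 1) Z2 h) => //.
apply: weighted_cos_unique => //.
- by rewrite integral_probability_cst.
- by rewrite integral_probability_cst.
move=> s th s01; pose s' := [seq (p.1, Num.min p.2 l) | p <- s].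
have s'l p : p \in s' -> 0 <= p.2 <= l.
  by move=> /mapP[q /s01 /andP[q0 _] ->]/=; rewrite le_min q0 (ltW l0) ge_min lexx orbT.
have lin1 w : lin s (stop l w) = lin s' w.
  by rewrite /lin big_map; apply: eq_bigr => p _; rewrite stopE.
pose k := c * \sum_(p <- s') p.1 * p.2.
have lin2 w : lin s' (add_drift c w) = lin s' w + k.
  rewrite /lin /k mulr_sumr -big_split; apply: eq_bigr => p _ /=.
  by rewrite add_driftE; ring.
under eq_integral do rewrite mul1r lin1.
under [in RHS]eq_integral do rewrite mul1r lin1 lin2 -addrA.
rewrite (bridge_cos th hX mX l1 s'l) (gam_cos hbeta _ _ _ l0) addrA.
congr (1 + cos (_ + _) * expR (- (_ / 2)))%:E.
  rewrite /k /lin_mean !mulr_sumr -big_split; apply: eq_big_seq => p /s'l /andP[p0 pl] /=.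
  rewrite clip_id ?divr_ge0 ?(ltW l0)//=; last by rewrite ler_pdivrMr ?mul1r.
  by rewrite /c; field; rewrite gt_eqF.
rewrite /lin_var mulr_sumr; apply: eq_big_seq => p /s'l /andP[p0 pl].
rewrite mulr_sumr; apply: eq_big_seq => q /s'l /andP[q0 ql].
rewrite !clip_id ?divr_ge0 ?(ltW l0)//= ?ler_pdivrMr ?mul1r//.
rewrite -minr_pMl ?invr_ge0 ?(ltW l0)//; set m := Num.min _ _.
by field; rewrite gt_eqF.
Qed.

(** [stop l] discards the values after [l], on which the hypothesis gives no information; the model
    [gam] is 0 there. *)
Lemma bridge_to0_law (P : probability (cpath R) R) x l (h : cpath R -> \bar R) :
  brownian_bridge P x 0 l id -> 0 < l <= 1 ->
  meas_fun h -> (forall w, 0 <= h w)%E ->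
  (\int[P]_w h (stop l w) = \int[beta]_w h (gam x l w))%E.
Proof.
move=> hP l01 mh h0; have /andP[l0 _] := l01.
rewrite (bridge_law hP (@measurable_id _ _ _) l01 mh h0).
by apply: eq_integral => w _; rewrite mul0r add_drift0 stop_gam.
Qed.

(** The three given bridge laws are replaced by images of [beta] one coordinate at a time, from the
    last to the first. *)
Lemma bessel_bridge_law (rho : probability (cpath R) R) x l (h : cpath R -> \bar R) :
  bessel3_bridge_to0_law x l rho -> 0 < l <= 1 ->
  meas_fun h -> (forall w, 0 <= h w)%E ->
  (\int[rho]_w h (stop l w) = \int[beta3]_w h (bes x l w))%E.
Proof.
move=> [b1 [b2 [b3 [h1 h2 h3 hrho]]]] l01 mh h0.
have /andP[l0 l1] := l01; have l01' : 0 <= l <= 1 by rewrite ltW.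
have ms := @measurable_stop l l01'.
pose H (w : P3) := h (norm3 w).
have mH : meas_fun H by exact: measurableT_comp mh (@measurable_norm3 R).
have H0 w : (0 <= H w)%E by exact: h0.
pose m12 : probability (cpath R * cpath R)%type R := (b1 \x b2)%E.
pose m123 : probability P3 R := (m12 \x b3)%E.
have mstop : meas_fun (fun w : P3 => (stop l w.1.1, stop l w.1.2, stop l w.2)).
  by meas.
transitivity (\int[m123]_w H (stop l w.1.1, stop l w.1.2, stop l w.2))%E.
  transitivity (\int[pushforward m123 (@norm3 R)]_w h (stop l w))%E.
    by apply: eq_integral_law => A mA; exact: hrho.
  have mhs : meas_fun (fun w => h (stop l w)) by apply: measurableT_comp mh ms.
  have := @ge0_integral_pushforward _ _ P3 (cpath R) R (@norm3 R) (@measurable_norm3 R) m123 setT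
    (fun w => h (stop l w)) measurableT mhs (fun w _ => h0 _).
  by move=> ->; apply: eq_integral => -[[w1 w2] w3] _; rewrite /H stop_norm3.

have mgam x' : meas_fun (gam x' l) by apply: measurable_gam; meas.
rewrite [LHS](@fubini_tonelli1 _ _ _ _ R m12 b3 _ (measurableT_comp mH mstop) (fun w => H0 _)).
transitivity (\int[m12]_w \int[beta]_w3 H (stop l w.1, stop l w.2, gam 0 l w3))%E.
  apply: eq_integral => -[w1 w2] _.
  apply: (bridge_to0_law (h := fun w3 => H (stop l w1, stop l w2, w3)) h3 l01) => //.
  by meas.
have [G1 [mG1 G10 G1E]] : exists G1 : cpath R * cpath R -> \bar R, [/\ meas_fun G1,
    forall w, (0 <= G1 w)%E & forall w, G1 w = (\int[beta]_w3 H (w.1, w.2, gam 0 l w3))%E].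
  have m : meas_fun (fun z : cpath R * cpath R * cpath R => H (z.1.1, z.1.2, gam 0 l z.2)).
    apply: (measurableT_comp mH); apply: measurable_fun_pair.
      by meas.
    by apply: measurable_gam; meas.
  have := measurable_int_param beta (fun w w3 => H (w.1, w.2, gam 0 l w3)) m
    (fun _ _ => H0 _).
  by move=> mG; eexists; split; [exact: mG|move=> w; apply: integral_ge0 => w3 _; exact: H0|].
have ms2 : meas_fun (fun w : cpath R * cpath R => (stop l w.1, stop l w.2)).
  by meas.
transitivity (\int[m12]_w G1 (stop l w.1, stop l w.2))%E.
  by apply: eq_integral => w _; rewrite G1E.
rewrite [LHS](@fubini_tonelli1 _ _ _ _ R b1 b2 _ (measurableT_comp mG1 ms2) (fun w => G10 _)).
transitivity (\int[b1]_w1 \int[beta]_w2 G1 (stop l w1, gam 0 l w2))%E.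
  apply: eq_integral => w1 _.
  apply: (bridge_to0_law (h := fun w2 => G1 (stop l w1, w2)) h2 l01) => //.
  by meas.
have [G2 [mG2 G20 G2E]] : exists G2 : cpath R -> \bar R, [/\ meas_fun G2,
    forall w, (0 <= G2 w)%E & forall w, G2 w = (\int[beta]_w2 G1 (w, gam 0 l w2))%E].
  have m : meas_fun (fun z : cpath R * cpath R => G1 (z.1, gam 0 l z.2)).
    apply: (measurableT_comp mG1); apply: measurable_fun_pair; first by meas.
    by apply: measurable_gam; meas.
  have := measurable_int_param beta (fun w1 w2 => G1 (w1, gam 0 l w2)) m
    (fun _ _ => G10 _).
  by move=> mG; eexists; split; [exact: mG|move=> w; apply: integral_ge0 => w3 _; exact: G10|].
transitivity (\int[b1]_w1 G2 (stop l w1))%E; first by apply: eq_integral => w _; rewrite G2E.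
rewrite [LHS](bridge_to0_law (h := G2) h1 l01 mG2 G20).
have mb : meas_fun (fun w : P3 => bes x l w) by apply: measurable_bes; meas.
rewrite [RHS](integral_beta3 _ (measurableT_comp mh mb) (fun w => h0 _)).
apply: eq_integral => w1 _; rewrite G2E; apply: eq_integral => w2 _; rewrite G1E.
by apply: eq_integral.
Qed.

Lemma bessel_bridge_prob (rho : probability (cpath R) R) x l A :
  bessel3_bridge_to0_law x l rho -> 0 < l <= 1 -> measurable A ->
  (rho (stop l @^-1` A) = beta3 [set w | A (bes x l w)])%E.
Proof.
move=> hrho l01 mA; have /andP[l0 l1] := l01.
have ms : meas_fun (@stop R l) by apply: measurable_stop; rewrite ltW.
have mb : meas_fun (fun w : P3 => bes x l w) by apply: measurable_bes; meas.
pose S1 := stop l @^-1` A; pose S2 := bes x l @^-1` A.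
have mS1 : measurable S1 by exact: measurable_pre ms mA.
have mS2 : measurable S2 by exact: measurable_pre mb mA.
have mI : meas_fun (fun e : cpath R => (\1_A e)%:E : \bar R).
  by meas.
have I0 e : (0 <= (\1_A e)%:E :> \bar R)%E by rewrite lee_fin.
have E := bessel_bridge_law hrho l01 mI I0.
transitivity (\int[rho]_w (\1_S1 w)%:E)%E.
  by rewrite -/S1 -[S1 in rho S1]setIT -integral_indic.
by rewrite -/S2 -[S2 in beta3 S2]setIT -integral_indic.
Qed.

End with_bridge.

(** Averaging over the uniform time turns the condition [u <= H] into the weight [H]. *)
Lemma integral_le_indic (h : R) : 0 <= h <= 1 ->
  (\int[mu]_(u in `]0%R, 1%R[) (\1_[set u | u <= h] u)%:E = h%:E)%E.
Proof.
move=> /andP[h0 h1].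
rewrite integral_indic//; last first.
  by rewrite (_ : [set u | u <= h] = `]-oo, h]%classic)//; apply/seteqP; split => u /=; rewrite in_itv.
have [hl|hg] := ltP h 1.
  rewrite (_ : _ `&` _ = `]0, h]%classic); last first.
    apply/seteqP; split => u /=; rewrite !in_itv/=; first by case=> -> /andP[->].
    by move=> /andP[-> uh]; rewrite uh (le_lt_trans uh).
  rewrite [LHS]lebesgue_measure_itv/= lte_fin.
  by case: ltgtP h0 => // [h0 _|<- _//]; rewrite sube0.
have -> : h = 1 by apply/eqP; rewrite eq_le h1.
rewrite (_ : _ `&` _ = `]0, 1[%classic); last first.
  apply/seteqP; split => u /=; rewrite !in_itv/=; first by case.
  by move=> /andP[-> u1]; rewrite u1 (ltW u1).
by rewrite [LHS]lebesgue_measure_itv/= lte_fin ltr01 sube0.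
Qed.

Lemma measurable_indic_le d (T : measurableType d) (h : T -> R) : meas_fun h ->
  meas_fun (fun z : R * T => \1_[set u | u <= h z.2] z.1 : R).
Proof.
move=> mh; pose S := [set z : R * T | z.1 <= h z.2].
have mS : measurable S.
  by apply: measurable_le_set; [meas|meas].
rewrite (_ : (fun z => _) = \1_S); first exact: measurable_indic.
apply/funext => z; rewrite !indicE; congr ((nat_of_bool _)%:R).
Qed.

(** * Law of the Vervaat transform on the conditioning event *)

Section with_bridge.
Variables (beta : probability (cpath R) R) (lambda : R).
Hypothesis hbeta : brownian_bridge beta 0 0 1 id.
Hypothesis lambda_lt0 : lambda < 0.
Notation beta3 := (beta3 beta).
Notation X := (drifting_path (- lambda)).

Let a0 : 0 < - lambda. Proof. by rewrite oppr_gt0. Qed.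

Definition above_line : set (cpath R) := [set w | forall t : R, 0 < t < 1 -> lambda * t < w t].

Lemma measurable_above_line : measurable above_line.
Proof.
have c : continuous (fun t : R => lambda * t).
  by move=> t; apply: cvgM; [exact: cvg_cst|exact: cvg_id].
by have := measurable_above c; move=> /(_ 1); rewrite ltr01 lexx => /(_ isT).
Qed.

Lemma vervaat_drifted_rotation u (w : P3) (A : set (cpath R)) :
  0 < u < 1 -> measurable A -> (forall t, 0 < t < 1 -> 0 < bes 0 1 w t) ->
  (A `&` above_line) (vervaat (add_drift lambda (rotate u (bes 0 1 w)))) <->
  u <= first_negative (X w) /\ A (X w).
Proof.
move=> u01 mA wpos; have /andP[u0 u1] := u01; set f := add_drift lambda _.
have u01' : 0 <= u <= 1 by rewrite !ltW.
have X0 : X w 0 = 0 by exact: drifting_path0.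
have X1 : X w 1 = lambda by rewrite drifting_path1 opprK.
have XE t : 0 <= t <= 1 -> X w t = bes 0 1 w t + lambda * t.
  by move=> t01; rewrite drifting_pathE// mulNr opprK.
have Xabove s : 0 < s < 1 -> lambda * s < X w s.
  by move=> s01; have := drifting_path_above (- lambda) wpos s01; rewrite opprK.
have b0 : bes 0 1 w 0 = 0 by exact: bes_start.
have b1 : bes 0 1 w 1 = 0 by exact: bes_end.
have fb t : 0 <= t <= 1 - u -> f t = X w (u + t) - X w u.
  move=> /andP[t0 t1]; have ut : 0 <= u + t <= 1 by lra.
  rewrite /f add_driftE rotateE !XE// (clip_id u01') (clip_id ut) clip_lt0 ?b0; last by lra.
  by ring.
have fa t : 1 - u <= t <= 1 -> f t = X w (u + t - 1) - X w u + lambda.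
  move=> /andP[t0 t1]; have ut : 0 <= u + t - 1 <= 1 by lra.
  rewrite /f add_driftE rotateE !XE// (clip_id u01') (clip_id ut) clip_gt1 ?b1; last by lra.
  by ring.
have X1lt : X w 1 < 0 by rewrite X1.
have ge := first_negative_geP X1lt X0 u01'.
have [uh|hu] := boolP (u <= first_negative (X w)).
  have VX t := @vervaat_nonneg R _ _ _ _ lambda_lt0 u01 X1 Xabove fb fa t (iffLR ge uh).
  split; first by move=> [AV _]; split => //; apply: (cpath_saturated mA) AV => t /VX.
  move=> [_ AX]; split; first by apply: (cpath_saturated mA) AX => t /VX ->.
  by move=> t t01; rewrite VX ?Xabove//; case/andP: t01 => t0 t1; rewrite !ltW.
split; last by case.
move=> [_ hV]; exfalso; move/negP: hu; apply; apply/ge => s su.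
rewrite leNgt; apply/negP => Xs.
exact: (vervaat_negative lambda_lt0 u01 X1 Xabove fb fa su Xs hV).
Qed.

Lemma vervaat_law d (T : measurableType d) (P : probability T R) (B : T -> cpath R) A :
  brownian_bridge P 0 lambda 1 B -> meas_fun B -> measurable A ->
  (P [set omega | (A `&` above_line) (vervaat (B omega))] =
   \int[beta3]_w (first_negative (X w) * \1_A (X w))%:E)%E.
Proof.
move=> hB mB mA.
have one : 0 < (1 : R) <= 1 by rewrite ltr01 lexx.
pose C : set (cpath R) := @vervaat R @^-1` (A `&` above_line).
have mC : measurable C.
  apply: measurable_pre; first exact: measurable_vervaat.
  by apply: measurableI => //; exact: measurable_above_line.
have mIC : meas_fun (fun e : cpath R => (\1_C e)%:E : \bar R).
  by meas.
have IC0 e : (0 <= (\1_C e)%:E :> \bar R)%E by rewrite lee_fin.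
have stopC (w : cpath R) : \1_C (stop 1 w) = \1_C w :> R.
  have e (t : R) : 0 <= t <= 1 -> stop 1 w t = w t.
    by move=> /andP[t0 t1]; rewrite stopE min_l.
  rewrite !indicE; congr ((nat_of_bool _)%:R); apply/idP/idP; rewrite !inE => h.
    by apply: (cpath_saturated mC) h => t t01; exact: e.
  by apply: (cpath_saturated mC) h => t t01; rewrite e.
pose S1 := B @^-1` C.
have mS1 : measurable S1 by exact: measurable_pre mB mC.
transitivity (\int[P]_omega (\1_C (B omega))%:E)%E.
  by rewrite -/S1 -[S1 in P S1]setIT -integral_indic.
transitivity (\int[P]_omega (\1_C (stop 1 (B omega)))%:E)%E.
  by apply: eq_integral => om _; rewrite stopC.
rewrite [LHS](bridge_law hbeta hB mB one mIC IC0) divr1.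
under eq_integral do rewrite stopC.
pose F (e : cpath R) : \bar R := (\1_C (add_drift lambda e))%:E.
have mF : meas_fun F.
  exact: (measurableT_comp mIC (@measurable_add_drift lambda)).
have F0 e : (0 <= F e)%E by exact: IC0.
rewrite [LHS](bridge_rotate hbeta mF F0).
have mX : meas_fun (fun w : P3 => X w) by exact: measurable_drifting_path.
have mH : meas_fun (fun w : P3 => first_negative (X w)).
  exact: (measurableT_comp measurable_first_negative mX).
have mA' : meas_fun (fun w : P3 => \1_A (X w) : R).
  by apply: (measurableT_comp (f := \1_A : cpath R -> R) (g := fun w => X w)).
pose K (u : R) (w : P3) : \bar R := (\1_[set u | u <= first_negative (X w)] u * \1_A (X w))%:E.
have K0 u w : (0 <= K u w)%E by rewrite lee_fin mulr_ge0.

have mK : meas_fun (fun z : R * P3 => K z.1 z.2).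
  apply: mfE; apply: mfM; last by apply: (measurableT_comp mA'); meas.
  exact: (measurable_indic_le mH).
transitivity (\int[mu]_(u in `]0%R, 1%R[) \int[beta3]_w K u w)%E.
  apply: eq_integral => u; rewrite inE/= in_itv/= => u01.
  apply: ge0_ae_eq_integral.
  - exact: measurableT.
  - apply: (measurableT_comp mF); apply: measurable_rotate; first by meas.
    by apply: measurable_bes; meas.
  - exact: (@measurable_section _ _ _ _ _ K u mK).
  - by move=> w _; exact: F0.
  - by move=> w _; exact: K0.
  have := bes_positive hbeta one (lexx 0); apply: filterS => w hw _.
  have := vervaat_drifted_rotation u01 mA hw; rewrite /F /K => h.
  congr EFin; rewrite !indicE.
  have [hl|hl] := pselect ((A `&` above_line) (vervaat (add_drift lambda (rotate u (bes 0 1 w))))).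
    have hC : C (add_drift lambda (rotate u (bes 0 1 w))) by exact: hl.
    by rewrite (mem_set hC); have [h1 h2] := (iffLR h hl); rewrite !mem_set// mulr1.
  rewrite memNset//; apply/esym/eqP; rewrite mulf_eq0 !pnatr_eq0 !eqb0 -negb_and.
  by apply/negP => /andP[]; rewrite !inE => h1 h2; apply/hl/h.
pose K' (u : R) (w : P3) : \bar R := ((\1_(`]0%R, 1%R[%classic : set R) u)%:E * K u w)%E.
have K'0 u w : (0 <= K' u w)%E by rewrite mule_ge0// lee_fin.
have mK' : meas_fun (fun z : R * P3 => K' z.1 z.2).
  apply: mfeM => //; apply: mfE.
  by meas.
transitivity (\int[mu]_u \int[beta3]_w K' u w)%E.
  rewrite integral_mkcond; apply: eq_integral => u _; rewrite patchE /K'.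
  rewrite indicE; case: ifPn => _; first by under [in RHS]eq_integral do rewrite mul1e.
  by under [in RHS]eq_integral do rewrite mul0e; rewrite integral0.
rewrite [LHS](tonelli mu beta3 K' mK' K'0).
apply: eq_integral => w _.
have h01 : 0 <= first_negative (X w) <= 1 by apply: first_negative_itv; rewrite drifting_path1 opprK.
have mh : meas_fun (\1_[set u | u <= first_negative (X w)] : R -> R).
  by apply: measurable_indic; apply: measurable_le_set; meas.
transitivity (\int[mu]_u ((\1_A (X w))%:E *
    ((\1_(`]0%R, 1%R[%classic : set R) u)%:E * (\1_[set u | u <= first_negative (X w)] u)%:E)))%E.
  by apply: eq_integral => u _; rewrite /K' /K -!EFinM; congr EFin; ring.
rewrite ge0_integralZl_EFin//; last first.
  by meas.
rewrite EFinM muleC -(integral_le_indic h01) [in RHS]integral_mkcond; congr (_ * _)%E.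
apply: eq_integral => u _; rewrite patchE indicE; case: ifPn => _; first by rewrite mul1e.
by rewrite mul0e.
Qed.

End with_bridge.

Lemma probability_integral d (T : measurableType d) (P : probability T R) (S : set T) :
  measurable S -> (P S = \int[P]_w (\1_S w)%:E)%E.
Proof. by move=> mS; rewrite -[S in P S]setIT -integral_indic. Qed.

Lemma saturated_indic (A : set (cpath R)) (w w' : cpath R) : measurable A ->
  (forall t, 0 <= t <= 1 -> w t = w' t) -> \1_A w = \1_A w' :> R.
Proof.
move=> mA ww; rewrite !indicE; congr ((nat_of_bool _)%:R); apply/idP/idP; rewrite !inE => h.
  exact: (cpath_saturated mA ww).
by apply: (cpath_saturated mA) h => t t01; rewrite ww.
Qed.

Lemma measurable_stop_fun d (T : measurableType d) (l : T -> R) (X : T -> cpath R) :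
  meas_fun l -> meas_fun X -> (forall z, 0 <= l z <= 1) ->
  meas_fun (fun z => stop (l z) (X z)).
Proof.
move=> ml mX l01; apply: measurable_into_cpath => t /andP[t0 t1].
under eq_fun do rewrite stopE; apply: measurable_eval => //.
  by meas.
by move=> z; have /andP[l0 _] := l01 z; rewrite le_min t0 l0 ge_min t1.
Qed.

Lemma measurable_stop_shift d (T : measurableType d) (u : T -> R) (X : T -> cpath R) :
  meas_fun u -> meas_fun X -> (forall z, 0 <= u z <= 1) ->
  meas_fun (fun z => stop (1 - u z) (time_shift (u z) (X z))).
Proof.
move=> mu' mX u01; apply: measurable_into_cpath => t /andP[t0 t1].
under eq_fun do rewrite stopE time_shiftE; apply: measurable_eval => //.
  by meas.
move=> z; have /andP[u0 u1] := u01 z.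
by rewrite addr_ge0 ?le_min ?t0 ?subr_ge0//= -lerBrDl ge_min lexx orbT.
Qed.

(** * The two pieces of the path at its first return *)

Definition after_return a u (w : P3) : cpath R :=
  add_const (- (a * u)) (stop (1 - u) (add_drift (- a) (bes (a * u) (1 - u) w))).

Lemma after_returnE a u w t :
  after_return a u w t = bes (a * u) (1 - u) w (Num.min t (1 - u)) - a * (u + Num.min t (1 - u)).
Proof. by rewrite /after_return add_constE stopE add_driftE; ring. Qed.

Lemma measurable_after_return a d (T : measurableType d) (u : T -> R) (w : T -> P3) :
  meas_fun u -> meas_fun w -> (forall z, 0 <= u z <= 1) ->
  meas_fun (fun z => after_return a (u z) (w z)).
Proof.
move=> mu' mw u01; apply: measurable_into_cpath => t /andP[t0 t1].
under eq_fun do rewrite after_returnE.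
have mm : meas_fun (fun z => Num.min t (1 - u z)) by apply: measurable_minr; meas.
have mb : meas_fun (fun z => bes (a * u z) (1 - u z) (w z)) by apply: measurable_bes; meas.
have me : meas_fun (fun z => bes (a * u z) (1 - u z) (w z) (Num.min t (1 - u z))).
  apply: measurable_eval => // z; have /andP[u0 u1] := u01 z.
  by rewrite le_min t0 subr_ge0 u1 ge_min t1.
by apply: mfD => //; apply: mfN; apply: mfM; [meas|apply: mfD].
Qed.

Section return_pieces.
Variables (a u : R) (w w' : P3).
Hypotheses (a0 : 0 < a) (u01 : 0 < u < 1).

Lemma stop_return_path t : 0 <= t <= 1 -> stop u (return_path a u w w') t = bes 0 u w t.
Proof.
move=> /andP[t0 t1]; have /andP[u0 u1] := u01; rewrite stopE; have [tu|ut] := leP t u.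
  by rewrite return_path_before// t0.
by rewrite return_path_before ?lexx ?(ltW u0)// !bes_end// ltW.
Qed.

Lemma stop_shift_return_path t : 0 <= t <= 1 ->
  stop (1 - u) (time_shift u (return_path a u w w')) t = after_return a u w' t.
Proof.
move=> /andP[t0 t1]; have /andP[u0 u1] := u01.
rewrite stopE time_shiftE after_returnE return_path_after//; first by rewrite [u + _]addrC addrK [_ + u]addrC.
by rewrite lerDl le_min t0 subr_ge0 (ltW u1)/= -lerBrDl ge_min lexx orbT.
Qed.

End return_pieces.

Section with_bridge.
Variables (beta : probability (cpath R) R) (lambda : R).
Hypothesis hbeta : brownian_bridge beta 0 0 1 id.
Hypothesis lambda_lt0 : lambda < 0.
Notation beta3 := (beta3 beta).
Notation a := (- lambda).

Let a0 : 0 < a. Proof. by rewrite oppr_gt0. Qed.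

Definition line_event z : set (cpath R) :=
  [set w | forall t : R, 0 < t < 1 - z -> lambda * (t + z) < w t].

Lemma measurable_line_event z : 0 < z < 1 -> measurable (line_event z).
Proof.
move=> /andP[z0 z1]; apply: (measurable_above (g := fun t => lambda * (t + z))).
  move=> t; apply: cvgM; first exact: cvg_cst.
  by apply: cvgD; [exact: cvg_id|exact: cvg_cst].
by rewrite subr_gt0 z1 gerBl ltW.
Qed.

(** The passage bridge is [lambda] plus a Bessel bridge from [a]; measured from the line
    [lambda (t + z)] it is the lowered path of [survival_law]. Staying above the line thus has
    probability [z] and leaves a Bessel bridge from [a z]. *)
Lemma passage_bridge_piece (nu : probability (cpath R) R) z A : 0 < z < 1 ->
  first_passage_bridge_law lambda (1 - z) nu -> measurable A ->
  (nu (stop (1 - z) @^-1` A `&` line_event z) = z%:E * beta3 [set w | A (after_return a z w)])%E.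
Proof.
move=> z01 [rho hrho nuE] mA; have /andP[z0 z1] := z01; set l := 1 - z.
have l0 : 0 < l by rewrite subr_gt0.
have l1 : l <= 1 by rewrite gerBl ltW.
have l01 : 0 < l <= 1 by rewrite l0.
have l01' : 0 <= l <= 1 by rewrite (ltW l0).
have az : 0 < a * z by rewrite mulr_gt0.
have ms := @measurable_stop l l01'.
have mL := measurable_line_event z01.
pose raise (e : cpath R) := add_const (- (a * z)) (stop l (add_drift (- a) e)).
have mraise : meas_fun raise.
  apply: (measurableT_comp (@measurable_add_const _)).
  by apply: (measurableT_comp ms); exact: measurable_add_drift.
pose pos := [set e : cpath R | forall t, 0 < t < l -> 0 < e t].
have mpos : measurable pos by apply: (measurable_above (g := fun=> 0)) => // t; exact: cvg_cst.
pose C := pos `&` raise @^-1` A.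
have mC : measurable C by apply: measurableI => //; exact: measurable_pre mraise mA.
pose F (e : cpath R) : \bar R := (\1_C e)%:E.
have mF : meas_fun F by apply: mfE; exact: measurable_indic.
have F0 e : (0 <= F e)%E by rewrite lee_fin.
(* [F] vanishes on paths that touch 0, which removes the terms with a passage in [survival_law]. *)
have Fv (w : cpath R) t : 0 < t < 1 - z -> w t = 0 -> F w = 0%E.
  by move=> tl wt; rewrite /F indicE memNset// => -[/(_ t tl)]; rewrite wt ltxx.
have E := survival_law hbeta a0 z01 mF F0 Fv.
have mAL : measurable (A `&` line_event z) by exact: measurableI.
have mac := @measurable_add_const lambda.
have -> : stop l @^-1` A `&` line_event z = stop l @^-1` (A `&` line_event z).
  rewrite preimage_setI; congr (_ `&` _); apply/seteqP; split => w /= h t tl.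
    by rewrite stopE min_l ?h// ltW//; case/andP: tl.
  by have := h t tl; rewrite stopE min_l// ltW//; case/andP: tl.
rewrite nuE; last exact: measurable_pre ms mAL.
have mAL' : measurable (add_const lambda @^-1` (A `&` line_event z)) by exact: measurable_pre mac mAL.
have -> : add_const lambda @^-1` (stop l @^-1` (A `&` line_event z)) =
    stop l @^-1` (add_const lambda @^-1` (A `&` line_event z)).
  apply/seteqP; split => w; rewrite /preimage /= (_ : stop l (add_const lambda w) = add_const lambda (stop l w))//;
  by apply: cpath_ext => t; rewrite !(stopE, add_constE).
rewrite ltr0_norm// in hrho; rewrite (bessel_bridge_prob hbeta hrho l01 mAL').
have mb x : meas_fun (fun w : P3 => bes x l w) by apply: measurable_bes; meas.
set S1 := [set w | _]; set S2 := [set w | _].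
have mS1 : measurable S1 by exact: measurable_pre (mb _) mAL'.
have mS2 : measurable S2.
  have := measurable_pre (mb (a * z)) (measurable_pre mraise mA).
  exact.
rewrite (probability_integral _ mS1) (probability_integral _ mS2).
have lineE t p : (lambda * (t + z) < lambda + p) = (0 < p - a * (l - t)).
  by rewrite -subr_gt0; congr (0 < _); rewrite /l; ring.
transitivity (\int[beta3]_w F (lower 0 a l (bes a l w)))%E.
  apply: eq_integral => w _; rewrite /F !indicE; congr ((nat_of_bool _)%:R%:E).
  have lE t : 0 <= t <= l -> lower 0 a l (bes a l w) t = bes a l w t - a * (l - t).
    move=> /andP[t0 tl]; rewrite lowerE clip_id ?add0r//.
    by rewrite subr_ge0 tl lerBlDr (le_trans l1)// lerDl.
  have rE t : 0 <= t <= 1 -> raise (lower 0 a l (bes a l w)) t = add_const lambda (bes a l w) t.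
    move=> /andP[t0 t1]; rewrite /raise !add_constE stopE add_driftE lE; last first.
      by rewrite le_min t0 (ltW l0) ge_min lexx orbT.
    have -> : bes a l w (Num.min t l) = bes a l w t.
      by have [//|/ltW lt] := leP t l; rewrite !bes_end.
    by rewrite /l; ring.
  apply/idP/idP; rewrite !inE => -[h1 h2]; split.
  - move=> t tl; have /andP[t0 t1] := tl; rewrite lE ?(ltW t0) ?(ltW t1)//.
    by rewrite -lineE -add_constE; exact: h2.
  - by apply: (cpath_saturated mA) h1 => t /rE.
  - by apply: (cpath_saturated mA) h2 => t /rE.
  - move=> t tl; have /andP[t0 t1] := tl; have := h1 t tl; rewrite lE ?(ltW t0) ?(ltW t1)//.
    by rewrite -lineE add_constE.
rewrite E; congr (_ * _)%E; apply: ge0_ae_eq_integral.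
- exact: measurableT.
- exact: measurableT_comp mF (mb _).
- by meas.
- by move=> w _; exact: F0.
- by move=> w _; rewrite lee_fin.
have := bes_positive hbeta l01 (ltW az); apply: filterS => w hw _.
rewrite /F !indicE; congr ((nat_of_bool _)%:R%:E).
by apply/idP/idP; rewrite !inE; [case|move=> h; split].
Qed.

End with_bridge.
Section size_biased_return.
Variables (beta : probability (cpath R) R) (a : R).
Hypothesis hbeta : brownian_bridge beta 0 0 1 id.
Hypothesis a0 : 0 < a.
Notation beta3 := (beta3 beta).
Notation X := (drifting_path a).
Notation Z w := (first_return (X w)).

Lemma return_mean (h : R -> \bar R) : meas_fun h -> (forall u, 0 <= h u)%E ->
  (\int[beta3]_w ((Z w)%:E * h (Z w)) =
   \int[mu]_(u in `]0%R, 1%R[) ((return_density a u * u)%:E * h u))%E.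
Proof.
move=> mh h0; pose G (u : R) (w : cpath R) : \bar R := ((Num.max u 0)%:E * h u)%E.
have mG : meas_fun (fun z : R * cpath R => G z.1 z.2).
  apply: mfeM; first by apply: mfE; meas.
  by meas.
have G0 u w : (0 <= G u w)%E by rewrite mule_ge0// lee_fin le_max lexx orbT.
have := drifting_return_law hbeta a0 mG G0; rewrite /G.
under eq_integral do rewrite (max_l (first_return_ge0 _)).
move=> ->; apply: eq_integral => u; rewrite inE/= in_itv/= => /andP[u0 _].
rewrite max_l ?(ltW u0)// (EFinM (return_density a u)) -muleA; congr (_ * _)%E.
have c (k : \bar R) : (\int[beta3]_w k = k)%E.
  by rewrite integral_cst// [X in (_ * X)%E](probability_setT beta3) mule1.
by under eq_integral do rewrite c; rewrite c.
Qed.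

(** The factor [Z] is the unnormalized density of the conditioned path. It depends only on the
    return time, so it biases that time and leaves the two pieces independent given it. *)
Lemma return_decomposition (D : set R) (A1 A2 : set (cpath R)) :
  measurable D -> measurable A1 -> measurable A2 ->
  (\int[beta3]_w (Z w * (\1_D (Z w) * \1_A1 (stop (Z w) (X w)) *
       \1_A2 (stop (1 - Z w) (time_shift (Z w) (X w)))))%:E =
   \int[mu]_(u in `]0%R, 1%R[) ((return_density a u * u)%:E * ((\1_D u)%:E *
     (beta3 [set w | A1 (bes 0 u w)] * beta3 [set w | A2 (after_return a u w)]))))%E.
Proof.
move=> mD mA1 mA2.
have mI (A : set (cpath R)) d (T : measurableType d) (f : T -> cpath R) : measurable A ->
    meas_fun f -> meas_fun (fun z => \1_A (f z) : R).
  by move=> mA mf; apply: (measurableT_comp (f := \1_A : cpath R -> R) (g := f)).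
have mID : meas_fun (\1_D : R -> R) by exact: measurable_indic.
pose G u (w : cpath R) : \bar R := (clip u * (\1_D u * \1_A1 (stop (clip u) w) *
  \1_A2 (stop (1 - clip u) (time_shift (clip u) w))))%:E.
have G0 u w : (0 <= G u w)%E.
  by rewrite lee_fin; apply: mulr_ge0; [case/andP: (clip_itv u)|rewrite !mulr_ge0].
have mclip : meas_fun (fun z : R * cpath R => clip z.1).
  by meas.
have mG : meas_fun (fun z : R * cpath R => G z.1 z.2).
  apply: mfE; apply: mfM => //; apply: mfM; first apply: mfM.
  - by meas.
  - apply: (mI A1) mA1 _; apply: measurable_stop_fun.
    + exact: mclip.
    + by meas.
    + by move=> z; exact: clip_itv.
  - apply: (mI A2) mA2 _; apply: measurable_stop_shift.
    + exact: mclip.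
    + by meas.
    + by move=> z; exact: clip_itv.
have clipZ w : clip (Z w) = Z w by rewrite clip_id// first_return_ge0 first_return_le1.
transitivity (\int[beta3]_w G (Z w) (X w))%E.
  by apply: eq_integral => w _; rewrite /G clipZ.
rewrite (drifting_return_law hbeta a0 mG G0).
apply: eq_integral => u; rewrite inE/= in_itv/= => u01; have /andP[u0 u1] := u01.
have u01' : 0 <= u <= 1 by rewrite !ltW.
rewrite (EFinM (return_density a u)) -muleA; congr (_ * _)%E.
pose S1 := [set w : P3 | A1 (bes 0 u w)]; pose S2 := [set w : P3 | A2 (after_return a u w)].
have mbes : meas_fun (fun w : P3 => bes 0 u w) by apply: measurable_bes; meas.
have maft : meas_fun (fun w : P3 => after_return a u w).
  by apply: measurable_after_return; meas.
have mS1 : measurable S1 by exact: measurable_pre mbes mA1.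
have mS2 : measurable S2 by exact: measurable_pre maft mA2.
have mE1 : meas_fun (fun w : P3 => (\1_S1 w)%:E : \bar R).
  by meas.
have mE2 : meas_fun (fun w : P3 => (\1_S2 w)%:E : \bar R).
  by meas.
have k0 : 0 <= u * \1_D u by rewrite mulr_ge0 ?(ltW u0).
have GE w w' : G u (return_path a u w w') =
    ((u * \1_D u)%:E * ((\1_S1 w)%:E * (\1_S2 w')%:E))%E.
  rewrite /G (clip_id u01').
  rewrite (saturated_indic mA1 (@stop_return_path a u w w' a0 u01)).
  rewrite (saturated_indic mA2 (@stop_shift_return_path a u w w' u01)).
  have -> : \1_S1 w = \1_A1 (bes 0 u w) :> R by rewrite !indicE; congr ((nat_of_bool _)%:R).
  have -> : \1_S2 w' = \1_A2 (after_return a u w') :> R.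
    by rewrite !indicE; congr ((nat_of_bool _)%:R).
  move: (\1_A1 _) (\1_A2 _) (\1_D u) => i1 i2 i3.
  by rewrite -!EFinM; congr EFin; ring.
rewrite (probability_integral beta3 mS1) (probability_integral beta3 mS2) muleA -EFinM.
under eq_integral => w _.
  under eq_integral => w' _ do rewrite GE muleA.
  rewrite ge0_integralZl//; last by rewrite mule_ge0// lee_fin.
  over.
have m1 : meas_fun (fun w : P3 => ((u * \1_D u)%:E * (\1_S1 w)%:E)%E).
  by meas.
have g1 w : setT w -> (0 <= (u * \1_D u)%:E * (\1_S1 w)%:E)%E by rewrite mule_ge0// lee_fin.
have g2 : (0 <= \int[beta3]_w (\1_S2 w)%:E)%E by apply: integral_ge0 => w _; rewrite lee_fin.
rewrite (ge0_integralZr _ measurableT m1 g1 g2) ge0_integralZl//.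
by rewrite -muleA.
Qed.

End size_biased_return.

(** * The conditioned Vervaat transform *)

Section conditioned_vervaat_path.
Variables (beta : probability (cpath R) R) (lambda : R).
Hypothesis hbeta : brownian_bridge beta 0 0 1 id.
Hypothesis lambda_lt0 : lambda < 0.
Notation beta3 := (beta3 beta).
Notation a := (- lambda).
Notation X := (drifting_path a).
Notation Z w := (first_return (X w)).
Notation c := (c_const lambda).

Let a0 : 0 < a. Proof. by rewrite oppr_gt0. Qed.

Lemma c_const_gt0 : 0 < c.
Proof. by have [_] := integral_return_mean hbeta a0; rewrite opprK. Qed.

Lemma first_return_density_drift t :
  first_return_density lambda t = c^-1 * (return_density a t * t).
Proof.
rewrite /first_return_density /return_density sqrrN ltr0_norm//; set e := expR _.
by set s := Num.sqrt _; ring.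
Qed.

Lemma first_negative_ge0 (w : cpath R) : 0 <= first_negative w.
Proof.
rewrite /first_negative; set N := [set t | _].
have [[t Nt]|/set0P/negP/negPn/eqP ->] := pselect (N !=set0); last by rewrite inf0.
by apply: lb_le_inf; [exists t|move=> s [/andP[/ltW]]].
Qed.

Section law.
Variables (d : measure_display) (T : measurableType d) (P : probability T R)
  (B : {mfun T >-> cpath R}).
Hypothesis hB : brownian_bridge P 0 lambda 1 B.

Definition lawV : set (cpath R) -> \bar R := pushforward P (fun omega => vervaat (B omega)).
Definition lawY : set (cpath R) -> \bar R := cond_law lawV (above_line lambda).

Let mZ : meas_fun (fun w : P3 => Z w).
Proof. exact: (measurableT_comp measurable_first_return (measurable_drifting_path a)). Qed.

Let mN : meas_fun (fun w : P3 => first_negative (X w)).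
Proof. exact: (measurableT_comp measurable_first_negative (measurable_drifting_path a)). Qed.

Let mXA A : measurable A -> meas_fun (fun w : P3 => \1_A (X w) : R).
Proof.
move=> mA; apply: (measurableT_comp (f := \1_A : cpath R -> R) (g := fun w => X w)) => //.
exact: measurable_drifting_path.
Qed.

Let n0 (w : P3) : 0 <= first_negative (X w). Proof. exact: first_negative_ge0. Qed.

Let lawV_negative A : measurable A -> (lawV (A `&` above_line lambda) =
  \int[beta3]_w (first_negative (X w) * \1_A (X w))%:E)%E.
Proof. by move=> mA; exact: (vervaat_law hbeta lambda_lt0 hB (measurable_funPT B) mA). Qed.

(** The probability of the conditioning event is the mean of the first passage below 0, hence of the
    first return; this makes [c_const] the normalizing constant. *)
Lemma lawV_above_line : lawV (above_line lambda) = c%:E.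
Proof.
rewrite -[above_line _]setTI lawV_negative//.
transitivity (\int[beta3]_w (Z w)%:E)%E; last first.
  by rewrite -[in RHS](opprK lambda); exact: (integral_first_return hbeta a0).
apply: ge0_ae_eq_integral.
- exact: measurableT.
- by apply: mfE; apply: mfM => //; exact: mXA.
- exact: mfE.
- by move=> w _; rewrite lee_fin; apply: mulr_ge0 => //; exact: n0.
- by move=> w _; rewrite lee_fin first_return_ge0.
have := first_negative_eq_return hbeta a0; apply: filterS => w -> _.
by rewrite indicT mulr1.
Qed.

Lemma lawY_negative A : measurable A ->
  (lawY A = (c^-1)%:E * \int[beta3]_w (first_negative (X w) * \1_A (X w))%:E)%E.
Proof.
move=> mA; rewrite /lawY /cond_law lawV_above_line lawV_negative// inver.
by rewrite gt_eqF ?c_const_gt0// muleC.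
Qed.

Lemma lawY_return A : measurable A ->
  (lawY A = (c^-1)%:E * \int[beta3]_w (Z w * \1_A (X w))%:E)%E.
Proof.
move=> mA; rewrite lawY_negative//; congr (_ * _)%E; apply: ge0_ae_eq_integral.
- exact: measurableT.
- by apply: mfE; apply: mfM => //; exact: mXA.
- by apply: mfE; apply: mfM => //; exact: mXA.
- by move=> w _; rewrite lee_fin; apply: mulr_ge0 => //; exact: n0.
- by move=> w _; rewrite lee_fin mulr_ge0// first_return_ge0.
by have := first_negative_eq_return hbeta a0; apply: filterS => w -> _.
Qed.

Lemma measurable_first_return_preimage (D : set R) : measurable D ->
  measurable (@first_return R @^-1` D).
Proof. exact: measurable_pre measurable_first_return. Qed.

Let c_inv0 : 0 <= c^-1. Proof. by rewrite invr_ge0 ltW// c_const_gt0. Qed.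

Lemma integral_first_return_law (h : R -> \bar R) (S : set R) : measurable S ->
  measurable_fun S h -> (forall u, S u -> 0 <= h u)%E ->
  (\int[pushforward lawY (@first_return R)]_(z in S) h z =
   (c^-1)%:E * \int[mu]_(u in `]0%R, 1%R[) ((return_density a u * u)%:E * (h \_ S) u))%E.
Proof.
move=> mS mh h0.
have G0 w : 0 <= c^-1 * Z w by rewrite mulr_ge0// first_return_ge0.
have mG : meas_fun (fun w : P3 => c^-1 * Z w) by apply: mfM => //; meas.
rewrite (eq_integral_law (m2 := weighted beta3 mG G0 mZ)); last first.
  move=> D mD; rewrite weightedE// /pushforward lawY_return; last exact: measurable_first_return_preimage.
  rewrite -ge0_integralZl_EFin//.
  - by apply: eq_integral => w _; rewrite -EFinM mulrA.
  - by move=> w _; rewrite lee_fin mulr_ge0// first_return_ge0.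
  - by meas.
have mh' : meas_fun (h \_ S) by apply/(measurable_restrictT h mS).
have h0' u : (0 <= (h \_ S) u)%E by rewrite patchE; case: ifPn => // /set_mem /h0.
rewrite integral_mkcond [LHS]integral_weighted// -(return_mean hbeta a0 mh' h0').
rewrite -ge0_integralZl_EFin//.
- by apply: eq_integral => w _; rewrite EFinM muleA.
- by move=> w _; rewrite mule_ge0// lee_fin first_return_ge0.
- by meas.
Qed.

Lemma first_return_has_density :
  has_density (pushforward lawY (@first_return R)) `]0, 1[ (first_return_density lambda).
Proof.
move=> D mD; rewrite /pushforward lawY_return; last exact: measurable_first_return_preimage.
have mID : meas_fun (fun u : R => (\1_D u)%:E : \bar R) by apply: mfE; exact: measurable_indic.
have ID0 u : (0 <= (\1_D u)%:E :> \bar R)%E by rewrite lee_fin.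
have := return_mean hbeta a0 mID ID0.
under eq_integral do rewrite -EFinM.
move=> E; transitivity ((c^-1)%:E * \int[beta3]_w (Z w * \1_D (Z w))%:E)%E; first by [].
rewrite E -ge0_integralZl_EFin//; last 2 first.
- move=> u /=; rewrite in_itv/= => /andP[u0 _].
  by rewrite mule_ge0// lee_fin mulr_ge0 ?(ltW u0)// return_density_ge0// ltW.
- apply: measurable_funTS; apply: mfeM => //; apply: mfE; apply: mfM; last by meas.
  exact: measurable_return_density.
rewrite setIC [RHS]integral_mkcondr; apply: eq_integral => u _.
rewrite patchE indicE first_return_density_drift.
by case: ifPn => _; rewrite ?mule1 ?mule0// -EFinM.
Qed.

Section pieces.
Variables (exc fpb : R -> probability (cpath R) R).
Hypothesis exc_law : forall l : R, 0 < l <= 1 -> brownian_excursion_law l (exc l).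
Hypothesis fpb_law : forall l : R, 0 < l < 1 -> first_passage_bridge_law lambda l (fpb l).

Let k1 z A := exc z (stop z @^-1` A).
Let k2 z A := cond_law (fpb (1 - z)) (line_event lambda z) (stop (1 - z) @^-1` A).

Let k1E z A : 0 < z < 1 -> measurable A -> k1 z A = beta3 [set w | A (bes 0 z w)].
Proof.
move=> /andP[z0 z1] mA; have z01 : 0 < z <= 1 by rewrite z0 ltW.
exact: (bessel_bridge_prob hbeta (exc_law z01) z01 mA).
Qed.

Let k2E z A : 0 < z < 1 -> measurable A -> k2 z A = beta3 [set w | A (after_return a z w)].
Proof.
move=> z01 mA; have /andP[z0 z1] := z01.
have l01 : 0 < 1 - z < 1 by rewrite subr_gt0 z1 ltrBlDr ltrDl.
have E A' : measurable A' -> _ := passage_bridge_piece hbeta lambda_lt0 z01 (fpb_law l01) (A := A').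
(* The case [A = setT] gives the probability [z > 0] of the conditioning event, by which the general
   case is divided. *)
have := E _ measurableT; rewrite preimage_setT setTI => ET.
rewrite /k2 /cond_law E// ET.
have -> : beta3 [set w | setT (after_return a z w)] = 1%E by exact: probability_setT.
by rewrite mule1 inver gt_eqF// muleAC -EFinM divff ?mul1e// gt_eqF.
Qed.

Let mI A d' (T' : measurableType d') (f : T' -> cpath R) : measurable A ->
  meas_fun f -> meas_fun (fun z => (\1_A (f z))%:E : \bar R).
Proof.
move=> mA mf; apply: mfE.
by apply: (measurableT_comp (f := \1_A : cpath R -> R) (g := f)).
Qed.

Let probE A (f : P3 -> cpath R) : measurable A -> meas_fun f ->
  (beta3 [set w | A (f w)] = \int[beta3]_w (\1_A (f w))%:E)%E.
Proof. by move=> mA mf; rewrite probability_integral//; exact: measurable_pre mf mA. Qed.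

Let mk1 A : measurable A -> measurable_fun (`]0, 1[%classic : set R) (k1 ^~ A).
Proof.
move=> mA; pose g (u : R) : \bar R := (\int[beta3]_w (\1_A (bes 0 u w))%:E)%E.
have m : meas_fun (fun z : R * P3 => (\1_A (bes 0 z.1 z.2))%:E : \bar R).
  by apply: mI => //; apply: measurable_bes; meas.
have I0 (u : R) (w : P3) : (0 <= (\1_A (bes 0 u w))%:E :> \bar R)%E by rewrite lee_fin.
have mg : meas_fun g.
  exact: (measurable_int_param beta3 (fun u w => (\1_A (bes 0 u w))%:E) m I0).
apply: (eq_measurable_fun g); last exact: measurable_funTS.
move=> u; rewrite inE/= in_itv/= => u01; rewrite k1E// probE//.
by apply: measurable_bes; meas.
Qed.

Let mk2 A : measurable A -> measurable_fun (`]0, 1[%classic : set R) (k2 ^~ A).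
Proof.
move=> mA; pose g (u : R) : \bar R := (\int[beta3]_w (\1_A (after_return a (clip u) w))%:E)%E.
have m : meas_fun (fun z : R * P3 => (\1_A (after_return a (clip z.1) z.2))%:E : \bar R).
  apply: mI => //; apply: measurable_after_return.
  - by meas.
  - by meas.
  - by move=> z; exact: clip_itv.
have I0 (u : R) (w : P3) : (0 <= (\1_A (after_return a (clip u) w))%:E :> \bar R)%E.
  by rewrite lee_fin.
have mg : meas_fun g.
  exact: (measurable_int_param beta3 (fun u w => (\1_A (after_return a (clip u) w))%:E) m I0).
apply: (eq_measurable_fun g); last exact: measurable_funTS.
move=> u; rewrite inE/= in_itv/= => u01; have u01' : 0 <= u <= 1.
  by case/andP: u01 => u0 u1; rewrite !ltW.
rewrite /g (clip_id u01') (k2E u01 mA) (probE mA)//.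
by apply: measurable_after_return; meas.
Qed.

Lemma conditioned_path_decomposition :
  cond_indep_given lawY (@first_return R) `]0, 1[
    (fun w : cpath R => stop (first_return w) w)
    (fun w : cpath R => stop (1 - first_return w) (time_shift (first_return w) w)) k1 k2.
Proof.
split; [exact: mk1|exact: mk2|move=> D A1 A2 mD mA1 mA2].
have fr01 (w : cpath R) : 0 <= first_return w <= 1 by rewrite first_return_ge0 first_return_le1.
have mfr := @measurable_first_return R.
have m1 : meas_fun (fun w : cpath R => stop (first_return w) w).
  by apply: measurable_stop_fun => //; exact: measurable_id.
have m2 : meas_fun
    (fun w : cpath R => stop (1 - first_return w) (time_shift (first_return w) w)).
  by apply: measurable_stop_shift => //; exact: measurable_id.
set S := _ `&` _ `&` _.
have mS : measurable S.
  apply: measurableI; last exact: measurable_pre m2 mA2.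
  by apply: measurableI; [exact: measurable_pre mfr mD|exact: measurable_pre m1 mA1].
rewrite lawY_return//.
transitivity ((c^-1)%:E * \int[beta3]_w (Z w * (\1_D (Z w) * \1_A1 (stop (Z w) (X w)) *
       \1_A2 (stop (1 - Z w) (time_shift (Z w) (X w)))))%:E)%E.
  congr (_ * _)%E; apply: eq_integral => w _; congr (_ * _)%:E.
  by rewrite /S !indicE !in_setI -!natrM !mulnb.
have mDI : measurable (D `&` `]0, 1[%classic : set R) by exact: measurableI.
rewrite (return_decomposition hbeta a0 mD mA1 mA2) integral_first_return_law//.
- congr (_ * _)%E; apply: eq_integral => u; rewrite inE/= in_itv/= => u01; congr (_ * _)%E.
  rewrite patchE in_setI indicE; case: ifPn => [/andP[-> _]|]; first by rewrite mul1e k1E// k2E.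
  rewrite negb_and => /orP[/negPf ->|]; first by rewrite mul0e.
  by rewrite notin_setE/= in_itv/= u01.
- apply: emeasurable_funM; apply: measurable_funS (@subIsetr _ D _) _ => //; [exact: mk1|exact: mk2].
- move=> u [_]; rewrite /= in_itv/= => u01; rewrite (k1E u01 mA1) (k2E u01 mA2).
  by rewrite mule_ge0.
Qed.

End pieces.

(** The given excursion and the model agree on [0, 1], the only times that measurable sets of paths
    can see. *)
Lemma drifting_excursion_law (exc : probability (cpath R) R) A :
  brownian_excursion_law 1 exc -> measurable A ->
  pushforward exc (add_drift lambda) A = pushforward beta3 X A.
Proof.
move=> hexc mA; have one : 0 < (1 : R) <= 1 by rewrite ltr01 lexx.
pose A' := add_drift lambda @^-1` A.
have mA' : measurable A' by exact: measurable_pre (@measurable_add_drift lambda) mA.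
have E : A' = stop 1 @^-1` A'.
  have e (w : cpath R) t : 0 <= t <= 1 -> stop 1 w t = w t.
    by move=> /andP[t0 t1]; rewrite stopE min_l.
  apply/seteqP; split => w h; apply: (cpath_saturated mA') h => t t01; first by rewrite e.
  exact: e.
rewrite /pushforward -/A' E (bessel_bridge_prob hbeta hexc one mA').
apply: (congr1 (fun S : set P3 => beta3 S)); apply/seteqP; split => w h; apply: (cpath_saturated mA) h => t t01;
  by rewrite add_driftE drifting_pathE// mulNr opprK.
Qed.

Lemma lawY_dominated (exc : probability (cpath R) R) : brownian_excursion_law 1 exc ->
  lawY `<< pushforward exc (add_drift lambda).
Proof.
move=> hexc A A0 B' mB' B'A; have := A0 B' mB' B'A.
rewrite (drifting_excursion_law hexc mB') /pushforward => B'0.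
rewrite lawY_negative// (_ : integral _ _ _ = 0%E) ?mule0//.
transitivity (\int[beta3]_w (0 : \bar R))%E; last by rewrite integral0.
apply: ge0_ae_eq_integral.
- exact: measurableT.
- by apply: mfE; apply: mfM => //; exact: mXA.
- by meas.
- by move=> w _; rewrite lee_fin; apply: mulr_ge0 => //; exact: n0.
- by [].
exists ((fun w : P3 => X w) @^-1` B'); split => //.
  exact: measurable_pre (measurable_drifting_path a) mB'.
move=> w /= h; apply: contrapT => XB; apply: h => _.
by rewrite indicE memNset// mulr0.
Qed.

Lemma lawY_density (exc : probability (cpath R) R) A : brownian_excursion_law 1 exc -> measurable A ->
  lawY A = (\int[pushforward exc (add_drift lambda)]_(w in A) (first_negative w / c)%:E)%E.
Proof.
move=> hexc mA; rewrite lawY_negative//.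
rewrite (eq_integral_law (m2 := pushforward beta3 X)); last first.
  by move=> A' mA'; exact: drifting_excursion_law.
have mX : meas_fun (fun w : P3 => X w) by exact: measurable_drifting_path.
have mNA : measurable_fun A (fun w : cpath R => (first_negative w / c)%:E : \bar R).
  apply: measurable_funTS; apply: mfE; apply: mfM; last by meas.
  exact: measurable_first_negative.
have fn0 (w : cpath R) : 0 <= first_negative w by exact: first_negative_ge0.
have N0 : {in A, forall w : cpath R, (0 <= (first_negative w / c)%:E :> \bar R)%E}.
  by move=> w _; rewrite lee_fin divr_ge0// ltW// c_const_gt0.
rewrite (ge0_integral_pushforward mX beta3 mA mNA N0) integral_mkcond -ge0_integralZl_EFin//.
- apply: eq_integral => w _; rewrite patchE indicE -EFinM.
  have -> : (w \in X @^-1` A) = (X w \in A) by apply/idP/idP; rewrite !inE.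
  by case: ifPn => _; rewrite ?mulr0 ?mulr1//= mulrC.
- by move=> w _; rewrite lee_fin mulr_ge0.
- by apply: mfE; apply: mfM => //; exact: mXA.
Qed.

End law.
End conditioned_vervaat_path.

End drifting_excursion_functionals.

Theorem theorem3p5 (R : realType) (lambda : R) (lambda_lt0 : lambda < 0)
    (d : measure_display) (T : measurableType d) (P : probability T R)
    (B : {mfun T >-> cpath R}) (B_bridge : brownian_bridge P 0 lambda 1 B)
    (exc fpb : R -> probability (cpath R) R)
    (exc_law : forall l : R, 0 < l <= 1 -> brownian_excursion_law l (exc l))
    (fpb_law : forall l : R, 0 < l < 1 -> first_passage_bridge_law lambda l (fpb l)) :
  let lawV : set (cpath R) -> \bar R := pushforward P (fun omega => vervaat (B omega)) in
  let above_line := [set w : cpath R | forall t : R, 0 < t < 1 -> lambda * t < w t] in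
  let lawY := cond_law lawV above_line in
  let law_drifting_exc : set (cpath R) -> \bar R :=
    pushforward (exc 1) (add_drift lambda) in
  [/\ (0 < lawV above_line)%E,
      has_density (pushforward lawY (@first_return R)) `]0, 1[
        (first_return_density lambda),
      cond_indep_given lawY (@first_return R) `]0, 1[
        (fun w : cpath R => stop (first_return w) w)
        (fun w : cpath R => stop (1 - first_return w) (time_shift (first_return w) w))
        (fun z A => exc z (stop z @^-1` A))
        (fun z A => cond_law (fpb (1 - z))
           [set w : cpath R | forall t : R, 0 < t < 1 - z -> lambda * (t + z) < w t]
           (stop (1 - z) @^-1` A)),
      lawY `<< law_drifting_exc &
      forall A, measurable A ->
        lawY A = (\int[law_drifting_exc]_(w in A)
                    (first_negative w / c_const lambda)%:E)%E].
Proof.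
have one : 0 < (1 : R) <= 1 by rewrite ltr01 lexx.
(* The second coordinate of the excursion of length 1 is a standard bridge; it serves as [beta]. *)
have exc1 := exc_law _ one; have [_ [b2 [_ [_ hbeta _ _]]]] := exc1.
split.
- suff : (0 < lawV P B (above_line lambda))%E by [].
  by rewrite (lawV_above_line hbeta lambda_lt0 B_bridge) lte_fin (c_const_gt0 hbeta lambda_lt0).
- exact: (first_return_has_density hbeta lambda_lt0 B_bridge).
- exact: (conditioned_path_decomposition hbeta lambda_lt0 B_bridge exc_law fpb_law).
- exact: (lawY_dominated hbeta lambda_lt0 B_bridge exc1).
- by move=> A mA; exact: (lawY_density hbeta lambda_lt0 B_bridge exc1 mA).
Qed.
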